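(* Use the notation of the context. Assume that the boundary of the domain $D_\zeta$ is such that the following hold. (a) The contour derivative $\sigma'$ exists, is continuous and does not vanish on $\Gamma\setminus\mathcal X$, and there are numbers $\beta_j\in(-1,1]$, $j=1,\dots,m$, and a constant $c$ such that the derivative $\sigma'(Z)$ on $\overline{\mathcal U}\setminus\mathcal X$ satisfies $$|\sigma'(Z)|\le c\prod_{j=1}^m|Z-X_j|^{\beta_j}\qquad\forall Z\in\overline{\mathcal U}\setminus\mathcal X .$$ (b) For some $r_0\in(0,\mathcal R_0/4)$ there are a constant $c>0$ and non-decreasing bounded semi-additive functions $\omega_1,\omega_1^*:(0,+\infty)\to(0,+\infty)$ with $$\int_0^2\frac{\omega_1(\eta)}{\eta}\,d\eta<\infty,\qquad \int_0^\varepsilon\frac{\omega_1^*(\eta)}{\eta}\,d\eta<c\,\omega_1^*(\varepsilon)\quad\forall\varepsilon\in(0,r_0/2),$$ such that, for all $Z_0\in\Gamma\setminus\mathcal X$ with $\mathcal R(Z_0)\le r_0$ and all $Z\in\Gamma\cup s[0,Z_0]$ with $|Z-Z_0|\le\mathcal R(Z_0)/2$, $$|\sigma'(Z)-\sigma'(Z_0)|\le c\,\frac{\omega_1^*(|Z-Z_0|)}{\omega_1^*(\frac12\mathcal R(Z_0))}\prod_{j=1}^m|Z-X_j|^{\beta_j};$$ for all $Z_0\in\Gamma$ with $\mathcal R(Z_0)>r_0$ and all $Z\in\Gamma\cup s[0,Z_0]$ with $|Z-Z_0|\le\mathcal R(Z_0)/2$, $$|\sigma'(Z)-\sigma'(Z_0)|\le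 c\,\frac{\omega_1(|Z-Z_0|)}{\omega_1(\frac12\mathcal R(Z_0))}\prod_{j=1}^m|Z-X_j|^{\beta_j};$$ and for each $j=1,\dots,m$ $$|d(S,Z)|\ge c\,(|S-X_j|+|Z-X_j|)^{\beta_j}$$ for all $Z\in\overline{\mathcal U}\setminus\mathcal X$ with $|Z-X_j|\le r_0$ and all $S\in\Gamma\setminus\mathcal X$ with $|S-X_j|\le 2r_0$, $S\ne Z$. Let $\alpha_j\in(0,1)$, $j=1,\dots,m$, with $\alpha_j<1/(\beta_j+1)$ whenever $\beta_j\in[0,1]$, and put $\gamma_j:=(\beta_j+1)\alpha_j$. Let $u_1,u_3:\partial D_\zeta\setminus\Upsilon_\zeta\to\mathbb R$ be continuous and satisfy, with some constant $c$, $$|u_l(\zeta)|\le c\prod_{j=1}^m\|\zeta-\zeta_j\|^{-\alpha_j}\qquad\forall\zeta\in\partial D_\zeta\setminus\Upsilon_\zeta,\quad l\in\{1,3\},$$ and put $\widetilde u_l:=u_l\circ\widetilde\sigma$ on $\Gamma\setminus\mathcal X$. Then solving the piecewise continuous (1-3)-problem with data $u_1,u_3$ in the class of functions of the form $$\Phi(\zeta)=\frac1{2\pi i}\int_{\partial D_\zeta}\varphi(\tau)(\tau-\zeta)^{-1}\,d\tau\quad(\zeta\in D_\zeta),\qquad \varphi=\varphi_1e_1+\varphi_3e_2,$$ where $\varphi_1,\varphi_3:\partial D_\zeta\setminus\Upsilon_\zeta\to\mathbb R$ are continuous and satisfy $|\varphi_l(\zeta)|\le c\prod_{j=1}^m\|\zeta-\zeta_j\|^{-\alpha_j}$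 on $\partial D_\zeta\setminus\Upsilon_\zeta$ (with a constant $c$ independent of $\zeta$), reduces to solving, in the class of functions $\mathcal K\{\gamma_j\}_{j=1}^m$, the following system of integral equations for the functions $\widetilde\varphi_l:=\varphi_l\circ\widetilde\sigma$, $l\in\{1,3\}$: $$\tfrac12\widetilde\varphi_1(Z_0)+\mathrm{Re}\,\mathcal I[\Omega_1^{\widetilde\varphi_1}](Z_0)-2\,\mathrm{Im}\,\mathcal I[\Omega_2^{\widetilde\varphi_1}](Z_0)-2\,\mathrm{Re}\,\mathcal I[\Omega_2^{\widetilde\varphi_3}](Z_0)+C_{\widetilde\varphi_1}=\widetilde u_1(Z_0),$$ $$\tfrac12\widetilde\varphi_3(Z_0)+\mathrm{Re}\,\mathcal I[\Omega_1^{\widetilde\varphi_3}](Z_0)+2\,\mathrm{Im}\,\mathcal I[\Omega_2^{\widetilde\varphi_3}](Z_0)-2\,\mathrm{Re}\,\mathcal I[\Omega_2^{\widetilde\varphi_1}](Z_0)+C_{\widetilde\varphi_3}=\widetilde u_3(Z_0)$$ for all $Z_0\in\Gamma\setminus\mathcal X$.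
   Context: Algebra. $\mathbb B$ is the two-dimensional commutative associative algebra over $\mathbb C$ with basis $\{e_1,e_2\}$, where $e_1$ is the unit and $e_2^2=e_1+2ie_2$. Norm: $\|z_1e_1+z_2e_2\|=\sqrt{|z_1|^2+|z_2|^2}$ for $z_1,z_2\in\mathbb C$. The biharmonic plane is $\mu=\{xe_1+ye_2:x,y\in\mathbb R\}$; every nonzero element of $\mu$ is invertible in $\mathbb B$. For $a\in\mathbb B$ written as $a=U_1e_1+U_2\,ie_1+U_3e_2+U_4\,ie_2$ with real $U_l$, put $\mathrm U_l[a]:=U_l$. Domain. $D\subset\mathbb R^2$ is a bounded domain with piecewise smooth boundary (a closed Jordan curve) having a finite set of corner points $(x_j,y_j)$, $j=1,\dots,m$, $m\ge1$. $D_\zeta=\{xe_1+ye_2:(x,y)\in D\}\subset\mu$, with boundary $\partial D_\zeta$ (positively oriented), $\zeta_j=x_je_1+y_je_2$, $\Upsilon_\zeta=\{\zeta_1,\dots,\zeta_m\}$. $D_z=\{x+iy:(x,y)\in D\}\subset\mathbb C$, $z_j=x_j+iy_j$. Monogenic functions. $\Phi:D_\zeta\to\mathbb B$ is monogenic if $\Phi'(\zeta)=\lim_{h\to0,\,h\in\mu}(\Phi(\zeta+h)-\Phi(\zeta))h^{-1}$ exists at every $\zeta\in D_\zeta$. The piecewise continuous (1-3)-problem with data $u_1,u_3$ (and exponents $\alpha_j\in(0,1)$): find a monogenic $\Phi:D_\zeta\to\mathbb B$ such that $\lim_{\zeta\to\zeta_0,\,\zeta\in D_\zeta}\mathrm U_l[\Phi(\zeta)]=u_l(\zeta_0)$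 for all $\zeta_0\in\partial D_\zeta\setminus\Upsilon_\zeta$, $l\in\{1,3\}$, and such that for every $l\in\{1,3\}$ and $j\in\{1,\dots,m\}$, $|\mathrm U_l[\Phi(\zeta)]|\le c\,\|\zeta-\zeta_j\|^{-\alpha_j}$ as $\zeta\to\zeta_j$, $\zeta\in D_\zeta$, with $c$ independent of $\zeta$. Conformal map. $\mathcal U=\{|Z|<1\}$, $\Gamma=\{|S|=1\}$ (counterclockwise). $\sigma$ is a conformal map of $\mathcal U$ onto $D_z$, extended to a homeomorphism $\overline{\mathcal U}\to\overline{D_z}$. $\mathcal X=\{X_1,\dots,X_m\}\subset\Gamma$ with $\sigma(X_j)=z_j$. $\sigma_1=\mathrm{Re}\,\sigma$, $\sigma_2=\mathrm{Im}\,\sigma$, $\widetilde\sigma(Z)=\sigma_1(Z)e_1+\sigma_2(Z)e_2$, a homeomorphism $\overline{\mathcal U}\to\overline{D_\zeta}$. The contour derivative at $T\in\Gamma\setminus\mathcal X$ is $\sigma'(T)=\lim_{S\to T,\,S\in\Gamma\setminus\mathcal X}\frac{\sigma(S)-\sigma(T)}{S-T}$. When it exists and is continuous on $\Gamma\setminus\mathcal X$, it equals the limit of the difference quotient over $\overline{\mathcal U}$, and $\sigma'$ (the usual derivative in $\mathcal U$) is continuous on $\overline{\mathcal U}\setminus\mathcal X$. Likewise $\sigma_k'(T)=\lim_{S\to T,\,S\in\Gamma\setminus\mathcal X}\frac{\sigma_k(S)-\sigma_k(T)}{S-T}$ for $T\in\Gamma\setminus\mathcal X$ (complex-valued in general),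 $k=1,2$. For $S\in\Gamma\setminus\mathcal X$, $Z\in\overline{\mathcal U}\setminus\mathcal X$, $S\neq Z$: $d(S,Z)=\frac{\sigma(S)-\sigma(Z)}{S-Z}$, $d_2(S,Z)=\frac{\sigma_2(S)-\sigma_2(Z)}{S-Z}$. $\mathcal R(Z)=\min_j|Z-X_j|$; $\mathcal R_0=\min_{k\ne j}|X_k-X_j|$ if $m>1$, $\mathcal R_0=1$ if $m=1$. $s[0,Z_0]$ is the straight segment from $0$ to $Z_0$. A function $\omega:(0,+\infty)\to(0,+\infty)$ is semi-additive if $\omega(\eta_1+\eta_2)\le\omega(\eta_1)+\omega(\eta_2)$ for all $\eta_1,\eta_2>0$. For $\psi:\Gamma\setminus\mathcal X\to\mathbb R$ and $S\in\Gamma\setminus\mathcal X$, $Z\in\overline{\mathcal U}\setminus\mathcal X$, $S\ne Z$: $$\Omega_1^\psi(S,Z)=\psi(S)\Big(\frac{\sigma'(S)}{d(S,Z)}-1\Big),\qquad \Omega_2^\psi(S,Z)=\frac{\psi(S)}2\Big(\frac{\sigma'(S)\,d_2(S,Z)}{d(S,Z)^2}-\frac{\sigma_2'(S)}{d(S,Z)}\Big),$$ $$\mathcal I[\Omega](Z)=\frac1{2\pi i}\int_\Gamma\frac{\Omega(S,Z)}{S-Z}\,dS,\qquad C_\psi=\frac1{4\pi i}\int_\Gamma\frac{\psi(S)}S\,dS,$$ where for $Z=T\in\Gamma\setminus\mathcal X$ the integral $\mathcal I$ is the Cauchy principal value, $\lim_{\delta\to0+}$ of the integral over $\{S\in\Gamma:|S-T|>\delta\}$.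 $\mathcal K\{\gamma_j\}_{j=1}^m$ (all $\gamma_j<1$) is the class of continuous functions $\widetilde u:\Gamma\setminus\mathcal X\to\mathbb R$ with $|\widetilde u(S)|\le c\prod_{j=1}^m|S-X_j|^{-\gamma_j}$ for all $S\in\Gamma\setminus\mathcal X$, $c$ independent of $S$. *)

(* Defs.v *)
From HB Require Import structures.
From mathcomp Require Import all_boot all_order all_algebra complex ring.
From mathcomp Require Import all_classical all_reals all_analysis.

Set Implicit Arguments.
Unset Strict Implicit.
Unset Printing Implicit Defensive.

Import Order.TTheory GRing.Theory Num.Theory.
Import numFieldNormedType.Exports.

Local Open Scope ring_scope.
Local Open Scope complex_scope.
Local Open Scope classical_set_scope.

(* R[i] gets its usual topology, so that derivable, f^`(), lim and continuity
   are available for functions of a complex variable. *)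
HB.instance Definition _ (R : rcfType) := NormedModule.copy R[i] (R[i])^o.

Notation cabs := Normc.normc.
Local Notation Re := complex.Re.
Local Notation Im := complex.Im.

(* Biharm z1 z2 is z1 e1 + z2 e2. *)
Record biharm (R : Type) : Type := Biharm { co1 : R[i]; co2 : R[i] }.

Section BiharmonicAlgebra.
Variable R : rcfType.
Local Notation B := (biharm R).
Implicit Types a b c : B.

Definition pair_of_biharm a : R[i] * R[i] := (co1 a, co2 a).
Definition biharm_of_pair (u : R[i] * R[i]) : B := Biharm u.1 u.2.

Lemma pair_of_biharmK : cancel pair_of_biharm biharm_of_pair.
Proof. by case. Qed.

HB.instance Definition _ := Choice.copy B (can_type pair_of_biharmK).

Definition biharm_zero : B := Biharm 0 0.
Definition biharm_opp a : B := Biharm (- co1 a) (- co2 a).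
Definition biharm_add a b : B := Biharm (co1 a + co1 b) (co2 a + co2 b).

Lemma biharm_addA : associative biharm_add.
Proof. by move=> [a1 a2] [b1 b2] [c1 c2]; congr Biharm; rewrite addrA. Qed.

Lemma biharm_addC : commutative biharm_add.
Proof. by move=> [a1 a2] [b1 b2]; congr Biharm; rewrite addrC. Qed.

Lemma biharm_add0 : left_id biharm_zero biharm_add.
Proof. by move=> [a1 a2]; congr Biharm; rewrite add0r. Qed.

Lemma biharm_addN : left_inverse biharm_zero biharm_opp biharm_add.
Proof. by move=> [a1 a2]; congr Biharm; rewrite addNr. Qed.

HB.instance Definition _ := GRing.isZmodule.Build B
  biharm_addA biharm_addC biharm_add0 biharm_addN.

(* e2 ^+ 2 = e1 + 2 i e2 *)
Definition biharm_mul a b : B :=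
  Biharm (co1 a * co1 b + co2 a * co2 b)
         (co1 a * co2 b + co2 a * co1 b + 2 * 'i * (co2 a * co2 b)).

Definition biharm_one : B := Biharm 1 0.

Lemma biharm_mulA : associative biharm_mul.
Proof. by move=> a b c; congr Biharm => /=; ring. Qed.

Lemma biharm_mulC : commutative biharm_mul.
Proof. by move=> a b; congr Biharm => /=; ring. Qed.

Lemma biharm_mul1 : left_id biharm_one biharm_mul.
Proof. by move=> [a1 a2]; congr Biharm => /=; ring. Qed.

Lemma biharm_mulDl : left_distributive biharm_mul +%R.
Proof. by move=> [a1 a2] [b1 b2] [c1 c2]; congr Biharm => /=; ring. Qed.

Lemma biharm_one_neq0 : biharm_one != 0.
Proof. by apply/eqP => -[]/eqP; rewrite oner_eq0. Qed.

HB.instance Definition _ := GRing.Zmodule_isComNzRing.Build B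
  biharm_mulA biharm_mulC biharm_mul1 biharm_mulDl biharm_one_neq0.

(* Multiplication by z1 e1 + z2 e2 has determinant (z1 + i z2) ^+ 2. *)
Definition biharm_unit : pred B := fun a => co1 a + 'i * co2 a != 0.

Definition biharm_inv a : B :=
  if biharm_unit a then
    Biharm ((co1 a + 2 * 'i * co2 a) / (co1 a + 'i * co2 a) ^+ 2)
           (- co2 a / (co1 a + 'i * co2 a) ^+ 2)
  else a.

Lemma biharm_mulVr : {in biharm_unit, left_inverse 1 biharm_inv *%R}.
Proof.
move=> a; rewrite -[a \in _]/(biharm_unit a) => ua; rewrite /biharm_inv ua.
have i2 : 'i * 'i = -1 :> R[i] by rewrite -expr2 sqr_i.
rewrite /biharm_unit in ua.
set w := co1 a + 'i * co2 a in ua *.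
have w2 : w ^+ 2 != 0 by rewrite expf_neq0.
have ew : co1 a ^+ 2 + 2 * 'i * co2 a * co1 a - co2 a ^+ 2 = w ^+ 2.
  by rewrite -[- _]mulN1r -i2 /w; ring.
apply: (_ : biharm_mul _ _ = Biharm 1 0).
transitivity (Biharm ((w ^+ 2)^-1 * w ^+ 2) 0); last by rewrite mulVf.
rewrite /biharm_mul /=; set v := (w ^+ 2)^-1.
by rewrite -ew; congr Biharm; ring.
Qed.

Lemma biharm_unitP a b : b * a = 1 -> biharm_unit a.
Proof.
move=> ba; apply/eqP => a0.
have i2 : 'i * 'i = -1 :> R[i] by rewrite -expr2 sqr_i.
have : (co1 b + 'i * co2 b) * (co1 a + 'i * co2 a)
    = co1 (b * a) + 'i * co2 (b * a).
  rewrite [b * a]/(biharm_mul b a) /= mulrDl !mulrDr.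
  have -> : 'i * (2 * 'i * (co2 b * co2 a)) = 2 * ('i * 'i) * (co2 b * co2 a)
    by ring.
  have -> : 'i * co2 b * ('i * co2 a) = 'i * 'i * (co2 b * co2 a) by ring.
  by rewrite i2; ring.
rewrite ba a0 mulr0 [co1 1]/(1 : R[i]) [co2 1]/(0 : R[i]).
by rewrite mulr0 addr0 => /eqP; rewrite eq_sym oner_eq0.
Qed.

Lemma biharm_inv_out : {in [predC biharm_unit], biharm_inv =1 id}.
Proof.
move=> a; rewrite -[a \in _]/(~~ biharm_unit a) /biharm_inv.
by move=> /negbTE ->.
Qed.

HB.instance Definition _ := GRing.ComNzRing_hasMulInverse.Build B
  biharm_mulVr biharm_unitP biharm_inv_out.

Definition biharm_scale (k : R[i]) a : B := Biharm (k * co1 a) (k * co2 a).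

Lemma biharm_scaleA k l a :
  biharm_scale k (biharm_scale l a) = biharm_scale (k * l) a.
Proof. by congr Biharm; rewrite /= mulrA. Qed.

Lemma biharm_scale1 : left_id 1 biharm_scale.
Proof. by move=> [a1 a2]; congr Biharm; rewrite /= mul1r. Qed.

Lemma biharm_scaleDr : right_distributive biharm_scale +%R.
Proof. by move=> k [a1 a2] [b1 b2]; congr Biharm; rewrite /= mulrDr. Qed.

Lemma biharm_scaleDl a : {morph biharm_scale^~ a : k l / k + l}.
Proof. by move=> k l; congr Biharm; rewrite /= mulrDl. Qed.

HB.instance Definition _ := GRing.Zmodule_isLmodule.Build R[i] B
  biharm_scaleA biharm_scale1 biharm_scaleDr biharm_scaleDl.

Lemma biharm_scaleAl (k : R[i]) a b : k *: (a * b) = (k *: a) * b.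
Proof. by congr Biharm => /=; ring. Qed.

HB.instance Definition _ := GRing.Lmodule_isLalgebra.Build R[i] B
  biharm_scaleAl.

Definition bnorm a : R := Num.sqrt (cabs (co1 a) ^+ 2 + cabs (co2 a) ^+ 2).

Lemma cabs_ge0 (z : R[i]) : 0 <= cabs z.
Proof. by case: z => x y; exact: sqrtr_ge0. Qed.

Lemma bnormE a : bnorm a = cabs (cabs (co1 a) +i* cabs (co2 a)).
Proof. by []. Qed.

Lemma bnormD a b : bnorm (a + b) <= bnorm a + bnorm b.
Proof.
rewrite !bnormE; apply: le_trans (le_normcD _ _).
rewrite /= ler_wsqrtr// lerD// ler_sqr ?nnegrE ?addr_ge0 ?cabs_ge0//;
  exact: le_normcD.
Qed.

Lemma bnorm_eq0 a : bnorm a = 0 -> a = 0.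
Proof.
rewrite bnormE => /Normc.eq0_normc[].
by case: a => a1 a2 /= /Normc.eq0_normc -> /Normc.eq0_normc ->.
Qed.

Lemma bnormMn a n : bnorm (a *+ n) = bnorm a *+ n.
Proof.
have -> : a *+ n = Biharm (co1 a *+ n) (co2 a *+ n).
  by elim: n => [|n IHn] //; rewrite !mulrS IHn.
rewrite !bnormE [co1 _]/= [co2 (Biharm _ _)]/= !normcMn -[RHS]normcMn.
congr (cabs _); elim: n => [|n IHn] //.
by rewrite !mulrS -IHn.
Qed.

Lemma bnormN a : bnorm (- a) = bnorm a.
Proof. by rewrite /bnorm /= !normcN. Qed.

(* The norm `|a| of the algebra, with values in R, and the topology it
   defines. *)
HB.instance Definition _ := Num.Zmodule_isNormed.Build R B
  bnormD bnorm_eq0 bnormMn bnormN.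
HB.instance Definition _ := PseudoMetric.copy B (pseudoMetric_normed B).
HB.instance Definition _ := isPointed.Build B 0.
HB.instance Definition _ := NormedZmod_PseudoMetric_eq.Build R B erefl.

Definition e1 : B := Biharm 1 0.
Definition e2 : B := Biharm 0 1.

(* First and third coordinates in the real basis e1, i e1, e2, i e2. *)
Definition U1 a : R := Re (co1 a).
Definition U3 a : R := Re (co2 a).

Definition zeta_of (p : R * R) : B := p.1%:C *: e1 + p.2%:C *: e2.

Definition z_of (p : R * R) : R[i] := p.1 +i* p.2.

End BiharmonicAlgebra.

Arguments e1 {R}.
Arguments e2 {R}.

Lemma e2_sqr (R : rcfType) : e2 * e2 = e1 + (2 * 'i) *: e2 :> biharm R.
Proof. by congr Biharm => /=; ring. Qed.

Section Domains.
Variable R : realType.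
Implicit Types (D : set (R * R)) (m : nat).

Definition biplane : set (biharm R) := range (@zeta_of R).
Definition boundary D : set (R * R) := closure D `\` interior D.
Definition D_zeta D : set (biharm R) := @zeta_of R @` D.
Definition D_z D : set R[i] := @z_of R @` D.

(* The boundary of D_zeta, as a curve in the biharmonic plane, without the
   corner points. *)
Definition bd_zeta D m (p : 'I_m -> R * R) : set (biharm R) :=
  @zeta_of R @` (boundary D `\` range p).

(* g : [0, 1] -> R^2 runs once through the boundary of D, a closed Jordan curve
   made of the m arcs g ([t k, t k.+1]), each of them C^1 and regular up to its
   end points. The end points of the arcs are the points p j, listed in any
   order. The last clause is the positive orientation: D lies to the left of the
   velocity. *)
Definition pw_smooth_boundary D m (p : 'I_m -> R * R) (g : R -> R * R)
    (t : nat -> R) : Prop :=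
  [/\ [/\ t 0%N = 0, t m = 1 & forall k, (k < m)%N -> t k < t k.+1],
      [/\ {within `[0, 1], continuous g}, g 0 = g 1,
          {in `[0, 1[ &, injective g} & g @` `[0, 1] = boundary D],
      [set g (t k) | k in [set k | (k < m)%N]] = range p,
      forall k, (k < m)%N -> exists dg : R -> R * R,
        [/\ {within `[t k, t k.+1], continuous dg},
            forall s, s \in `]t k, t k.+1[ -> derivable g s 1 /\ g^`() s = dg s
          & forall s, s \in `[t k, t k.+1] -> dg s != 0]
    & forall s, s \in `[0, 1] -> (forall k, (k <= m)%N -> s != t k) ->
        \forall e \near 0^'+, D (g s + e *: (- (g^`() s).2, (g^`() s).1))].

Definition monogenic D (Phi : biharm R -> biharm R) : Prop :=
  forall zeta, D_zeta D zeta -> exists l : biharm R,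
    (Phi (zeta + h) - Phi zeta) * h^-1
      @[h --> within (biplane `\ 0) (nbhs (0 : biharm R))] --> l.

(* Boundary values and growth at the corner points of one component U of Phi. *)
Definition bvp_component D m (p : 'I_m -> R * R) (alpha : 'I_m -> R)
    (U : biharm R -> R) (u : biharm R -> R) (Phi : biharm R -> biharm R) : Prop :=
  (forall zeta0, bd_zeta D p zeta0 ->
     U (Phi zeta) @[zeta --> within (D_zeta D) (nbhs zeta0)] --> u zeta0) /\
  (forall j, exists c : R, \forall zeta \near within (D_zeta D) (nbhs (zeta_of (p j))),
     `|U (Phi zeta)| <= c * `|zeta - zeta_of (p j)| `^ (- alpha j)).

Definition problem13 D m (p : 'I_m -> R * R) (alpha : 'I_m -> R)
    (u1 u3 : biharm R -> R) (Phi : biharm R -> biharm R) : Prop :=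
  [/\ monogenic D Phi, bvp_component D p alpha (@U1 R) u1 Phi
    & bvp_component D p alpha (@U3 R) u3 Phi].

Definition bd_class D m (p : 'I_m -> R * R) (alpha : 'I_m -> R)
    (phi : biharm R -> R) : Prop :=
  {within bd_zeta D p, continuous phi} /\
  exists c : R, forall zeta, bd_zeta D p zeta ->
    `|phi zeta| <= c * \prod_j `|zeta - zeta_of (p j)| `^ (- alpha j).

End Domains.

Section Integrals.
Variable R : realType.

Definition cintegral (A : set R) (f : R -> R[i]) : R[i] :=
  (\int[lebesgue_measure]_(x in A) Re (f x)) +i*
  (\int[lebesgue_measure]_(x in A) Im (f x)).

Definition bintegral (A : set R) (f : R -> biharm R) : biharm R :=
  Biharm (cintegral A (fun x => co1 (f x))) (cintegral A (fun x => co2 (f x))).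

(* The integral of F(tau) d tau over the boundary curve zeta_of \o g. *)
Definition bd_integral (g : R -> R * R) (F : biharm R -> biharm R) : biharm R :=
  bintegral `[0, 1] (fun s => F (zeta_of (g s)) * zeta_of (g^`() s)).

Definition cauchy_type (g : R -> R * R) (phi1 phi3 : biharm R -> R)
    (zeta : biharm R) : biharm R :=
  (2 * pi%:C * 'i)^-1 *:
    bd_integral g (fun tau =>
      ((phi1 tau)%:C *: e1 + (phi3 tau)%:C *: e2) * (tau - zeta)^-1).

Definition expi (x : R) : R[i] := cos x +i* sin x.

(* The integral of F(S) dS over the part of the unit circle that lies in A,
   counterclockwise. *)
Definition circle_integral (A : set R[i]) (F : R[i] -> R[i]) : R[i] :=
  cintegral (`[0, 2 * pi] `&` expi @^-1` A)
    (fun x => F (expi x) * ('i * expi x)).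

End Integrals.

Section ConformalMap.
Variable R : realType.
Variable m : nat.
Variable X : 'I_m -> R[i].
Implicit Types (Z S T : R[i]) (sigma f : R[i] -> R[i]).

Definition disc : set R[i] := [set Z | cabs Z < 1].
Definition cdisc : set R[i] := [set Z | cabs Z <= 1].
Definition circle : set R[i] := [set Z | cabs Z = 1].

Definition homeo_on (A B : set R[i]) f : Prop :=
  {within A, continuous f} /\
  exists g : R[i] -> R[i], [/\ {within B, continuous g},
    forall Z, A Z -> B (f Z) /\ g (f Z) = Z
  & forall w, B w -> A (g w) /\ f (g w) = w].

Definition conformal_ext (D : set (R * R)) sigma : Prop :=
  [/\ forall Z, disc Z -> derivable sigma Z 1, sigma @` disc = D_z D
    & homeo_on cdisc (closure (D_z D)) sigma].

(* The difference quotients over the contour circle `\` range X. *)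
Definition contour_quotients f T :=
  (f S - f T) / (S - T) @[S --> within ((circle `\` range X) `\ T) (nbhs T)].

Definition contour_deriv f T : R[i] := lim (contour_quotients f T).

(* The derivative of sigma on the closed disc: the usual one inside, the contour
   derivative on the circle. *)
Definition deriv_cdisc sigma Z : R[i] :=
  if cabs Z < 1 then sigma^`() Z else contour_deriv sigma Z.

Definition sigma2 sigma Z : R[i] := (Im (sigma Z))%:C.

Definition sigma_tilde sigma Z : biharm R := zeta_of (Re (sigma Z), Im (sigma Z)).

Definition dquot f S Z : R[i] := (f S - f Z) / (S - Z).

Definition calR Z : R := inf [set cabs (Z - X j) | j in setT].

Definition calR0 : R :=
  if (1 < m)%N then
    inf [set cabs (X kj.1 - X kj.2) | kj in [set kj : 'I_m * 'I_m | kj.1 != kj.2]]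
  else 1.

Definition segment0 Z0 : set R[i] := [set s%:C * Z0 | s in `[0, 1]].

Definition prodX (beta : 'I_m -> R) Z : R := \prod_j cabs (Z - X j) `^ beta j.

Definition hyp_a sigma (beta : 'I_m -> R) : Prop :=
  [/\ forall T, (circle `\` range X) T -> cvg (contour_quotients sigma T),
      {within circle `\` range X, continuous (contour_deriv sigma)},
      forall T, (circle `\` range X) T -> contour_deriv sigma T != 0
    & exists c : R, forall Z, (cdisc `\` range X) Z ->
        cabs (deriv_cdisc sigma Z) <= c * prodX beta Z].

Definition modulus (omega : R -> R) : Prop :=
  [/\ forall x, 0 < x -> 0 < omega x,
      forall x y, 0 < x -> x <= y -> omega x <= omega y,
      exists M : R, forall x, 0 < x -> omega x <= M
    & forall x y, 0 < x -> 0 < y -> omega (x + y) <= omega x + omega y].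

(* Z != Z0 is required because omega is only meaningful on (0, +oo); for Z = Z0
   the left-hand side of the estimate is 0. *)
Definition deriv_oscillation sigma (beta : 'I_m -> R) (omega : R -> R)
    (A : set R[i]) (c : R) : Prop :=
  forall Z0 Z, A Z0 -> (circle `|` segment0 Z0) Z -> Z != Z0 ->
    cabs (Z - Z0) <= calR Z0 / 2 ->
    cabs (deriv_cdisc sigma Z - deriv_cdisc sigma Z0) <=
      c * (omega (cabs (Z - Z0)) / omega (calR Z0 / 2)) * prodX beta Z.

(* The letter c denotes a positive constant that may differ from one estimate to
   another. *)
Definition hyp_b sigma (beta : 'I_m -> R) : Prop :=
  exists (r0 : R) (omega1 omega1s : R -> R),
    [/\ 0 < r0 < calR0 / 4, modulus omega1 & modulus omega1s] /\
    [/\ (\int[lebesgue_measure]_(x in `]0%R, (2 : R)%R[) (omega1 x / x)%:E < +oo)%E,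
        exists2 c : R, 0 < c & forall eps, 0 < eps < r0 / 2 ->
          (\int[lebesgue_measure]_(x in `]0%R, eps[) (omega1s x / x)%:E
             < (c * omega1s eps)%:E)%E,
        exists2 c : R, 0 < c & deriv_oscillation sigma beta omega1s
          [set Z0 | (circle `\` range X) Z0 /\ calR Z0 <= r0] c,
        exists2 c : R, 0 < c & deriv_oscillation sigma beta omega1
          [set Z0 | circle Z0 /\ r0 < calR Z0] c
      & exists2 c : R, 0 < c & forall j S Z,
          (cdisc `\` range X) Z -> cabs (Z - X j) <= r0 ->
          (circle `\` range X) S -> cabs (S - X j) <= 2 * r0 -> S != Z ->
          c * (cabs (S - X j) + cabs (Z - X j)) `^ beta j <=
            cabs (dquot sigma S Z)].

Definition Omega1 sigma (psi : R[i] -> R) S Z : R[i] :=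
  (psi S)%:C * (contour_deriv sigma S / dquot sigma S Z - 1).

Definition Omega2 sigma (psi : R[i] -> R) S Z : R[i] :=
  (psi S)%:C / 2 *
    (contour_deriv sigma S * dquot (sigma2 sigma) S Z / dquot sigma S Z ^+ 2
     - contour_deriv (sigma2 sigma) S / dquot sigma S Z).

(* The truncations of the singular integral of Omega at a point T of the circle;
   calI is the principal value. *)
Definition pv_truncations (Omega : R[i] -> R[i] -> R[i]) T :=
  (2 * pi%:C * 'i)^-1 *
    circle_integral [set S | delta < cabs (S - T)] (fun S => Omega S T / (S - T))
  @[delta --> 0^'+].

Definition calI Omega T : R[i] := lim (pv_truncations Omega T).

Definition C_ (psi : R[i] -> R) : R[i] :=
  (4 * pi%:C * 'i)^-1 * circle_integral setT (fun S => (psi S)%:C / S).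

Definition classK (gamma : 'I_m -> R) (psi : R[i] -> R) : Prop :=
  {within circle `\` range X, continuous psi} /\
  exists c : R, forall S, (circle `\` range X) S ->
    `|psi S| <= c * prodX (fun j => - gamma j) S.

(* A solution is required to make all four principal values exist. C_ psi is a
   complex number, so the equations are read in R[i]. *)
Definition solves_system sigma (v1 v3 psi1 psi3 : R[i] -> R) : Prop :=
  forall Z0, (circle `\` range X) Z0 ->
    [/\ cvg (pv_truncations (Omega1 sigma psi1) Z0),
        cvg (pv_truncations (Omega2 sigma psi1) Z0),
        cvg (pv_truncations (Omega1 sigma psi3) Z0)
      & cvg (pv_truncations (Omega2 sigma psi3) Z0)] /\
    (psi1 Z0 / 2 + Re (calI (Omega1 sigma psi1) Z0)
       - 2 * Im (calI (Omega2 sigma psi1) Z0)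
       - 2 * Re (calI (Omega2 sigma psi3) Z0))%:C + C_ psi1 = (v1 Z0)%:C /\
    (psi3 Z0 / 2 + Re (calI (Omega1 sigma psi3) Z0)
       + 2 * Im (calI (Omega2 sigma psi3) Z0)
       - 2 * Re (calI (Omega2 sigma psi1) Z0))%:C + C_ psi3 = (v3 Z0)%:C.

End ConformalMap.

Arguments disc {R}.
Arguments cdisc {R}.
Arguments circle {R}.

(* Main.v *)
Require Import Defs.
From HB Require Import structures.
From mathcomp Require Import all_boot all_order all_algebra complex ring lra.
From mathcomp Require Import all_classical all_reals all_analysis.
From mathcomp Require Import measurable_realfun.
Set Implicit Arguments.
Unset Strict Implicit.
Unset Printing Implicit Defensive.
Import Order.TTheory GRing.Theory Num.Theory.
Import numFieldNormedType.Exports.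
Local Open Scope ring_scope.
Local Open Scope complex_scope.
Local Open Scope classical_set_scope.
Local Notation Re := complex.Re.
Local Notation Im := complex.Im.



(** The disc serves as a model of the domain. Write a contour point as $\sigma(S)$ with $S=e^{ix}$,
    put $w=\sigma(S)-\sigma(Z)$ and let the prime on $w$ denote $d/dx$. A computation in $\mathbb B$
    ([biharm_cauchy_kernel]) turns $(\tau-\zeta)^{-1}d\tau$ into $((k_1+2ik_2)e_1-2k_2e_2)\,dx$ with
    $k_1=w'/w$ and $k_2=(4i)^{-1}(\overline w/w)'$; these are [map_k1] and [map_k2]. Hence
    $U_1[\Phi]$ and $U_3[\Phi]$ are combinations of real and imaginary parts of the integrals of
    $\varphi_lk_1$ and $\varphi_lk_2$ ([cauchy_type_components]), with the coefficients of the
    system.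

    Boundary values at a regular point. The kernel $k_1$ is the Cauchy kernel of the disc plus a
    remainder. By the Dini condition the remainder is at most $K\omega(|S-T|)/|S-T|$ near the point,
    where $T$ is the radial projection of $Z$, so its integral is continuous up to the boundary
    ([map_k1_limit]). The real part of the Cauchy integral of a real density is
    $(4\pi)^{-1}\int\psi(P+1)\,dx$ with the Poisson kernel $P$, and tends to $\psi/2+C_\psi$
    ([cauchy_limit]). The kernel $k_2$ equals, up to a similar remainder,
    $\overline{\sigma'}/\sigma'$ times a kernel of the disc dominated by $P+1$ and of zero integral,
    so it produces no jump ([map_k2_limit]). On the circle both the remainder of $k_1$ and $k_2$ are
    absolutely integrable, so the principal values of the system are ordinary integrals of them
    ([principal_values]). The limits of $U_1[\Phi]$ and $U_3[\Phi]$ are therefore the left-hand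
    sides of the system.

    The other requirements hold for every $\Phi$ of the given form. It is monogenic by
    differentiation under the integral ([cauchy_type_derivative]). Near a corner its components are
    $O(|Z-X_j|^{-\gamma_j})$ ([corner_growth]), and $|\sigma(Z)-\sigma(X_j)|\le
    c|Z-X_j|^{\beta_j+1}$ converts this into the required bound. The two-sided version of the latter
    estimate on the circle ([map_corner_weight_le]) identifies the class of $\varphi_l$ with
    $\mathcal K\{\gamma_j\}$. Thus [problem13_iff_system] reduces to equality of boundary values,
    and [classK_pullback] shows that every element of $\mathcal K$ comes from some $\varphi$.

    The contour integral is defined by a parametrization [g] unrelated to $\sigma$. The argument of
    $\sigma^{-1}(g(u))$ is continuously differentiable on the arcs, and positive orientation forces
    it to increase, so a change of variable leads to the circle ([contour_integral_transfer]).
    Hypotheses (a) and (b) are repackaged in the record [corner_map]. *)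

Section ComplexBasics.
Variable R : realType.
Local Notation C := R[i].
Implicit Types (x y z w : C) (r s : R).

(** * Modulus, components, neighbourhoods and limits of complex numbers *)

Lemma normcE z : `|z| = (cabs z)%:C.
Proof. by case: z. Qed.

Lemma cabs_sqr z : cabs z ^+ 2 = Re z ^+ 2 + Im z ^+ 2.
Proof. by case: z => a b /=; rewrite sqr_sqrtr// addr_ge0// sqr_ge0. Qed.

Lemma cabs_real r : cabs r%:C = `|r|.
Proof. by rewrite /= expr0n addr0 sqrtr_sqr. Qed.

Lemma cabs_i : cabs ('i : C) = 1.
Proof. by rewrite /= expr0n add0r expr1n sqrtr1. Qed.

Lemma cabs_eq0 z : (cabs z == 0) = (z == 0).
Proof.
by apply/eqP/eqP => [/Normc.eq0_normc//|->]; rewrite Normc.normc0.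
Qed.

Lemma cabs_gt0 z : (0 < cabs z) = (z != 0).
Proof. by rewrite lt0r cabs_eq0 cabs_ge0 andbT. Qed.

Lemma cabsB x y : cabs (x - y) = cabs (y - x).
Proof. by rewrite -normcN opprB. Qed.

Lemma ler_cabsD x y : cabs (x + y) <= cabs x + cabs y.
Proof. exact: le_normcD. Qed.

Lemma ler_cabsB x y : cabs (x - y) <= cabs x + cabs y.
Proof. by rewrite -(normcN y) le_normcD. Qed.

Lemma cabs_dist_triangle y x z : cabs (x - z) <= cabs (x - y) + cabs (y - z).
Proof. by rewrite -{1}(subrK y x) -addrA le_normcD. Qed.

Lemma lerB_cabs x y : cabs x - cabs y <= cabs (x - y).
Proof. by rewrite lerBlDr -{1}(subrK y x) le_normcD. Qed.

Lemma ler_dist_cabs x y : `|cabs x - cabs y| <= cabs (x - y).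
Proof.
by rewrite ler_norml lerB_cabs andbT lerNl opprB (cabsB x) lerB_cabs.
Qed.

Lemma ler_norm_Re z : `|Re z| <= cabs z.
Proof.
rewrite -(@ler_pXn2r _ 2%N) ?nnegrE ?cabs_ge0//.
by rewrite cabs_sqr real_normK ?num_real// lerDl sqr_ge0.
Qed.

Lemma ler_norm_Im z : `|Im z| <= cabs z.
Proof.
rewrite -(@ler_pXn2r _ 2%N) ?nnegrE ?cabs_ge0//.
by rewrite cabs_sqr real_normK ?num_real// lerDr sqr_ge0.
Qed.

Lemma ler_cabs_ReIm z : cabs z <= `|Re z| + `|Im z|.
Proof.
rewrite -(@ler_pXn2r _ 2%N) ?nnegrE ?cabs_ge0// ?addr_ge0//.
rewrite cabs_sqr sqrrD !real_normK ?num_real//.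
by rewrite lerD2r lerDl mulrn_wge0 // mulr_ge0.
Qed.

Lemma cabsM x y : cabs (x * y) = cabs x * cabs y.
Proof. exact: Normc.normcM. Qed.

Lemma cabsV x : cabs x^-1 = (cabs x)^-1.
Proof. exact: Normc.normcV. Qed.

Lemma cabs_div x y : cabs (x / y) = cabs x / cabs y.
Proof. by rewrite cabsM cabsV. Qed.

Lemma cabs1 : cabs (1 : C) = 1.
Proof. exact: Normc.normc1. Qed.

Lemma cabs0 : cabs (0 : C) = 0.
Proof. exact: Normc.normc0. Qed.

Lemma cabsX z n : cabs (z ^+ n) = cabs z ^+ n.
Proof. by elim: n => [|n IHn]; rewrite ?expr0 ?cabs1// !exprS cabsM IHn. Qed.

Lemma cabsJ z : cabs (conjc z) = cabs z.
Proof. by case: z => a b /=; rewrite sqrrN. Qed.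

Lemma mulcJ z : z * conjc z = ((cabs z) ^+ 2)%:C.
Proof. by rewrite -sqr_normc normcE -rmorphXn. Qed.

Lemma ReD x y : Re (x + y) = Re x + Re y. Proof. by case: x y => [? ?] [? ?]. Qed.
Lemma ImD x y : Im (x + y) = Im x + Im y. Proof. by case: x y => [? ?] [? ?]. Qed.
Lemma ReN x : Re (- x) = - Re x. Proof. by case: x. Qed.
Lemma ImN x : Im (- x) = - Im x. Proof. by case: x. Qed.
Lemma ReB x y : Re (x - y) = Re x - Re y. Proof. by rewrite ReD ReN. Qed.
Lemma ImB x y : Im (x - y) = Im x - Im y. Proof. by rewrite ImD ImN. Qed.
Lemma ReM x y : Re (x * y) = Re x * Re y - Im x * Im y.
Proof. by case: x y => [? ?] [? ?]. Qed.
Lemma ImM x y : Im (x * y) = Re x * Im y + Im x * Re y.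
Proof. by case: x y => [? ?] [? ?]. Qed.
Lemma ReMr r x : Re (r%:C * x) = r * Re x.
Proof. by rewrite ReM /= mul0r subr0. Qed.
Lemma ImMr r x : Im (r%:C * x) = r * Im x.
Proof. by rewrite ImM /= mul0r addr0. Qed.

Lemma eq_complexP x y : Re x = Re y -> Im x = Im y -> x = y.
Proof. by case: x y => [? ?] [? ?] /= -> ->. Qed.

Lemma ii : 'i * 'i = -1 :> C. Proof. by rewrite -expr2 sqr_i. Qed.

Lemma nbhs_cabsP z (A : set C) :
  nbhs z A <-> exists2 e : R, 0 < e & forall w, cabs (w - z) < e -> A w.
Proof.
split=> [/nbhs_normP[e /= e0 eA]|[e e0 eA]].
  (* Radii of balls in [R[i]] are complex numbers; positivity forces the imaginary part to
     vanish. *)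
  have ee : e = (Re e)%:C.
    by case: e e0 {eA} => a b; rewrite ltcE /= => /andP[/eqP ->].
  exists (Re e); first by move: e0; rewrite ltcE /= => /andP[].
  move=> w wz; apply: eA; rewrite /ball_/= ee normcE cabsB.
  by rewrite ltcR.
apply/nbhs_normP; exists e%:C => /=; first by rewrite ltcR.
by move=> w; rewrite /ball_/= normcE ltcR cabsB => /eA.
Qed.

Lemma cvgcP T (F : set_system T) (FF : Filter F) (f : T -> C) (l : C) :
  f @ F --> l <-> forall e : R, 0 < e -> \forall t \near F, cabs (f t - l) < e.
Proof.
split=> [fl e e0|fl A].
  by apply: (fl [set w | cabs (w - l) < e]); apply/nbhs_cabsP; exists e.
move=> /nbhs_cabsP[e e0 eA]; rewrite /nbhs/=.
by apply: filterS (fl e e0) => t; exact: eA.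
Qed.

Lemma cvg_cabsP T (F : set_system T) (FF : Filter F) (f : T -> C) (l : C) :
  f @ F --> l <-> cabs (f t - l) @[t --> F] --> (0 : R).
Proof.
rewrite cvgcP; split=> [fl|/cvgrPdist_lt fl].
  apply/cvgrPdist_lt => e e0; apply: filterS (fl e e0) => t.
  by rewrite sub0r normrN ger0_norm ?cabs_ge0.
by move=> e /fl; apply: filterS => t; rewrite sub0r normrN ger0_norm ?cabs_ge0.
Qed.

Lemma cvg_ReImP T (F : set_system T) (FF : Filter F) (f : T -> C) (l : C) :
  f @ F --> l <->
  (Re (f t) @[t --> F] --> Re l /\ Im (f t) @[t --> F] --> Im l).
Proof.
rewrite cvgcP; split=> [fl|[/cvgrPdist_lt fr /cvgrPdist_lt fi] e e0].
  split; apply/cvgrPdist_lt => e e0; apply: filterS (fl e e0) => t.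
    by apply: le_lt_trans; rewrite -ReB cabsB ler_norm_Re.
  by apply: le_lt_trans; rewrite -ImB cabsB ler_norm_Im.
have e20 : 0 < e / 2 by rewrite divr_gt0.
apply: filterS2 (fr _ e20) (fi _ e20) => t hr hi.
rewrite cabsB (le_lt_trans (ler_cabs_ReIm _))// ReB ImB [e]splitr ltrD//.
Qed.

Lemma nearbyc z (P : C -> Prop) :
  (\forall w \near z, P w) <-> exists2 e : R, 0 < e & forall w, cabs (w - z) < e -> P w.
Proof. exact: nbhs_cabsP. Qed.

Lemma near_withinc (A : set C) z (P : C -> Prop) :
  (\forall w \near within A (nbhs z), P w) <->
  exists2 e : R, 0 < e & forall w, cabs (w - z) < e -> A w -> P w.
Proof. exact: nbhs_cabsP. Qed.

Lemma continuous_withinc (A : set C) (f : C -> C) :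
  {within A, continuous f} <->
  forall z, A z -> forall e : R, 0 < e -> exists2 d : R, 0 < d &
    forall w, A w -> cabs (w - z) < d -> cabs (f w - f z) < e.
Proof.
split=> [/subspace_continuousP fA z Az e e0|fA].
  have /cvgcP/(_ e e0)/near_withinc[d d0 dP] := fA _ Az.
  by exists d => // w Aw wd; exact: dP.
apply/subspace_continuousP => z Az; apply/cvgcP => e e0.
have [d d0 dP] := fA z Az e e0.
by apply/near_withinc; exists d => // w wd Aw; exact: dP.
Qed.

End ComplexBasics.

Lemma is_derive_ge0_le (R : realType) (f df : R -> R) (a b : R) : a <= b ->
  (forall x, a < x < b -> is_derive x 1 f (df x)) ->
  {within `[a, b], continuous f} ->
  (forall x, a < x < b -> 0 <= df x) -> f a <= f b.
Proof.
move=> ab fd fc d0; apply: (@ger0_derive1_le_cc _ f a b) => //.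
- by move=> x; rewrite in_itv/= => /fd[].
- move=> x; rewrite in_itv/= => xab; rewrite derive1E.
  by rewrite (@derive_val _ _ _ _ _ _ _ (fd _ xab)) d0.
- by rewrite in_itv/= lexx.
- by rewrite in_itv/= ab lexx.
Qed.

Lemma is_derive_continuous (R : realType) (f : R -> R) (x d : R) :
  is_derive x 1 f d -> {for x, continuous f}.
Proof.
by move=> [df _]; apply: differentiable_continuous; exact/derivable1_diffP.
Qed.

(** * The unit circle: arguments, chords and arcs *)

Section UnitCircle.
Variable R : realType.
Local Notation C := R[i].
Implicit Types (z w T S : C) (x y r s : R).

Lemma cabs_expi x : cabs (expi x) = 1.
Proof. by rewrite /= cos2Dsin2 sqrtr1. Qed.

Lemma circle_expi x : circle (expi x).
Proof. exact: cabs_expi. Qed.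

Lemma expi0 : expi (0 : R) = 1.
Proof. by rewrite /expi cos0 sin0. Qed.

Lemma expiD x y : expi (x + y) = expi x * expi y.
Proof. by apply: eq_complexP; rewrite ?ReM ?ImM /= ?cosD ?sinD// addrC. Qed.

Lemma expiN x : expi (- x) = conjc (expi x).
Proof. by rewrite /expi cosN sinN. Qed.

Lemma expi_neq0 x : expi x != 0 :> C.
Proof. by rewrite -cabs_gt0 cabs_expi. Qed.

Lemma expi_conj_mul x : expi x * conjc (expi x) = 1.
Proof. by rewrite -expiN -expiD subrr expi0. Qed.

Lemma expi_conj x : conjc (expi x) = (expi x)^-1.
Proof.
by apply: (mulfI (expi_neq0 x)); rewrite expi_conj_mul divff ?expi_neq0.
Qed.

Lemma expiD2pi x : expi (x + 2 * pi) = expi x.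
Proof. by rewrite mulr_natl /expi (cosD2pi x) (sinD2pi x). Qed.

Lemma expiB x y : expi (x - y) = expi x / expi y.
Proof. by rewrite expiD expiN expi_conj. Qed.

Lemma circle_neq0 z : circle z -> z != 0.
Proof. by rewrite /circle/= => z1; rewrite -cabs_gt0 z1. Qed.

Lemma circle_conj z : circle z -> conjc z = z^-1.
Proof.
move=> z1; apply: (mulfI (circle_neq0 z1)).
by rewrite mulcJ z1 expr1n divff ?circle_neq0.
Qed.

Lemma circle_argP z : circle z -> exists2 x, - pi < x <= pi & expi x = z.
Proof.
case: z => a b z1.
have ab : a ^+ 2 + b ^+ 2 = 1.
  by have := cabs_sqr (a +i* b); rewrite z1 expr1n.
have a1 : -1 <= a <= 1.
  rewrite -ler_norml -(@ler_pXn2r _ 2%N) ?nnegrE// expr1n.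
  by rewrite real_normK ?num_real// -ab lerDl sqr_ge0.
have sa : sin (acos a) ^+ 2 = b ^+ 2.
  rewrite sin2cos2 acosK; last by rewrite in_itv.
  by rewrite -ab addrAC subrr add0r.
have acpi : 0 <= acos a <= pi by rewrite acos_ge0// acos_lepi.
have [b0|b0] := leP 0 b.
  exists (acos a).
    case/andP: acpi => h ->; rewrite andbT (lt_le_trans _ h)// ltrNl oppr0.
    exact: pi_gt0.
  congr (_ +i* _); first by rewrite acosK ?in_itv.
  apply/eqP; rewrite -(eqrXn2 (n:=2))//; first by rewrite sa.
  by rewrite sin_ge0_pi.
exists (- acos a).
  case/andP: acpi => h1 h2; apply/andP; split; last first.
    by rewrite (le_trans _ (ltW (pi_gt0 R)))// lerNl oppr0.
  (* The argument [- pi] is excluded: [acos a = pi] would give [b ^+ 2 = 0], against [b < 0]. *)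
  rewrite ltrN2 lt_neqAle h2 andbT; apply/eqP => e.
  by move: sa; rewrite e sinpi expr0n => /esym/eqP; rewrite sqrf_eq0 lt_eqF.
congr (_ +i* _); first by rewrite cosN acosK ?in_itv.
rewrite sinN; apply/eqP; rewrite eqr_oppLR.
rewrite -(eqrXn2 (n:=2)) ?sqrrN ?sa//; first by rewrite sin_ge0_pi.
by rewrite lerNr oppr0 ltW.
Qed.

Lemma expi_eq1 x : `|x| < 2 * pi -> expi x = 1 -> x = 0.
Proof.
wlog x0 : x / 0 <= x => [hw|].
  have [/hw//|x0] := leP 0 x; move=> xpi e; apply/eqP.
  rewrite -oppr_eq0; apply/eqP/hw; first by rewrite lerNr oppr0 ltW.
    by rewrite normrN.
  by rewrite expiN e conjc1.
rewrite ger0_norm// => xpi [cx sx].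
have [xp|xp] := leP x pi.
  by apply: cos_inj; rewrite ?in_itv/= ?x0 ?xp ?lexx ?pi_ge0// cos0.
(* Beyond [pi], reflect: [2 * pi - x] lies in [[0, pi]], where the cosine is injective. *)
suff e : 2 * pi - x = 0 by move: xpi; rewrite -subr_gt0 e ltxx.
apply: cos_inj; rewrite ?in_itv/= ?lexx ?pi_ge0//.
  by rewrite subr_ge0 (ltW xpi)/= lerBlDr mulr_natl mulr2n lerD2l ltW.
by rewrite cosB mulr_natl cos2pi sin2pi mul1r mul0r addr0 cx cos0.
Qed.

Lemma expi_inj x y : `|x - y| < 2 * pi -> expi x = expi y -> x = y.
Proof.
move=> xy e; apply/subr0_eq/expi_eq1 => //.
by rewrite expiB e divff ?expi_neq0.
Qed.

Lemma sin_le x : 0 <= x -> sin x <= x.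
Proof.
move=> x0; rewrite -subr_ge0.
pose f (t : R) := t - sin t.
have df (t : R) : is_derive t 1 f (1 - cos t) by exact: is_deriveB.
have : f 0 <= f x.
  apply: (is_derive_ge0_le x0 (fun t _ => df t)); last first.
    by move=> t _; rewrite subr_ge0 cos_le1.
  by apply: continuous_subspaceT => t; exact: is_derive_continuous (df t).
by rewrite /f sin0 subr0.
Qed.

(** Up to [pi / 4] the derivative $\cos t-1/3$ is nonnegative because $\cos^2(\pi/4)=1/2$. Beyond,
    $\sin x\ge\sin(\pi/4)\ge2/3\ge x/3$ since $x\le\pi/2<2$. *)
Lemma sin_ge_third x : 0 <= x <= pi / 2 -> x / 3 <= sin x.
Proof.
move=> /andP[x0 x2].
have hp := @pihalf_lt2 R.
have c4 : (cos (pi / 4) : R) ^+ 2 = 1 / 2.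
  have := cos_mulr2n (pi / 4 : R).
  have -> : pi / 4 *+ 2 = pi / 2 :> R by rewrite -mulr_natr; field.
  by rewrite cos_pihalf => /esym/eqP; rewrite subr_eq0 -mulr_natr => /eqP; lra.
have s4 : (sin (pi / 4) : R) ^+ 2 = 1 / 2 by rewrite sin2cos2 c4; lra.
have p0 := @pi_gt0 R.
have c40 : 0 <= cos (pi / 4 : R) by rewrite cos_ge0_pihalf//; apply/andP; split; lra.
have s40 : 0 <= sin (pi / 4 : R) by rewrite sin_ge0_pi//; apply/andP; split; lra.
have [x4|x4] := leP x (pi / 4); last first.
  apply: (@le_trans _ _ (sin (pi / 4))).
    rewrite (@le_trans _ _ (2 / 3))//; first by lra.
    rewrite -(@ler_pXn2r _ 2%N) ?nnegrE ?s4//; lra.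
  by rewrite ltW// ltr_sin// in_itv/=; apply/andP; split; lra.
pose f (t : R) := sin t - 3^-1 * t.
have df (t : R) : is_derive t 1 f (cos t - 3^-1).
  have -> : cos t - 3^-1 = cos t - 3^-1 *: 1 by rewrite /GRing.scale/= mulr1.
  by apply: is_deriveB; exact: is_deriveZ.
have : f 0 <= f x.
  apply: (is_derive_ge0_le x0 (fun t _ => df t)).
    by apply: continuous_subspaceT => t; exact: is_derive_continuous (df t).
  move=> t /andP[t0 tx]; rewrite subr_ge0.
  apply: (@le_trans _ _ (cos (pi / 4))).
    by rewrite -(@ler_pXn2r _ 2%N) ?nnegrE ?c4//; lra.
  by rewrite ltW// ltr_cos ?in_itv/=; try (apply/andP; split); lra.
by rewrite /f sin0 mulr0 subr0 subr_ge0 mulrC.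
Qed.

Lemma cabs_expiB x y : cabs (expi x - expi y) = 2 * `|sin ((x - y) / 2)|.
Proof.
have -> : expi x - expi y = expi y * (expi (x - y) - 1).
  by rewrite mulrBr mulr1 -expiD subrKC.
rewrite cabsM cabs_expi mul1r.
set u := (x - y) / 2.
have -> : x - y = u *+ 2 by rewrite /u -mulr_natr; field.
apply/eqP; rewrite -(eqrXn2 (n:=2)) ?cabs_ge0 ?mulr_ge0//; apply/eqP.
rewrite cabs_sqr exprMn real_normK ?num_real// ReB ImB /= cos_mulr2n sin_mulr2n.
rewrite cos2sin2 !mulr2n; have := cos2sin2 u.
by move: (cos u) (sin u) => c s; rewrite !expr2 => h; nra.
Qed.

Lemma chord_le x y : cabs (expi x - expi y) <= `|x - y|.
Proof.
rewrite cabs_expiB.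
have : `|sin ((x - y) / 2)| <= `|(x - y) / 2|.
  have [h|h] := leP 0 ((x - y) / 2).
    rewrite (ger0_norm h) ler_norml sin_le// andbT.
    have [h1|h1] := leP ((x - y) / 2) pi.
      by rewrite (le_trans _ (sin_ge0_pi _)) ?h ?h1// lerNl oppr0.
    rewrite (le_trans _ (sin_geN1 _))// lerN2.
    by rewrite (le_trans _ (ltW h1))// (le_trans _ (pi_ge2 R))// ler1n.
  rewrite (ltr0_norm h) -normrN -sinN.
  have h' : 0 <= - ((x - y) / 2) by rewrite lerNr oppr0 ltW.
  rewrite ler_norml sin_le// andbT.
  have [h1|h1] := leP (- ((x - y) / 2)) pi.
    by rewrite (le_trans _ (sin_ge0_pi _)) ?h' ?h1// lerNl oppr0.
  rewrite (le_trans _ (sin_geN1 _))// lerN2.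
  by rewrite (le_trans _ (ltW h1))// (le_trans _ (pi_ge2 R))// ler1n.
rewrite normrM (gtr0_norm (_ : 0 < 2^-1)) ?invr_gt0//; lra.
Qed.

Lemma norm_sin_half x : `|x| <= pi -> `|sin (x / 2)| = sin (`|x| / 2).
Proof.
have key u : 0 <= u -> u <= pi -> `|sin (u / 2)| = sin (u / 2) :> R.
  move=> u0 up; apply: ger0_norm; apply: sin_ge0_pi.
  by apply/andP; split; have := pi_ge0 R; lra.
have [x0|x0] := leP 0 x.
  by rewrite (ger0_norm x0) => /(key _ x0).
rewrite (ltr0_norm x0) => xp.
by rewrite -normrN -sinN -mulNr key// oppr_ge0 ltW.
Qed.

(** With [chord_le], this makes chords and arcs of length at most [pi] comparable; it is the source
    of many factors 3 below. *)
Lemma chord_ge x y : `|x - y| <= pi -> `|x - y| / 3 <= cabs (expi x - expi y).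
Proof.
move=> h; rewrite cabs_expiB.
rewrite norm_sin_half//.
have n0 := normr_ge0 (x - y).
have := @sin_ge_third (`|x - y| / 2); rewrite (_ : 0 <= _ <= _); last first.
  by apply/andP; split; lra.
by move=> /(_ isT); lra.
Qed.

(* Along an arc of length at most [pi] the chord issued from an end point increases. *)
Lemma chord_mono x y t : `|x - t| <= `|y - t| -> `|y - t| <= pi ->
  cabs (expi x - expi t) <= cabs (expi y - expi t).
Proof.
move=> xy yp.
have aux u : `|u| <= pi -> cabs (expi (t + u) - expi t) = 2 * sin (`|u| / 2).
  move=> up; rewrite cabs_expiB addrAC subrr add0r.
  by rewrite norm_sin_half.
have ex : x = t + (x - t) by rewrite subrKC.
have ey : y = t + (y - t) by rewrite subrKC.
rewrite ex ey !aux// ?(le_trans xy)// ler_pM2l//.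
have p0 := pi_gt0 R; have n0 := normr_ge0 (x - t); have n1 := normr_ge0 (y - t).
move: xy; rewrite le_eqVlt => /predU1P[->//|xy]; apply: ltW.
by rewrite ltr_sin ?in_itv/= ?ltr_pM2r ?invr_gt0//; apply/andP; split; lra.
Qed.

End UnitCircle.

(** * Lebesgue integrals under translation, reflection and shift by a period *)

Section LebesgueTools.
Variable R : realType.
Local Notation mu := (@lebesgue_measure R).
Implicit Types (a b c x y : R).

Lemma lebesgue_measure_translate a (A : set R) : measurable A ->
  pushforward mu ((fun x => x + a) : _ -> measurableTypeR R) A = mu A.
Proof.
move=> mA; apply/esym/lebesgue_measure_unique => //=.
  by apply: measurable_funD => //; exact: measurable_cst.
move=> mf _ [[c d]] _ <-.
rewrite /pushforward (_ : _ @^-1` _ = `]c - a, d - a]%classic); last first.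
  by apply/seteqP; split => x /=; rewrite !in_itv/= ltrBlDr lerBrDr.
rewrite !lebesgue_measure_itv/= !lte_fin ltrD2r.
by case: ifPn => // _; rewrite -!EFinD opprB addrA subrK.
Qed.

Lemma ge0_integral_translate (f : R -> \bar R) a (D : set R) : measurable D ->
  measurable_fun [set: R] f -> (forall x, 0 <= f x)%E ->
  (\int[mu]_(x in D) f x = \int[mu]_(x in (fun x => x + a)%R @^-1` D) f (x + a)%R)%E.
Proof.
move=> mD mf f0.
have mt : measurable_fun setT ((fun x => x + a) : measurableTypeR R -> measurableTypeR R).
  by apply: measurable_funD => //; exact: measurable_cst.
transitivity (\int[pushforward mu ((fun x => x + a)%R : _ -> measurableTypeR R)]_(x in D) f x)%E.
  by apply: eq_measure_integral => //= A mA AS; exact/esym/lebesgue_measure_translate.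
by rewrite ge0_integral_pushforward//; exact: measurable_funS mf.
Qed.

Lemma ge0_integral_opp (f : R -> \bar R) (D : set R) : measurable D ->
  measurable_fun [set: R] f -> (forall x, 0 <= f x)%E ->
  (\int[mu]_(x in D) f x = \int[mu]_(x in -%R @^-1` D) f (- x)%R)%E.
Proof.
move=> mD mf f0.
transitivity (\int[pushforward mu (-%R : _ -> measurableTypeR R)]_(x in D) f x)%E.
  by apply: eq_measure_integral => //= A mA AS; exact/esym/lebesgue_measureN.
by rewrite ge0_integral_pushforward//; exact: measurable_funS mf.
Qed.


Lemma ge0_integral_co_split (f : R -> \bar R) a c b : a <= c -> c <= b ->
  measurable_fun [set: R] f -> (forall x, 0 <= f x)%E ->
  (\int[mu]_(x in `[a, b[) f x =
   \int[mu]_(x in `[a, c[) f x + \int[mu]_(x in `[c, b[) f x)%E.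
Proof.
move=> ac cb mf f0.
have -> : `[a, b[%classic = (`[a, c[ `|` `[c, b[)%classic.
  apply/seteqP; split=> x /=; rewrite !in_itv/=.
    by move=> /andP[ax xb]; have [xc|cx] := ltP x c; [left|right]; rewrite ?ax ?cx.
  case=> /andP[h1 h2]; first by rewrite h1 (lt_le_trans h2).
  by rewrite h2 (le_trans ac).
rewrite ge0_integral_setU//.
- exact: measurable_funS mf.
- apply/disj_setPS => x [/=]; rewrite !in_itv/= => /andP[_ xc] /andP[cx _].
  by move: (le_lt_trans cx xc); rewrite ltxx.
Qed.

(** Shifting by a multiple of [P] brings [a] to some [b] in [[0, P]]. The part of [[b, b + P[]
    beyond [P] is the translate of [[0, b[], and the two pieces fill one period. *)
Lemma ge0_integral_periodic_full (P : R) (f : R -> \bar R) a : 0 < P ->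
  measurable_fun [set: R] f -> (forall x, 0 <= f x)%E ->
  (forall x, f (x + P) = f x) ->
  (\int[mu]_(x in `[a, (a + P)%R]) f x = \int[mu]_(x in `[0%R, P]) f x)%E.
Proof.
move=> P0 mf f0 fP.
rewrite -!integral_itv_bndo_bndc; last 2 first.
- exact: measurable_funTS.
- exact: measurable_funTS.
have tr b c d : (forall x, f (x + d) = f x) ->
    (\int[mu]_(x in `[(b + d)%R, (c + d)%R[) f x = \int[mu]_(x in `[b, c[) f x)%E.
  move=> fd; rewrite (ge0_integral_translate d)//.
  have -> : (fun x => x + d) @^-1` `[b + d, c + d[ = `[b, c[%classic.
    by apply/seteqP; split => x /=; rewrite !in_itv/= lerD2r ltrD2r.
  by apply: eq_integral => x _; rewrite fd.
have fN n x : f (x + P *+ n) = f x.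
  by elim: n x => [|n IHn] x; rewrite ?mulr0n ?addr0// mulrSr addrA fP.
have fZ (n : int) x : f (x + P *~ n) = f x.
  case: n => n; first by rewrite -pmulrn fN.
  by rewrite NegzE mulrNz -pmulrn -[LHS](fN n.+1) subrK.
pose n : int := Num.floor (a / P).
pose b := a - P *~ n.
have b0 : 0 <= b.
  rewrite subr_ge0 -mulrzr mulrC -ler_pdivlMr//.
  exact: Num.Theory.ge_floor.
have bP : b <= P.
  rewrite lerBlDr -mulrzr -{1}(mulr1 P) -mulrDr mulrC -ler_pdivrMr//.
  by rewrite ltW// addrC; have := @Num.Theory.floorD1_gt R (a / P); rewrite rmorphD.
have -> : a = b + P *~ n by rewrite subrK.
rewrite [_ + _ + P]addrAC tr//.
rewrite (@ge0_integral_co_split _ b P)// ?lerDl ?lerDr//.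
have := tr 0 b P fP; rewrite add0r => ->.
by rewrite addeC -ge0_integral_co_split.
Qed.

(* Estimate of the integral over a period of a function that is controlled by the
   distance to the point [t]. *)
Lemma ge0_integral_period_le (f k : R -> \bar R) t :
  measurable_fun [set: R] f -> (forall x, 0 <= f x)%E ->
  (forall x, f (x + 2 * pi) = f x) ->
  measurable_fun [set: R] k -> (forall x, 0 <= k x)%E ->
  (forall y : R, (0 < y <= pi)%R ->
    f (t + y)%R <= k y /\ f (t - y)%R <= k y)%E ->
  (\int[mu]_(x in `[0%R, (2 * pi)%R]) f x <= 2%:E * \int[mu]_(x in `]0%R, pi]) k x)%E.
Proof.
move=> mf f0 fP mk k0 fk.
have p0 := @pi_gt0 R.
(* The period is recentred at [t]; both halves are carried to []0, pi]], the left one by a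
   reflection. *)
rewrite -(@ge0_integral_periodic_full (2 * pi) f (t - pi))// ?mulr_gt0//.
rewrite -integral_itv_bndo_bndc; last exact: measurable_funTS.
rewrite (@ge0_integral_co_split _ _ t)//; last 2 first.
  by rewrite lerBlDr lerDl ltW.
  by lra.
have mft : measurable_fun [set: R] (fun x => f (x + t)).
  apply: measurableT_comp => //.
  by apply: measurable_funD => //; exact: measurable_cst.
rewrite [leRHS]mule_natl mule2n; apply: leeD.
  rewrite (ge0_integral_translate t)//.
  have -> : (fun x => x + t) @^-1` `[t - pi, t[ = `[- pi, 0[%classic.
    by apply/seteqP; split => x /=; rewrite !in_itv/= => /andP[h1 h2]; apply/andP; split; lra.
  rewrite ge0_integral_opp//.
  have -> : @GRing.opp R @^-1` `[- pi, 0[ = `]0, pi]%classic.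
    by apply/seteqP; split => x /=; rewrite !in_itv/= => /andP[h1 h2]; apply/andP; split; lra.
  apply: ge0_le_integral => //.
  - apply: measurable_funTS; apply: (measurableT_comp mft).
    exact: oppr_measurable.
  - exact: measurable_funTS.
  - by move=> x /=; rewrite in_itv/= => /fk[_]; rewrite addrC.
rewrite (ge0_integral_translate t)//.
have -> : (fun x => x + t) @^-1` `[t, t - pi + 2 * pi[ = `[0, pi[%classic.
  by apply/seteqP; split => x /=; rewrite !in_itv/= => /andP[h1 h2]; apply/andP; split; lra.
rewrite integral_itv_bndo_bndc; last exact: measurable_funTS.
rewrite -integral_itv_obnd_cbnd; last exact: measurable_funTS.
apply: ge0_le_integral => //.
- exact: measurable_funTS.
- exact: measurable_funTS.
- by move=> x /=; rewrite in_itv/= => /fk[+ _]; rewrite addrC.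
Qed.

End LebesgueTools.

(** * Integrals near zero and integrals of powers *)

Section PowerIntegrals.
Variable R : realType.
Local Notation mu := (@lebesgue_measure R).
Implicit Types (a b c x y : R).

Lemma cvgn_le_at_right_integral (f : R -> \bar R) b : 0 < b ->
  measurable_fun [set: R] f -> (forall x, 0 <= f x)%E ->
  (\int[mu]_(x in `](b * n.+1%:R^-1)%R, b]) f x)%E @[n --> \oo]
    --> (\int[mu]_(x in `]0%R, b]) f x)%E.
Proof.
move=> b0 mf f0.
pose F n := `](b * n.+1%:R^-1), b]%classic.
have -> : `]0%R, b]%classic = \bigcup_n F n.
  apply/seteqP; split => [x|x [n _]] /=; rewrite /F /= !in_itv/=; last first.
    by move=> /andP[h ->]; rewrite andbT (le_lt_trans _ h)// mulr_ge0// ltW.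
  move=> /andP[x0 xb].
  have [n nx] : exists n : nat, b / x < n.+1%:R.
    exists (Num.trunc (b / x)).
    exact: truncnS_gt.
  exists n => //=; rewrite in_itv/= xb andbT.
  by rewrite ltr_pdivrMr// mulrC -ltr_pdivrMr.
apply: ge0_nondecreasing_set_cvg_integral => //.
- move=> m n mn; apply/subsetPset => x; rewrite /F/= !in_itv/= => /andP[h ->].
  by rewrite andbT (le_lt_trans _ h)// ler_pM2l// lef_pV2 ?posrE// ler_nat.
- by move=> i; exact: measurable_funTS.
Qed.

Lemma ge0_integral_oc_le (f : R -> \bar R) b (M : \bar R) : 0 < b ->
  measurable_fun [set: R] f -> (forall x, 0 <= f x)%E ->
  (forall a, 0 < a < b -> (\int[mu]_(x in `[a, b]) f x <= M)%E) ->
  (0 <= M)%E ->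
  (\int[mu]_(x in `]0%R, b]) f x <= M)%E.
Proof.
move=> b0 mf f0 fM M0.
apply: (cvge_to_le (cvgn_le_at_right_integral b0 mf f0)).
(* For index 0 the interval is empty. For the others the left end is below [b], and the half-open
   interval lies in the closed one to which the hypothesis applies. *)
apply: nearW => -[|n].
  by rewrite invr1 mulr1 set_itvoc0 integral_set0.
rewrite (le_trans _ (fM (b * n.+2%:R^-1) _))//; last first.
  by rewrite mulr_gt0//= ltr_pdivrMr// ltr_pMr// ltr1n.
apply: ge0_subset_integral => //; first exact: measurable_funTS.
by apply: subset_itvr; rewrite bnd_simp.
Qed.

(** The integrals over [](b / n.+1), b]] increase to a finite limit, so what a late one leaves out
    is small. *)
Lemma ge0_integral_oc_tail (f : R -> \bar R) b : 0 < b ->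
  measurable_fun [set: R] f -> (forall x, 0 <= f x)%E ->
  (\int[mu]_(x in `]0%R, b]) f x < +oo)%E ->
  forall e : R, 0 < e -> exists2 d : R, 0 < d <= b &
    (\int[mu]_(x in `]0%R, d]) f x <= e%:E)%E.
Proof.
move=> b0 mf f0 fy e e0.
have fin : (\int[mu]_(x in `]0%R, b]) f x)%E \is a fin_num.
  by rewrite ge0_fin_numE// integral_ge0.
have : (\int[mu]_(x in `](b * n.+1%:R^-1)%R, b]) f x)%E @[n --> \oo]
    --> (\int[mu]_(x in `]0%R, b]) f x)%E by exact: cvgn_le_at_right_integral.
have lt : (\int[mu]_(x in `]0%R, b]) f x - e%:E < \int[mu]_(x in `]0%R, b]) f x)%E.
  by rewrite lteBlDr// lteDl// lte_fin.
move=> /(_ _ (open_nbhs_nbhs (conj (@open_ereal_gt_ereal _ _) lt)))[n _ /(_ n (leqnn n))/= nP].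
exists (b * n.+1%:R^-1).
  by rewrite mulr_gt0//= ler_pdivrMr// ler_pMr// ler1n.
set d := b * n.+1%:R^-1 in nP *.
have d0 : 0 < d by rewrite mulr_gt0.
have db : d <= b by rewrite ler_pdivrMr// ler_pMr// ler1n.
have E : (\int[mu]_(x in `]0%R, b]) f x =
    \int[mu]_(x in `]0%R, d]) f x + \int[mu]_(x in `]d, b]) f x)%E.
  have -> : `]0, b]%classic = (`]0, d] `|` `]d, b])%classic.
    apply/seteqP; split=> x /=; rewrite !in_itv/=.
      by move=> /andP[ax xb]; have [xc|cx] := leP x d; [left|right]; rewrite ?ax ?cx.
    case=> /andP[h1 h2]; first by rewrite h1 (le_trans h2).
    by rewrite h2 (lt_trans d0).
  rewrite ge0_integral_setU//.
  - exact: measurable_funTS.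
  - apply/disj_setPS => x [/=]; rewrite !in_itv/= => /andP[_ xc] /andP[cx _].
    by move: (lt_le_trans cx xc); rewrite ltxx.
move: fin nP; rewrite E fin_numD => /andP[fu fv].
by rewrite EFinN lteBlDr// addeC lteD2lE// => /ltW.
Qed.

Lemma integral_powR p a b : p != -1 -> 0 < a < b ->
  (\int[mu]_(x in `[a, b]) (x `^ p)%:E =
   ((b `^ (p + 1) - a `^ (p + 1)) / (p + 1))%:E)%E.
Proof.
move=> p1 /andP[a0 ab].
have p10 : p + 1 != 0 by rewrite addr_eq0.
pose F x := (p + 1)^-1 * x `^ (p + 1).
have dF x : 0 < x -> is_derive x 1 F (x `^ p).
  move=> x0; rewrite (_ : x `^ p = (p + 1)^-1 *: ((p + 1) * x `^ (p + 1 - 1))).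
    by apply: is_deriveZ; exact: is_derive1_powR.
  by rewrite /GRing.scale/= mulKf// addrK.
have cF x : 0 < x -> {for x, continuous F} by move=> x0; exact: is_derive_continuous (dF _ x0).
rewrite (@continuous_FTC2 _ _ F)//.
- by rewrite -EFinB /F -mulrBr mulrC.
- apply: continuous_in_subspaceT => x; rewrite inE/= in_itv/= => /andP[ax _].
  have x0 : 0 < x by rewrite (lt_le_trans a0).
  by apply: (is_derive_continuous (d := p * x `^ (p - 1))); exact: is_derive1_powR.
- split.
  + by move=> x; rewrite in_itv/= => /andP[ax _]; have [] := dF x (lt_trans a0 ax).
  + by apply: cvg_at_right_filter; exact: cF.
  + by apply: cvg_at_left_filter; apply: cF; exact: lt_trans ab.
- move=> x; rewrite in_itv/= => /andP[ax _]; have [_] := dF x (lt_trans a0 ax).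
  by rewrite derive1E.
Qed.

Lemma measurable_powR_EFin p : measurable_fun [set: R] (fun x => (x `^ p)%:E).
Proof. by apply/measurable_EFinP; exact: measurable_powR. Qed.

Lemma integral_powR_le p b : -1 < p -> 0 < b ->
  (\int[mu]_(x in `]0%R, b]) (x `^ p)%:E <= (b `^ (p + 1) / (p + 1))%:E)%E.
Proof.
move=> p1 b0; have p10 : 0 < p + 1 by lra.
apply: ge0_integral_oc_le => //.
- exact: measurable_powR_EFin.
- by move=> x; rewrite lee_fin powR_ge0.
- move=> a ab; rewrite integral_powR ?gt_eqF// lee_fin.
  by rewrite ler_pM2r ?invr_gt0// lerBlDr lerDl powR_ge0.
- by rewrite lee_fin divr_ge0 ?powR_ge0// ltW.
Qed.

(** An exponent below [-1] makes the bound independent of the upper end [b]. *)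
Lemma integral_powR_tail_le g a b : 0 < g -> 0 < a ->
  (\int[mu]_(x in `[a, b]) (x `^ (- g - 1))%:E <= (a `^ (- g) / g)%:E)%E.
Proof.
move=> g0 a0; have [ab|ba] := ltP a b; last first.
  have : `[a, b]%classic `<=` [set a].
    by move=> x /=; rewrite in_itv/= => /andP[ax xb]; apply/eqP; rewrite eq_le ax (le_trans xb).
  by move=> /integral_Sset1 ->; rewrite lee_fin divr_ge0 ?powR_ge0// ltW.
rewrite integral_powR ?a0//; last by lra.
rewrite subrK lee_fin invrN mulrN -mulNr opprB ler_pM2r ?invr_gt0//.
by rewrite lerBlDr lerDl powR_ge0.
Qed.

End PowerIntegrals.

(** * Vitali's convergence theorem *)

Section VitaliConvergence.
Local Open Scope ereal_scope.
Context d (T : measurableType d) (R : realType).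
Variable mu : {measure set T -> \bar R}.

Lemma limn_einf_le (u : (\bar R)^nat) (M : \bar R) :
  (forall n, u n <= M) -> limn_einf u <= M.
Proof.
move=> uM; rewrite limn_einf_lim; apply: lime_le; first exact: is_cvg_einfs.
apply: nearW => n; apply: le_trans (uM n).
by apply: ereal_inf_lbound; exists n => //=; exact: leqnn.
Qed.

Lemma ge0_integral_setIDr (A B : set T) (f : T -> \bar R) : measurable A -> measurable B ->
  measurable_fun A f -> (forall x, A x -> 0 <= f x) ->
  \int[mu]_(x in A) f x = \int[mu]_(x in A `&` B) f x + \int[mu]_(x in A `\` B) f x.
Proof.
move=> mA mB mf f0; rewrite -{1}(setUIDK A B) ge0_integral_setU//.
- exact: measurableI.
- exact: measurableD.
- by rewrite setUIDK.
- by move=> x; rewrite setUIDK; exact: f0.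
- by apply/disj_setPS => x [[_ Bx] [_ /(_ Bx)]].
Qed.

(* Vitali's theorem: the integrals converge as soon as, up to sets on which they are
   uniformly small, the functions are dominated. *)
Lemma vitali_cvg_integral (A : set T) (F : (T -> R)^nat) (F0 : T -> R) :
  measurable A ->
  (forall n, measurable_fun A (F n)) -> measurable_fun A F0 ->
  (forall x, A x -> F n x @[n --> \oo] --> F0 x) ->
  (forall e : R, (0 < e)%R -> exists (B : set T) (G : T -> R) (n0 : nat),
    [/\ measurable B, mu.-integrable (A `\` B) (EFin \o G),
     forall n, (n0 <= n)%N -> \int[mu]_(x in A `&` B) `|F n x|%:E <= e%:E &
     forall n x, (n0 <= n)%N -> A x -> ~ B x -> (`|F n x| <= G x)%R]) ->
  mu.-integrable A (EFin \o F0) /\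
  (\int[mu]_(x in A) F n x)%R @[n --> \oo] --> (\int[mu]_(x in A) F0 x)%R.
Proof.
move=> mA mF mF0 cF small.
have aF n : measurable_fun A (fun x => `|F n x|%:E).
  by apply/measurable_EFinP; exact: measurableT_comp.
have aF0 : measurable_fun A (fun x => `|F0 x|%:E).
  by apply/measurable_EFinP; exact: measurableT_comp.
(* The three shares of [e] are: [F n] on [B], [F0] on [B], and their difference off [B], where
   dominated convergence applies. *)
have key (e : R) : (0 < e)%R -> exists n0 : nat,
   [/\ mu.-integrable A (EFin \o F0),
     forall n, (n0 <= n)%N -> mu.-integrable A (EFin \o F n) &
     forall n, (n0 <= n)%N -> \int[mu]_(x in A) `|F n x - F0 x|%:E <= (e *+ 3)%:E].
  move=> e0; have [B [G [n0 [mB iG FB FG]]]] := small _ e0.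
  have mAB : measurable (A `&` B) by exact: measurableI.
  have mDB : measurable (A `\` B) by exact: measurableD.
  (* Fatou's lemma carries the smallness on [B] over to the limit function. *)
  have F0B : \int[mu]_(x in A `&` B) `|F0 x|%:E <= e%:E.
    rewrite (eq_integral (fun x => limn_einf (fun n => `|F (n + n0)%N x|%:E))); last first.
      move=> x; rewrite inE => -[Ax _]; apply/esym.
      have : `|F (n + n0)%N x|%:E @[n --> \oo] --> `|F0 x|%:E.
        apply: cvg_EFin; first exact: nearW.
        by apply: cvg_norm; rewrite (cvg_shiftn n0 (F ^~ x)); exact: cF.
      by move=> /cvg_limn_einf_sup[].
    apply: le_trans.
      by apply: fatou => //= n; apply: (measurable_funS mA).
    by apply: limn_einf_le => n; apply: FB; rewrite leq_addl.
  have F0G x : A x -> ~ B x -> (`|F0 x| <= G x)%R.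
    move=> Ax Bx; have : `|F (n + n0)%N x|%R @[n --> \oo] --> `|F0 x|%R.
      by apply: cvg_norm; rewrite (cvg_shiftn n0 (F ^~ x)); exact: cF.
    by move/cvgr_to_le; apply; apply: nearW => n; apply: FG => //; rewrite leq_addl.
  have Gfin : \int[mu]_(x in A `\` B) (G x)%:E < +oo by exact: integrable_lty.
  have mG : measurable_fun (A `\` B) (fun x => (G x)%:E) by case/integrableP: iG.
  have integ (H : T -> R) : measurable_fun A H ->
      \int[mu]_(x in A `&` B) `|H x|%:E <= e%:E ->
      (forall x, A x -> ~ B x -> (`|H x| <= G x)%R) -> mu.-integrable A (EFin \o H).
    move=> mH HB HG; apply/integrableP; split; first exact/measurable_EFinP.
    have mH' : measurable_fun A (fun x => `|H x|%:E).
      by apply/measurable_EFinP; exact: measurableT_comp.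
    rewrite (@ge0_integral_setIDr A B)//=.
    apply: lte_add_pinfty; first by rewrite (le_lt_trans HB)// ltry.
    apply: le_lt_trans Gfin; apply: ge0_le_integral => //.
    - by apply: (measurable_funS mA) => //; exact: subDsetl.
    - by move=> x [Ax Bx]; rewrite lee_fin HG.
  have iF0 : mu.-integrable A (EFin \o F0) by apply: integ.
  have iF n : (n0 <= n)%N -> mu.-integrable A (EFin \o F n).
    by move=> n0n; apply: integ => //; [exact: FB|move=> x; exact: FG].
  have FnF0 x : A x -> F (n + n0)%N x @[n --> \oo] --> F0 x.
    by move=> Ax; rewrite (cvg_shiftn n0 (F ^~ x)); exact: cF.
  have mS (H : T -> R) : measurable_fun A H -> measurable_fun (A `\` B) (EFin \o H).
    by move=> mH; apply/measurable_EFinP; apply: measurable_funS mH => //; exact: subDsetl.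
  have dc1 : {ae mu, forall x, (A `\` B) x ->
      (F (n + n0)%N x)%:E @[n --> \oo] --> (F0 x)%:E}.
    by apply: aeW => x [Ax _]; apply: cvg_EFin; [exact: nearW|exact: FnF0].
  have dc2 : {ae mu, forall x n, (A `\` B) x ->
      `|(F (n + n0)%N x)%:E| <= (EFin \o G) x}.
    by apply: aeW => x n [Ax Bx]; rewrite lee_fin; apply: FG => //; rewrite leq_addl.
  have [_ + _] := dominated_convergence mDB (fun n => mS _ (mF (n + n0)%N))
    (mS _ mF0) dc1 iG dc2.
  have e0' : (0 : \bar R) < e%:E by rewrite lte_fin.
  move=> /(_ _ (open_nbhs_nbhs (conj (@open_ereal_lt_ereal _ _) e0')))[n1 _ n1P].
  exists (n0 + n1)%N; split => // [n|n] nn.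
    by apply: iF; rewrite (leq_trans _ nn)// leq_addr.
  have n0n : (n0 <= n)%N by rewrite (leq_trans _ nn)// leq_addr.
  have mD : measurable_fun A (fun x => `|F n x - F0 x|%:E).
    by apply/measurable_EFinP/measurableT_comp => //; exact: measurable_funB.
  rewrite (@ge0_integral_setIDr A B)//=.
  rewrite mulrSr EFinD; apply: leeD; last first.
    have := n1P (n - n0)%N; rewrite /= leq_subRL// => /(_ nn); rewrite subnK//.
    by move=> /ltW.
  rewrite mulr2n EFinD.
  apply: (@le_trans _ _ (\int[mu]_(x in A `&` B) (`|F n x|%:E + `|F0 x|%:E))).
    apply: ge0_le_integral => //.
    - by apply: measurable_funS mD => //; exact: subIsetl.
    - by apply: emeasurable_funD; apply: measurable_funS mA (@subIsetl _ _ _) _ => //.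
    - by move=> x _; rewrite lee_fin ler_normB.
  rewrite ge0_integralD//; last 2 first.
  - exact: measurable_funS (aF n).
  - exact: measurable_funS aF0.
  by apply: leeD => //; exact: FB.
have [n0 [iF0 _ _]] := key 1%R ltr01.
split=> //; apply/cvgrPdist_le => e e0.
have [|n1 [_ iF h]] := key (e / 3)%R; first by rewrite divr_gt0.
exists n1 => // n /= n1n.
rewrite distrC -RintegralB//; last exact: iF.
have iD : mu.-integrable A (EFin \o (F n \- F0)%R).
  by rewrite (_ : _ \o _ = (EFin \o F n) \- (EFin \o F0))//; apply: integrableB => //; exact: iF.
apply: le_trans; first exact: le_normr_Rintegral.
have e3 : (e / 3 *+ 3 = e)%R by rewrite -[LHS]mulr_natr divfK ?pnatr_eq0.
have := h n n1n; rewrite e3 => he.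
rewrite -lee_fin fineK//.
rewrite ge0_fin_numE; first by rewrite (le_lt_trans he)// ltry.
by apply: integral_ge0 => x _; rewrite lee_fin.
Qed.

End VitaliConvergence.

(** * Integration of complex-valued functions of a real variable *)

Section ComplexIntegral.
Variable R : realType.
Local Notation C := R[i].
Local Notation mu := (@lebesgue_measure R).
Implicit Types (A N : set R) (f g : R -> C).

(** Every subset of a countable set is measurable, so arbitrary values on [N] do no harm. All
    kernels below are continuous off a countable set of angles and take default values there. *)
Lemma measurable_fun_off_countable N (f : R -> R) : countable N ->
  (forall x, ~ N x -> {for x, continuous f}) -> measurable_fun setT f.
Proof.
move=> cN cf.
have mN B : B `<=` N -> measurable B.
  by move=> BN; apply: countable_measurable => //; exact: (sub_countable (subset_card_le BN) cN).
have mN0 : measurable N by exact: mN.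
rewrite -(setUv N); apply/measurable_funU => //; first exact: measurableC.
split; last first.
  apply: subspace_continuous_measurable_fun; first exact: measurableC.
  apply/subspace_continuousP => x Nx.
  by apply: cvg_trans (cf x Nx); apply: cvg_app; exact: cvg_within.
by move=> _ B mB; apply: mN => x [].
Qed.

Definition cont_off N f := forall x, ~ N x -> {for x, continuous f}.

Definition cmeasurable A f :=
  measurable_fun A (fun x => Re (f x)) /\ measurable_fun A (fun x => Im (f x)).

Definition cintegrable A f :=
  cmeasurable A f /\ (\int[mu]_(x in A) (cabs (f x))%:E < +oo)%E.

Lemma cont_off_cmeasurable N f : countable N -> cont_off N f -> cmeasurable setT f.
Proof.
move=> cN cf; split; apply: (measurable_fun_off_countable cN) => x /cf.
  by move=> /cvg_ReImP[].
by move=> /cvg_ReImP[].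
Qed.

Lemma cmeasurableS A B f : measurable A -> B `<=` A -> cmeasurable A f -> cmeasurable B f.
Proof. by move=> mA BA [fr fi]; split; exact: (measurable_funS mA BA). Qed.

Lemma cmeasurableD A f g : cmeasurable A f -> cmeasurable A g ->
  cmeasurable A (fun x => f x + g x).
Proof.
move=> [fr fi] [gr gi]; split.
  by under eq_fun do rewrite ReD; exact: measurable_funD.
by under eq_fun do rewrite ImD; exact: measurable_funD.
Qed.

Lemma cmeasurableM A f g : cmeasurable A f -> cmeasurable A g ->
  cmeasurable A (fun x => f x * g x).
Proof.
move=> [fr fi] [gr gi]; split.
  under eq_fun do rewrite ReM.
  by apply: measurable_funB; exact: measurable_funM.
under eq_fun do rewrite ImM.
by apply: measurable_funD; exact: measurable_funM.
Qed.

Lemma cmeasurable_cst A (k : C) : cmeasurable A (fun=> k).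
Proof. by split; exact: measurable_cst. Qed.

Lemma cmeasurable_real A (h : R -> R) : measurable_fun A h ->
  cmeasurable A (fun x => (h x)%:C).
Proof. by move=> mh; split => //=; exact: measurable_cst. Qed.

Lemma cmeasurable_conj A f : cmeasurable A f -> cmeasurable A (fun x => conjc (f x)).
Proof.
move=> [fr fi]; split.
  by rewrite [X in measurable_fun _ X](_ : _ = (fun x => Re (f x)))//; apply/funext => x; case: (f x).
rewrite [X in measurable_fun _ X](_ : _ = (fun x => - Im (f x))); first exact: measurableT_comp.
by apply/funext => x; case: (f x).
Qed.

Lemma measurable_sqrt A (h : R -> R) : measurable_fun A h ->
  measurable_fun A (fun x => Num.sqrt (h x)).
Proof.
move=> mh; apply: measurableT_comp mh.
by apply: continuous_measurable_fun; exact: sqrt_continuous.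
Qed.

Lemma cmeasurable_cabs A f : cmeasurable A f -> measurable_fun A (fun x => cabs (f x)).
Proof.
move=> [fr fi].
rewrite [X in measurable_fun _ X](_ : _ = (fun x => Num.sqrt (Re (f x) ^+ 2 + Im (f x) ^+ 2))).
  by apply: measurable_sqrt; apply: measurable_funD; exact: measurable_funX.
by apply/funext => x; rewrite -cabs_sqr sqrtr_sqr ger0_norm// cabs_ge0.
Qed.

Lemma cmeasurable_cabsE A f : cmeasurable A f ->
  measurable_fun A (fun x => (cabs (f x))%:E).
Proof. by move=> mf; apply/measurable_EFinP; exact: cmeasurable_cabs. Qed.

Lemma cintegrable_ReIm A f : measurable A -> cintegrable A f <->
  mu.-integrable A (fun x => (Re (f x))%:E) /\ mu.-integrable A (fun x => (Im (f x))%:E).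
Proof.
move=> mA; split=> [[mf fy]|[fr fi]].
  have [fr fi] := mf.
  split; apply/integrableP; split; try exact/measurable_EFinP.
    apply: le_lt_trans fy; apply: ge0_le_integral => //.
    - by apply/measurable_EFinP; apply: measurableT_comp fr.
    - exact: cmeasurable_cabsE.
    - by move=> x _; rewrite lee_fin ler_norm_Re.
  apply: le_lt_trans fy; apply: ge0_le_integral => //.
  - by apply/measurable_EFinP; apply: measurableT_comp fi.
  - exact: cmeasurable_cabsE.
  - by move=> x _; rewrite lee_fin ler_norm_Im.
have mf : cmeasurable A f.
  by split; apply/measurable_EFinP; [case/integrableP : fr|case/integrableP : fi].
split => //.
have [mr mi] := mf.
have /integrableP[_ fry] := fr; have /integrableP[_ fiy] := fi.
have mr' : measurable_fun A (fun x => `|Re (f x)|%:E).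
  by apply/measurable_EFinP; exact: measurableT_comp mr.
have mi' : measurable_fun A (fun x => `|Im (f x)|%:E).
  by apply/measurable_EFinP; exact: measurableT_comp mi.
apply: (@le_lt_trans _ _ (\int[mu]_(x in A) (`|Re (f x)|%:E + `|Im (f x)|%:E))%E).
  apply: ge0_le_integral => //.
  - by move=> x _; rewrite lee_fin cabs_ge0.
  - exact: cmeasurable_cabsE.
  - exact: emeasurable_funD.
  - by move=> x _; rewrite lee_fin ler_cabs_ReIm.
rewrite ge0_integralD//.
exact: lte_add_pinfty.
Qed.

Lemma cintegrable_dom A f (h : R -> R) : measurable A -> cmeasurable A f ->
  mu.-integrable A (EFin \o h) -> (forall x, A x -> cabs (f x) <= h x) ->
  cintegrable A f.
Proof.
move=> mA mf ih fh; split => //.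
have hy : (\int[mu]_(x in A) (h x)%:E < +oo)%E by exact: integrable_lty.
apply: (le_lt_trans _ hy); apply: ge0_le_integral => //.
- by move=> x _; rewrite lee_fin cabs_ge0.
- exact: cmeasurable_cabsE.
- by case/integrableP : ih.
Qed.

Lemma integrable_cabs A f : measurable A -> cintegrable A f ->
  mu.-integrable A (fun x => (cabs (f x))%:E).
Proof.
move=> mA [mf fy]; apply/integrableP; split; first exact: cmeasurable_cabsE.
by under eq_integral do rewrite /= ger0_norm ?cabs_ge0//.
Qed.

Lemma cintegralE A f : cintegral A f =
  (\int[mu]_(x in A) Re (f x))%R +i* (\int[mu]_(x in A) Im (f x))%R.
Proof. by []. Qed.

Lemma eq_cintegral A f g : (forall x, A x -> f x = g x) -> cintegral A f = cintegral A g.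
Proof.
by move=> fg; rewrite /cintegral; congr (_ +i* _); apply: eq_Rintegral => x;
  rewrite inE => /fg ->.
Qed.

Lemma cintegrableD A f g : measurable A -> cintegrable A f -> cintegrable A g ->
  cintegrable A (fun x => f x + g x).
Proof.
move=> mA /(cintegrable_ReIm _ mA)[fr fi] /(cintegrable_ReIm _ mA)[gr gi].
apply/(cintegrable_ReIm _ mA); split.
  under eq_fun do rewrite ReD EFinD.
  exact: integrableD.
under eq_fun do rewrite ImD EFinD.
exact: integrableD.
Qed.

Lemma cintegralD A f g : measurable A -> cintegrable A f -> cintegrable A g ->
  cintegral A (fun x => f x + g x) = cintegral A f + cintegral A g.
Proof.
move=> mA /(cintegrable_ReIm _ mA)[fr fi] /(cintegrable_ReIm _ mA)[gr gi].
apply: eq_complexP => /=.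
  by under eq_Rintegral do rewrite ReD; rewrite RintegralD.
by under eq_Rintegral do rewrite ImD; rewrite RintegralD.
Qed.

Lemma cintegrableZ A (k : C) f : measurable A -> cintegrable A f ->
  cintegrable A (fun x => k * f x).
Proof.
move=> mA /(cintegrable_ReIm _ mA)[fr fi]; apply/(cintegrable_ReIm _ mA); split.
  under eq_fun do rewrite ReM EFinB !EFinM.
  by apply: integrableB => //; exact: integrableZl.
under eq_fun do rewrite ImM EFinD !EFinM.
by apply: integrableD => //; exact: integrableZl.
Qed.

Lemma cintegralZ A (k : C) f : measurable A -> cintegrable A f ->
  cintegral A (fun x => k * f x) = k * cintegral A f.
Proof.
move=> mA /(cintegrable_ReIm _ mA)[fr fi].
have Z (a : R) (h : R -> R) : mu.-integrable A (EFin \o h) ->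
    mu.-integrable A (EFin \o (fun x => a * h x)).
  move=> ih; rewrite (_ : _ \o _ = (fun x => a%:E * (h x)%:E)%E)//.
  exact: integrableZl.
apply: eq_complexP => /=.
  under eq_Rintegral do rewrite ReM.
  by rewrite RintegralB ?RintegralZl ?ReM//=; exact: Z.
under eq_Rintegral do rewrite ImM.
by rewrite RintegralD ?RintegralZl ?ImM//=; exact: Z.
Qed.

Lemma cintegrableN A f : measurable A -> cintegrable A f -> cintegrable A (fun x => - f x).
Proof.
move=> mA /(cintegrableZ (- 1) mA).
by under eq_fun do rewrite mulN1r.
Qed.

Lemma cintegralN A f : measurable A -> cintegrable A f ->
  cintegral A (fun x => - f x) = - cintegral A f.
Proof.
by move=> mA /(cintegralZ (- 1) mA); under eq_fun do rewrite mulN1r; rewrite mulN1r.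
Qed.

Lemma cintegrableB A f g : measurable A -> cintegrable A f -> cintegrable A g ->
  cintegrable A (fun x => f x - g x).
Proof. by move=> mA fi gi; apply: cintegrableD => //; exact: cintegrableN. Qed.

Lemma cintegralB A f g : measurable A -> cintegrable A f -> cintegrable A g ->
  cintegral A (fun x => f x - g x) = cintegral A f - cintegral A g.
Proof.
by move=> mA fi gi; rewrite cintegralD//; [rewrite cintegralN|exact: cintegrableN].
Qed.

(** The factor 2 comes from bounding the real and imaginary parts separately. *)
Lemma cabs_cintegral_le A f (M : R) : measurable A -> cmeasurable A f ->
  (\int[mu]_(x in A) (cabs (f x))%:E <= M%:E)%E -> cabs (cintegral A f) <= 2 * M.
Proof.
move=> mA mf fM.
have fy : cintegrable A f by split => //; rewrite (le_lt_trans fM)// ltry.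
have ia := integrable_cabs mA fy.
have /(cintegrable_ReIm _ mA)[fr fi] := fy.
have fM' : (\int[mu]_(x in A) cabs (f x))%R <= M.
  rewrite -lee_fin fineK// ge0_fin_numE; first by rewrite (le_lt_trans fM)// ltry.
  by apply: integral_ge0 => x _; rewrite lee_fin cabs_ge0.
apply: le_trans (ler_cabs_ReIm _) _ => /=; rewrite mulr2n mulrDl !mul1r.
apply: lerD; apply: le_trans fM'; apply: le_trans (le_normr_Rintegral _ _) _ => //.
  apply: le_Rintegral => //; last by move=> x _; exact: ler_norm_Re.
  exact: integrable_norm fr.
apply: le_Rintegral => //; last by move=> x _; exact: ler_norm_Im.
exact: integrable_norm fi.
Qed.

Lemma ge0_integral_setD_countable A N (f : R -> \bar R) : measurable A -> countable N ->
  measurable_fun A f -> (forall x, A x -> 0 <= f x)%E ->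
  (\int[mu]_(x in A `\` N) f x = \int[mu]_(x in A) f x)%E.
Proof.
move=> mA cN mf f0; apply/esym/ge0_negligible_integral => //.
  exact: countable_measurable.
exact: countable_lebesgue_measure0.
Qed.

Lemma cintegral_setD_countable A N f : measurable A -> countable N ->
  cmeasurable A f -> cintegral (A `\` N) f = cintegral A f.
Proof.
move=> mA cN [fr fi].
have key (h : R -> R) : measurable_fun A h ->
    (\int[mu]_(x in A `\` N) h x)%R = (\int[mu]_(x in A) h x)%R.
  move=> mh; rewrite /Rintegral; congr fine.
  have mh' : measurable_fun A (EFin \o h) by exact/measurable_EFinP.
  rewrite integralE [in RHS]integralE; congr (_ - _)%E.
    by apply: ge0_integral_setD_countable => //; exact: measurable_funepos.
  by apply: ge0_integral_setD_countable => //; exact: measurable_funeneg.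
by rewrite /cintegral !key.
Qed.

Lemma vitali_cvg_cintegral A (F : nat -> R -> C) (F0 : R -> C) : measurable A ->
  (forall n, cmeasurable A (F n)) -> cmeasurable A F0 ->
  (forall x, A x -> F n x @[n --> \oo] --> F0 x) ->
  (forall e : R, 0 < e -> exists (B : set R) (G : R -> R) (n0 : nat),
    [/\ measurable B, mu.-integrable (A `\` B) (EFin \o G),
     forall n, (n0 <= n)%N -> (\int[mu]_(x in A `&` B) (cabs (F n x))%:E <= e%:E)%E &
     forall n x, (n0 <= n)%N -> A x -> ~ B x -> cabs (F n x) <= G x]) ->
  cintegrable A F0 /\ cintegral A (F n) @[n --> \oo] --> cintegral A F0.
Proof.
move=> mA mF mF0 cF small.
have sub (p : C -> R) : (forall z, `|p z| <= cabs z) ->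
    (forall n, measurable_fun A (fun x => p (F n x))) ->
    forall e : R, 0 < e -> exists (B : set R) (G : R -> R) (n0 : nat),
    [/\ measurable B, mu.-integrable (A `\` B) (EFin \o G),
     forall n, (n0 <= n)%N -> (\int[mu]_(x in A `&` B) `|p (F n x)|%:E <= e%:E)%E &
     forall n x, (n0 <= n)%N -> A x -> ~ B x -> `|p (F n x)| <= G x].
  move=> pz mp e /small[B [G [n0 [mB iG FB FG]]]]; exists B, G, n0; split => //.
    move=> n /FB; apply: le_trans; apply: ge0_le_integral => //.
    - exact: measurableI.
    - apply: measurable_funS mA (@subIsetl _ _ _) _.
      by apply/measurable_EFinP; exact: measurableT_comp (mp n).
    - by apply: measurable_funS mA (@subIsetl _ _ _) _; exact: cmeasurable_cabsE.
    - by move=> x _; rewrite lee_fin pz.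
  by move=> n x /FG h Ax /(h x Ax); exact: le_trans.
have cFr x : A x -> Re (F n x) @[n --> \oo] --> Re (F0 x).
  by move=> /cF/cvg_ReImP[].
have cFi x : A x -> Im (F n x) @[n --> \oo] --> Im (F0 x).
  by move=> /cF/cvg_ReImP[].
have [ir cr] : mu.-integrable A (EFin \o (fun x => Re (F0 x))) /\
    (\int[mu]_(x in A) Re (F n x))%R @[n --> \oo] --> (\int[mu]_(x in A) Re (F0 x))%R.
  apply: (@vitali_cvg_integral _ (measurableTypeR R) R mu A (fun n x => Re (F n x))) => //.
  - by move=> n; have [] := mF n.
  - by have [] := mF0.
  - apply: (sub (fun z => Re z)); first exact: ler_norm_Re.
    by move=> n; have [] := mF n.
have [ii ci] : mu.-integrable A (EFin \o (fun x => Im (F0 x))) /\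
    (\int[mu]_(x in A) Im (F n x))%R @[n --> \oo] --> (\int[mu]_(x in A) Im (F0 x))%R.
  apply: (@vitali_cvg_integral _ (measurableTypeR R) R mu A (fun n x => Im (F n x))) => //.
  - by move=> n; have [] := mF n.
  - by have [] := mF0.
  - apply: (sub (fun z => Im z)); first exact: ler_norm_Im.
    by move=> n; have [] := mF n.
split; first by apply/cintegrable_ReIm.
by apply/cvg_ReImP; split.
Qed.

End ComplexIntegral.

(** * Differentiable paths, the chain rule and the mean value inequality *)

Section Paths.
Variable R : realType.
Local Notation C := R[i].
Local Notation mu := (@lebesgue_measure R).
Implicit Types (f g : R -> C) (x a b : R) (z v w : C).

(* Derivative [v] at [x] of a path, and derivative [v] at [z] along a set [A]. *)
Definition pderiv f x v := forall e : R, 0 < e -> exists2 d : R, 0 < d &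
  forall h : R, `|h| < d -> cabs (f (x + h) - f x - h%:C * v) <= e * `|h|.

Definition cdiff (A : set C) (s : C -> C) z v := forall e : R, 0 < e ->
  exists2 d : R, 0 < d & forall w, A w -> cabs (w - z) < d ->
    cabs (s w - s z - v * (w - z)) <= e * cabs (w - z).

Lemma is_derive_epsP (u : R -> R) x (c : R) : is_derive x 1 u c <->
  forall e : R, 0 < e -> exists2 d : R, 0 < d &
    forall h : R, `|h| < d -> `|u (x + h) - u x - h * c| <= e * `|h|.
Proof.
split=> [[du uc] e e0|H].
  have : h^-1 *: (u (h *: 1 + x) - u x) @[h --> 0^'] --> c.
    by rewrite -uc; exact: du.
  move=> /cvgrPdist_le/(_ e e0)[d /= d0 dP].
  exists d => // h hd; have [->|h0] := eqVneq h 0.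
    by rewrite addr0 subrr mul0r subr0 normr0 mulr0.
  have := dP h; rewrite /= sub0r normrN => /(_ hd h0).
  rewrite distrC /GRing.scale/= mulr1 (addrC h) => H.
  rewrite (_ : _ - _ = h * (h^-1 * (u (x + h) - u x) - c)); last by field.
  by rewrite normrM mulrC ler_wpM2r.
suff : h^-1 *: (u (h *: 1 + x) - u x) @[h --> 0^'] --> c.
  move=> uc; split; first by apply/cvg_ex; exists c.
  exact/cvg_lim.
apply/cvgrPdist_le => e e0; have [d d0 dP] := H e e0.
exists d => //= h; rewrite /= sub0r normrN => hd h0.
rewrite distrC /GRing.scale/= mulr1 (addrC h).
rewrite (_ : _ - c = h^-1 * (u (x + h) - u x - h * c)); last by field.
rewrite normrM normrV ?unitfE// ler_pdivrMl ?normr_gt0// [`|h| * e]mulrC.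
exact: dP.
Qed.

Lemma pderivP f x v : pderiv f x v <->
  is_derive x 1 (fun t => Re (f t)) (Re v) /\ is_derive x 1 (fun t => Im (f t)) (Im v).
Proof.
rewrite !is_derive_epsP; split=> [H|[Hr Hi] e e0].
  split=> e /H[d d0 dP]; exists d => // h /dP; apply: le_trans.
    by apply: le_trans (ler_norm_Re _); rewrite !ReB ReMr.
  by apply: le_trans (ler_norm_Im _); rewrite !ImB ImMr.
have e2 : 0 < e / 2 by rewrite divr_gt0.
have [d1 d10 P1] := Hr _ e2; have [d2 d20 P2] := Hi _ e2.
exists (Num.min d1 d2); first by rewrite lt_min d10.
move=> h; rewrite lt_min => /andP[/P1 h1 /P2 h2].
apply: le_trans (ler_cabs_ReIm _) _; rewrite !ReB !ImB ReMr ImMr.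
by rewrite [e]splitr mulrDl lerD.
Qed.

Lemma pderiv_continuous f x v : pderiv f x v -> {for x, continuous f}.
Proof.
move=> /pderivP[/is_derive_continuous fr /is_derive_continuous fi].
exact/cvg_ReImP.
Qed.

(** Differentiability of [s] is asked along [A] only: [setT] serves interior points, [circle] serves
    boundary points, where only the contour derivative is known. *)
Lemma pderiv_comp (A : set C) (s : C -> C) g x u v : pderiv g x u ->
  cdiff A s (g x) v -> (exists2 d : R, 0 < d & forall h : R, `|h| < d -> A (g (x + h))) ->
  pderiv (fun t => s (g t)) x (v * u).
Proof.
move=> gu sv [d0 d00 Ag] e e0.
pose K := cabs u + 1; pose L := cabs v + 1.
have K0 : 0 < K by rewrite ltr_wpDl ?cabs_ge0.
have L0 : 0 < L by rewrite ltr_wpDl ?cabs_ge0.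
have eK : 0 < e / 2 / K by rewrite !divr_gt0.
have eL : 0 < e / 2 / L by rewrite !divr_gt0.
have [d1 d10 P1] := sv _ eK.
have [d2 d20 P2] := gu 1 ltr01; have [d3 d30 P3] := gu _ eL.
have d1K : 0 < d1 / K by rewrite divr_gt0.
exists (Num.min (Num.min d0 (d1 / K)) (Num.min d2 d3)).
  by rewrite !lt_min d00 d1K d20 d30.
move=> h; rewrite !lt_min => /andP[/andP[h0 h1] /andP[h2 h3]].
have gh : cabs (g (x + h) - g x) <= K * `|h|.
  have -> : g (x + h) - g x = (g (x + h) - g x - h%:C * u) + h%:C * u by rewrite subrK.
  apply: le_trans (ler_cabsD _ _) _; rewrite cabsM cabs_real mulrDl addrC mulrC.
  by apply: lerD => //; exact: P2.
have ghd : cabs (g (x + h) - g x) < d1.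
  by apply: le_lt_trans gh _; rewrite mulrC -ltr_pdivlMr.
have -> : s (g (x + h)) - s (g x) - h%:C * (v * u) =
    (s (g (x + h)) - s (g x) - v * (g (x + h) - g x)) +
    v * (g (x + h) - g x - h%:C * u) by ring.
apply: le_trans (ler_cabsD _ _) _; rewrite [e]splitr mulrDl; apply: lerD.
  apply: le_trans (P1 _ (Ag _ h0) ghd) _.
  apply: (@le_trans _ _ (e / 2 / K * (K * `|h|))); first by rewrite ler_pM2l.
  by rewrite mulrA divfK ?gt_eqF.
rewrite cabsM; apply: (@le_trans _ _ (L * (e / 2 / L * `|h|))).
  by apply: ler_pM; rewrite ?cabs_ge0 ?lerDl ?P3.
by rewrite mulrA mulrC [L * _]mulrC divfK ?gt_eqF// mulrC.
Qed.

Lemma pderiv_affine z w x : pderiv (fun t => z + t%:C * w) x w.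
Proof.
move=> e e0; exists 1 => // h _.
rewrite (_ : _ - _ = 0); first by rewrite cabs0 mulr_ge0// ltW.
by rewrite rmorphD /=; ring.
Qed.

Lemma pderivZ (k : C) f x v : pderiv f x v -> pderiv (fun t => k * f t) x (k * v).
Proof.
move=> fv; apply: (@pderiv_comp setT (fun w => k * w) f x v k fv); last by exists 1.
move=> e e0; exists 1 => // w _ _; rewrite mulrBr subrr cabs0.
by rewrite mulr_ge0 ?cabs_ge0// ltW.
Qed.

Lemma is_derive_scale_arg (u : R -> R) (a x c : R) : is_derive (a * x) 1 u c ->
  is_derive x 1 (fun t => u (a * t)) (a * c).
Proof.
move=> du; have da : is_derive x 1 (fun t => a * t) a.
  by apply: is_derive_eq; rewrite /GRing.scale/= mulr1.
have := @is_derive1_comp _ u (fun t => a * t) x c a du da.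
by rewrite mulrC.
Qed.

Lemma pderiv_expi (a x : R) : pderiv (fun t => expi (a * t)) x (a%:C * ('i * expi (a * x))).
Proof.
apply/pderivP; rewrite ReMr ImMr ReM ImM /= !(mul0r, mul1r, sub0r, add0r).
by split; apply: is_derive_scale_arg.
Qed.

Lemma pderiv_expi1 (x : R) : pderiv (@expi R) x ('i * expi x).
Proof.
have := pderiv_expi 1 x; rewrite mul1r mul1r.
by under [X in pderiv X]eq_fun do rewrite mul1r.
Qed.

(** Rotate by the unimodular [w] for which $w(f(b)-f(a))=|f(b)-f(a)|$. Then $u=\mathrm{Re}(wf)$ has
    $u'\le|f'|\le G'$, so $G-u$ is nondecreasing. *)
Lemma cabs_mean_value f (G G' : R -> R) a b : a <= b ->
  (forall x, a < x < b -> exists v, [/\ pderiv f x v, cabs v <= G' x & is_derive x 1 G (G' x)]) ->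
  {within `[a, b], continuous f} -> {within `[a, b], continuous G} ->
  cabs (f b - f a) <= G b - G a.
Proof.
move=> ab fd fc Gc.
set e := f b - f a; have [e0|e0] := eqVneq e 0.
  rewrite e0 cabs0 subr_ge0; apply: (@is_derive_ge0_le _ G G') => //.
    by move=> x /fd[v []].
  by move=> x /fd[v [_ + _]]; apply: le_trans; exact: cabs_ge0.
pose w := conjc e / (cabs e)%:C.
have ce0 : cabs e != 0 by rewrite cabs_eq0.
have w1 : cabs w = 1.
  by rewrite cabs_div cabsJ cabs_real ger0_norm ?cabs_ge0// divff.
have we : Re (w * e) = cabs e.
  rewrite /w mulrAC [conjc e * e]mulrC mulcJ -fmorphV -rmorphM /=.
  by rewrite expr2 mulfK.
pose u x := Re (w * f x).
have -> : cabs e = u b - u a by rewrite -we /u -ReB -mulrBr.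
suff : G a - u a <= G b - u b by lra.
have ux x v : pderiv f x v -> is_derive x 1 u (Re (w * v)).
  move=> /pderivP[dr di]; rewrite /u.
  rewrite (_ : (fun _ => _) = (fun x => Re w * Re (f x)) - (fun x => Im w * Im (f x))).
    rewrite ReM -[_ * Re v]/(_ *: _) -[_ * Im v]/(_ *: _).
    by apply: is_deriveB; apply: is_deriveZ.
  by apply/funext => t; rewrite ReM.
pose v x := xget 0 [set v | pderiv f x v /\ cabs v <= G' x].
have vP x : a < x < b -> pderiv f x (v x) /\ cabs (v x) <= G' x.
  by move=> /fd[v0 [p1 p2 _]]; rewrite /v; case: xgetP => [? _ []//|/(_ v0)[]].
apply: (@is_derive_ge0_le _ (G - u) (fun x => G' x - Re (w * v x))) => //.
- move=> x axb; apply: is_deriveB; first by have [? [_ _]] := fd x axb.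
  by apply: ux; have [] := vP x axb.
- move=> x; apply: cvgB; first exact: Gc.
  have /cvg_ReImP[c1 c2] := fc x.
  rewrite /u; rewrite (_ : (fun _ => _) = (fun x => Re w * Re (f x)) - (fun x => Im w * Im (f x))); last first.
    by apply/funext => t; rewrite ReM.
  by rewrite ReM; exact: (cvgB (cvgM (cvg_cst _) c1) (cvgM (cvg_cst _) c2)).
- move=> x axb; rewrite subr_ge0; have [_] := vP x axb; apply: le_trans.
  by apply: le_trans (ler_norm _) _; apply: le_trans (ler_norm_Re _) _; rewrite cabsM w1 mul1r.
Qed.

Lemma continuous_cintegrable f a b : continuous f -> cintegrable `[a, b] f.
Proof.
move=> fc; apply/cintegrable_ReIm => //; split.
  apply: continuous_compact_integrable; first exact: segment_compact.
  by apply: continuous_subspaceT => x; have /cvg_ReImP[] := fc x.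
apply: continuous_compact_integrable; first exact: segment_compact.
by apply: continuous_subspaceT => x; have /cvg_ReImP[] := fc x.
Qed.

Lemma cintegral_FTC2 (F : R -> C) f a b : a < b -> continuous f ->
  (forall x, pderiv F x (f x)) -> cintegral `[a, b] f = F b - F a.
Proof.
move=> ab fc dF.
have key (U u : R -> R) : continuous u -> (forall x, is_derive x 1 U (u x)) ->
    (\int[mu]_(x in `[a, b]) u x)%R = U b - U a.
  move=> uc dU; rewrite /Rintegral (@continuous_FTC2 _ u U)//.
  - exact: continuous_subspaceT.
  - split; first by move=> x _; have [] := dU x.
      by apply: cvg_at_right_filter; exact: is_derive_continuous (dU a).
    by apply: cvg_at_left_filter; exact: is_derive_continuous (dU b).
  - by move=> x _; have [_] := dU x; rewrite derive1E.
apply: eq_complexP; rewrite ?ReB ?ImB /=.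
  apply: (key (fun x => Re (F x)) (fun x => Re (f x))) => x.
    by have /cvg_ReImP[] := fc x.
  by have /pderivP[] := dF x.
apply: (key (fun x => Im (F x)) (fun x => Im (f x))) => x.
  by have /cvg_ReImP[] := fc x.
by have /pderivP[] := dF x.
Qed.

End Paths.

(** * Pointwise continuity of complex expressions *)

Section ContinuityR.
Variable R : realType.
Local Notation C := R[i].
Variables (T : topologicalType) (x : T).
Implicit Types (f g : T -> C).

Lemma ccontinuousD f g : {for x, continuous f} -> {for x, continuous g} ->
  {for x, continuous (fun t => f t + g t)}.
Proof. by move=> cf cg; exact: (@cvgD _ C _ (nbhs x) _ f g _ _ cf cg). Qed.

Lemma ccontinuousN f : {for x, continuous f} -> {for x, continuous (fun t => - f t)}.
Proof. by move=> cf; exact: (@cvgN _ C _ (nbhs x) _ f _ cf). Qed.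

Lemma ccontinuousB f g : {for x, continuous f} -> {for x, continuous g} ->
  {for x, continuous (fun t => f t - g t)}.
Proof. by move=> cf cg; exact: (@cvgB _ C _ (nbhs x) _ f g _ _ cf cg). Qed.

Lemma ccontinuousM f g : {for x, continuous f} -> {for x, continuous g} ->
  {for x, continuous (fun t => f t * g t)}.
Proof. by move=> cf cg; exact: (@cvgM C _ (nbhs x) _ f g _ _ cf cg). Qed.

Lemma ccontinuousV f : f x != 0 -> {for x, continuous f} ->
  {for x, continuous (fun t => (f t)^-1)}.
Proof. by move=> fx0 cf; exact: (@cvgV C _ (nbhs x) _ f _ fx0 cf). Qed.

Lemma ccontinuous_div f g : g x != 0 -> {for x, continuous f} -> {for x, continuous g} ->
  {for x, continuous (fun t => f t / g t)}.
Proof. by move=> gx0 cf cg; exact: (ccontinuousM cf (ccontinuousV gx0 cg)). Qed.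

Lemma ccontinuousX f n : {for x, continuous f} -> {for x, continuous (fun t => f t ^+ n)}.
Proof.
move=> cf; elim: n => [|n IHn].
  by rewrite (_ : (fun t => f t ^+ 0) = (fun=> 1)); [exact: cvg_cst|exact/funext].
rewrite (_ : (fun t => f t ^+ n.+1) = (fun t => f t * f t ^+ n)).
  exact: (ccontinuousM cf IHn).
by apply/funext => t; rewrite exprS.
Qed.

Lemma ccontinuous_conj f : {for x, continuous f} -> {for x, continuous (fun t => conjc (f t))}.
Proof.
move=> /cvg_cabsP cf; apply/cvg_cabsP; apply: cvg_trans cf.
apply: near_eq_cvg; apply: nearW => t /=.
by rewrite -rmorphB cabsJ.
Qed.

Lemma ccontinuous_real (u : T -> R) : {for x, continuous u} ->
  {for x, continuous (fun t => (u t)%:C : C)}.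
Proof. by move=> cu; apply/cvg_ReImP; split => //=; exact: cvg_cst. Qed.

Lemma ccontinuous_cst (k : C) : {for x, continuous (fun _ : T => k)}.
Proof. exact: cvg_cst. Qed.

End ContinuityR.

(** * The Cauchy and Poisson kernels of the disc and a kernel of mean zero *)

Section CircleKernels.
Variable R : realType.
Local Notation C := R[i].
Local Notation mu := (@lebesgue_measure R).
Local Notation I := (`[0, 2 * pi]%classic : set R).
Implicit Types (f : R -> C) (x : R) (Z : C).

Lemma conjcM (z w : C) : conjc (z * w) = conjc z * conjc w.
Proof. exact: rmorphM. Qed.
Lemma conjcD (z w : C) : conjc (z + w) = conjc z + conjc w.
Proof. exact: rmorphD. Qed.
Lemma conjcB (z w : C) : conjc (z - w) = conjc z - conjc w.
Proof. exact: rmorphB. Qed.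
Lemma conjcN (z : C) : conjc (- z) = - conjc z.
Proof. exact: rmorphN. Qed.
Lemma conjcV (z : C) : conjc z^-1 = (conjc z)^-1.
Proof. exact: fmorphV. Qed.
Lemma realcB (a b : R) : (a - b)%:C = a%:C - b%:C :> C.
Proof. exact: rmorphB. Qed.
Lemma realcD (a b : R) : (a + b)%:C = a%:C + b%:C :> C.
Proof. exact: rmorphD. Qed.
Lemma realcM (a b : R) : (a * b)%:C = a%:C * b%:C :> C.
Proof. exact: rmorphM. Qed.
Lemma realcV (a : R) : (a^-1)%:C = (a%:C)^-1 :> C.
Proof. exact: fmorphV. Qed.

Lemma conjc_i : conjc ('i : C) = - 'i.
Proof. by apply: eq_complexP; rewrite ?ReN ?ImN /= ?oppr0. Qed.

Lemma expi_continuous : continuous (@expi R).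
Proof. by move=> x; exact: pderiv_continuous (pderiv_expi1 x). Qed.

Lemma expi_sub_neq0 x Z : cabs Z < 1 -> expi x - Z != 0.
Proof. by apply: contraTneq => /subr0_eq <-; rewrite cabs_expi ltxx. Qed.

Lemma cabs_eps_eq0 (z : C) (M r : R) : 0 <= r < 1 -> (forall n, cabs z <= r ^+ n * M) -> z = 0.
Proof.
move=> /andP[r0 r1] zr; apply/eqP; rewrite -cabs_eq0 eq_le cabs_ge0 andbT.
have : r ^+ n * M @[n --> \oo] --> (0 * M : R).
  by apply: cvgMl; apply: cvg_expr; rewrite ger0_norm.
by rewrite mul0r => /cvgr_to_ge; apply; apply: nearW.
Qed.

(** If [f] has no positive frequencies, then neither has its product with $S/(S-Z)=\sum_k(Z/S)^k$,
    and the mean is unchanged. The moments of the product satisfy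
    [J n = (moment of f) + Z * J n.+1]; they are bounded, and [cabs Z < 1]. This takes the place of
    Cauchy's theorem. *)
Lemma circle_moments_cauchy f Z : continuous f -> cabs Z < 1 ->
  (forall n, cintegral I (fun x => conjc (expi x) ^+ n.+1 * f x) = 0) ->
  cintegral I (fun x => f x * (expi x / (expi x - Z))) = cintegral I f /\
  forall n, cintegral I (fun x => conjc (expi x) ^+ n.+1 * (f x * (expi x / (expi x - Z)))) = 0.
Proof.
move=> fc Z1 fm.
pose q x := expi x / (expi x - Z).
have qc : continuous q.
  move=> x; apply: ccontinuous_div; first exact: expi_sub_neq0.
    exact: expi_continuous.
  by apply: ccontinuousB; [exact: expi_continuous|exact: ccontinuous_cst].
have conc n : continuous (fun x => conjc (expi x) ^+ n : C).
  by move=> x; exact: (ccontinuousX (n:=n) (ccontinuous_conj (@expi_continuous x))).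
have fqc : continuous (fun x => f x * q x).
  by move=> x; exact: (ccontinuousM (fc x) (qc x)).
pose J n := cintegral I (fun x => conjc (expi x) ^+ n * (f x * q x)).
have Jrec n : J n = cintegral I (fun x => conjc (expi x) ^+ n * f x) + Z * J n.+1.
  rewrite /J -cintegralZ//; last first.
    apply: continuous_cintegrable => x.
    exact: (ccontinuousM (conc n.+1 x) (fqc x)).
  rewrite -cintegralD//; last 2 first.
  - apply: continuous_cintegrable => x.
    exact: (ccontinuousM (conc n x) (fc x)).
  - apply: cintegrableZ => //; apply: continuous_cintegrable => x.
    exact: (ccontinuousM (conc n.+1 x) (fqc x)).
  apply: eq_cintegral => x _.
  have qE : q x = 1 + Z * (conjc (expi x) * q x).
    rewrite /q expi_conj; have w0 := expi_sub_neq0 x Z1; have s0 := expi_neq0 x.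
    by set S := expi x in w0 s0 *; field; rewrite w0 s0.
  rewrite {1}qE exprS; set u := _ ^+ n; set v := conjc _; set w := q x.
  by ring.
have [M JM] : exists M, forall n, cabs (J n) <= M.
  have fqi := @continuous_cintegrable _ _ 0 (2 * pi) fqc.
  exists (2 * fine (\int[mu]_(x in I) (cabs (f x * q x))%:E)%E) => n.
  have mn : cmeasurable I (fun x => conjc (expi x) ^+ n * (f x * q x)).
    suff [] : cintegrable I (fun x => conjc (expi x) ^+ n * (f x * q x)) by [].
    apply: continuous_cintegrable => x.
    exact: (ccontinuousM (conc n x) (fqc x)).
  apply: cabs_cintegral_le => //.
  under eq_integral do rewrite cabsM cabsX cabsJ cabs_expi expr1n mul1r.
  rewrite fineK// ge0_fin_numE; first by case: fqi.
  by apply: integral_ge0 => x _; rewrite lee_fin cabs_ge0.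
(* Iterating the recursion [k] times bounds the moment by [cabs Z ^+ k * M] for every [k]. *)
have J0 n : J n.+1 = 0.
  apply: (@cabs_eps_eq0 _ M (cabs Z)); first by rewrite cabs_ge0.
  move=> k; suff -> : J n.+1 = Z ^+ k * J (n.+1 + k)%N.
    by rewrite cabsM cabsX ler_wpM2l ?exprn_ge0 ?cabs_ge0.
  elim: k => [|k IHk]; first by rewrite mul1r addn0.
  by rewrite IHk addSn Jrec fm add0r exprSr mulrA addnS.
split => //.
have := Jrec 0; rewrite J0 mulr0 addr0 /J => H.
have -> : cintegral I f = cintegral I (fun x => conjc (expi x) ^+ 0 * f x).
  by apply: eq_cintegral => x _; rewrite mul1r.
by rewrite -H; apply: eq_cintegral => x _; rewrite mul1r.
Qed.

Lemma cintegral_expi_conjX n : cintegral I (fun x => conjc (expi x) ^+ n.+1) = 0.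
Proof.
have E x : conjc (expi x) ^+ n.+1 = expi (- n.+1%:R * x) :> C.
  elim: n => [|n IHn]; first by rewrite expr1 mulN1r expiN.
  rewrite exprS IHn -expiN -expiD; congr expi.
  by rewrite [in RHS]mulrS opprD mulrDl mulN1r.
rewrite (@eq_cintegral _ _ _ (fun x => expi (- n.+1%:R * x)))//.
pose k : C := ('i / n.+1%:R).
rewrite (@cintegral_FTC2 _ (fun x => k * expi (- n.+1%:R * x))).
- rewrite mulr0 expi0 -mulrBr (_ : expi _ = 1) ?subrr ?mulr0//.
  rewrite -E; have := expiD2pi (0 : R); rewrite add0r => ->.
  by rewrite expi0 conjc1 expr1n.
- by rewrite mulr_gt0// pi_gt0.
- move=> x; apply: (pderiv_continuous (v := (- n.+1%:R)%:C * ('i * expi (- n.+1%:R * x)))).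
  exact: pderiv_expi.
move=> x; have := pderiv_expi (- n.+1%:R) x.
move=> /(pderivZ k); rewrite (_ : k * _ = expi (- n.+1%:R * x))//.
have n0 : n.+1%:R != 0 :> C by rewrite pnatr_eq0.
rewrite /k rmorphN rmorph_nat; set u := expi _; set N := n.+1%:R in n0 *.
transitivity (- ('i * 'i) * u * (N / N)); first by ring.
by rewrite ii divff// opprK mul1r mulr1.
Qed.

Lemma cintegral_cauchy_kernel Z : cabs Z < 1 ->
  cintegral I (fun x => expi x / (expi x - Z)) = (2 * pi)%:C.
Proof.
move=> Z1; have c1 : continuous (fun _ : R => 1 : C) by move=> x; exact: ccontinuous_cst.
have [|h _] := circle_moments_cauchy c1 Z1.
  by move=> n; rewrite -[RHS](cintegral_expi_conjX n); apply: eq_cintegral => x _; rewrite mulr1.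
rewrite -[LHS](@eq_cintegral _ _ (fun x => 1 * (expi x / (expi x - Z)))); last first.
  by move=> x _; rewrite mul1r.
rewrite h /cintegral /= !Rintegral_cst//= lebesgue_measure_itv/= lte_fin mulr_gt0 ?pi_gt0//.
by rewrite /= subr0 mul1r mul0r.
Qed.

Definition poisson Z x : R := (1 - cabs Z ^+ 2) / cabs (expi x - Z) ^+ 2.

(** This is $\frac{d}{dx}(\overline v/v)$ for $v=e^{ix}-Z$, as [dconj_kernelE] shows. The form
    chosen separates a term of the size of the Poisson kernel from a term of modulus one. *)
Definition dconj_kernel Z x : C :=
  - 'i * (((1 - cabs Z ^+ 2)%:C) / (expi x - Z) ^+ 2 + conjc (expi x - Z) / (expi x - Z)).

Lemma poisson_Re Z x : expi x != Z ->
  poisson Z x = 2 * Re (expi x / (expi x - Z)) - 1.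
Proof.
move=> SZ; set S := expi x; have w0 : S - Z != 0 by rewrite subr_eq0.
have n0 : cabs (S - Z) ^+ 2 != 0 by rewrite expf_neq0// cabs_eq0.
have -> : S / (S - Z) = S * conjc (S - Z) / (cabs (S - Z) ^+ 2)%:C.
  have c0 : conjc (S - Z) != 0 by rewrite conjc_eq0.
  rewrite -mulcJ; move: (conjc (S - Z)) c0 => v v0.
  by field; rewrite w0 v0.
rewrite -fmorphV [X in Re X]mulrC ReMr /poisson -/S.
have -> : 1 - cabs Z ^+ 2 = 2 * Re (S * conjc (S - Z)) - cabs (S - Z) ^+ 2.
  have S1 : cabs S ^+ 2 = 1 by rewrite cabs_expi expr1n.
  move: S1; rewrite !cabs_sqr; case: S {SZ w0 n0} => a b; case: (Z) => c d /=.
  move=> h; transitivity (a ^+ 2 + b ^+ 2 - (c ^+ 2 + d ^+ 2)); first by rewrite h.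
  by ring.
move: (cabs (S - Z) ^+ 2) (Re _) n0 => r q r0.
by field.
Qed.

Lemma poisson_ge0 Z x : cabs Z <= 1 -> 0 <= poisson Z x.
Proof.
move=> Z1; rewrite /poisson divr_ge0 ?exprn_ge0 ?cabs_ge0// subr_ge0.
by rewrite expr_le1 ?cabs_ge0.
Qed.

Lemma poisson_continuous Z : cabs Z < 1 -> continuous (poisson Z).
Proof.
move=> Z1 x; rewrite (_ : poisson Z = fun x => 2 * Re (expi x / (expi x - Z)) - 1); last first.
  by apply/funext => y; apply: poisson_Re; rewrite -subr_eq0 expi_sub_neq0.
apply: cvgB; last exact: cvg_cst.
apply: cvgM; first exact: cvg_cst.
have : {for x, continuous (fun x => expi x / (expi x - Z))}.
  apply: ccontinuous_div; first exact: expi_sub_neq0.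
    exact: expi_continuous.
  by apply: ccontinuousB; [exact: expi_continuous|exact: ccontinuous_cst].
by move=> /cvg_ReImP[].
Qed.

Lemma integral_poisson Z : cabs Z < 1 ->
  (\int[mu]_(x in I) (poisson Z x)%:E = (2 * pi)%:E)%E.
Proof.
move=> Z1.
have pi2 : 0 < 2 * pi :> R by rewrite mulr_gt0// pi_gt0.
have qc : continuous (fun x => expi x / (expi x - Z)).
  move=> x; apply: ccontinuous_div; first exact: expi_sub_neq0.
    exact: expi_continuous.
  by apply: ccontinuousB; [exact: expi_continuous|exact: ccontinuous_cst].
have /(cintegrable_ReIm _ (measurable_itv _))[ir _] := @continuous_cintegrable _ _ 0 (2 * pi) qc.
have ip : mu.-integrable I (EFin \o poisson Z).
  apply: continuous_compact_integrable; first exact: segment_compact.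
  by apply: continuous_subspaceT; exact: poisson_continuous.
have : (\int[mu]_(x in I) poisson Z x)%R = 2 * pi.
  transitivity (\int[mu]_(x in I) (2 * Re (expi x / (expi x - Z)) - 1))%R.
    by apply: eq_Rintegral => x _; rewrite poisson_Re// -subr_eq0 expi_sub_neq0.
  rewrite RintegralB//; last 2 first.
  - rewrite (_ : _ \o _ = (fun x => 2%:E * (Re (expi x / (expi x - Z)))%:E)%E)//.
    exact: integrableZl.
  - apply: continuous_compact_integrable; first exact: segment_compact.
    by apply: continuous_subspaceT => x; exact: cvg_cst.
  rewrite RintegralZl//.
  have := cintegral_cauchy_kernel Z1; rewrite /cintegral => -[-> _].
  rewrite Rintegral_cst//= lebesgue_measure_itv/= lte_fin pi2/= subr0; lra.
move=> H; rewrite -[X in _ = X%:E]H fineK//.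
by apply: (integrable_fin_num _ ip).
Qed.

Lemma dconj_kernelE Z x : expi x != Z -> dconj_kernel Z x =
  ((expi x - Z) * conjc ('i * expi x) - conjc (expi x - Z) * ('i * expi x)) / (expi x - Z) ^+ 2.
Proof.
move=> SZ; have w0 : expi x - Z != 0 by rewrite subr_eq0.
rewrite /dconj_kernel conjcM conjc_i.
have -> : (1 - cabs Z ^+ 2)%:C = (expi x - Z) * conjc (expi x) + conjc (expi x - Z) * expi x
    - (expi x - Z) * conjc (expi x - Z).
  have -> : (1 - cabs Z ^+ 2)%:C = expi x * conjc (expi x) - Z * conjc Z.
    by rewrite realcB -mulcJ expi_conj_mul.
  by rewrite !conjcB; ring.
set S := expi x; set w := S - Z; set v := conjc w; set u := conjc S.
by field.
Qed.

(** The first summand of the definition has the modulus of the Poisson kernel and the second has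
    modulus 1. *)
Lemma cabs_dconj_kernel_le Z x : cabs Z <= 1 -> expi x != Z ->
  cabs (dconj_kernel Z x) <= poisson Z x + 1.
Proof.
move=> Z1 SZ; have w0 : expi x - Z != 0 by rewrite subr_eq0.
rewrite /dconj_kernel cabsM normcN cabs_i mul1r.
apply: le_trans (ler_cabsD _ _) _.
rewrite !cabs_div cabsX cabsJ divff ?cabs_eq0// cabs_real ger0_norm//.
by rewrite subr_ge0 expr_le1 ?cabs_ge0.
Qed.

(** The kernel is the derivative of a periodic function. Here it is written through $q=S/(S-Z)$ and
    $q^2$ times positive powers of $\overline S$; all these moments vanish by
    [circle_moments_cauchy], used once for $1$ and once for $q$. *)
Lemma cintegral_dconj_kernel Z : cabs Z < 1 -> cintegral I (dconj_kernel Z) = 0.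
Proof.
move=> Z1.
have c1 : continuous (fun _ : R => 1 : C) by move=> x; exact: ccontinuous_cst.
have [|_ h1] := circle_moments_cauchy c1 Z1.
  by move=> n; rewrite -[RHS](cintegral_expi_conjX n); apply: eq_cintegral => x _; rewrite mulr1.
pose q x := expi x / (expi x - Z).
have qc : continuous q.
  move=> x; apply: ccontinuous_div; first exact: expi_sub_neq0.
    exact: expi_continuous.
  by apply: ccontinuousB; [exact: expi_continuous|exact: ccontinuous_cst].
have h1' n : cintegral I (fun x => conjc (expi x) ^+ n.+1 * q x) = 0.
  by rewrite -[RHS](h1 n); apply: eq_cintegral => x _; rewrite mul1r.
have [_ h2] := circle_moments_cauchy qc Z1 h1'.
pose a : C := - 'i * (1 - cabs Z ^+ 2)%:C.
have conc n : continuous (fun x => conjc (expi x) ^+ n : C).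
  by move=> x; exact: (ccontinuousX (n:=n) (ccontinuous_conj (@expi_continuous x))).
have cq n : cintegrable I (fun x => conjc (expi x) ^+ n * q x).
  by apply: continuous_cintegrable => x; exact: (ccontinuousM (conc n x) (qc x)).
have cqq : cintegrable I (fun x => conjc (expi x) ^+ 2 * (q x * q x)).
  apply: continuous_cintegrable => x.
  exact: (ccontinuousM (conc 2%N x) (ccontinuousM (qc x) (qc x))).
rewrite (@eq_cintegral _ _ _ (fun x => a * (conjc (expi x) ^+ 2 * (q x * q x)) +
  (- 'i * (conjc (expi x) ^+ 2 * q x) + ('i * conjc Z) * (conjc (expi x) ^+ 1 * q x)))); last first.
  move=> x _; rewrite /dconj_kernel /a /q conjcB expi_conj.
  have w0 := expi_sub_neq0 x Z1; have s0 := expi_neq0 x.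
  by set S := expi x in w0 s0 *; field; rewrite w0 s0.
rewrite cintegralD//; last 2 first.
- exact: cintegrableZ.
- by apply: cintegrableD => //; exact: cintegrableZ.
rewrite cintegralD//; [|exact: cintegrableZ|exact: cintegrableZ].
by rewrite !cintegralZ// h2 !h1' !mulr0 !addr0.
Qed.

(** On the circle $\overline{S-Z}/(S-Z)=-\overline S\,\overline Z$, so the singularity
    disappears. *)
Lemma dconj_kernel_circle Z x : circle Z -> expi x != Z ->
  dconj_kernel Z x = ('i * conjc Z) * conjc (expi x).
Proof.
move=> Z1 SZ; rewrite /dconj_kernel Z1 expr1n subrr mul0r add0r.
rewrite conjcB expi_conj (circle_conj Z1).
have w0 : expi x - Z != 0 by rewrite subr_eq0.
have s0 := expi_neq0 x; have z0 := circle_neq0 Z1.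
by set S := expi x in w0 s0 *; field; rewrite w0 s0 z0.
Qed.

Lemma poisson_circle Z x : circle Z -> poisson Z x = 0.
Proof. by move=> Z1; rewrite /poisson Z1 expr1n subrr mul0r. Qed.

End CircleKernels.

Lemma is_derive_mulr_cst (R : realType) (K x : R) : is_derive x 1 (fun y => y * K) K.
Proof.
apply/is_derive_epsP => e e0; exists 1 => // h _.
rewrite (_ : (x + h) * K - x * K - h * K = 0); last by ring.
by rewrite normr0 mulr_ge0// ltW.
Qed.

(** * Semi-additive moduli and the Dini condition *)

Section Moduli.
Variable R : realType.
Local Notation mu := (@lebesgue_measure R).
Variable omega : R -> R.
Hypothesis om : modulus omega.

Let om_gt0 x : 0 < x -> 0 < omega x. Proof. by case: om => + _ _ _; exact. Qed.
Let om_le x y : 0 < x -> x <= y -> omega x <= omega y.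
Proof. by case: om => _ + _ _; exact. Qed.

Lemma modulus_muln x n : 0 < x -> omega (x *+ n.+1) <= omega x *+ n.+1.
Proof.
move=> x0; elim: n => [|n IHn]; first by rewrite !mulr1n.
rewrite [X in omega X]mulrS [leRHS]mulrS.
have [_ _ _ omD] := om; apply: le_trans (omD _ _ x0 _) _.
  by rewrite mulrn_wgt0.
by rewrite lerD2l.
Qed.

(** With [n] the integer part of [x / y], semi-additivity bounds [omega x] by [n.+1] copies of
    [omega y], and [n.+1 <= 2 * (x / y)] because [1 <= x / y]. *)
Lemma modulus_ratio x y : 0 < y -> y <= x -> omega x <= 2 * (x / y) * omega y.
Proof.
move=> y0 yx; pose n := Num.trunc (x / y).
have x0 : 0 < x by exact: lt_le_trans yx.
have xy0 : 0 <= x / y by rewrite divr_ge0 ?ltW.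
have /andP[nx xn] := truncn_itv xy0.
apply: (@le_trans _ _ (omega (y *+ n.+1))).
  by apply: om_le => //; rewrite -[leRHS]mulr_natl -ler_pdivrMr// ltW.
apply: le_trans (modulus_muln n y0) _; rewrite -[leLHS]mulr_natl.
apply: ler_wpM2r; first exact/ltW/om_gt0.
have : 1 <= x / y by rewrite ler_pdivlMr// mul1r.
by rewrite -natr1 => h; move: nx; rewrite -/n => nx; lra.
Qed.

(* The quotient [omega u / u] is almost decreasing. *)
Lemma modulus_quot_le u y : 0 < y -> 0 < u -> y <= 2 * u ->
  omega u / u <= 2 * (omega y / y).
Proof.
move=> y0 u0 yu; have oy := om_gt0 y0; have ou := om_gt0 u0.
have [uy|yu'] := leP u y.
  have h : omega u <= omega y by exact: om_le.
  rewrite ler_pdivrMr//; apply: (le_trans h).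
  have q1 : 1 <= 2 * u / y by rewrite ler_pdivlMr// mul1r.
  rewrite (_ : _ * u = omega y * (2 * u / y)); first by rewrite ler_peMr// ltW.
  by field; rewrite gt_eqF.
rewrite ler_pdivrMr// (le_trans (modulus_ratio y0 (ltW yu')))//.
by rewrite le_eqVlt; apply/orP; left; apply/eqP; field; rewrite gt_eqF.
Qed.

(** Nothing is known of [omega] on nonpositive numbers; the extension by 0 is monotone on the whole
    line, hence measurable. *)
Definition modulus_ext (x : R) : R := if 0 < x then omega x else 0.

Lemma measurable_modulus_ext : measurable_fun [set: R] modulus_ext.
Proof.
apply: nondecreasing_measurable => // x y xy; rewrite /modulus_ext.
case: ifPn => x0; first by rewrite (lt_le_trans x0 xy) om_le.
by case: ifPn => // y0; exact/ltW/om_gt0.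
Qed.

Lemma modulus_ext_ge0 x : 0 <= modulus_ext x.
Proof. by rewrite /modulus_ext; case: ifPn => // x0; exact/ltW/om_gt0. Qed.

Lemma modulus_ext_quot_ge0 x : 0 <= modulus_ext x / x.
Proof.
rewrite /modulus_ext; case: ifPn => x0; last by rewrite mul0r.
by rewrite divr_ge0// ltW// om_gt0.
Qed.

Lemma measurable_modulus_quot : measurable_fun [set: R] (fun x => (modulus_ext x / x)%:E).
Proof.
apply/measurable_EFinP; apply: measurable_funM; first exact: measurable_modulus_ext.
apply: (@measurable_fun_off_countable _ [set 0]); first exact: countable1.
by move=> x /eqP x0; exact: cvgV.
Qed.

Hypothesis dini : (\int[mu]_(x in `]0%R, 1%R]) (modulus_ext x / x)%:E < +oo)%E.

Lemma dini_tail e : 0 < e -> exists2 d : R, 0 < d <= 1 &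
  (\int[mu]_(x in `]0%R, d]) (modulus_ext x / x)%:E <= e%:E)%E.
Proof.
apply: ge0_integral_oc_tail => //; first exact: measurable_modulus_quot.
by move=> x; rewrite lee_fin modulus_ext_quot_ge0.
Qed.

(** On [[d / 2, d]] the integrand is at least [omega (d / 2) / d], so half of [omega (d / 2)] is
    bounded by a small tail of the Dini integral. *)
Lemma dini_modulus_small e : 0 < e -> exists2 d : R, 0 < d & forall x, 0 < x <= d -> omega x <= e.
Proof.
move=> e0; have [|d /andP[d0 d1] dP] := @dini_tail (e / 2); first by rewrite divr_gt0.
have d20 : 0 < d / 2 by rewrite divr_gt0.
exists (d / 2) => // x /andP[x0 xd].
apply: le_trans (om_le x0 xd) _.
have : ((omega (d / 2) / d * (d / 2))%:E <= (e / 2)%:E)%E.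
  apply: le_trans dP.
  apply: (@le_trans _ _ (\int[mu]_(x in `[(d / 2)%R, d]) (modulus_ext x / x)%:E)%E); last first.
    apply: ge0_subset_integral => //.
    - by apply: measurable_funTS; exact: measurable_modulus_quot.
    - by move=> y _; rewrite lee_fin modulus_ext_quot_ge0.
    - by apply: subset_itvr; rewrite bnd_simp.
  have -> : (omega (d / 2) / d * (d / 2))%:E =
      (\int[mu]_(x in `[(d / 2)%R, d]) (omega (d / 2) / d)%:E)%E.
    rewrite integral_cst//= lebesgue_measure_itv/= lte_fin ltr_pdivrMr// ltr_pMr// ltr1n.
    by rewrite -EFinB -EFinM; congr (_ * _)%:E; field.
  apply: ge0_le_integral => //.
  - by move=> y _; rewrite lee_fin divr_ge0// ltW// om_gt0.
  - by apply: measurable_funTS; exact: measurable_modulus_quot.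
  - move=> y /=; rewrite in_itv/= => /andP[dy yd].
    have y0 : 0 < y by exact: lt_le_trans dy.
    rewrite lee_fin /modulus_ext y0; apply: ler_pM => //.
    + exact/ltW/om_gt0.
    + by rewrite invr_ge0 ltW.
    + exact: om_le.
    + by rewrite lef_pV2 ?posrE.
rewrite lee_fin (_ : _ / d * (d / 2) = omega (d / 2) / 2); last first.
  by field; rewrite gt_eqF.
by rewrite ler_pM2r// invr_gt0.
Qed.

End Moduli.

(** * Difference quotients of the map near a point of the circle *)

Section LocalEstimates.
Variables (R : realType) (s s1 : R[i] -> R[i]).
Local Notation C := R[i].
Hypothesis s_cont : forall Z, cdisc Z -> forall e : R, 0 < e -> exists2 d : R, 0 < d &
  forall W, cdisc W -> cabs (W - Z) < d -> cabs (s W - s Z) < e.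
Hypothesis s_diff : forall Z, disc Z -> cdiff setT s Z (s1 Z).

Variables (omega : R -> R).
Hypothesis om : modulus omega.
Let om_gt0 x : 0 < x -> 0 < omega x. Proof. by case: om => + _ _ _; exact. Qed.
Let om_le x y : 0 < x -> x <= y -> omega x <= omega y.
Proof. by case: om => _ + _ _; exact. Qed.

Variables (T : C) (A rho : R).
Hypotheses (T1 : circle T) (A0 : 0 <= A).
Hypothesis s_diff_arc : forall S, circle S -> cabs (S - T) <= rho -> cdiff circle s S (s1 S).
Hypothesis osc : forall W, (circle W \/ exists2 r : R, 0 <= r < 1 & W = r%:C * T) ->
  W != T -> cabs (W - T) <= rho -> cabs (s1 W - s1 T) <= A * omega (cabs (W - T)).

Lemma cdisc_path_continuous (g : R -> C) a b : {within `[a, b], continuous g} ->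
  (forall x, a <= x <= b -> cdisc (g x)) -> {within `[a, b], continuous (fun x => s (g x))}.
Proof.
move=> /subspace_continuousP gc gd; apply/subspace_continuousP => x xab.
have xab' : a <= x <= b by move: xab; rewrite /= in_itv.
apply/cvgcP => e e0; have [d d0 dP] := s_cont (gd x xab') e0.
have /cvgcP/(_ d d0) := gc x xab.
rewrite !near_withinE; apply: filterS => y h yab.
by apply: dP; [apply: gd; move: yab; rewrite /= in_itv|exact: h].
Qed.

Lemma cabs_radial r : 0 <= r <= 1 -> cabs (r%:C * T - T) = 1 - r.
Proof.
move=> /andP[r0 r1]; rewrite -[X in _ - X]mul1r -mulrBl cabsM T1 mulr1.
by rewrite -(realcB r 1) cabs_real distrC ger0_norm// subr_ge0.
Qed.

(** Apply the mean value inequality on the radius to [s] minus its linear part at [T]; the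
    derivative of this difference is the oscillation of [s1]. *)
Lemma radial_estimate r : 0 <= r < 1 -> 1 - r <= rho ->
  cabs (s T - s (r%:C * T) - s1 T * (T - r%:C * T)) <= (1 - r) * (A * omega (1 - r)).
Proof.
move=> /andP[r0 r1] rr.
have r10 : 0 < 1 - r by rewrite subr_gt0.
pose f (x : R) := s (0 + x%:C * T) - s1 T * (0 + x%:C * T).
pose K := A * omega (1 - r).
have := @cabs_mean_value _ f (fun x => x * K) (fun=> K) r 1 (ltW r1).
have -> : f 1 - f r = s T - s (r%:C * T) - s1 T * (T - r%:C * T).
  by rewrite /f !add0r mul1r; ring.
rewrite -mulrBl; apply.
- move=> x /andP[rx x1].
  have x0 : 0 <= x by rewrite (le_trans r0) ?ltW.
  have xT : disc (x%:C * T) by rewrite /disc/= cabsM cabs_real T1 mulr1 ger0_norm.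
  exists (s1 (x%:C * T) * T - s1 T * T); split.
  + have h : pderiv (fun x : R => 0 + x%:C * T) x T by exact: pderiv_affine.
    have h1 : pderiv (fun x : R => s (0 + x%:C * T)) x (s1 (x%:C * T) * T).
      apply: (pderiv_comp h (A := setT)); last by exists 1.
      by rewrite add0r; exact: s_diff.
    have h2 := pderivZ (s1 T) h.
    by apply/pderivP; split; rewrite /f ?ReB ?ImB;
      [under eq_fun do rewrite ReB|under eq_fun do rewrite ImB];
      apply: is_deriveB; [case/pderivP: h1|case/pderivP: h2|case/pderivP: h1|case/pderivP: h2].
  + rewrite -mulrBl cabsM T1 mulr1.
    have dx : cabs (x%:C * T - T) = 1 - x by rewrite cabs_radial// x0 ltW.
    have x10 : 0 < 1 - x by rewrite subr_gt0.
    apply: le_trans (osc _ _ _) _.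
    * by right; exists x => //; rewrite x0.
    * by apply/eqP => e; move: dx; rewrite e subrr cabs0 => h; move: x10; rewrite -h ltxx.
    * by rewrite dx (le_trans _ rr)// lerB// ltW.
    * by rewrite dx ler_wpM2l// om_le// lerB// ltW.
  + exact: is_derive_mulr_cst.
- have c1 : {within `[r, 1], continuous (fun x : R => 0 + x%:C * T)}.
    apply: continuous_subspaceT => x.
    exact: (pderiv_continuous (pderiv_affine 0 T x)).
  have c2 : {within `[r, 1], continuous (fun x : R => s (0 + x%:C * T))}.
    apply: cdisc_path_continuous => // x /andP[rx x1].
    by rewrite add0r /cdisc/= cabsM cabs_real T1 mulr1 ger0_norm// (le_trans r0).
  move=> x; apply: (@ccontinuousB _ _ x (fun x : R => s (0 + x%:C * T))); first exact: c2.
  apply: (@ccontinuousM _ _ x (fun=> s1 T)); last exact: c1.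
  exact: ccontinuous_cst.
- apply: continuous_subspaceT => x; apply: cvgM; first exact: cvg_id.
  exact: cvg_cst.
Qed.

(** The same argument along the arc; [chord_mono] bounds the oscillation at intermediate points by
    the one at the end point. *)
Lemma arc_estimate x t : T = expi t -> `|x - t| <= pi -> x != t ->
  cabs (expi x - T) <= rho ->
  cabs (s (expi x) - s T - s1 T * (expi x - T)) <= `|x - t| * (A * omega (cabs (expi x - T))).
Proof.
move=> Tt xpi xt xrho.
set K := A * omega (cabs (expi x - T)).
pose f (y : R) := s (expi y) - s1 T * expi y.
have fE : s (expi x) - s T - s1 T * (expi x - T) = f x - f t by rewrite /f -Tt; ring.
have key (a b : R) : a < b -> (forall y, a < y < b -> `|y - t| <= `|x - t| /\ y != t) ->
    cabs (f b - f a) <= (b - a) * K.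
  move=> ab abP; have := @cabs_mean_value _ f (fun x => x * K) (fun=> K) a b (ltW ab).
  rewrite -mulrBl; apply.
  - move=> y yab; have [yx yt] := abP y yab.
    have ydist : cabs (expi y - T) <= cabs (expi x - T) by rewrite Tt chord_mono.
    have yrho := le_trans ydist xrho.
    have yT : expi y != T.
      apply/eqP; rewrite Tt => /expi_inj e; move: yt; rewrite e ?eqxx//.
      by rewrite (le_lt_trans yx)// (le_lt_trans xpi)// mulr_natl mulr2n ltrDl pi_gt0.
    have yTgt : 0 < cabs (expi y - T) by rewrite cabs_gt0 subr_eq0.
    exists (s1 (expi y) * ('i * expi y) - s1 T * ('i * expi y)); split.
    + have h := pderiv_expi1 y.
      have h1 : pderiv (fun x : R => s (expi x)) y (s1 (expi y) * ('i * expi y)).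
        apply: (pderiv_comp h (A := circle)); last by exists 1 => // *; exact: circle_expi.
        by apply: s_diff_arc => //; exact: circle_expi.
      have h2 := pderivZ (s1 T) h.
      by apply/pderivP; split; rewrite /f ?ReB ?ImB;
        [under eq_fun do rewrite ReB|under eq_fun do rewrite ImB];
        apply: is_deriveB; [case/pderivP: h1|case/pderivP: h2|case/pderivP: h1|case/pderivP: h2].
    + rewrite -mulrBl !cabsM cabs_i mul1r cabs_expi mulr1.
      apply: le_trans (osc _ yT yrho) _; first by left; exact: circle_expi.
      by rewrite ler_wpM2l// om_le.
    + exact: is_derive_mulr_cst.
  - have c1 : {within `[a, b], continuous (@expi R)}.
      by apply: continuous_subspaceT => y; exact: expi_continuous.
    have c2 : {within `[a, b], continuous (fun x : R => s (expi x))}.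
      apply: cdisc_path_continuous => // y _.
      by have := cabs_expi y; rewrite /cdisc/= => ->.
    move=> y; apply: (@ccontinuousB _ _ y (fun x : R => s (expi x))); first exact: c2.
    apply: (@ccontinuousM _ _ y (fun=> s1 T)); last exact: c1.
    exact: ccontinuous_cst.
  - apply: continuous_subspaceT => y; apply: cvgM; first exact: cvg_id.
    exact: cvg_cst.
rewrite fE; have [tx|xt'|e] := ltgtP t x.
- have -> : `|x - t| = x - t by rewrite ger0_norm ?subr_ge0 ?ltW.
  apply: (key t x tx) => y /andP[ty yx].
  have h1 : 0 <= y - t by rewrite subr_ge0 ltW.
  have h2 : 0 <= x - t by rewrite subr_ge0 ltW.
  by rewrite (ger0_norm h1) (ger0_norm h2) lerD2r (ltW yx) gt_eqF.
- have -> : `|x - t| = t - x by rewrite ltr0_norm ?subr_lt0// opprB.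
  rewrite cabsB; apply: (key x t xt') => y /andP[xy yt].
  have h1 : y - t <= 0 by rewrite subr_le0 ltW.
  have h2 : x - t <= 0 by rewrite subr_le0 ltW.
  by rewrite (ler0_norm h1) (ler0_norm h2) lerN2 lerD2r (ltW xy) lt_eqF.
- by move: xt; rewrite e eqxx.
Qed.

Variables (S : C) (r : R).
Hypotheses (S1 : circle S) (r01 : 0 <= r <= 1) (ST : S != T) (SZ : S != r%:C * T).
Hypotheses (Srho : cabs (S - T) <= rho) (rrho : 1 - r <= rho).
Let Z := r%:C * T.

Lemma radial_dist_le : 1 - r <= cabs (S - Z) /\ cabs (S - T) <= 2 * cabs (S - Z).
Proof.
have h : 1 - r <= cabs (S - Z).
  apply: le_trans (lerB_cabs _ _); rewrite S1 /Z cabsM T1 mulr1 cabs_real ger0_norm//.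
  by case/andP: r01.
split=> //; have := cabs_dist_triangle Z S T; rewrite cabs_radial//; lra.
Qed.

(** Go from [S] to [T] along the arc and from [T] to [Z] along the radius, and add the two
    remainders of the linear approximation at [T]. *)
Lemma local_dquot_center : cabs (dquot s S Z - s1 T) <= 13 * A * omega (cabs (S - Z)).
Proof.
have [t _ Tt] := circle_argP T1; have [x0 x0pi Sx] := circle_argP S1.
have [x xpi Sx'] : exists2 x, `|x - t| <= pi & S = expi x.
  have [u /andP[u1 u2] uP] : exists2 u, - pi < u <= pi & expi u = S / T :> C.
    by apply: circle_argP; rewrite /circle/= cabs_div S1 T1 divr1.
  exists (t + u); first by rewrite addrAC subrr add0r ler_norml u2 ltW.
  by rewrite expiD Tt uP mulrC divfK ?circle_neq0.
have xt : x != t by apply: contraNneq ST => e; rewrite Sx' e Tt.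
have [h1 h2] := radial_dist_le.
have SZ0 : 0 < cabs (S - Z) by rewrite cabs_gt0 subr_eq0.
have ST0 : 0 < cabs (S - T) by rewrite cabs_gt0 subr_eq0.
have oS := om_gt0 SZ0.
set u := cabs (S - Z) in h1 h2 SZ0 oS *.
have o2 : omega (cabs (S - T)) <= 2 * omega u.
  have [_ _ _ omD] := om.
  by apply: le_trans (om_le ST0 h2) _; rewrite mulrDl !mul1r [leRHS]mulrDl !mul1r omD.
have n0 : S - Z != 0 by rewrite subr_eq0.
have -> : dquot s S Z - s1 T = ((s S - s T - s1 T * (S - T)) +
    (s T - s Z - s1 T * (T - Z))) / (S - Z).
  by rewrite /dquot; field.
rewrite cabs_div ler_pdivrMr//.
apply: le_trans (ler_cabsD _ _) _.
(* The arc is at most 3 chords, the chord at most twice [u], and doubling the argument at most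
   doubles [omega]: this gives 12, and the radius adds 1. *)
have e1 : cabs (s S - s T - s1 T * (S - T)) <= 6 * u * (A * (2 * omega u)).
  have := arc_estimate (esym Tt) xpi xt; rewrite -Sx' => /(_ Srho) /le_trans; apply.
  have h3 : `|x - t| <= 3 * cabs (S - T).
    by have := chord_ge xpi; rewrite -Sx' Tt; lra.
  apply: ler_pM => //.
  - by rewrite mulr_ge0// ltW// om_gt0.
  - lra.
  - by rewrite ler_wpM2l.
have e2 : cabs (s T - s Z - s1 T * (T - Z)) <= u * (A * omega u).
  have /andP[r0] := r01; rewrite le_eqVlt => /predU1P[re|r1].
    by rewrite /Z re mul1r !subrr mulr0 subrr cabs0 !mulr_ge0// ltW.
  have r10 : 0 < 1 - r by rewrite subr_gt0.
  apply: le_trans (radial_estimate _ rrho) _; first by rewrite r0.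
  apply: ler_pM => //; first exact: ltW.
    by rewrite mulr_ge0// ltW// om_gt0.
  by rewrite ler_wpM2l// om_le.
apply: le_trans (lerD e1 e2) _; rewrite -/u.
by rewrite le_eqVlt; apply/orP; left; apply/eqP; ring.
Qed.

(** The right-hand side depends on [S] and [T] only, so one bound serves all points of the radius
    ending at [T]. The constant is twice $13+2$: the summand 2 is the oscillation of [s1] between
    [T] and [S], and the factor 2 is that of [modulus_quot_le]. *)
Lemma local_dquot : cabs (dquot s S Z - s1 S) / cabs (S - Z) <=
  30 * A * (omega (cabs (S - T)) / cabs (S - T)).
Proof.
have [h1 h2] := radial_dist_le.
have SZ0 : 0 < cabs (S - Z) by rewrite cabs_gt0 subr_eq0.
have ST0 : 0 < cabs (S - T) by rewrite cabs_gt0 subr_eq0.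
have oS := om_gt0 SZ0.
have := local_dquot_center.
have := osc (or_introl S1) ST Srho.
have o2 : omega (cabs (S - T)) <= 2 * omega (cabs (S - Z)).
  have [_ _ _ omD] := om.
  by apply: le_trans (om_le ST0 h2) _; rewrite mulrDl !mul1r [leRHS]mulrDl !mul1r omD.
have := modulus_quot_le om ST0 SZ0 h2.
have := cabs_dist_triangle (s1 T) (dquot s S Z) (s1 S).
rewrite (cabsB (s1 T)).
set u := cabs (S - Z) in SZ0 oS o2 *; set y := cabs (S - T) in o2 *.
set a := cabs (_ - s1 S); set b := cabs (_ - s1 T); set c := cabs (s1 S - _).
move=> abc q hc hb.
have ha : a <= 15 * A * omega u.
  apply: le_trans abc _; have : A * omega y <= A * (2 * omega u) by rewrite ler_wpM2l.
  nra.
rewrite ler_pdivrMr// (le_trans ha)//.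
have : 15 * A * (omega u / u) <= 15 * A * (2 * (omega y / y)).
  by rewrite ler_wpM2l// mulr_ge0.
move=> h; have : 15 * A * (omega u / u) * u <= 30 * A * (omega y / y) * u.
  by rewrite ler_pM2r//; lra.
by rewrite -[15 * A * _ * u]mulrA divfK ?gt_eqF.
Qed.

End LocalEstimates.

(** * The properties of the conformal map used in the proof, and the corner angles *)

Section CornerMaps.
Variable R : realType.
Local Notation C := R[i].
Local Notation mu := (@lebesgue_measure R).
Local Notation I := (`[0, 2 * pi]%classic : set R).

Definition dini (omega : R -> R) : Prop :=
  (\int[mu]_(x in `]0%R, 1%R]) (modulus_ext omega x / x)%:E < +oo)%E.

(* The oscillation at most [A * omega] of [s1] around the point [T] of the circle,
   along the circle and along the radius. *)
Definition osc_at (s1 : C -> C) (omega : R -> R) (A rho : R) (T : C) : Prop :=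
  forall W, (circle W \/ exists2 r : R, 0 <= r < 1 & W = r%:C * T) ->
    W != T -> cabs (W - T) <= rho -> cabs (s1 W - s1 T) <= A * omega (cabs (W - T)).

(* What the proof uses of a conformal map [s] of the disc and of its derivative [s1],
   extended to the closed disc without the preimages [X] of the corners. *)
Record corner_map (m : nat) (X : 'I_m -> C) (beta : 'I_m -> R) (s s1 : C -> C) : Prop := {
  cm_circle : forall j, circle (X j);
  cm_beta : forall j, -1 < beta j <= 1;
  cm_bounded : exists M : R, forall Z, cdisc Z -> cabs (s Z) <= M;
  cm_cont : forall Z, cdisc Z -> forall e : R, 0 < e -> exists2 d : R, 0 < d &
    forall W, cdisc W -> cabs (W - Z) < d -> cabs (s W - s Z) < e;
  cm_inv : forall Z, cdisc Z -> forall d : R, 0 < d -> exists2 e : R, 0 < e &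
    forall W, cdisc W -> cabs (s W - s Z) < e -> cabs (W - Z) < d;
  cm_diff : forall Z, disc Z -> cdiff setT s Z (s1 Z);
  cm_diff_arc : forall T, (circle `\` range X) T -> cdiff circle s T (s1 T);
  cm_deriv_cont : forall T, (circle `\` range X) T -> forall e : R, 0 < e ->
    exists2 d : R, 0 < d & forall S, (circle `\` range X) S -> cabs (S - T) < d ->
      cabs (s1 S - s1 T) < e;
  cm_deriv_neq0 : forall T, (circle `\` range X) T -> s1 T != 0;
  cm_deriv_le : exists2 c : R, 0 < c & forall Z, (cdisc `\` range X) Z ->
    cabs (s1 Z) <= c * prodX X beta Z;
  cm_osc : forall T0, (circle `\` range X) T0 -> exists (omega : R -> R) (A rho : R),
    [/\ modulus omega, dini omega, 0 <= A, 0 < rho &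
      forall T, circle T -> cabs (T - T0) <= rho ->
        (forall S, circle S -> cabs (S - T) <= rho -> (circle `\` range X) S) /\
        osc_at s1 omega A rho T];
  cm_osc_corner : forall j, exists (omega : R -> R) (A r1 k : R),
    [/\ modulus omega, 0 <= A, 0 < r1 <= 1,
      forall e, 0 < e <= r1 ->
        (\int[mu]_(x in `]0%R, e]) (modulus_ext omega x / x)%:E <= (k * omega e)%:E)%E &
      forall T, circle T -> T != X j -> cabs (T - X j) <= r1 ->
        (forall S, circle S -> cabs (S - T) <= cabs (T - X j) / 2 -> (circle `\` range X) S) /\
        osc_at s1 omega (A * cabs (T - X j) `^ beta j / omega (cabs (T - X j) / 2))
          (cabs (T - X j) / 2) T];
  cm_deriv_corner : forall j, exists2 c : R, 0 < c & exists2 r1 : R, 0 < r1 &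
    forall Z, cdisc Z -> Z != X j -> cabs (Z - X j) <= r1 ->
      ~ range X Z /\ cabs (s1 Z) <= c * cabs (Z - X j) `^ beta j;
  cm_dquot_corner : forall j, exists2 c : R, 0 < c & exists2 r1 : R, 0 < r1 &
    forall S Z, (cdisc `\` range X) Z -> cabs (Z - X j) <= r1 ->
      (circle `\` range X) S -> cabs (S - X j) <= 2 * r1 -> S != Z ->
      c * (cabs (S - X j) + cabs (Z - X j)) `^ beta j <= cabs (dquot s S Z) }.

Lemma expiD2piz x (k : int) : expi (x + 2 * pi *~ k) = expi x :> C.
Proof.
have hn n y : expi (y + 2 * pi *+ n) = expi y :> C.
  by elim: n y => [|n IHn] y; rewrite ?mulr0n ?addr0// mulrSr addrA expiD2pi.
case: k => n; first by rewrite -pmulrn hn.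
by rewrite NegzE mulrNz -pmulrn -[LHS](hn n.+1) subrK.
Qed.

(** Two arguments of [z] differ by a multiple of [2 * pi]. This makes the angles of the corners, and
    of any chosen point, a null set. *)
Lemma countable_expi_fiber (z : C) : countable [set x : R | expi x = z].
Proof.
have [[x0 x0z]|none] := pselect (exists x0, expi x0 = z); last first.
  rewrite (_ : [set x | _] = set0)//; apply/seteqP; split => x //= xz.
  by apply: none; exists x.
apply: (@sub_countable _ _ _ (range (fun k : int => x0 + 2 * pi *~ k))); last first.
  apply: (sub_countable (card_image_le _ _)); exact: countableP.
apply: subset_card_le => x /= xz.
have p2 : 0 < 2 * pi :> R by rewrite mulr_gt0// pi_gt0.
pose k := Num.floor ((x - x0) / (2 * pi)).
pose y := x - x0 - 2 * pi *~ k.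
have y0 : 0 <= y.
  by rewrite subr_ge0 -mulrzr mulrC -ler_pdivlMr//; exact: Num.Theory.ge_floor.
have yp : y < 2 * pi.
  rewrite ltrBlDr -mulrzr -{1}(mulr1 (2 * pi)) -mulrDr mulrC -ltr_pdivrMr//.
  by rewrite [1 + _]addrC; have := @Num.Theory.floorD1_gt R ((x - x0) / (2 * pi)); rewrite rmorphD.
exists k => //; apply/eqP; rewrite eq_sym -subr_eq0 opprD addrA; apply/eqP.
apply: expi_eq1; first by rewrite ger0_norm.
have -> : x - x0 - 2 * pi *~ k = x - x0 + 2 * pi *~ (- k) by rewrite mulrNz.
by rewrite expiD2piz expiB xz x0z divff// -x0z expi_neq0.
Qed.

Definition corner_args m (X : 'I_m -> C) := [set x : R | range X (expi x)].

Lemma countable_corner_args m (X : 'I_m -> C) : countable (corner_args X).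
Proof.
rewrite (_ : corner_args X = \bigcup_(j in [set: 'I_m]) [set x | expi x = X j]).
  by apply: bigcup_countable => // j _; exact: countable_expi_fiber.
by apply/seteqP; split => x [j _ h]; exists j.
Qed.

Lemma circle_cdisc (T : C) : circle T -> cdisc T.
Proof. by rewrite /circle /cdisc/= => ->. Qed.

Lemma disc_cdisc (Z : C) : disc Z -> cdisc Z.
Proof. exact: ltW. Qed.

Lemma disc_notin_corner m (X : 'I_m -> C) (Z : C) : (forall j, circle (X j)) ->
  disc Z -> ~ range X Z.
Proof.
by move=> XC Z1 [j _ jZ]; move: Z1; rewrite -jZ /disc/= (XC j) ltxx.
Qed.

End CornerMaps.

(** * The kernels transferred to the circle and their comparison with kernels of the disc *)

Section Kernels.
Variables (R : realType) (s s1 : R[i] -> R[i]).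
Local Notation C := R[i].
Implicit Types (x : R) (Z : C).

(** These kernels are densities in the angle [x]; the factor ['i * expi x] is $dS/dx$ for
    $S=e^{ix}$. *)
Definition cauchy_k x Z : C := 'i * expi x / (expi x - Z).
Definition map_k1 x Z : C := 'i * expi x * s1 (expi x) / (s (expi x) - s Z).
(** At regular points this is $(4i)^{-1}\frac{d}{dx}(\overline w/w)$ with $w=\sigma(S)-\sigma(Z)$:
    the non-analytic part of the biharmonic Cauchy kernel. *)
Definition map_k2 x Z : C := (4 * 'i)^-1 *
  (((s (expi x) - s Z) * conjc ('i * expi x * s1 (expi x))
    - conjc (s (expi x) - s Z) * ('i * expi x * s1 (expi x))) / (s (expi x) - s Z) ^+ 2).
(** What [map_k2] becomes when $\sigma(S)-\sigma(Z)$ is replaced by $\sigma'(S)(S-Z)$. *)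
Definition main_k2 x Z : C :=
  (4 * 'i)^-1 * (conjc (s1 (expi x)) / s1 (expi x)) * dconj_kernel Z x.

Lemma four_i_neq0 : 4 * 'i != 0 :> C.
Proof. by rewrite mulf_neq0 ?pnatr_eq0// -cabs_gt0 cabs_i. Qed.

Lemma cabs_four_iV : cabs (4 * 'i : C)^-1 = 4^-1.
Proof.
rewrite cabsV cabsM cabs_i mulr1; congr (_^-1).
by rewrite -[4 : C](rmorph_nat (real_complex R)) cabs_real ger0_norm.
Qed.

(** Up to a unimodular factor the difference equals $(d-\sigma'(S))/((S-Z)\,d)$ with $d=d(S,Z)$. *)
Lemma cabs_map_k1_sub_le x Z : expi x != Z -> s (expi x) != s Z ->
  cabs (map_k1 x Z - cauchy_k x Z) <=
  cabs (dquot s (expi x) Z - s1 (expi x)) / cabs (expi x - Z) / cabs (dquot s (expi x) Z).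
Proof.
move=> SZ sSZ; have w0 : expi x - Z != 0 by rewrite subr_eq0.
have w1 : s (expi x) - s Z != 0 by rewrite subr_eq0.
rewrite -!cabs_div.
have -> : map_k1 x Z - cauchy_k x Z = - 'i * expi x *
   ((dquot s (expi x) Z - s1 (expi x)) / (expi x - Z) / dquot s (expi x) Z).
  rewrite /map_k1 /cauchy_k /dquot; set S := expi x in w0 w1 *.
  move: (s S - s Z) w1 => W W0; move: (S - Z) w0 => w w00.
  by field; rewrite W0 w00.
by rewrite [leLHS]cabsM mulNr normcN [cabs ('i * _)]cabsM cabs_i cabs_expi !mul1r.
Qed.

Lemma cabs_map_k2_sub_le x Z : expi x != Z -> s (expi x) != s Z -> s1 (expi x) != 0 ->
  cabs (map_k2 x Z - main_k2 x Z) <=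
  cabs (dquot s (expi x) Z - s1 (expi x)) / cabs (expi x - Z) *
  ((cabs (dquot s (expi x) Z))^-1 + cabs (s1 (expi x)) / cabs (dquot s (expi x) Z) ^+ 2).
Proof.
move=> SZ sSZ p0.
have v0 : expi x - Z != 0 by rewrite subr_eq0.
have w0 : s (expi x) - s Z != 0 by rewrite subr_eq0.
have sd : s (expi x) - s Z = (expi x - Z) * dquot s (expi x) Z.
  by rewrite /dquot mulrC divfK.
have d0 : dquot s (expi x) Z != 0.
  by apply: contraNneq w0 => d0; rewrite sd d0 mulr0.
rewrite /map_k2 /main_k2 dconj_kernelE// sd.
set S := expi x; set v := S - Z in v0 *; set d := dquot s S Z in d0 *; set p := s1 S in p0 *.
clear sd w0; clearbody p d v.
have e1 : cabs ('i * S) = 1 by rewrite cabsM cabs_i cabs_expi mulr1.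
(* Writing $w=vd$ and comparing with $w=vp$, the identity puts a factor $d-p$ or its conjugate into
   every term. *)
have -> : (4 * 'i)^-1 * ((v * d * conjc ('i * S * p) - conjc (v * d) * ('i * S * p)) / (v * d) ^+ 2) -
    (4 * 'i)^-1 * (conjc p / p) * ((v * conjc ('i * S) - conjc v * ('i * S)) / v ^+ 2) =
    (4 * 'i)^-1 * (conjc ('i * S) * conjc p / v * ((p - d) / (d * p)) -
     conjc v * ('i * S) / v ^+ 2 * ((conjc (d - p) * p ^+ 2 + conjc p * ((p - d) * (p + d))) / (d ^+ 2 * p))).
  rewrite [conjc ('i * S * p)]conjcM [conjc (v * d)]conjcM [conjc (d - p)]conjcB.
  set c := conjc ('i * S); set e := 'i * S; set pb := conjc p; set db := conjc d; set vb := conjc v.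
  move: ((4 * 'i)^-1) => k.
  by field; rewrite v0 d0 p0.
rewrite cabsM cabs_four_iV.
have cv0 : 0 < cabs v by rewrite cabs_gt0.
have cd0 : 0 < cabs d by rewrite cabs_gt0.
have cp0 : 0 < cabs p by rewrite cabs_gt0.
set D := cabs (d - p).
have D0 : 0 <= D by exact: cabs_ge0.
have h1 : cabs (conjc ('i * S) * conjc p / v * ((p - d) / (d * p))) = D / cabs v / cabs d.
  rewrite !(cabsM, cabsV, cabsJ) cabs_i cabs_expi (cabsB p).
  by rewrite -/D; field; rewrite !gt_eqF.
have h2 : cabs (conjc v * ('i * S) / v ^+ 2 * ((conjc (d - p) * p ^+ 2 + conjc p * ((p - d) * (p + d))) / (d ^+ 2 * p)))
    <= D / cabs v * ((2 * cabs p + cabs d) / cabs d ^+ 2).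
  have h3 : cabs (conjc (d - p) * p ^+ 2 + conjc p * ((p - d) * (p + d))) <=
      D * cabs p * (2 * cabs p + cabs d).
    apply: le_trans (ler_cabsD _ _) _.
    rewrite !(cabsM, cabsX, cabsJ) (cabsB p) -/D.
    have := ler_cabsD p d; set q := cabs (p + d) => hq.
    have : cabs p * (D * q) <= cabs p * (D * (cabs p + cabs d)).
      by apply: ler_wpM2l; [exact: ltW|apply: ler_wpM2l].
    rewrite !expr2; lra.
  rewrite cabsM cabs_div (cabsM _ ('i * S)) e1 cabsJ mulr1 cabsX cabs_div (cabsM _ p) cabsX.
  apply: (@le_trans _ _ (cabs v / cabs v ^+ 2 * (D * cabs p * (2 * cabs p + cabs d) / (cabs d ^+ 2 * cabs p)))).
    apply: ler_wpM2l; first by rewrite divr_ge0 ?exprn_ge0 ?ltW.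
    by apply: ler_wpM2r => //; rewrite invr_ge0 mulr_ge0 ?exprn_ge0 ?ltW.
  rewrite le_eqVlt; apply/orP; left; apply/eqP.
  by field; rewrite !gt_eqF.
apply: (@le_trans _ _ (4^-1 * (D / cabs v / cabs d + D / cabs v * ((2 * cabs p + cabs d) / cabs d ^+ 2)))).
  apply: ler_wpM2l; first by rewrite invr_ge0.
  by apply: le_trans (ler_cabsB _ _) _; rewrite h1 lerD2l.
have -> : 4^-1 * (D / cabs v / cabs d + D / cabs v * ((2 * cabs p + cabs d) / cabs d ^+ 2)) =
  2^-1 * (D / cabs v * ((cabs d)^-1 + cabs p / cabs d ^+ 2)).
  by field; rewrite !gt_eqF.
rewrite ler_piMl//; last by rewrite invf_le1// ler1n.
apply: mulr_ge0; first by rewrite divr_ge0// ltW.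
by rewrite addr_ge0 ?invr_ge0 ?divr_ge0 ?exprn_ge0// ltW.
Qed.

Lemma cabs_map_k2_le x Z : s (expi x) != s Z ->
  cabs (map_k2 x Z) <= cabs (s1 (expi x)) / cabs (s (expi x) - s Z).
Proof.
move=> sSZ; have w0 : s (expi x) - s Z != 0 by rewrite subr_eq0.
rewrite /map_k2 cabsM cabs_four_iV cabs_div cabsX.
set W := s (expi x) - s Z in w0 *; set p := s1 (expi x).
have cw0 : 0 < cabs W by rewrite cabs_gt0.
have h : cabs (W * conjc ('i * expi x * p) - conjc W * ('i * expi x * p)) <= 2 * (cabs W * cabs p).
  apply: le_trans (ler_cabsB _ _) _.
  by rewrite !(cabsM, cabsJ) cabs_i cabs_expi !mul1r; lra.
apply: (@le_trans _ _ (4^-1 * (2 * (cabs W * cabs p) / cabs W ^+ 2))).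
  apply: ler_wpM2l; first by rewrite invr_ge0.
  by apply: ler_wpM2r => //; rewrite invr_ge0 exprn_ge0// cabs_ge0.
rewrite (_ : 4^-1 * _ = 2^-1 * (cabs p / cabs W)); last by field; rewrite gt_eqF.
rewrite ler_piMl ?divr_ge0 ?cabs_ge0//.
by rewrite invf_le1// ler1n.
Qed.

Lemma cabs_map_k1 x Z :
  cabs (map_k1 x Z) = cabs (s1 (expi x)) / cabs (s (expi x) - s Z).
Proof. by rewrite /map_k1 cabs_div !cabsM cabs_i cabs_expi !mul1r. Qed.

Lemma cabs_cauchy_k x Z : cabs (cauchy_k x Z) = (cabs (expi x - Z))^-1.
Proof. by rewrite /cauchy_k cabs_div cabsM cabs_i cabs_expi !mul1r. Qed.

Lemma cabs_main_k2_le x Z : cabs Z <= 1 -> expi x != Z ->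
  cabs (main_k2 x Z) <= poisson Z x + 1.
Proof.
move=> Z1 SZ; rewrite /main_k2.
move: (dconj_kernel Z x) (cabs_dconj_kernel_le Z1 SZ) => M MP.
rewrite !cabsM cabs_four_iV cabsV cabsJ.
have P0 : 0 <= poisson Z x + 1 by rewrite addr_ge0 ?poisson_ge0.
apply: (@le_trans _ _ (1 * (poisson Z x + 1))); last by rewrite mul1r.
apply: ler_pM => //; first by rewrite !mulr_ge0 ?invr_ge0 ?cabs_ge0.
- exact: cabs_ge0.
- rewrite -[leRHS]mulr1; apply: ler_pM; rewrite ?invr_ge0 ?divr_ge0 ?cabs_ge0//.
    by rewrite invf_le1// ler1n.
  have [->|h] := eqVneq (s1 (expi x)) 0; first by rewrite cabs0 mul0r.
  by rewrite divff// cabs_eq0.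
Qed.

End Kernels.

(** * Bounds over finite families and for powers *)

Section FiniteBounds.
Variable R : realType.

Lemma finite_pos_lower_bound (J : finType) (P : pred J) (f : J -> R) :
  (forall i, P i -> 0 < f i) -> exists2 d : R, 0 < d & forall i, P i -> d <= f i.
Proof.
move=> f0; exists (\big[Num.min/1]_(i | P i) f i).
  by elim/big_ind: _ => // x y x0 y0; rewrite lt_min x0.
by move=> i Pi; rewrite (bigD1 i)//= ge_min lexx.
Qed.

Lemma finite_upper_bound (J : finType) (f : J -> R) :
  exists2 K : R, 1 <= K & forall i, f i <= K.
Proof.
exists (\big[Num.max/1]_i f i).
  by elim/big_rec: _ => // i x _ x1; rewrite le_max x1 orbT.
by move=> i; rewrite (bigD1 i)//= le_max lexx.
Qed.

(** A power is monotone, in one direction or the other according to the sign of [a]; the sum of both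
    end values covers both cases. *)
Lemma powR_le_endpoints (a d M t : R) : 0 < d -> d <= t <= M ->
  t `^ a <= d `^ a + M `^ a.
Proof.
move=> d0 /andP[dt tM]; have t0 : 0 < t by exact: lt_le_trans dt.
have M0 : 0 < M by exact: lt_le_trans tM.
have [a0|a0] := leP 0 a.
  rewrite (@le_trans _ _ (M `^ a))//; first by rewrite ge0_ler_powR// nnegrE ltW.
  by rewrite lerDr powR_ge0.
rewrite (@le_trans _ _ (d `^ a))//; last by rewrite lerDl powR_ge0.
rewrite -(opprK a) powRN (powRN d) lef_pV2 ?posrE ?powR_gt0//.
have na : 0 <= - a by rewrite oppr_ge0 ltW.
by rewrite ge0_ler_powR// nnegrE ltW.
Qed.

Lemma powR_third_le (a c y : R) : 0 < y -> y / 3 <= c <= y ->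
  c `^ a <= (1 + 3 `^ (- a)) * y `^ a.
Proof.
move=> y0 cy; have y30 : 0 < y / 3 by rewrite divr_gt0.
apply: le_trans (powR_le_endpoints a y30 cy) _.
have y0' := ltW y0.
rewrite powRM ?invr_ge0// -powR_inv1// -powRrM mulN1r.
by rewrite le_eqVlt; apply/orP; left; apply/eqP; ring.
Qed.

End FiniteBounds.

(** * The corner weights on the closed disc and their integrability *)

Section CornerProducts.
Variables (R : realType) (m : nat) (X : 'I_m -> R[i]).
Hypotheses (XC : forall j, circle (X j)) (Xinj : injective X).
Local Notation C := R[i].
Local Notation mu := (@lebesgue_measure R).
Local Notation I := (`[0, 2 * pi]%classic : set R).

Lemma corners_separated : exists2 d : R, 0 < d & forall j k, j != k -> 2 * d <= cabs (X j - X k).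
Proof.
have [|d d0 dP] := @finite_pos_lower_bound R ('I_m * 'I_m)%type (fun p => p.1 != p.2)
  (fun p => cabs (X p.1 - X p.2)).
  by move=> [j k] /= jk; rewrite cabs_gt0 subr_eq0 (inj_eq Xinj).
exists (d / 2); first by rewrite divr_gt0.
by move=> j k jk; rewrite mulrC divfK//; exact: (dP (j, k)).
Qed.

Lemma cdisc_corner_le2 Z j : cdisc Z -> cabs (Z - X j) <= 2.
Proof.
move=> Z1; apply: le_trans (ler_cabsB _ _) _; rewrite (XC j).
by rewrite -[leRHS](_ : 1 + 1 = 2)// lerD2r.
Qed.

(** A point is close to at most one corner; each of the remaining factors is a power of a number in
    [[d, 2]], hence bounded. *)
Lemma prodX_local (a : 'I_m -> R) : exists2 c : R, 1 <= c & exists2 d : R, 0 < d &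
  (forall Z, cdisc Z -> (forall j, d <= cabs (Z - X j)) -> prodX X a Z <= c) /\
  (forall Z j, cdisc Z -> cabs (Z - X j) < d ->
    (forall k, k != j -> d <= cabs (Z - X k)) /\ prodX X a Z <= c * cabs (Z - X j) `^ a j).
Proof.
have [d d0 dP] := corners_separated.
have [K K1 KP] := @finite_upper_bound R _ (fun j : 'I_m => d `^ a j + 2 `^ a j).
have K0 : 0 <= K by exact: le_trans K1.
have fac Z j : cdisc Z -> d <= cabs (Z - X j) -> 0 <= cabs (Z - X j) `^ a j <= K.
  move=> Z1 dZ; rewrite powR_ge0/= (le_trans _ (KP j))//.
  by apply: powR_le_endpoints => //; rewrite dZ cdisc_corner_le2.
exists (K ^+ m); first exact: exprn_ege1.
exists d => //; split=> [Z Z1 dZ|Z j Z1 Zj].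
  rewrite /prodX (@le_trans _ _ (\prod_(j < m) K))//; last by rewrite prodr_const card_ord.
  by apply: ler_prod => j _; exact: fac.
have far k : k != j -> d <= cabs (Z - X k).
  move=> kj; have := dP k j kj; have := cabs_dist_triangle Z (X k) (X j).
  by rewrite (cabsB (X k) Z); move: Zj; lra.
split=> //; rewrite /prodX (bigD1 j)//= mulrC; apply: ler_wpM2r; first exact: powR_ge0.
rewrite (@le_trans _ _ (\prod_(k < m | k != j) K))//.
  by apply: ler_prod => k kj; apply: fac => //; exact: far.
rewrite prodr_const; apply: ler_weXn2l => //.
by rewrite (leq_trans (max_card _))// card_ord.
Qed.

(** Since at most one factor is singular at a time, the product is controlled by a sum of single
    powers, which can be integrated corner by corner. *)
Lemma prodX_le_sum (a : 'I_m -> R) : exists2 c : R, 0 < c &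
  forall Z, cdisc Z -> prodX X a Z <= c * (1 + \sum_j cabs (Z - X j) `^ a j).
Proof.
have [c c1 [d d0 [far near]]] := prodX_local a.
have c0 : 0 < c by exact: lt_le_trans c1.
exists c => // Z Z1.
have s0 : 0 <= \sum_j cabs (Z - X j) `^ a j by apply: sumr_ge0 => j _; exact: powR_ge0.
have [[j Zj]|none] := pselect (exists j, cabs (Z - X j) < d).
  have [_ h] := near Z j Z1 Zj; apply: le_trans h _; rewrite ler_pM2l//.
  rewrite (bigD1 j)//= addrCA lerDl addr_ge0// sumr_ge0// => k _.
  exact: powR_ge0.
rewrite (@le_trans _ _ c)//; last by rewrite ler_pMr// lerDl.
apply: far => // j; rewrite leNgt; apply/negP => h.
by apply: none; exists j.
Qed.

Lemma integral_dist_powR (T : C) a : circle T -> -1 < a ->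
  (\int[mu]_(x in I) (cabs (expi x - T) `^ a)%:E < +oo)%E.
Proof.
move=> T1 a1; have [t _ Tt] := circle_argP T1.
pose c := 1 + 3 `^ (- a).
have c0 : 0 < c by rewrite ltr_wpDr ?powR_ge0.
have p0 := @pi_gt0 R.
have mf : measurable_fun [set: R] (fun x => (cabs (expi x - T) `^ a)%:E).
  apply/measurable_EFinP; apply: (measurableT_comp (@measurable_powR R a)).
  apply: cmeasurable_cabs; apply: (@cont_off_cmeasurable R set0) => // x _.
  by apply: ccontinuousB; [exact: expi_continuous|exact: ccontinuous_cst].
have mk : measurable_fun [set: R] (fun y => (c * y `^ a)%:E).
  apply/measurable_EFinP; apply: measurable_funM; first exact: measurable_cst.
  exact: measurable_powR.
apply: le_lt_trans.
  apply: (@ge0_integral_period_le R _ (fun y => (c * y `^ a)%:E) t mf) => //.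
  - by move=> x; rewrite lee_fin powR_ge0.
  - by move=> x; rewrite expiD2pi.
  - by move=> x; rewrite lee_fin mulr_ge0 ?powR_ge0// ltW.
  - move=> y /andP[y0 yp]; rewrite !lee_fin -Tt.
    have h (z : R) : `|z - t| = y -> cabs (expi z - expi t) `^ a <= c * y `^ a.
      move=> zt; apply: powR_third_le => //.
      by rewrite -zt chord_le chord_ge// zt.
    split; apply: h; first by rewrite addrAC subrr add0r ger0_norm// ltW.
    by rewrite addrAC subrr add0r normrN ger0_norm// ltW.
have mp := @measurable_powR_EFin R a.
under eq_integral do rewrite EFinM.
rewrite ge0_integralZl//; last 3 first.
- exact: measurable_funTS.
- by move=> x _; rewrite lee_fin powR_ge0.
- by rewrite lee_fin ltW.
have fy := le_lt_trans (integral_powR_le a1 p0) (ltry _).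
apply: lte_mul_pinfty; [by []|by []|].
by apply: lte_mul_pinfty; [exact: ltW|by []|].
Qed.

Lemma integral_corner_powers (a : 'I_m -> R) : (forall j, -1 < a j) ->
  mu.-integrable I (fun x => (1 + \sum_j cabs (expi x - X j) `^ a j)%:E).
Proof.
move=> a1.
rewrite (_ : (fun x => _) = (fun x => 1%:E + \sum_j (cabs (expi x - X j) `^ a j)%:E)%E); last first.
  by apply/funext => x; rewrite EFinD sumEFin.
apply: integrableD => //.
  by apply: continuous_compact_integrable; [exact: segment_compact|
    apply: continuous_subspaceT => x; exact: cvg_cst].
apply: integrable_sum => //= j _; apply/integrableP; split.
  apply/measurable_EFinP; apply: measurable_funTS.
  apply: (measurableT_comp (@measurable_powR R (a j))).
  apply: cmeasurable_cabs; apply: (@cont_off_cmeasurable R set0) => // x _.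
  by apply: ccontinuousB; [exact: expi_continuous|exact: ccontinuous_cst].
under eq_integral do rewrite /= ger0_norm ?powR_ge0//.
exact: integral_dist_powR.
Qed.

End CornerProducts.

(** * Dini quotients centred at a point of the circle *)

Section CircleTails.
Variable R : realType.
Local Notation C := R[i].
Local Notation mu := (@lebesgue_measure R).
Local Notation I := (`[0, 2 * pi]%classic : set R).

Definition modulus_near (omega : R -> R) (d : R) (T : C) (x : R) : R :=
  if cabs (expi x - T) < d then modulus_ext omega (cabs (expi x - T)) / cabs (expi x - T) else 0.

Lemma modulus_near_ge0 omega d T x : modulus omega -> 0 <= modulus_near omega d T x.
Proof. by move=> om; rewrite /modulus_near; case: ifPn => // _; exact: modulus_ext_quot_ge0. Qed.

Lemma measurable_dist_expi (T : C) : measurable_fun [set: R] (fun x => cabs (expi x - T)).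
Proof.
apply: cmeasurable_cabs; apply: (@cont_off_cmeasurable R set0) => // x _.
by apply: ccontinuousB; [exact: expi_continuous|exact: ccontinuous_cst].
Qed.

Lemma measurable_modulus_near omega d T : modulus omega ->
  measurable_fun [set: R] (fun x => (modulus_near omega d T x)%:E).
Proof.
move=> om; apply/measurable_EFinP; apply: measurable_fun_ifT => //=.
  by apply: measurable_fun_ltr; [exact: measurable_dist_expi|exact: measurable_cst].
apply: (measurableT_comp _ (measurable_dist_expi T) : measurable_fun _ ((fun u => modulus_ext omega u / u) \o _)).
by apply/measurable_EFinP; exact: measurable_modulus_quot.
Qed.

(** The bound does not depend on the centre [T]. The constant 6 is 2 for the two sides of [T] times
    3 for the comparison of chord and arc, which also turns [d] into [3 * d]. *)
Lemma integral_modulus_near_le omega d T : modulus omega -> circle T -> 0 < d ->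
  (\int[mu]_(x in I) (modulus_near omega d T x)%:E <=
   6%:E * \int[mu]_(y in `]0%R, (3 * d)%R]) (modulus_ext omega y / y)%:E)%E.
Proof.
move=> om T1 d0; have [t _ Tt] := circle_argP T1.
have p0 := @pi_gt0 R.
pose k (y : R) := if y <= 3 * d then 3 * (modulus_ext omega y / y) else 0.
have k0 y : 0 <= k y.
  by rewrite /k; case: ifPn => // _; rewrite mulr_ge0 ?modulus_ext_quot_ge0.
have mk : measurable_fun [set: R] (fun y => (k y)%:E).
  apply/measurable_EFinP; apply: measurable_fun_ifT => //=.
    by apply: measurable_fun_ler; [exact: measurable_id|exact: measurable_cst].
  apply: measurable_funM; first exact: measurable_cst.
  by apply/measurable_EFinP; exact: measurable_modulus_quot.
have mq := measurable_modulus_quot om.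
apply: le_trans.
  apply: (@ge0_integral_period_le R _ (fun y => (k y)%:E) t (measurable_modulus_near d T om)) => //.
  - by move=> x; rewrite lee_fin modulus_near_ge0.
  - by move=> x; rewrite /modulus_near expiD2pi.
  - move=> y /andP[y0 yp]; rewrite !lee_fin -Tt.
    have h (z : R) : `|z - t| = y -> modulus_near omega d (expi t) z <= k y.
      move=> zt; rewrite /modulus_near.
      have c1 : cabs (expi z - expi t) <= y by rewrite -zt chord_le.
      have c2 : y / 3 <= cabs (expi z - expi t) by rewrite -zt chord_ge// zt.
      move: c1 c2; set c := cabs _ => c1 c2.
      have c0 : 0 < c by rewrite (lt_le_trans _ c2)// divr_gt0.
      case: ifPn => cd; last exact: k0.
      rewrite /k ifT; last by lra.
      rewrite /modulus_ext c0 y0 mulrCA; have [oP oL _ _] := om.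
      apply: ler_pM; [exact/ltW/oP|by rewrite invr_ge0 ltW|exact: oL|].
      by rewrite ler_pdivlMr// ler_pdivrMl//; lra.
    split; apply: h; first by rewrite addrAC subrr add0r ger0_norm// ltW.
    by rewrite addrAC subrr add0r normrN ger0_norm// ltW.
have -> : (6%:E = 2%:E * 3%:E :> \bar R)%E by rewrite -EFinM; congr (_%:E); ring.
rewrite -muleA lee_pmul2l//.
rewrite -ge0_integralZl//; last 2 first.
- exact: measurable_funTS.
- by move=> x _; rewrite lee_fin modulus_ext_quot_ge0.
have mc : measurable_fun [set: R] (fun x => 3%:E * (modulus_ext omega x / x)%:E)%E.
  by apply: emeasurable_funM => //; exact: measurable_cst.
have [pd|dp] := leP pi (3 * d).
  apply: (@le_trans _ _ (\int[mu]_(x in `]0%R, pi]) (3%:E * (modulus_ext omega x / x)%:E))%E).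
    apply: ge0_le_integral => //.
    - by move=> x _; rewrite lee_fin.
    - exact: measurable_funTS.
    - exact: measurable_funTS.
    - move=> x /=; rewrite in_itv/= => /andP[x0 xp].
      by rewrite -EFinM lee_fin /k (le_trans xp pd).
  apply: ge0_subset_integral => //.
  - exact: measurable_funTS.
  - by move=> x _; rewrite -EFinM lee_fin mulr_ge0 ?modulus_ext_quot_ge0.
  - by apply: subset_itvl; rewrite bnd_simp.
rewrite (@ge0_integral_setIDr _ _ R mu _ `]0%R, (3 * d)%R])//; last 2 first.
- exact: measurable_funTS.
- by move=> x _; rewrite lee_fin.
rewrite [X in (_ + X)%E](_ : _ = 0)%E ?adde0; last first.
  apply: integral0_eq => x [/=]; rewrite !in_itv/= => /andP[x0 xp] /negP.
  by rewrite x0/= -ltNge /k ltNge => /negbTE ->.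
have -> : `]0, pi] `&` `]0, 3 * d]%classic = `]0, 3 * d]%classic :> set R.
  apply/seteqP; split => [x []//|x h]; split => //.
  by move: h; rewrite /= !in_itv/= => /andP[-> h]; rewrite (le_trans h)// ltW.
apply: ge0_le_integral => //.
- by move=> x _; rewrite lee_fin.
- exact: measurable_funTS.
- exact: measurable_funTS.
- move=> x /=; rewrite in_itv/= => /andP[x0 xp].
  by rewrite -EFinM lee_fin /k xp.
Qed.

End CircleTails.

(** * Limits of complex expressions along a filter *)

Section ComplexLimits.
Variables (R : realType) (T : Type) (F : set_system T).
Context {FF : Filter F}.
Local Notation C := R[i].
Implicit Types (f g : T -> C) (a b : C).

Lemma ccvgD f g a b : f @ F --> a -> g @ F --> b -> (fun t => f t + g t) @ F --> a + b.
Proof. exact: (@cvgD _ C T F FF f g a b). Qed.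
Lemma ccvgB f g a b : f @ F --> a -> g @ F --> b -> (fun t => f t - g t) @ F --> a - b.
Proof. exact: (@cvgB _ C T F FF f g a b). Qed.
Lemma ccvgM f g a b : f @ F --> a -> g @ F --> b -> (fun t => f t * g t) @ F --> a * b.
Proof. exact: (@cvgM C T F FF f g a b). Qed.
Lemma ccvgV f a : a != 0 -> f @ F --> a -> (fun t => (f t)^-1) @ F --> a^-1.
Proof. by move=> a0 fa; exact: (@cvgV C T F FF f a a0 fa). Qed.
Lemma ccvg_div f g a b : b != 0 -> f @ F --> a -> g @ F --> b ->
  (fun t => f t / g t) @ F --> a / b.
Proof. by move=> b0 fa gb; exact: (ccvgM fa (ccvgV b0 gb)). Qed.
Lemma ccvg_cst a : (fun _ : T => a) @ F --> a.
Proof. exact: cvg_cst. Qed.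
Lemma ccvg_sqr f a : f @ F --> a -> (fun t => f t ^+ 2) @ F --> a ^+ 2.
Proof.
move=> fa; rewrite (_ : (fun t => f t ^+ 2) = (fun t => f t * f t)).
  by rewrite expr2; exact: (ccvgM fa fa).
by apply/funext => t; rewrite expr2.
Qed.
Lemma ccvg_conj f a : f @ F --> a -> (fun t => conjc (f t)) @ F --> conjc a.
Proof.
move=> /cvgcP fa; apply/cvgcP => e /fa; apply: filterS => t.
by rewrite -conjcB cabsJ.
Qed.
Lemma ccvg_real (u : T -> R) (r : R) : u @ F --> r -> (fun t => (u t)%:C : C) @ F --> (r%:C : C).
Proof. by move=> ur; apply/cvg_ReImP; split => //=; exact: cvg_cst. Qed.
Lemma cvg_cabs f a : f @ F --> a -> (fun t => cabs (f t)) @ F --> cabs a.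
Proof.
move=> /cvgcP fa; apply/cvgrPdist_lt => e /fa; apply: filterS => t.
by apply: le_lt_trans; rewrite distrC ler_dist_cabs.
Qed.

End ComplexLimits.

(** * Densities with corner weights and truncated integrals *)

Section Densities.
Variable R : realType.
Local Notation C := R[i].
Local Notation mu := (@lebesgue_measure R).
Local Notation I := (`[0, 2 * pi]%classic : set R).

(** An epsilon-delta form of [classK] with a positive constant, which avoids subspace topologies in
    the estimates. *)
Record density m (X : 'I_m -> C) (gamma : 'I_m -> R) (psi : C -> R) : Prop := {
  den_cont : forall T, (circle `\` range X) T -> forall e : R, 0 < e ->
    exists2 d : R, 0 < d & forall S, (circle `\` range X) S -> cabs (S - T) < d ->
      `|psi S - psi T| < e;
  den_le : exists2 c : R, 0 < c & forall S, (circle `\` range X) S ->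
    `|psi S| <= c * prodX X (fun j => - gamma j) S }.

(** For an absolutely integrable [g] the truncations are dominated by the modulus of [g], so a
    principal value is an ordinary integral. The angles of [T] are left out because no truncation
    contains them. *)
Lemma cvg_truncated_integral (g : R -> C) (T : C) : cintegrable I g ->
  cintegral (I `&` (@expi R) @^-1` [set S | d < cabs (S - T)]) g @[d --> 0^'+] -->
  cintegral (I `\` [set x | expi x = T]) g.
Proof.
move=> ig; have [mg gy] := ig.
pose A d : set R := (@expi R) @^-1` [set S | d < cabs (S - T)].
have mA d : measurable (A d).
  have -> : A d = setT `&` (fun x => cabs (expi x - T)) @^-1` `]d, +oo[%classic.
    by rewrite setTI; apply/seteqP; split => x; rewrite /A /= in_itv/= andbT.
  exact: (measurable_dist_expi T).
pose I' := I `\` [set x | expi x = T].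
have cN := @countable_expi_fiber R T.
have mI' : measurable I' by apply: measurableD => //; exact: countable_measurable.
have key (h : R -> R) : mu.-integrable I (EFin \o h) ->
    (\int[mu]_(x in I `&` A d) h x)%R @[d --> 0^'+] --> (\int[mu]_(x in I') h x)%R.
  move=> ih; apply/cvg_at_rightP => u [u0 ucv].
  have IA : (fun n => \int[mu]_(x in I `&` A (u n)) h x)%R =
      (fun n => \int[mu]_(x in I') (h \_ (A (u n))) x)%R.
    apply/funext => n; rewrite -Rintegral_mkcondr; congr Rintegral.
    apply/seteqP; split => x [xI xA]; split => //; last by case: xI.
    split => //= xT; move: xA; rewrite /A/= xT subrr cabs0 ltNge.
    by rewrite (ltW (u0 n)).
  rewrite IA.
  have ih' : mu.-integrable I' (EFin \o h).
    by apply: integrableS ih => //; exact: subDsetl.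
  have mh' : measurable_fun I' h by apply/measurable_EFinP; case/integrableP: ih'.
  have [] // := @vitali_cvg_integral _ (measurableTypeR R) R mu I'
    (fun n => h \_ (A (u n))) h mI'.
  - move=> n; apply/(measurable_restrict _ (mA _) mI').
    by apply: measurable_funS mh'.
  - move=> x [_ xT].
    have xT0 : 0 < cabs (expi x - T) by rewrite cabs_gt0 subr_eq0; exact/eqP.
    apply/cvgrPdist_lt => e e0.
    move/cvgrPdist_lt : ucv => /(_ _ xT0); apply: filterS => n.
    rewrite sub0r normrN gtr0_norm// => unx.
    by rewrite patchE mem_set ?subrr ?normr0.
  - move=> e e0; exists set0, (fun x => `|h x|), 0%N; split => //.
    + by rewrite setD0; exact: integrable_norm.
    + by move=> n _; rewrite setI0 integral_set0 lee_fin ltW.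
    + move=> n x _ _ _; rewrite patchE; case: ifPn => // _.
      by rewrite normr0.
have /(cintegrable_ReIm _ (measurable_itv _))[ir ii] := ig.
by apply/cvg_ReImP; split => /=; exact: key.
Qed.

End Densities.

(** * Integrability of densities against the kernels *)

Section BoundaryLimit.
Variables (R : realType) (m : nat) (X : 'I_m -> R[i]) (beta gamma : 'I_m -> R).
Variables (s s1 : R[i] -> R[i]) (psi : R[i] -> R).
Local Notation C := R[i].
Local Notation mu := (@lebesgue_measure R).
Local Notation I := (`[0, 2 * pi]%classic : set R).
Hypothesis Xinj : injective X.
Hypothesis cm : corner_map X beta s s1.
Hypothesis gamma_bd : forall j, 0 < gamma j < 1 /\ gamma j < beta j + 1.
Hypothesis pd : density X gamma psi.

Let XC : forall j, circle (X j) := cm_circle cm.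
Let N := corner_args X.
Let f (x : R) : C := (psi (expi x))%:C.

Lemma corner_args_circle x : ~ N x -> (circle `\` range X) (expi x).
Proof. by move=> Nx; split => //; exact: circle_expi. Qed.

Lemma map_inj_cdisc Z W : cdisc Z -> cdisc W -> s Z = s W -> Z = W.
Proof.
move=> Z1 W1 e; apply/eqP; rewrite -subr_eq0 -cabs_eq0; apply/eqP/le_anti.
rewrite cabs_ge0 andbT leNgt; apply/negP => h.
have [d d0 dP] := cm_inv cm W1 h.
by have := dP Z Z1; rewrite e subrr cabs0 => /(_ d0); rewrite ltxx.
Qed.

Lemma near_notin_corner (T : C) : ~ range X T ->
  exists2 d : R, 0 < d & forall S, cabs (S - T) < d -> ~ range X S.
Proof.
move=> TX.
have [|d d0 dP] := @finite_pos_lower_bound R 'I_m xpredT (fun j => cabs (T - X j)).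
  move=> j _; rewrite cabs_gt0 subr_eq0; apply/eqP => e.
  by apply: TX; exists j.
exists d => // S Sd [j _ jS]; have := dP j isT; rewrite jS cabsB leNgt.
by rewrite Sd.
Qed.

Lemma cont_off_circle_fun (h : C -> C) :
  (forall T, (circle `\` range X) T -> forall e : R, 0 < e -> exists2 d : R, 0 < d &
    forall S, (circle `\` range X) S -> cabs (S - T) < d -> cabs (h S - h T) < e) ->
  cont_off N (fun x => h (expi x)).
Proof.
move=> hc x Nx; apply/cvgcP => e e0.
have [d d0 dP] := hc _ (corner_args_circle Nx) e e0.
have [d1 d10 d1P] := near_notin_corner Nx.
have dd : 0 < Num.min d d1 by rewrite lt_min d0.
have /cvgcP/(_ _ dd) := @expi_continuous R x.
apply: filterS => y; rewrite lt_min => /andP[h1 h2].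
by apply: dP => //; split; [exact: circle_expi|exact: d1P].
Qed.

Lemma cont_off_density : cont_off N f.
Proof.
apply: (@cont_off_circle_fun (fun S => (psi S)%:C)) => T TX e e0.
have [d d0 dP] := den_cont pd TX e0; exists d => // S SX /(dP S SX).
by rewrite -realcB cabs_real.
Qed.

Lemma cont_off_deriv : cont_off N (fun x => s1 (expi x)).
Proof. exact: (cont_off_circle_fun (cm_deriv_cont cm)). Qed.

Lemma continuous_map_expi : continuous (fun x => s (expi x)).
Proof.
move=> x; apply/cvgcP => e e0.
have [d d0 dP] := cm_cont cm (circle_cdisc (circle_expi x)) e0.
have /cvgcP/(_ _ d0) := @expi_continuous R x.
by apply: filterS => y; apply: dP; exact/circle_cdisc/circle_expi.
Qed.

Lemma prodXD (a b : 'I_m -> R) Z : ~ range X Z ->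
  prodX X a Z * prodX X b Z = prodX X (fun j => a j + b j) Z.
Proof.
move=> ZX; rewrite /prodX -big_split; apply: eq_bigr => j _ /=.
rewrite powRD//; apply/implyP => _; rewrite cabs_eq0 subr_eq0.
by apply/eqP => e; apply: ZX; exists j.
Qed.

(** The two summands carry the weights with exponents $-\gamma_j$ and $\beta_j-\gamma_j$. Both
    exceed $-1$ because $\gamma_j<1$ and $\gamma_j<\beta_j+1$. *)
Lemma density_dominated : exists2 G : R -> R, mu.-integrable I (EFin \o G) &
  forall x, ~ N x -> `|psi (expi x)| * (1 + cabs (s1 (expi x))) <= G x.
Proof.
have [c c0 cP] := den_le pd; have [c' c'0 c'P] := cm_deriv_le cm.
have [k k0 kP] := prodX_le_sum XC Xinj (fun j => - gamma j).
have [k' k'0 k'P] := prodX_le_sum XC Xinj (fun j => - gamma j + beta j).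
pose S a x := 1 + \sum_j cabs (expi x - X j) `^ (a j : R).
exists (fun x => c * k * S (fun j => - gamma j) x + c * c' * k' * S (fun j => - gamma j + beta j) x).
  rewrite (_ : _ \o _ = (fun x => (c * k)%:E * (S (fun j => - gamma j) x)%:E +
    (c * c' * k')%:E * (S (fun j => - gamma j + beta j) x)%:E)%E)//.
  apply: integrableD => //; apply: integrableZl => //; apply: integral_corner_powers => //.
    by move=> j; have [] := gamma_bd j; lra.
  by move=> j; have [] := gamma_bd j; lra.
move=> x /corner_args_circle Sx.
have S1 := circle_cdisc Sx.1; have hs : (cdisc `\` range X) (expi x) by split => //; exact: Sx.2.
have h1 := cP _ Sx; have h2 := c'P _ hs.
have p1 := kP _ S1; have p2 := k'P _ S1.
rewrite mulrDr mulr1; apply: lerD.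
  by apply: le_trans h1 _; rewrite -mulrA ler_pM2l.
apply: (@le_trans _ _ ((c * prodX X (fun j => - gamma j) (expi x)) * (c' * prodX X beta (expi x)))).
  by apply: ler_pM; rewrite ?cabs_ge0.
rewrite mulrACA prodXD; last exact: Sx.2.
by rewrite -[leRHS]mulrA ler_pM2l// mulr_gt0.
Qed.

Lemma density_integrable_gen (k : R -> C) (N' : set R) (K : R) : countable N' -> N `<=` N' ->
  cont_off N' k -> (forall x, ~ N' x -> cabs (k x) <= K * (1 + cabs (s1 (expi x)))) ->
  cintegrable I (fun x => f x * k x).
Proof.
move=> cN' NN' ck kK.
have mfk : cmeasurable setT (fun x => f x * k x).
  apply: (@cont_off_cmeasurable R N' _ cN') => x Nx.
  by apply: (ccontinuousM (f := f) (g := k) _ (ck x Nx)); apply: cont_off_density => /NN'.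
have mI : cmeasurable I (fun x => f x * k x) by apply: cmeasurableS mfk.
have [G iG GP] := density_dominated.
have mI' : measurable (I `\` N') by apply: measurableD => //; exact: countable_measurable.
have iG' : mu.-integrable (I `\` N') (EFin \o (fun x => K * G x)).
  rewrite (_ : _ \o _ = (fun x => K%:E * (G x)%:E)%E)//.
  by apply: integrableZl => //; apply: integrableS iG => //; exact: subDsetl.
have [mI'' fin] : cintegrable (I `\` N') (fun x => f x * k x).
  apply: (cintegrable_dom mI' _ iG').
    by apply: cmeasurableS mI => //; exact: subDsetl.
  move=> x [_ Nx]; rewrite cabsM cabs_real.
  have K0 : 0 <= K.
    have := le_trans (cabs_ge0 _) (kK x Nx).
    by rewrite pmulr_lge0// ltr_wpDr ?cabs_ge0.
  apply: (@le_trans _ _ (`|psi (expi x)| * (K * (1 + cabs (s1 (expi x)))))).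
    by apply: ler_wpM2l => //; exact: kK.
  by rewrite mulrCA; apply: ler_wpM2l => //; apply: GP => /NN'.
split => //.
rewrite -(@ge0_integral_setD_countable R I N')//.
- exact: cmeasurable_cabsE.
- by move=> x _; rewrite lee_fin cabs_ge0.
Qed.

Lemma density_integrable : cintegrable I f.
Proof.
rewrite (_ : f = (fun x => f x * 1)); last by apply/funext => x; rewrite mulr1.
apply: (@density_integrable_gen (fun=> 1) N 1) => //; first exact: countable_corner_args.
- by move=> x _; exact: ccontinuous_cst.
- by move=> x _; rewrite cabs1 mul1r lerDl cabs_ge0.
Qed.

Lemma map_kernels_cont (Z : C) (N' : set R) : N `<=` N' -> (forall x, ~ N' x -> expi x != Z) ->
  (forall x, ~ N' x -> s (expi x) != s Z) ->
  [/\ cont_off N' (fun x => cauchy_k x Z), cont_off N' (fun x => map_k1 s s1 x Z),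
      cont_off N' (fun x => map_k2 s s1 x Z) & cont_off N' (dconj_kernel Z)].
Proof.
move=> NN' SZ sSZ.
have ce x : {for x, continuous (fun y => expi y : C)} := @expi_continuous R x.
have cie (x : R) : {for x, continuous (fun y : R => 'i * expi y : C)}.
  exact: (ccontinuousM (@ccontinuous_cst _ _ _ _) (ce x)).
have cs1 x : ~ N' x -> {for x, continuous (fun y => 'i * expi y * s1 (expi y))}.
  by move=> Nx; apply: (ccontinuousM (cie x)); apply: cont_off_deriv => /NN'.
have cw x : {for x, continuous (fun y => s (expi y) - s Z)}.
  exact: (ccontinuousB (@continuous_map_expi x) (@ccontinuous_cst _ _ _ _)).
have cv x : {for x, continuous (fun y => expi y - Z)}.
  exact: (ccontinuousB (ce x) (@ccontinuous_cst _ _ _ _)).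
have v0 x : ~ N' x -> expi x - Z != 0 by move=> /SZ; rewrite subr_eq0.
have w0 x : ~ N' x -> s (expi x) - s Z != 0 by move=> /sSZ; rewrite subr_eq0.
split=> x Nx.
- exact: (ccontinuous_div (g := fun y : R => expi y - Z) (v0 x Nx) (cie x) (cv x)).
- exact: (ccontinuous_div (g := fun y : R => s (expi y) - s Z) (w0 x Nx) (cs1 x Nx) (cw x)).
- have w20 : (fun y : R => (s (expi y) - s Z) ^+ 2) x != 0 by rewrite /= expf_neq0// w0.
  exact: (ccontinuousM (@ccontinuous_cst _ _ _ _) (ccontinuous_div (g := fun y : R => (s (expi y) - s Z) ^+ 2) w20
    (ccontinuousB (ccontinuousM (cw x) (ccontinuous_conj (cs1 x Nx)))
      (ccontinuousM (ccontinuous_conj (cw x)) (cs1 x Nx)))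
    (ccontinuousX (n := 2) (cw x)))).
- have v20 : (fun y : R => (expi y - Z) ^+ 2) x != 0 by rewrite /= expf_neq0// v0.
  have v10 : (fun y : R => expi y - Z) x != 0 by rewrite /= v0.
  exact: (ccontinuousM (@ccontinuous_cst _ _ _ _) (ccontinuousD
    (ccontinuous_div (g := fun y : R => (expi y - Z) ^+ 2) v20 (@ccontinuous_cst _ _ _ _) (ccontinuousX (n := 2) (cv x)))
    (ccontinuous_div (g := fun y : R => expi y - Z) v10 (ccontinuous_conj (cv x)) (cv x)))).
Qed.

Lemma main_k2_cont (Z : C) (N' : set R) : N `<=` N' -> cont_off N' (dconj_kernel Z) ->
  cont_off N' (fun x => main_k2 s1 x Z).
Proof.
move=> NN' cd x Nx; have Nx' : ~ N x by move=> /NN'.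
apply: (ccontinuousM (f := fun y => _ * _)); last exact: cd.
apply: (ccontinuousM (@ccontinuous_cst _ _ _ _)).
apply: (ccontinuous_div (f := fun y => conjc (s1 (expi y)))).
- exact/(cm_deriv_neq0 cm)/corner_args_circle.
- exact/ccontinuous_conj/cont_off_deriv.
- exact: cont_off_deriv.
Qed.

Section InteriorIntegrable.
Variable Z : C.
Hypothesis Zd : disc Z.

(** For an interior [Z] all denominators stay away from 0 on the circle: the distance to [Z] is at
    least [1 - cabs Z], and continuity of the inverse map does the rest. *)
Lemma map_dist_circle : exists2 e : R, 0 < e & forall S, circle S ->
  e <= cabs (S - Z) /\ e <= cabs (s S - s Z).
Proof.
have h : 0 < 1 - cabs Z by rewrite subr_gt0.
have [e e0 eP] := cm_inv cm (disc_cdisc Zd) h.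
have far S : circle S -> 1 - cabs Z <= cabs (S - Z).
  by move=> S1; apply: le_trans (lerB_cabs _ _); rewrite S1.
exists (Num.min e (1 - cabs Z)); first by rewrite lt_min e0.
move=> S S1; split; first by rewrite ge_min far// orbT.
rewrite ge_min leNgt; case: ltP => //= h1.
by have := eP S (circle_cdisc S1) h1; rewrite ltNge far.
Qed.

Lemma interior_neq x : expi x != Z /\ s (expi x) != s Z.
Proof.
have [e e0 eP] := map_dist_circle.
have [h1 h2] := eP _ (circle_expi x).
by split; rewrite -subr_eq0 -cabs_gt0; [exact: lt_le_trans h1|exact: lt_le_trans h2].
Qed.

Lemma interior_integrable :
  [/\ cintegrable I (fun x => f x * cauchy_k x Z),
      cintegrable I (fun x => f x * map_k1 s s1 x Z),
      cintegrable I (fun x => f x * map_k2 s s1 x Z) &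
      cintegrable I (fun x => f x * main_k2 s1 x Z)].
Proof.
have [e e0 eP] := map_dist_circle.
have cN := countable_corner_args X.
have [c1 c2 c3 c4] := map_kernels_cont (@subset_refl _ N) (fun x _ => (interior_neq x).1)
  (fun x _ => (interior_neq x).2).
have c5 := main_k2_cont (@subset_refl _ N) c4.
have ei : 0 < e^-1 by rewrite invr_gt0.
have inv_le (u : R) : e <= u -> u^-1 <= e^-1.
  by move=> eu; rewrite lef_pV2 ?posrE// (lt_le_trans e0).
split.
- apply: (@density_integrable_gen _ N e^-1) => // x _; rewrite cabs_cauchy_k.
  apply: (@le_trans _ _ e^-1); first exact/inv_le/(eP _ (circle_expi x)).1.
  by rewrite ler_peMr ?lerDl ?cabs_ge0// ltW.
- apply: (@density_integrable_gen _ N e^-1) => // x _; rewrite cabs_map_k1 mulrC.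
  apply: ler_pM; rewrite ?invr_ge0 ?cabs_ge0 ?lerDr//.
  exact/inv_le/(eP _ (circle_expi x)).2.
- apply: (@density_integrable_gen _ N e^-1) => // x _.
  apply: le_trans (cabs_map_k2_le _ (interior_neq x).2) _; rewrite mulrC.
  apply: ler_pM; rewrite ?invr_ge0 ?cabs_ge0 ?lerDr//.
  exact/inv_le/(eP _ (circle_expi x)).2.
- apply: (@density_integrable_gen _ N (e ^- 2 + 1)) => // x _.
  apply: le_trans (cabs_main_k2_le _ (ltW Zd) (interior_neq x).1) _.
  have K0 : 0 <= e ^- 2 + 1 by rewrite addr_ge0 ?invr_ge0 ?exprn_ge0// ltW.
  apply: (@le_trans _ _ (e ^- 2 + 1)); last by rewrite ler_peMr ?lerDl ?cabs_ge0.
  rewrite lerD2r /poisson.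
  have eS : e ^+ 2 <= cabs (expi x - Z) ^+ 2.
    by rewrite ler_sqr ?nnegrE ?cabs_ge0 ?(ltW e0)// (eP _ (circle_expi x)).1.
  rewrite -[leRHS]mul1r; apply: ler_pM; rewrite ?invr_ge0 ?exprn_ge0 ?cabs_ge0//.
  + by rewrite subr_ge0 expr_le1 ?cabs_ge0// ltW.
  + by rewrite lerBlDr lerDl exprn_ge0 ?cabs_ge0.
  + have e2 : 0 < e ^+ 2 by rewrite exprn_gt0.
    by rewrite lef_pV2 ?posrE ?(lt_le_trans e2 eS).
Qed.

End InteriorIntegrable.

End BoundaryLimit.

Lemma cvg_sqr (R : realType) T (F : set_system T) {FF : Filter F} (u : T -> R) (a : R) :
  u @ F --> a -> (fun t => u t ^+ 2) @ F --> a ^+ 2.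
Proof.
move=> ua; rewrite (_ : (fun t => u t ^+ 2) = u \* u); last by apply/funext => t /=; rewrite expr2.
by rewrite expr2; exact: (cvgM ua ua).
Qed.

(** * Bounds for the kernels near and away from a regular boundary point *)

Section BoundaryKernelBounds.
Variables (R : realType) (m : nat) (X : 'I_m -> R[i]) (beta : 'I_m -> R).
Variables (s s1 : R[i] -> R[i]).
Local Notation C := R[i].
Local Notation mu := (@lebesgue_measure R).
Local Notation I := (`[0, 2 * pi]%classic : set R).
Hypothesis cm : corner_map X beta s s1.
Implicit Types Z T S : C.

(** The radial projection to the circle. At [0] it takes the default value [0]; [unit_partP]
    concerns points within [1 / 2] of a point of the circle. *)
Definition unit_part Z : C := ((cabs Z)^-1)%:C * Z.

Lemma unit_partP Z Z0 : cdisc Z -> circle Z0 -> cabs (Z - Z0) <= 1 / 2 ->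
  [/\ circle (unit_part Z), Z = (cabs Z)%:C * unit_part Z, 0 <= cabs Z <= 1,
      1 - cabs Z <= cabs (Z - Z0) & cabs (unit_part Z - Z0) <= 2 * cabs (Z - Z0)].
Proof.
move=> Z1 C0 ZZ0.
have h : 1 - cabs Z <= cabs (Z - Z0) by rewrite -C0 cabsB lerB_cabs.
have r0 : 0 < cabs Z by lra.
have ZE : Z = (cabs Z)%:C * unit_part Z.
  by rewrite /unit_part mulrA -realcM divff ?gt_eqF// mul1r.
have UC : circle (unit_part Z).
  by rewrite /circle/= /unit_part cabsM cabs_real ger0_norm ?invr_ge0 ?ltW// mulVf// gt_eqF.
have r01 : 0 <= cabs Z <= 1 by rewrite ltW.
split => //.
have := cabs_dist_triangle Z (unit_part Z) Z0.
rewrite [cabs (unit_part Z - Z)]cabsB {2}ZE cabs_radial//; lra.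
Qed.

(** Near a regular point [local_dquot_center] keeps the difference quotient close to the nonzero
    [s1 Z0]. The comparison with the disc kernels then costs only [local_dquot], a Dini quotient
    centred at the projection of [Z]. *)
Lemma map_kernels_near Z0 : (circle `\` range X) Z0 -> exists (omega : R -> R) (K d : R),
  [/\ modulus omega, dini omega, 0 <= K, 0 < d <= 1 / 2 &
    forall Z x, cdisc Z -> cabs (Z - Z0) <= d -> cabs (expi x - Z0) <= d ->
      expi x != Z -> expi x != unit_part Z ->
      let b := K * (omega (cabs (expi x - unit_part Z)) / cabs (expi x - unit_part Z)) in
      cabs (map_k1 s s1 x Z - cauchy_k x Z) <= b /\
      cabs (map_k2 s s1 x Z - main_k2 s1 x Z) <= b].
Proof.
move=> CX0; have [om [A [rho [mom dom A0 rho0 oscP]]]] := cm_osc cm CX0.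
have c0 := cm_deriv_neq0 cm CX0; set c := cabs (s1 Z0).
have cp : 0 < c by rewrite /c cabs_gt0.
have c4 : 0 < c / 4 by rewrite divr_gt0.
have [d1 d10 d1P] := cm_deriv_cont cm CX0 c4.
have e0 : 0 < c / 4 / (13 * A + 1) by rewrite divr_gt0//; lra.
have [d2 d20 d2P] := dini_modulus_small mom dom e0.
(* The projection of [Z] lies within [2 * d] of [Z0] and within [3 * d] of [S]; the quarters keep
   these distances inside [rho], inside the continuity range [d1] and inside the range [d2] where
   [om] is small. *)
pose d := Num.min (Num.min (1 / 2) (rho / 4)) (Num.min (d1 / 4) (d2 / 4)).
have [dh dr da db] : [/\ d <= 1 / 2, d <= rho / 4, d <= d1 / 4 & d <= d2 / 4].
  by rewrite /d !ge_min !lexx ?orbT.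
have d0 : 0 < d by rewrite /d !lt_min !divr_gt0.
exists om, (30 * A * (28 / c)), d; split => //.
- by rewrite !mulr_ge0// invr_ge0 ltW.
- by rewrite d0 dh.
move=> Z x Z1 Zd xd xZ xT /=; set T := unit_part Z in xT *; set S := expi x in xd xZ xT *.
have [T1 ZE r01 rZ TZ0] := unit_partP Z1 CX0.1 (le_trans Zd dh).
have S1 : circle S by exact: circle_expi.
have Trho : cabs (T - Z0) <= rho by lra.
have [nT oT] := oscP T T1 Trho.
have STd : cabs (S - T) <= 3 * d.
  by have := cabs_dist_triangle Z0 S T; rewrite [cabs (Z0 - T)]cabsB; lra.
have SX : (circle `\` range X) S by apply: nT => //; lra.
have Trho' : cabs (T - T) <= rho by rewrite subrr cabs0 ltW.
have TX : (circle `\` range X) T by exact: nT.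
have diffT S' : circle S' -> cabs (S' - T) <= rho -> cdiff circle s S' (s1 S').
  by move=> S'1 S'r; apply: (cm_diff_arc cm); exact: nT.
have Srho : cabs (S - T) <= rho by lra.
have Zrho : 1 - cabs Z <= rho by lra.
have xZ' : S != (cabs Z)%:C * T by rewrite -ZE.
have L1 := local_dquot_center (cm_cont cm) (cm_diff cm) mom T1 A0 diffT oT S1 r01 xT xZ' Srho Zrho.
have L2 := local_dquot (cm_cont cm) (cm_diff cm) mom T1 A0 diffT oT S1 r01 xT xZ' Srho Zrho.
rewrite -ZE in L1 L2.
have SZd : 0 < cabs (S - Z) <= d2.
  rewrite cabs_gt0 subr_eq0 xZ /=; have := cabs_dist_triangle Z0 S Z.
  by rewrite [cabs (Z0 - Z)]cabsB; lra.
have L1' : cabs (dquot s S Z - s1 T) <= c / 4.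
  apply: (le_trans L1); apply: (@le_trans _ _ ((13 * A + 1) * (c / 4 / (13 * A + 1)))).
    apply: ler_pM; rewrite ?mulr_ge0 ?lerDl//; last exact: d2P.
    by case: mom => + _ _ _; move/(_ (cabs (S - Z))); case/andP: SZd => -> _ /(_ isT)/ltW.
  by rewrite mulrC divfK// gt_eqF//; lra.
have sT : cabs (s1 T - s1 Z0) < c / 4 by apply: d1P => //; lra.
have sS : cabs (s1 S - s1 Z0) < c / 4 by apply: d1P => //; lra.
have q0 : c / 2 <= cabs (dquot s S Z).
  have := cabs_dist_triangle (s1 T) (dquot s S Z) (s1 Z0).
  by have := lerB_cabs (s1 Z0) (dquot s S Z); rewrite [cabs (s1 Z0 - _)]cabsB -/c; lra.
have p0 : cabs (s1 S) <= 5 / 4 * c.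
  by have := lerB_cabs (s1 S) (s1 Z0); rewrite -/c; lra.
have qp : 0 < cabs (dquot s S Z) by lra.
have sSZ : s S != s Z.
  apply/eqP => e; move: qp; rewrite /dquot e subrr mul0r cabs0; lra.
have k1 := cabs_map_k1_sub_le s1 xZ sSZ.
have k2 := cabs_map_k2_sub_le xZ sSZ (cm_deriv_neq0 cm SX).
move: k1 k2 L2; rewrite -/S; set a := cabs (dquot s S Z - s1 S) / _; set q := cabs (dquot s S Z) in q0 qp *.
set b := om _ / _; set p := cabs (s1 S) in p0 *; move=> k1 k2 L2.
have a0 : 0 <= a by rewrite divr_ge0 ?cabs_ge0.
have q1 : q^-1 <= 2 / c.
  by rewrite -[2 / c]invf_div lef_pV2 ?posrE ?divr_gt0//; lra.
have q2 : p / q ^+ 2 <= 5 / c.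
  rewrite (_ : 5 / c = 5 / 4 * c * (2 / c) ^+ 2); last by field; rewrite gt_eqF.
  rewrite -exprVn; apply: ler_pM => //; rewrite ?cabs_ge0 ?exprn_ge0 ?invr_ge0 ?(ltW qp)//.
  by rewrite ler_sqr ?nnegrE ?invr_ge0 ?divr_ge0// ltW.
have ci : 0 < c^-1 by rewrite invr_gt0.
rewrite (_ : 30 * A * (28 / c) * b = 30 * A * b * (28 / c)); last by ring.
split.
  apply: (le_trans k1); apply: ler_pM => //; first by rewrite invr_ge0 ltW.
  by apply: (le_trans q1); rewrite ler_pM2r//; lra.
apply: (le_trans k2); apply: ler_pM => //.
  by rewrite addr_ge0 ?invr_ge0 ?divr_ge0 ?exprn_ge0 ?cabs_ge0// ltW.
by lra.
Qed.

(** If [S] stays away from [Z0], continuity of the inverse keeps [s S] away from [s Z0], hence from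
    [s Z] for all [Z] near [Z0]. All denominators are then bounded below uniformly. *)
Lemma map_kernels_far Z0 e : circle Z0 -> 0 < e -> exists K d : R,
  [/\ 0 <= K, 0 < d & forall Z x, cdisc Z -> cabs (Z - Z0) < d -> e <= cabs (expi x - Z0) ->
    expi x != Z /\ [/\ cabs (cauchy_k x Z) <= K,
        cabs (map_k1 s s1 x Z) <= K * cabs (s1 (expi x)),
        cabs (map_k2 s s1 x Z) <= K * cabs (s1 (expi x)),
        poisson Z x <= K & cabs (dconj_kernel Z x) <= K]].
Proof.
move=> CX0 e0; have Z01 := circle_cdisc CX0.
have [a a0 aP] := cm_inv cm Z01 e0.
have a2 : 0 < a / 2 by rewrite divr_gt0.
have [d d0 dP] := cm_cont cm Z01 a2.
pose K := 2 / e + 2 / a + (2 / e) ^+ 2 + 1.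
have h1 : 0 < 2 / e by rewrite divr_gt0.
have h2 : 0 < 2 / a by rewrite divr_gt0.
have h3 : 0 < (2 / e) ^+ 2 by rewrite exprn_gt0.
exists K, (Num.min d (e / 2)); split.
- by rewrite /K; lra.
- by rewrite lt_min d0 divr_gt0.
move=> Z x Z1; rewrite lt_min => /andP[Zd Ze] xe; set S := expi x in xe *.
have SZ : e / 2 <= cabs (S - Z).
  by have := cabs_dist_triangle Z S Z0; lra.
have sSZ : a / 2 <= cabs (s S - s Z).
  have : a <= cabs (s S - s Z0).
    rewrite leNgt; apply/negP => h; have := aP S (circle_cdisc (circle_expi x)) h; lra.
  have := cabs_dist_triangle (s Z) (s S) (s Z0); have := dP Z Z1 Zd; lra.
have SZ0 : S != Z by rewrite -subr_eq0 -cabs_gt0; lra.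
have sSZ0 : s S != s Z by rewrite -subr_eq0 -cabs_gt0; lra.
have i1 : (cabs (S - Z))^-1 <= 2 / e.
  by rewrite -[2 / e]invf_div lef_pV2 ?posrE ?divr_gt0//; lra.
have i2 : (cabs (s S - s Z))^-1 <= 2 / a.
  by rewrite -[2 / a]invf_div lef_pV2 ?posrE ?divr_gt0//; lra.
have P : poisson Z x <= (2 / e) ^+ 2.
  rewrite /poisson -exprVn -[leRHS]mul1r; apply: ler_pM.
  - by rewrite subr_ge0 expr_le1 ?cabs_ge0.
  - by rewrite exprn_ge0 ?invr_ge0 ?cabs_ge0.
  - by rewrite lerBlDr lerDl exprn_ge0 ?cabs_ge0.
  - by rewrite ler_sqr ?nnegrE ?invr_ge0 ?cabs_ge0// ltW.
have i2' : (cabs (s S - s Z))^-1 <= K by rewrite /K; lra.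
split => //; split.
- by rewrite cabs_cauchy_k -/S /K; lra.
- by rewrite cabs_map_k1 mulrC; apply: ler_wpM2r => //; exact: cabs_ge0.
- apply: le_trans (cabs_map_k2_le _ sSZ0) _; rewrite mulrC.
  by apply: ler_wpM2r => //; exact: cabs_ge0.
- by rewrite /K; lra.
- by have := cabs_dconj_kernel_le Z1 SZ0; rewrite /K; lra.
Qed.

Lemma cvg_kernels (Zn : nat -> C) Z0 x : cdisc Z0 -> (forall n, cdisc (Zn n)) ->
  Zn n @[n --> \oo] --> Z0 -> expi x != Z0 ->
  [/\ cauchy_k x (Zn n) @[n --> \oo] --> cauchy_k x Z0,
      map_k1 s s1 x (Zn n) @[n --> \oo] --> map_k1 s s1 x Z0,
      map_k2 s s1 x (Zn n) @[n --> \oo] --> map_k2 s s1 x Z0,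
      dconj_kernel (Zn n) x @[n --> \oo] --> dconj_kernel Z0 x &
      poisson (Zn n) x @[n --> \oo] --> poisson Z0 x].
Proof.
move=> Z01 Zn1 ZZ xZ0.
have sSZ0 : s (expi x) != s Z0.
  apply/eqP => e; move/eqP: xZ0; apply.
  exact: (map_inj_cdisc cm (circle_cdisc (circle_expi x)) Z01 e).
have cs : s (Zn n) @[n --> \oo] --> s Z0.
  apply/cvgcP => e e0; have [d d0 dP] := cm_cont cm Z01 e0.
  by move/cvgcP : ZZ => /(_ d d0); apply: filterS => n; exact: dP.
have v0 : expi x - Z0 != 0 by rewrite subr_eq0.
have w0 : s (expi x) - s Z0 != 0 by rewrite subr_eq0.
have v20 : (expi x - Z0) ^+ 2 != 0 by rewrite expf_neq0.
have w20 : (s (expi x) - s Z0) ^+ 2 != 0 by rewrite expf_neq0.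
have cv : (fun n => expi x - Zn n) @ \oo --> expi x - Z0.
  exact: (ccvgB (@ccvg_cst _ _ _ _ _) ZZ).
have cw : (fun n => s (expi x) - s (Zn n)) @ \oo --> s (expi x) - s Z0.
  exact: (ccvgB (@ccvg_cst _ _ _ _ _) cs).
have cz2 : (fun n => 1 - cabs (Zn n) ^+ 2) @ \oo --> 1 - cabs Z0 ^+ 2.
  apply: cvgB; first exact: cvg_cst.
  exact: (cvg_sqr (cvg_cabs ZZ)).
have cv2 := ccvg_sqr (FF := eventually_filter) cv; have cw2 := ccvg_sqr (FF := eventually_filter) cw.
split.
- exact: (ccvg_div v0 (@ccvg_cst _ _ _ _ _) cv).
- exact: (ccvg_div w0 (@ccvg_cst _ _ _ _ _) cw).
- apply: (ccvgM (@ccvg_cst _ _ _ _ _)); apply: (ccvg_div w20 _ cw2).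
  exact: (ccvgB (ccvgM cw (@ccvg_cst _ _ _ _ _)) (ccvgM (ccvg_conj cw) (@ccvg_cst _ _ _ _ _))).
- apply: (ccvgM (@ccvg_cst _ _ _ _ _)); apply: ccvgD.
    exact: (ccvg_div v20 (ccvg_real cz2) cv2).
  exact: (ccvg_div v0 (ccvg_conj cv) cv).
- apply: (cvgM cz2); apply: cvgV; first by rewrite expf_neq0// cabs_eq0.
  exact: (cvg_sqr (cvg_cabs cv)).
Qed.

End BoundaryKernelBounds.

(** * Limits of integrals whose integrands are singular at one point *)

Section ConcentratedLimit.
Variable R : realType.
Local Notation C := R[i].
Local Notation mu := (@lebesgue_measure R).
Local Notation I := (`[0, 2 * pi]%classic : set R).

Lemma countable_setU (A B : set R) : countable A -> countable B -> countable (A `|` B).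
Proof.
by move=> cA cB; rewrite -bigcup2E; apply: bigcup_countable => // -[|[|n]].
Qed.

Lemma cintegrable_setD_countable (A N : set R) (f : R -> C) : measurable A -> countable N ->
  cmeasurable A f -> cintegrable (A `\` N) f -> cintegrable A f.
Proof.
move=> mA cN mf [_ fin]; split => //.
rewrite -(@ge0_integral_setD_countable R A N)//.
- exact: cmeasurable_cabsE.
- by move=> x _; rewrite lee_fin cabs_ge0.
Qed.

(** Vitali's theorem with a short arc around [Z0] as the exceptional set: domination is needed only
    away from [Z0], and near [Z0] only uniformly small mass. *)
Lemma concentrated_limit (Z0 : C) (N : set R) (F : nat -> R -> C) (F0 : R -> C) :
  countable N -> (forall n, cont_off N (F n)) -> cont_off N F0 ->
  (forall x, ~ N x -> F n x @[n --> \oo] --> F0 x) ->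
  (forall e : R, 0 < e -> exists (G : R -> R) (n0 : nat), mu.-integrable I (EFin \o G) /\
     forall n x, (n0 <= n)%N -> ~ N x -> e <= cabs (expi x - Z0) -> cabs (F n x) <= G x) ->
  (forall e : R, 0 < e -> exists (d : R) (n0 : nat), 0 < d /\ forall n, (n0 <= n)%N ->
     (\int[mu]_(x in (I `\` N) `&` [set x | (cabs (expi x - Z0) < d)%R]) (cabs (F n x))%:E <= e%:E)%E) ->
  cintegrable I F0 /\ cintegral I (F n) @[n --> \oo] --> cintegral I F0.
Proof.
move=> cN cF cF0 pt far near.
have mI : measurable I by exact: measurable_itv.
have mIN : measurable (I `\` N) by apply: measurableD => //; exact: countable_measurable.
have mF n : cmeasurable I (F n) by apply: cmeasurableS (cont_off_cmeasurable cN (cF n)).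
have mF0 : cmeasurable I F0 by apply: cmeasurableS (cont_off_cmeasurable cN cF0).
have sub (h : R -> C) : cmeasurable I h -> cmeasurable (I `\` N) h.
  by move=> mh; apply: cmeasurableS mh => //; exact: subDsetl.
have [|i0 l0] := @vitali_cvg_cintegral R (I `\` N) F F0 mIN (fun n => sub _ (mF n)) (sub _ mF0)
    (fun x xA => pt x xA.2).
  move=> e e0; have [d [n1 [d0 nearP]]] := near e e0.
  have [G [n2 [iG GP]]] := far d d0.
  have mB : measurable [set x : R | cabs (expi x - Z0) < d].
    have -> : [set x : R | cabs (expi x - Z0) < d] =
        setT `&` (fun x => cabs (expi x - Z0)) @^-1` `]-oo, d[%classic.
      by rewrite setTI; apply/seteqP; split => x; rewrite /= in_itv.
    exact: (measurable_dist_expi Z0).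
  exists [set x | cabs (expi x - Z0) < d], G, (maxn n1 n2); split => //.
  - by apply: integrableS iG => //; [exact: measurableD|move=> x [[]]].
  - by move=> n; rewrite geq_max => /andP[h _]; exact: nearP.
  - move=> n x; rewrite geq_max => /andP[_ h] [_ Nx] Bx; apply: GP => //.
    by rewrite leNgt; apply/negP.
split; first exact: cintegrable_setD_countable i0.
rewrite -(cintegral_setD_countable mI cN mF0).
by under eq_fun do rewrite -(cintegral_setD_countable mI cN (mF _)).
Qed.

End ConcentratedLimit.

(** * Boundary values of the integrals at a regular point *)

Section BoundaryLimits.
Variables (R : realType) (m : nat) (X : 'I_m -> R[i]) (beta gamma : 'I_m -> R).
Variables (s s1 : R[i] -> R[i]) (psi : R[i] -> R).
Local Notation C := R[i].
Local Notation mu := (@lebesgue_measure R).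
Local Notation I := (`[0, 2 * pi]%classic : set R).
Hypothesis Xinj : injective X.
Hypothesis cm : corner_map X beta s s1.
Hypothesis gamma_bd : forall j, 0 < gamma j < 1 /\ gamma j < beta j + 1.
Hypothesis pd : density X gamma psi.
Variables (Z0 : C) (Zn : nat -> C).
Hypothesis CX0 : (circle `\` range X) Z0.
Hypothesis Znd : forall n, disc (Zn n).
Hypothesis ZnZ0 : Zn n @[n --> \oo] --> Z0.

Let XC : forall j, circle (X j) := cm_circle cm.
Let f (x : R) : C := (psi (expi x))%:C.
(** The Dini bounds divide by the distance to the projection of [Zn n], so the angles of all these
    projections are excluded as well; the set stays countable. *)
Let N : set R := corner_args X `|` [set x | expi x = Z0] `|`
  \bigcup_n [set x | expi x = unit_part (Zn n)].

Let cN : countable N.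
Proof.
rewrite /N; apply: countable_setU; last by apply: bigcup_countable => // n _; exact: countable_expi_fiber.
by apply: countable_setU; [exact: countable_corner_args|exact: countable_expi_fiber].
Qed.

Let NX : corner_args X `<=` N. Proof. by move=> x Xx; left; left. Qed.
Let NZ x : ~ N x -> expi x != Z0.
Proof. by move=> Nx; apply/eqP => e; apply: Nx; left; right. Qed.
Let NT n x : ~ N x -> expi x != unit_part (Zn n).
Proof. by move=> Nx; apply/eqP => e; apply: Nx; right; exists n. Qed.
Let NZn n x : expi x != Zn n.
Proof. by apply/eqP => e; have := cabs_expi x; rewrite e => h; have := Znd n; rewrite /disc/= h ltxx. Qed.
Let NsZ x : ~ N x -> s (expi x) != s Z0.
Proof.
move=> /NZ/eqP h; apply/eqP => e; apply: h.
exact: (map_inj_cdisc cm (circle_cdisc (circle_expi x)) (circle_cdisc CX0.1) e).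
Qed.
Let NsZn n x : s (expi x) != s (Zn n).
Proof.
apply/eqP => e; move/eqP: (NZn n x); apply.
exact: (map_inj_cdisc cm (circle_cdisc (circle_expi x)) (disc_cdisc (Znd n)) e).
Qed.

Let cf : cont_off N f.
Proof. by move=> x Nx; apply: (cont_off_density pd) => /NX. Qed.

Let contZ0 := map_kernels_cont cm NX NZ NsZ.
Let contZn n := map_kernels_cont cm NX (fun x _ => NZn n x) (fun x _ => NsZn n x).

Let cont_offM (g h : R -> C) : cont_off N g -> cont_off N h -> cont_off N (fun x => g x * h x).
Proof. by move=> cg ch x Nx; exact: (ccontinuousM (cg x Nx) (ch x Nx)). Qed.
Let cont_offB (g h : R -> C) : cont_off N g -> cont_off N h -> cont_off N (fun x => g x - h x).
Proof. by move=> cg ch x Nx; exact: (ccontinuousB (cg x Nx) (ch x Nx)). Qed.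

Let near_Z0 d : 0 < d -> exists n0 : nat, forall n, (n0 <= n)%N -> cabs (Zn n - Z0) < d.
Proof. by move=> d0; move/cvgcP : ZnZ0 => /(_ d d0)[n0 _ h]; exists n0. Qed.

Let psi_local : exists M d : R, [/\ 0 < M, 0 < d & forall x, cabs (expi x - Z0) < d ->
  `|psi (expi x)| <= M].
Proof.
have [d d0 dP] := den_cont pd CX0 ltr01.
have [d' d'0 d'P] := near_notin_corner CX0.2.
exists (`|psi Z0| + 1), (Num.min d d'); split; first by rewrite ltr_wpDl.
  by rewrite lt_min d0.
move=> x; rewrite lt_min => /andP[h1 h2].
have := dP (expi x) (conj (circle_expi x) (d'P _ h2)) h1.
have := lerB_dist (psi (expi x)) (psi Z0); lra.
Qed.

(** The bound near [Z0] is a Dini quotient centred at the moving point [unit_part (Zn n)]. Its mass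
    on a short arc is small uniformly in the centre by [integral_modulus_near_le], so nothing
    concentrates at [Z0]. *)
Let dini_limit (k : R -> C -> C) : (forall n, cont_off N (k^~ (Zn n))) -> cont_off N (k^~ Z0) ->
  (forall x, ~ N x -> k x (Zn n) @[n --> \oo] --> k x Z0) ->
  (forall e, 0 < e -> exists K d : R, 0 < d /\ forall Z x, cdisc Z -> cabs (Z - Z0) < d ->
    e <= cabs (expi x - Z0) -> cabs (k x Z) <= K * (1 + cabs (s1 (expi x)))) ->
  (exists (omega : R -> R) (K d : R), [/\ modulus omega, dini omega, 0 <= K, 0 < d <= 1 / 2 &
    forall Z x, cdisc Z -> cabs (Z - Z0) <= d -> cabs (expi x - Z0) <= d ->
      expi x != Z -> expi x != unit_part Z ->
      cabs (k x Z) <= K * (omega (cabs (expi x - unit_part Z)) / cabs (expi x - unit_part Z))]) ->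
  cintegrable I (fun x => f x * k x Z0) /\
  cintegral I (fun x => f x * k x (Zn n)) @[n --> \oo] --> cintegral I (fun x => f x * k x Z0).
Proof.
move=> ckn ck0 pt far [om [K [d [mom dom K0 /andP[d0 dh] near]]]].
apply: (concentrated_limit (Z0 := Z0) cN).
- by move=> n; exact: (cont_offM cf (ckn n)).
- exact: (cont_offM cf ck0).
- by move=> x Nx; apply: (ccvgM (@ccvg_cst _ _ _ _ _)); exact: pt.
- move=> e e0; have [K' [d' [d'0 farP]]] := far e e0.
  have [n0 n0P] := near_Z0 d'0.
  have [G iG GP] := density_dominated Xinj cm gamma_bd pd.
  exists (fun x => `|K'| * G x), n0; split.
    rewrite (_ : _ \o _ = (fun x => `|K'|%:E * (G x)%:E)%E)//.
    exact: integrableZl.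
  move=> n x n0n Nx ex; rewrite cabsM cabs_real.
  have := farP _ _ (disc_cdisc (Znd n)) (n0P n n0n) ex.
  have := GP x (fun h => Nx (NX h)); set a := 1 + _; set b := cabs _; set p := `|psi _| => h1 h2.
  have a0 : 0 <= a by rewrite addr_ge0 ?cabs_ge0.
  apply: (@le_trans _ _ (p * (`|K'| * a))).
    apply: ler_wpM2l; rewrite /p ?normr_ge0//; apply: (le_trans h2).
    by apply: ler_wpM2r => //; exact: ler_norm.
  by rewrite mulrCA; apply: ler_wpM2l.
- move=> e e0; have [M [d1 [M0 d10 MP]]] := psi_local.
  have e' : 0 < e / (6 * (M * K + 1)).
    by rewrite divr_gt0// mulr_gt0// ltr_wpDl// mulr_ge0// ltW.
  have [dt /andP[dt0 dt1] dtP] := dini_tail mom dom e'.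
  (* Points within [eta] of [Z0] are within [2 * eta] of the projection; the integral estimate then
     extends to [3 * (2 * eta)], which is at most [dt]. *)
  pose eta := Num.min (Num.min d d1) (dt / 6).
  have [h1 h2 h3] : [/\ eta <= d, eta <= d1 & eta <= dt / 6].
    by rewrite /eta !ge_min !lexx ?orbT.
  have eta0 : 0 < eta by rewrite /eta !lt_min d0 d10 divr_gt0.
  have eta2 : 0 < eta / 2 by rewrite divr_gt0.
  have [n0 n0P] := near_Z0 eta2.
  exists eta, n0; split => // n n0n.
  have Zd := n0P n n0n.
  have [T1 ZE r01 rZ TZ0] := unit_partP (disc_cdisc (Znd n)) CX0.1 (ltac:(lra)).
  set T := unit_part (Zn n) in T1 ZE TZ0 *.
  have eta2' : 0 < 2 * eta by rewrite mulr_gt0.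
  have mI : measurable I by exact: measurable_itv.
  have mnE : measurable_fun I (fun x => ((M * K) * modulus_near om (2 * eta) T x)%:E).
    apply: measurable_funTS; apply/measurable_EFinP; apply: measurable_funM => //.
    by apply/measurable_EFinP; exact: measurable_modulus_near.
  have mB : measurable [set x : R | cabs (expi x - Z0) < eta].
    have -> : [set x : R | cabs (expi x - Z0) < eta] =
        setT `&` (fun x => cabs (expi x - Z0)) @^-1` `]-oo, eta[%classic.
      by rewrite setTI; apply/seteqP; split => x; rewrite /= in_itv.
    exact: (measurable_dist_expi Z0).
  have mA : measurable ((I `\` N) `&` [set x | cabs (expi x - Z0) < eta]).
    by apply: measurableI => //; apply: measurableD => //; exact: countable_measurable.
  have AI : (I `\` N) `&` [set x | cabs (expi x - Z0) < eta] `<=` I by move=> x [[]].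
  have MK0 : 0 <= M * K by rewrite mulr_ge0// ltW.
  have mn0 x : 0 <= M * K * modulus_near om (2 * eta) T x.
    by rewrite mulr_ge0// modulus_near_ge0.
  apply: (@le_trans _ _ (\int[mu]_(x in I) ((M * K) * modulus_near om (2 * eta) T x)%:E)%E).
    apply: (@le_trans _ _ (\int[mu]_(x in (I `\` N) `&` [set x | (cabs (expi x - Z0) < eta)%R])
       ((M * K) * modulus_near om (2 * eta) T x)%:E)%E).
      apply: ge0_le_integral => //.
      - by move=> x _; rewrite lee_fin cabs_ge0.
      - apply: cmeasurable_cabsE; apply: cmeasurableS (cont_off_cmeasurable cN (cont_offM cf (ckn n))) => //.
      - exact: measurable_funS mnE.
      move=> x [[_ Nx] /= xe]; rewrite lee_fin cabsM cabs_real -mulrA.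
      apply: ler_pM; rewrite ?cabs_ge0//; first by apply: MP; lra.
      have := near (Zn n) x (disc_cdisc (Znd n)) (ltac:(lra)) (ltac:(lra)) (NZn n x) (NT n Nx).
      move/le_trans; apply; apply: ler_wpM2l => //.
      have ST := cabs_dist_triangle Z0 (expi x) T; rewrite [cabs (Z0 - T)]cabsB in ST.
      have ST0 : 0 < cabs (expi x - T) by rewrite cabs_gt0 subr_eq0; exact: NT.
      by rewrite /modulus_near ifT; [rewrite /modulus_ext ST0|rewrite /=; lra].
    by apply: ge0_subset_integral => // x _; rewrite lee_fin.
  under eq_integral do rewrite EFinM.
  rewrite ge0_integralZl//; last 2 first.
    by apply: measurable_funTS; exact: measurable_modulus_near.
    by move=> x _; rewrite lee_fin modulus_near_ge0.
  have key := integral_modulus_near_le mom T1 eta2'.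
  apply: (@le_trans _ _ ((M * K)%:E * (6%:E * (e / (6 * (M * K + 1)))%:E))%E).
    rewrite lee_wpmul2l// ?lee_fin//; apply: (le_trans key).
    rewrite lee_wpmul2l// ?lee_fin//; apply: le_trans dtP.
    apply: ge0_subset_integral => //.
    - by apply: measurable_funTS; exact: measurable_modulus_quot.
    - by move=> x _; rewrite lee_fin modulus_ext_quot_ge0.
    - by apply: subset_itvl; rewrite bnd_simp; lra.
  rewrite -!EFinM lee_fin.
  have q : 0 < M * K + 1 by rewrite ltr_wpDl.
  rewrite (_ : M * K * _ = e * (M * K / (M * K + 1))); last by field; rewrite gt_eqF.
  by rewrite ler_piMr ?(ltW e0)// ler_pdivrMr// mul1r lerDl.
Qed.

Lemma map_k1_limit :
  cintegrable I (fun x => f x * (map_k1 s s1 x Z0 - cauchy_k x Z0)) /\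
  cintegral I (fun x => f x * (map_k1 s s1 x (Zn n) - cauchy_k x (Zn n))) @[n --> \oo] -->
  cintegral I (fun x => f x * (map_k1 s s1 x Z0 - cauchy_k x Z0)).
Proof.
apply: (dini_limit (k := fun x Z => map_k1 s s1 x Z - cauchy_k x Z)).
- by move=> n; have [c1 c2 _ _] := contZn n; exact: (cont_offB c2 c1).
- by have [c1 c2 _ _] := contZ0; exact: (cont_offB c2 c1).
- move=> x Nx; have [c1 c2 _ _ _] := cvg_kernels cm (circle_cdisc CX0.1)
    (fun n => disc_cdisc (Znd n)) ZnZ0 (NZ Nx).
  exact: (ccvgB c2 c1).
- move=> e e0; have [K [d [K0 d0 P]]] := map_kernels_far cm CX0.1 e0.
  exists K, d; split => // Z x Z1 Zd xe.
  have [_ [h1 h2 _ _ _]] := P Z x Z1 Zd xe.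
  by apply: le_trans (ler_cabsB _ _) _; rewrite mulrDr mulr1 addrC lerD.
- have [om [K [d [a b c e P]]]] := map_kernels_near cm CX0; exists om, K, d; split => //.
  by move=> Z x *; have [] := P Z x.
Qed.

Let map_k2_sub_limit :
  cintegrable I (fun x => f x * (map_k2 s s1 x Z0 - main_k2 s1 x Z0)) /\
  cintegral I (fun x => f x * (map_k2 s s1 x (Zn n) - main_k2 s1 x (Zn n))) @[n --> \oo] -->
  cintegral I (fun x => f x * (map_k2 s s1 x Z0 - main_k2 s1 x Z0)).
Proof.
apply: (dini_limit (k := fun x Z => map_k2 s s1 x Z - main_k2 s1 x Z)).
- by move=> n; have [_ _ c1 c2] := contZn n; exact: (cont_offB c1 (main_k2_cont cm NX c2)).
- by have [_ _ c1 c2] := contZ0; exact: (cont_offB c1 (main_k2_cont cm NX c2)).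
- move=> x Nx; have [_ _ c1 c2 _] := cvg_kernels cm (circle_cdisc CX0.1)
    (fun n => disc_cdisc (Znd n)) ZnZ0 (NZ Nx).
  exact: (ccvgB c1 (ccvgM (@ccvg_cst _ _ _ _ _) c2)).
- move=> e e0; have [K [d [K0 d0 P]]] := map_kernels_far cm CX0.1 e0.
  exists (K + 1), d; split => // Z x Z1 Zd xe.
  have [SZ [_ _ h1 h2 _]] := P Z x Z1 Zd xe.
  apply: le_trans (ler_cabsB _ _) _.
  have h3 := cabs_main_k2_le s1 Z1 SZ.
  have h4 := cabs_ge0 (s1 (expi x)).
  apply: (@le_trans _ _ (K * cabs (s1 (expi x)) + (K + 1))); first by apply: lerD => //; lra.
  by rewrite mulrDr mulr1 addrC lerD2l ler_wpM2r//; lra.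
- have [om [K [d [a b c e P]]]] := map_kernels_near cm CX0; exists om, K, d; split => //.
  by move=> Z x *; have [] := P Z x.
Qed.

(** An approximate identity argument. The kernel is dominated by [poisson + 1] and has the constant
    integral [L]. After subtracting the boundary value [g0], the factor [g - g0] is small where the
    kernel may concentrate; the subtracted part contributes [g0 * L]. *)
Let main_limit (k : R -> C -> C) (g : R -> C) (g0 L : C) :
  (forall n, cont_off N (k^~ (Zn n))) -> cont_off N (k^~ Z0) -> cont_off N g ->
  (forall x, ~ N x -> k x (Zn n) @[n --> \oo] --> k x Z0) ->
  (forall n x, cabs (k x (Zn n)) <= poisson (Zn n) x + 1) ->
  (forall e, 0 < e -> exists K d : R, 0 < d /\ forall Z x, cdisc Z -> cabs (Z - Z0) < d ->
    e <= cabs (expi x - Z0) -> cabs (k x Z) <= K) ->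
  (forall x, ~ N x -> cabs (g x) <= `|psi (expi x)|) ->
  (forall e, 0 < e -> exists2 d : R, 0 < d &
     forall x, ~ N x -> cabs (expi x - Z0) < d -> cabs (g x - g0) <= e) ->
  (forall n, cintegral I (k^~ (Zn n)) = L) ->
  (forall n, cintegrable I (fun x => g x * k x (Zn n))) ->
  cintegrable I (fun x => (g x - g0) * k x Z0) /\
  cintegral I (fun x => g x * k x (Zn n)) @[n --> \oo] -->
    cintegral I (fun x => (g x - g0) * k x Z0) + g0 * L.
Proof.
move=> ckn ck0 cg pt kP far gpsi gnear kL gki.
have mI : measurable I by exact: measurable_itv.
have cgg0 : cont_off N (fun x => g x - g0).
  by apply: (cont_offB (h := fun=> g0) cg) => x _; exact: ccontinuous_cst.
have mP n : measurable_fun I (poisson (Zn n)).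
  apply: measurable_funTS; apply: continuous_measurable_fun.
  by apply: poisson_continuous; exact: Znd.
have iP n : mu.-integrable I (EFin \o (fun x => poisson (Zn n) x + 1)).
  apply: continuous_compact_integrable; first exact: segment_compact.
  apply: continuous_subspaceT => x; apply: cvgD; last exact: cvg_cst.
  exact: (poisson_continuous (Znd n)).
have ki n : cintegrable I (k^~ (Zn n)).
  apply: (cintegrable_dom mI _ (iP n)) => //.
  by apply: cmeasurableS (cont_off_cmeasurable cN (ckn n)).
have kgi n : cintegrable I (fun x => g0 * k x (Zn n)) by exact: cintegrableZ.
have E n : cintegral I (fun x => g x * k x (Zn n)) =
    cintegral I (fun x => (g x - g0) * k x (Zn n)) + g0 * L.
  rewrite -(kL n) -cintegralZ// -cintegralD//.
    by apply: eq_cintegral => x _; rewrite -mulrDl subrK.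
  rewrite (_ : (fun x => _) = (fun x => g x * k x (Zn n) - g0 * k x (Zn n))).
    by apply: cintegrableB.
  by apply/funext => x; rewrite mulrBl.
have [i0 l0] : cintegrable I (fun x => (g x - g0) * k x Z0) /\
    cintegral I (fun x => (g x - g0) * k x (Zn n)) @[n --> \oo] -->
    cintegral I (fun x => (g x - g0) * k x Z0).
  apply: (concentrated_limit (Z0 := Z0) cN).
  - by move=> n; exact: (cont_offM cgg0 (ckn n)).
  - exact: (cont_offM cgg0 ck0).
  - by move=> x Nx; apply: (ccvgM (@ccvg_cst _ _ _ _ _)); exact: pt.
  - move=> e e0; have [K [d [d0 farP]]] := far e e0.
    have [n0 n0P] := near_Z0 d0.
    have [G iG GP] := density_dominated Xinj cm gamma_bd pd.
    exists (fun x => `|K| * (G x + cabs g0)), n0; split.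
      rewrite (_ : _ \o _ = (fun x => `|K|%:E * ((G x)%:E + (cabs g0)%:E))%E)//.
      apply: integrableZl => //; apply: integrableD => //.
      apply/integrableP; split => //=.
      rewrite (_ : (fun=> _) = cst (`|cabs g0|)%:E)// integral_cst//= lebesgue_measure_itv/=.
      by case: ifP => _; rewrite ?ltry// -EFinB -EFinM ltry.
    move=> n x n0n Nx ex; rewrite cabsM mulrC.
    apply: ler_pM; rewrite ?cabs_ge0//.
      exact: le_trans (farP _ _ (disc_cdisc (Znd n)) (n0P n n0n) ex) (ler_norm _).
    apply: le_trans (ler_cabsB _ _) _; apply: lerD => //.
    apply: le_trans (gpsi x Nx) _; apply: le_trans (GP x (fun h => Nx (NX h))).
    by rewrite ler_peMr// lerDl cabs_ge0.
  - move=> e e0; have p0 : 0 < 4 * pi :> R by rewrite mulr_gt0// pi_gt0.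
    (* [4 * pi] is the total mass of [poisson + 1] over a period. *)
    have e' : 0 < e / (4 * pi) by rewrite divr_gt0.
    have [d d0 dP] := gnear _ e'.
    exists d, 0%N; split => // n _.
    have mB : measurable [set x : R | cabs (expi x - Z0) < d].
      have -> : [set x : R | cabs (expi x - Z0) < d] =
          setT `&` (fun x => cabs (expi x - Z0)) @^-1` `]-oo, d[%classic.
        by rewrite setTI; apply/seteqP; split => x; rewrite /= in_itv.
      exact: (measurable_dist_expi Z0).
    have mA : measurable ((I `\` N) `&` [set x | cabs (expi x - Z0) < d]).
      by apply: measurableI => //; apply: measurableD => //; exact: countable_measurable.
    have AI : (I `\` N) `&` [set x | cabs (expi x - Z0) < d] `<=` I by move=> x [[]].
    have mPE1 : measurable_fun I (fun x => (poisson (Zn n) x + 1)%:E).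
      by apply/measurable_EFinP; apply: measurable_funD.
    have mPE : measurable_fun I (fun x => (poisson (Zn n) x)%:E) by exact/measurable_EFinP.
    have mP1 : measurable_fun I (fun x => (e / (4 * pi))%:E * (poisson (Zn n) x + 1)%:E)%E.
      by apply: emeasurable_funM => //; apply/measurable_EFinP; apply: measurable_funD.
    have P1 x : 0 <= poisson (Zn n) x + 1.
      by rewrite addr_ge0 ?(poisson_ge0 _ (ltW (Znd n))).
    have P1' x : (0 <= (poisson (Zn n) x + 1)%:E)%E by rewrite lee_fin.
    have P2 x : (0 <= (e / (4 * pi))%:E * (poisson (Zn n) x + 1)%:E)%E.
      by rewrite mule_ge0// lee_fin ?(ltW e').
    apply: (@le_trans _ _ (\int[mu]_(x in I) ((e / (4 * pi))%:E * (poisson (Zn n) x + 1)%:E))%E).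
      apply: (@le_trans _ _ (\int[mu]_(x in (I `\` N) `&` [set x | (cabs (expi x - Z0) < d)%R])
        ((e / (4 * pi))%:E * (poisson (Zn n) x + 1)%:E))%E).
        apply: ge0_le_integral => //.
        - by move=> x _; rewrite lee_fin cabs_ge0.
        - apply: cmeasurable_cabsE.
          by apply: cmeasurableS (cont_off_cmeasurable cN (cont_offM cgg0 (ckn n))).
        - exact: measurable_funS mP1.
        move=> x [[_ Nx] /= xd]; rewrite -EFinM lee_fin cabsM.
        by apply: ler_pM; rewrite ?cabs_ge0//; exact: dP.
      by apply: ge0_subset_integral.
    rewrite (@ge0_integralZl _ (measurableTypeR R) R mu I mI _ mPE1 _ (fun x _ => P1' x)); last first.
      by rewrite lee_fin ltW.
    under eq_integral do rewrite EFinD.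
    rewrite ge0_integralD//; try exact: mPE; try by move=> x _; rewrite lee_fin (poisson_ge0 _ (ltW (Znd n))).
    rewrite integral_poisson; last exact: Znd.
    have p2 : 0 < 2 * pi :> R by rewrite mulr_gt0// pi_gt0.
    rewrite integral_cst//= mul1e lebesgue_measure_itv/= lte_fin p2 sube0 -EFinD -EFinM lee_fin.
    by rewrite -mulrDl -natrD divfK// gt_eqF.
split; first exact: i0.
rewrite (_ : (fun n => cintegral I _) = (fun n => cintegral I (fun x => (g x - g0) * k x (Zn n)) + g0 * L)).
  exact: (ccvgD l0 (@ccvg_cst _ _ _ _ _)).
by apply/funext.
Qed.

Let realdist (a b : R) : cabs (a%:C - b%:C : C) = `|a - b|.
Proof. by rewrite -realcB cabs_real. Qed.

(** For a real density $2\,\mathrm{Re}\frac{S}{S-Z}=P+1$, so the real part is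
    $(4\pi)^{-1}\int\psi(P+1)\,dx$. The Poisson part yields the jump $\psi(Z_0)/2$ and the constant
    1 yields the mean term. *)
Lemma cauchy_limit :
  Re ((2 * pi%:C * 'i)^-1 * cintegral I (fun x => f x * cauchy_k x (Zn n))) @[n --> \oo] -->
  psi Z0 / 2 + (4 * pi)^-1 * (\int[mu]_(x in I) psi (expi x))%R.
Proof.
have mI : measurable I by exact: measurable_itv.
have ic n : cintegrable I (fun x => f x * cauchy_k x (Zn n)).
  by have [h _ _ _] := interior_integrable Xinj cm gamma_bd pd (Znd n).
have fi : cintegrable I f by exact: (density_integrable Xinj cm gamma_bd pd).
have pn : pi != 0 :> R by rewrite gt_eqF// pi_gt0.
have alg1 (q a : R) : q != 0 -> a / 2 = (4 * q)^-1 * (a * (2 * q)) by move=> q0; field.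
have alg2 (q a b : R) : q != 0 -> (2 * q)^-1 * a = (4 * q)^-1 * (2 * a - b + b).
  by move=> q0; field.
have PE n x : (poisson (Zn n) x)%:C = - 'i * cauchy_k x (Zn n) + conjc (- 'i * cauchy_k x (Zn n)) - 1 :> C.
  have -> : - 'i * cauchy_k x (Zn n) = expi x / (expi x - Zn n).
    by rewrite /cauchy_k !mulrA mulNr -expr2 sqr_i opprK mul1r.
  rewrite poisson_Re; last exact: NZn.
  by move: (expi x / _) => [a b]; apply: eq_complexP => /=; ring.
pose P n := fun x => f x * (poisson (Zn n) x)%:C.
have iP n : cintegrable I (P n).
  have i1 : cintegrable I (fun x => - 'i * (f x * cauchy_k x (Zn n))) by exact: cintegrableZ.
  have i2 : cintegrable I (fun x => conjc (- 'i * (f x * cauchy_k x (Zn n)))).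
    have [mi yi] := i1; split; first exact: cmeasurable_conj.
    by under eq_integral do rewrite cabsJ.
  rewrite (_ : P n = (fun x => - 'i * (f x * cauchy_k x (Zn n)) +
      conjc (- 'i * (f x * cauchy_k x (Zn n))) - f x)).
    exact: (cintegrableB mI (cintegrableD mI i1 i2) fi).
  apply/funext => x; rewrite /P PE; set c := cauchy_k _ _; rewrite !conjcM.
  have -> : conjc (f x) = f x by rewrite /f conjc_real.
  by ring.
(* The value given for [g0] is just [psi Z0]; its null summand is removed by [mulr0] and [add0r]
   below. *)
have [||||||||||_ lim] := @main_limit (fun x Z => (poisson Z x)%:C) f (f 0 * 0 + (psi Z0)%:C) (2 * pi)%:C.
- move=> n x Nx; apply: ccontinuous_real; exact: (poisson_continuous (Znd n)).
- rewrite (_ : (fun x => _) = fun=> 0) => [x _|]; first exact: ccontinuous_cst.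
  by apply/funext => x; rewrite poisson_circle//; exact: CX0.1.
- exact: cf.
- move=> x Nx; apply: ccvg_real.
  by have [_ _ _ _ ] := cvg_kernels cm (circle_cdisc CX0.1) (fun n => disc_cdisc (Znd n)) ZnZ0 (NZ Nx).
- by move=> n x; rewrite cabs_real ger0_norm ?lerDl// poisson_ge0// ltW//; exact: Znd.
- move=> e e0; have [K [d [K0 d0 Pb]]] := map_kernels_far cm CX0.1 e0.
  exists K, d; split => // Z x Z1 Zd xe; have [_ [_ _ _ h _]] := Pb Z x Z1 Zd xe.
  by rewrite cabs_real ger0_norm// poisson_ge0.
- by move=> x _; rewrite cabs_real.
- move=> e e0; have [d d0 dP] := den_cont pd CX0 e0.
  exists d => // x Nx xd; rewrite mulr0 add0r realdist ltW//; apply: dP => //.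
  by apply: corner_args_circle => /NX.
- move=> n; have := integral_poisson (Znd n) => h.
  apply: eq_complexP => /=; rewrite /Rintegral; first by rewrite h.
  by rewrite integral0.
- exact: iP.
rewrite mulr0 add0r in lim.
(* The Poisson kernel vanishes on the circle, so only the jump [g0 * L] survives. *)
rewrite (_ : cintegral I _ = 0) ?add0r in lim; last first.
  rewrite (@eq_cintegral _ _ _ (fun=> 0)).
    by apply: eq_complexP => /=; rewrite /Rintegral integral0.
  by move=> x _; rewrite poisson_circle ?mulr0//; exact: CX0.1.
have lim' : Re (cintegral I (P n)) @[n --> \oo] --> psi Z0 * (2 * pi).
  have /cvg_ReImP[h _] := lim; suff -> : psi Z0 * (2 * pi) = Re ((psi Z0)%:C * (2 * pi)%:C) by [].
  by rewrite -realcM.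
rewrite (_ : (fun n => Re _) = (fun n => (4 * pi)^-1 * Re (cintegral I (P n)) +
    (4 * pi)^-1 * (\int[mu]_(x in I) psi (expi x))%R)).
  apply: cvgD; last exact: cvg_cst.
  rewrite (_ : psi Z0 / 2 = (4 * pi)^-1 * (psi Z0 * (2 * pi))).
    by apply: cvgM; [exact: cvg_cst|exact: lim'].
  exact: alg1.
apply/funext => n.
have -> : cintegral I (fun x => f x * cauchy_k x (Zn n)) =
    'i * cintegral I (fun x => - 'i * (f x * cauchy_k x (Zn n))).
  by rewrite cintegralZ// mulrA mulrN -expr2 sqr_i opprK mul1r.
set h := fun x => - 'i * _.
have ih : cintegrable I h by exact: cintegrableZ.
have -> : (2 * pi%:C * 'i)^-1 * ('i * cintegral I h) = ((2 * pi)^-1)%:C * cintegral I h.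
  rewrite realcV realcM -(rmorph_nat (real_complex R) 2) mulrA; congr (_ * _).
  rewrite invfM -mulrA mulVf ?mulr1//; by rewrite -cabs_gt0 cabs_i.
have -> : Re (((2 * pi)^-1)%:C * cintegral I h) = (2 * pi)^-1 * Re (cintegral I h).
  by rewrite ReM /= mul0r subr0.
rewrite -mulrDr.
have -> : Re (cintegral I (P n)) = 2 * Re (cintegral I h) - (\int[mu]_(x in I) psi (expi x))%R.
  have i2 : cintegrable I (fun x => conjc (h x)).
    have [mi yi] := ih; split; first exact: cmeasurable_conj.
    by under eq_integral do rewrite cabsJ.
  rewrite (_ : P n = (fun x => h x + conjc (h x) - f x)); last first.
    apply/funext => x; rewrite /P PE /h; set c := cauchy_k _ _; rewrite !conjcM.
    have -> : conjc (f x) = f x by rewrite /f conjc_real.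
    by ring.
  rewrite (cintegralB mI (cintegrableD mI ih i2) fi) (cintegralD mI ih i2).
  rewrite ReB ReD (_ : Re (cintegral I (fun x => conjc (h x))) = Re (cintegral I h)).
    by rewrite /=; ring.
  by rewrite /=; apply: eq_Rintegral => x _; case: (h x).
exact: alg2.
Qed.

(** The coefficient $\overline{\sigma'}/\sigma'$ is continuous at [Z0] and joins the density in [q].
    Since [dconj_kernel] has integral zero, [main_limit] applies with [L = 0] and there is no
    jump. *)
Let main_k2_limit :
  cintegrable I (fun x => f x * main_k2 s1 x Z0) /\
  cintegral I (fun x => f x * main_k2 s1 x (Zn n)) @[n --> \oo] -->
  cintegral I (fun x => f x * main_k2 s1 x Z0).
Proof.
have mI : measurable I by exact: measurable_itv.
pose q (S : C) : C := (psi S)%:C * ((4 * 'i)^-1 * (conjc (s1 S) / s1 S)).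
have E Z : (fun x => f x * main_k2 s1 x Z) = (fun x => q (expi x) * dconj_kernel Z x).
  by apply/funext => x; rewrite /q /f /main_k2 -!mulrA.
have cq : q @ within (circle `\` range X) (nbhs Z0) --> q Z0.
  have c1 : (fun S => (psi S)%:C : C) @ within (circle `\` range X) (nbhs Z0) --> (psi Z0)%:C.
    apply/cvgcP => e e0; apply/near_withinc; have [d d0 dP] := den_cont pd CX0 e0.
    by exists d => // S Sd SX; rewrite realdist; exact: dP.
  have c2 : s1 @ within (circle `\` range X) (nbhs Z0) --> s1 Z0.
    apply/cvgcP => e e0; apply/near_withinc; have [d d0 dP] := cm_deriv_cont cm CX0 e0.
    by exists d => // S Sd SX; exact: dP.
  have h : (fun S => conjc (s1 S) / s1 S) @ within (circle `\` range X) (nbhs Z0) -->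
    conjc (s1 Z0) / s1 Z0 by exact: (ccvg_div (cm_deriv_neq0 cm CX0) (ccvg_conj c2) c2).
  exact: (ccvgM c1 (ccvgM (@ccvg_cst _ _ _ _ _) h)).
have cqN : cont_off N (fun x => q (expi x)).
  have cs : cont_off N (fun x => s1 (expi x)).
    by move=> x Nx; apply: (cont_off_deriv cm) => /NX.
  move=> x Nx; have s10 : (fun y => s1 (expi y)) x != 0.
    by apply/(cm_deriv_neq0 cm)/corner_args_circle => /NX.
  exact: (ccontinuousM (cf Nx) (ccontinuousM (@ccontinuous_cst _ _ _ _)
    (ccontinuous_div s10 (ccontinuous_conj (cs x Nx)) (cs x Nx)))).
pose k' (x : R) : C := 'i * conjc Z0 * conjc (expi x).
have ik' : cintegrable I k'.
  apply: continuous_cintegrable => x.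
  exact: (ccontinuousM (@ccontinuous_cst _ _ _ _) (ccontinuous_conj (@expi_continuous R x))).
have k'0 : cintegral I k' = 0.
  have h := cintegral_expi_conjX R 0; rewrite /k' cintegralZ//; last first.
    by apply: continuous_cintegrable => x; exact: (ccontinuous_conj (@expi_continuous R x)).
  by rewrite (_ : (fun x => conjc (expi x)) = (fun x => conjc (expi x) ^+ 1))// h mulr0.
have [_ _ _ cd0] := contZ0.
have kk' x : (I `\` N) x -> dconj_kernel Z0 x = k' x.
  by move=> [_ Nx]; rewrite dconj_kernel_circle//; [exact: CX0.1|exact: NZ].
have mk : cmeasurable I (dconj_kernel Z0) by apply: cmeasurableS (cont_off_cmeasurable cN cd0).
have mIN : measurable (I `\` N) by apply: measurableD => //; exact: countable_measurable.
have ik : cintegrable I (dconj_kernel Z0).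
  apply: (cintegrable_setD_countable (N := N)) => //; split.
    by apply: cmeasurableS mk => //; exact: subDsetl.
  rewrite (_ : (\int[mu]_(x in I `\` N) _)%E = (\int[mu]_(x in I `\` N) (cabs (k' x))%:E)%E); last first.
    by apply: eq_integral => x; rewrite inE => /kk' ->.
  have [mk' fin] := ik'; apply: le_lt_trans fin; apply: ge0_subset_integral => //.
  - exact: cmeasurable_cabsE.
  - by move=> x _; rewrite lee_fin cabs_ge0.
have k0 : cintegral I (dconj_kernel Z0) = 0.
  rewrite -(cintegral_setD_countable mI cN mk) (eq_cintegral kk').
  by rewrite (cintegral_setD_countable mI cN) => //; case: ik'.
have [||||||||||i0 lim] := @main_limit (fun x Z => dconj_kernel Z x) (fun x => q (expi x)) (q Z0) 0.
- by move=> n; have [_ _ _ ] := contZn n.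
- exact: cd0.
- exact: cqN.
- move=> x Nx.
  by have [_ _ _ h _] := cvg_kernels cm (circle_cdisc CX0.1) (fun n => disc_cdisc (Znd n)) ZnZ0 (NZ Nx).
- by move=> n x; apply: cabs_dconj_kernel_le; [exact: (ltW (Znd n))|exact: NZn].
- move=> e e0; have [K [d [K0 d0 Pb]]] := map_kernels_far cm CX0.1 e0.
  by exists K, d; split => // Z x Z1 Zd xe; have [_ [_ _ _ _ h]] := Pb Z x Z1 Zd xe.
- move=> x _; rewrite /q cabsM cabs_real ler_piMr// cabsM cabs_four_iV cabs_div cabsJ.
  have [->|h] := eqVneq (cabs (s1 (expi x))) 0; first by rewrite mul0r mulr0.
  by rewrite divff// mulr1 invf_le1// ler1n.
- move=> e e0; have /cvgcP/(_ e e0)/near_withinc[d d0 dP] := cq.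
  exists d => // x Nx xd; rewrite ltW//; apply: dP => //.
  by apply: corner_args_circle => /NX.
- by move=> n; exact: cintegral_dconj_kernel (Znd n).
- by move=> n; have [_ _ _] := interior_integrable Xinj cm gamma_bd pd (Znd n); rewrite -/f E.
have iq : cintegrable I (fun x => q (expi x) * dconj_kernel Z0 x).
  rewrite (_ : (fun x => _) = (fun x => (q (expi x) - q Z0) * dconj_kernel Z0 x + q Z0 * dconj_kernel Z0 x)).
    exact: (cintegrableD mI i0 (cintegrableZ (q Z0) mI ik)).
  by apply/funext => x; rewrite -mulrDl subrK.
rewrite E; split; first exact: iq.
rewrite mulr0 addr0 in lim; under eq_fun do rewrite E.
(* On the circle too the integral of [dconj_kernel] is zero, so subtracting [q Z0] changes
   nothing. *)
suff -> : cintegral I (fun x => q (expi x) * dconj_kernel Z0 x) =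
  cintegral I (fun x => (q (expi x) - q Z0) * dconj_kernel Z0 x) by exact: lim.
rewrite [RHS](eq_cintegral (g := fun x => q (expi x) * dconj_kernel Z0 x - q Z0 * dconj_kernel Z0 x)).
  2: by move=> x _; rewrite mulrBl.
rewrite (cintegralB mI iq (cintegrableZ (q Z0) mI ik)).
by rewrite (cintegralZ (q Z0) mI ik) k0 mulr0 subr0.
Qed.

Lemma map_k2_limit :
  cintegrable I (fun x => f x * map_k2 s s1 x Z0) /\
  cintegral I (fun x => f x * map_k2 s s1 x (Zn n)) @[n --> \oo] -->
  cintegral I (fun x => f x * map_k2 s s1 x Z0).
Proof.
have mI : measurable I by exact: measurable_itv.
have [i1 l1] := map_k2_sub_limit; have [i2 l2] := main_k2_limit.
have E x Z : f x * map_k2 s s1 x Z =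
    f x * (map_k2 s s1 x Z - main_k2 s1 x Z) + f x * main_k2 s1 x Z.
  by rewrite -mulrDr subrK.
have iE : (fun x => f x * map_k2 s s1 x Z0) =
    (fun x => f x * (map_k2 s s1 x Z0 - main_k2 s1 x Z0) + f x * main_k2 s1 x Z0).
  by apply/funext => x; exact: E.
split; first by rewrite iE; exact: cintegrableD.
rewrite iE (cintegralD mI i1 i2).
rewrite (_ : (fun n => _) = (fun n =>
  cintegral I (fun x => f x * (map_k2 s s1 x (Zn n) - main_k2 s1 x (Zn n))) +
  cintegral I (fun x => f x * main_k2 s1 x (Zn n)))).
  exact: (ccvgD l1 l2).
apply/funext => n; have [_ _ a b] := interior_integrable Xinj cm gamma_bd pd (Znd n).
have i3 : cintegrable I (fun x => f x * (map_k2 s s1 x (Zn n) - main_k2 s1 x (Zn n))).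
  rewrite (_ : (fun x => _) = (fun x => f x * map_k2 s s1 x (Zn n) - f x * main_k2 s1 x (Zn n))).
    exact: (cintegrableB mI a b).
  by apply/funext => x; rewrite mulrBr.
rewrite -(cintegralD mI i3 b); apply: eq_cintegral => x _; exact: E.
Qed.

End BoundaryLimits.

(** * Total masses of nonnegative functions over the circle *)

Section MassBounds.
Variable R : realType.
Local Notation C := R[i].
Local Notation mu := (@lebesgue_measure R).
Local Notation I := (`[0, 2 * pi]%classic : set R).

Definition mass_le (h : R -> R) (B : R) : Prop :=
  [/\ measurable_fun I (fun x => (h x)%:E), forall x, 0 <= h x &
      (\int[mu]_(x in I) (h x)%:E <= B%:E)%E].

Lemma mass_leD h1 h2 B1 B2 : mass_le h1 B1 -> mass_le h2 B2 ->
  mass_le (fun x => h1 x + h2 x) (B1 + B2).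
Proof.
move=> [m1 p1 l1] [m2 p2 l2]; split.
- exact: (emeasurable_funD m1 m2).
- by move=> x; rewrite addr_ge0.
under eq_integral do rewrite EFinD.
have mI : measurable I by exact: measurable_itv.
rewrite ge0_integralD//; try by move=> x _; rewrite lee_fin.
by rewrite EFinD leeD.
Qed.

Lemma mass_leZ h B k : 0 <= k -> mass_le h B -> mass_le (fun x => k * h x) (k * B).
Proof.
move=> k0 [m p l]; split.
- exact: (emeasurable_funM (measurable_cst k%:E) m).
- by move=> x; rewrite mulr_ge0.
under eq_integral do rewrite EFinM.
have mI : measurable I by exact: measurable_itv.
rewrite ge0_integralZl//; try by move=> x _; rewrite lee_fin.
by rewrite EFinM lee_wpmul2l.
Qed.

Lemma mass_le_weak h B B' : B <= B' -> mass_le h B -> mass_le h B'.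
Proof. by move=> BB' [m p l]; split => //; rewrite (le_trans l)// lee_fin. Qed.

Lemma powR_triple_le (a x y : R) : 0 < x -> x / 3 <= y <= 3 * x ->
  y `^ a <= (3 `^ (- a) + 3 `^ a) * x `^ a.
Proof.
move=> x0 xy; have x30 : 0 < x / 3 by rewrite divr_gt0.
apply: le_trans (powR_le_endpoints a x30 xy) _; have x0' := ltW x0.
rewrite !powRM ?invr_ge0// -powR_inv1// -powRrM mulN1r.
by rewrite mulrDl [x `^ a * _]mulrC.
Qed.

(** [P] cuts off by the length of the chord, [Q] is what this implies for the arc, and [D] contains
    the arcs concerned. This form covers both short arcs and tails. *)
Lemma mass_le_dist_powR (T : C) (a : R) (P Q : R -> bool) (D : set R) (B : R) : circle T ->
  measurable_fun [set: R] P -> measurable_fun [set: R] Q -> measurable D ->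
  (forall c y, 0 < y -> y / 3 <= c <= y -> P c -> Q y) ->
  (`]0, pi]%classic `&` [set y | Q y] `<=` D) ->
  (\int[mu]_(y in D) (y `^ a)%:E <= B%:E)%E ->
  mass_le (fun x => if P (cabs (expi x - T)) then cabs (expi x - T) `^ a else 0)
    (2 * (1 + 3 `^ (- a)) * B).
Proof.
move=> T1 mP mQ mD PQ QD DB; have [t _ Tt] := circle_argP T1.
pose c := 1 + 3 `^ (- a); have c0 : 0 < c by rewrite ltr_wpDr ?powR_ge0.
pose F (u : R) := if P u then u `^ a else 0.
have F0 u : 0 <= F u by rewrite /F; case: ifP => // _; exact: powR_ge0.
have mF : measurable_fun [set: R] F.
  by apply: measurable_fun_ifT => //; exact: measurable_powR.
have mFd : measurable_fun [set: R] (fun x => (F (cabs (expi x - T)))%:E).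
  by apply/measurable_EFinP; apply: (measurableT_comp mF (measurable_dist_expi T)).
pose k (y : R) := if Q y then c * y `^ a else 0.
have k0 y : 0 <= k y by rewrite /k; case: ifP => // _; rewrite mulr_ge0 ?powR_ge0// ltW.
have mk : measurable_fun [set: R] (fun y => (k y)%:E).
  apply/measurable_EFinP; apply: measurable_fun_ifT => //.
  by apply: measurable_funM; [exact: measurable_cst|exact: measurable_powR].
split; [exact: measurable_funTS|by move=> x; exact: F0|].
apply: le_trans.
  apply: (@ge0_integral_period_le R _ (fun y => (k y)%:E) t mFd) => //.
  - by move=> x; rewrite lee_fin.
  - by move=> x; rewrite expiD2pi.
  move=> y /andP[y0 yp]; rewrite !lee_fin -Tt.
  have h (z : R) : `|z - t| = y -> F (cabs (expi z - expi t)) <= k y.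
    move=> zt.
    have c1 : cabs (expi z - expi t) <= y by rewrite -zt chord_le.
    have c2 : y / 3 <= cabs (expi z - expi t) by rewrite -zt chord_ge// zt.
    have cc : y / 3 <= cabs (expi z - expi t) <= y by rewrite c2.
    rewrite /F; case: ifPn => Pc; last exact: k0.
    by rewrite /k (PQ _ _ y0 cc Pc); exact: powR_third_le.
  split; apply: h; first by rewrite addrAC subrr add0r ger0_norm// ltW.
  by rewrite addrAC subrr add0r normrN ger0_norm// ltW.
rewrite -mulrA EFinM lee_pmul2l//.
have mDI : measurable (`]0, pi]%classic `&` [set y | Q y] : set R).
  apply: measurableI => //.
  by have := mQ measurableT [set true] Logic.I; rewrite setTI.
have mp (E : set R) : measurable_fun E (fun y : R => (c * y `^ a)%:E).
  by apply: measurable_funTS; apply/measurable_EFinP; apply: measurable_funM => //; exact: measurable_powR.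
rewrite (_ : (\int[mu]_(x in _) _)%E = (\int[mu]_(y in `]0%R, pi] `&` [set y | Q y]) (c * y `^ a)%:E)%E).
  apply: (@le_trans _ _ (\int[mu]_(y in D) (c * y `^ a)%:E)%E).
    apply: ge0_subset_integral => //; first exact: mp.
    by move=> y _; rewrite lee_fin mulr_ge0 ?powR_ge0// ltW.
  under eq_integral do rewrite EFinM.
  rewrite ge0_integralZl//; last 3 first.
  - by apply: measurable_funTS; exact: measurable_powR_EFin.
  - by move=> y _; rewrite lee_fin powR_ge0.
  - by rewrite lee_fin ltW.
  by rewrite EFinM lee_pmul2l.
rewrite [in RHS]integral_mkcondr; apply: eq_integral => y _.
rewrite patchE /k; case: (boolP (Q y)) => Qy; first by rewrite mem_set.
by rewrite memNset//=; exact/negP.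
Qed.

Lemma mass_le_near_powR (T : C) (a : R) : circle T -> -1 < a -> exists2 B : R, 0 <= B &
  forall r : R, 0 < r ->
  mass_le (fun x => if cabs (expi x - T) < r then cabs (expi x - T) `^ a else 0) (B * r `^ (a + 1)).
Proof.
move=> T1 a1; have a10 : 0 < a + 1 by lra.
exists (2 * (1 + 3 `^ (- a)) * (3 `^ (a + 1) / (a + 1))).
  by rewrite !mulr_ge0 ?addr_ge0 ?powR_ge0 ?invr_ge0// ltW.
move=> r r0; have r30 : 0 < 3 * r by rewrite mulr_gt0.
rewrite -[_ * r `^ _]mulrA.
apply: (@mass_le_dist_powR T a (fun c => c < r) (fun y => y <= 3 * r) `]0, 3 * r]) => //.
- by apply: measurable_fun_ltr; [exact: measurable_id|exact: measurable_cst].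
- by apply: measurable_fun_ler; [exact: measurable_id|exact: measurable_cst].
- by move=> c y y0 /andP[h1 h2] h3; lra.
- by move=> y [] /=; rewrite !in_itv/= => /andP[-> _] ->.
apply: le_trans (integral_powR_le a1 r30) _.
by rewrite powRM ?(ltW r0)// lee_fin mulrAC.
Qed.

Lemma mass_le_tail_powR (T : C) (g : R) : circle T -> 0 < g -> exists2 B : R, 0 <= B &
  forall r : R, 0 < r ->
  mass_le (fun x => if r <= cabs (expi x - T) then cabs (expi x - T) `^ (- g - 1) else 0) (B * r `^ (- g)).
Proof.
move=> T1 g0.
exists (2 * (1 + 3 `^ (- (- g - 1))) * g^-1).
  by rewrite !mulr_ge0 ?addr_ge0 ?powR_ge0 ?invr_ge0// ltW.
move=> r r0.
rewrite -[_ * r `^ _]mulrA [g^-1 * _]mulrC.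
apply: (@mass_le_dist_powR T _ (fun c => r <= c) (fun y => r <= y) `[r, pi]) => //.
- by apply: measurable_fun_ler; [exact: measurable_cst|exact: measurable_id].
- by apply: measurable_fun_ler; [exact: measurable_cst|exact: measurable_id].
- by move=> c y y0 /andP[h1 h2] h3; lra.
- by move=> y [] /=; rewrite !in_itv/= => /andP[_ ->] ->.
exact: integral_powR_tail_le.
Qed.

Lemma mass_le_poisson Z : disc Z -> mass_le (poisson Z) (2 * pi).
Proof.
move=> Z1; split; last by rewrite integral_poisson.
- apply: measurable_funTS; apply/measurable_EFinP; apply: continuous_measurable_fun.
  exact: poisson_continuous.
- by move=> x; apply: poisson_ge0; exact: ltW.
Qed.

Lemma mass_le_cst (k : R) : 0 <= k -> mass_le (fun=> k) (2 * pi * k).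
Proof.
move=> k0; have p2 : 0 < 2 * pi :> R by rewrite mulr_gt0// pi_gt0.
split => //; rewrite (_ : (fun=> _) = cst k%:E)// integral_cst//= lebesgue_measure_itv/= lte_fin p2.
by rewrite sube0 -EFinM mulrC.
Qed.

Lemma cabs_cintegral_mass (F : R -> C) (N : set R) (H : R -> R) B : countable N ->
  cmeasurable I F -> mass_le H B -> (forall x, ~ N x -> cabs (F x) <= H x) ->
  cabs (cintegral I F) <= 2 * B.
Proof.
move=> cN mF [mH H0 HB] FH; have mI : measurable I by exact: measurable_itv.
apply: cabs_cintegral_le => //; apply: le_trans HB.
rewrite -(@ge0_integral_setD_countable R I N _ mI cN (cmeasurable_cabsE mF)); last first.
  by move=> x _; rewrite lee_fin cabs_ge0.
have mIN : measurable (I `\` N) by apply: measurableD => //; exact: countable_measurable.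
have sI : I `\` N `<=` I by exact: subDsetl.
apply: (@le_trans _ _ (\int[mu]_(x in I `\` N) (H x)%:E)%E).
  apply: ge0_le_integral => //.
  - by move=> x _; rewrite lee_fin cabs_ge0.
  - by apply: cmeasurable_cabsE; exact: cmeasurableS mF.
  - exact: measurable_funS mH.
  - by move=> x [_ Nx]; rewrite lee_fin FH.
by apply: ge0_subset_integral => // x _; rewrite lee_fin.
Qed.

End MassBounds.

(** * Growth of the integrals at the corners *)

Section CornerGrowth.
Variables (R : realType) (m : nat) (X : 'I_m -> R[i]) (beta gamma : 'I_m -> R).
Variables (s s1 : R[i] -> R[i]) (psi : R[i] -> R).
Local Notation C := R[i].
Local Notation mu := (@lebesgue_measure R).
Local Notation I := (`[0, 2 * pi]%classic : set R).
Hypothesis Xinj : injective X.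
Hypothesis cm : corner_map X beta s s1.
Hypothesis gamma_bd : forall j, 0 < gamma j < 1 /\ gamma j < beta j + 1.
Hypothesis pd : density X gamma psi.
Variable j : 'I_m.
Local Notation b := (beta j).
Local Notation g := (gamma j).
Implicit Types Z T S : C.

Let XC : forall j, circle (X j) := cm_circle cm.
Let f (x : R) : C := (psi (expi x))%:C.

Let pow_mul (a c r : R) : 0 < r -> r `^ a * r `^ c = r `^ (a + c).
Proof. by move=> r0; rewrite powRD//; apply/implyP => _; rewrite gt_eqF. Qed.

(* [lra] is slow in long contexts. *)
Ltac clra := clear -Xinj cm gamma_bd pd XC f j pow_mul; lra.

(** The Cauchy kernel itself, of size $1/|S-Z|$, has no bounded mass as [Z] approaches the circle;
    only its real part is required, and that is counted by the Poisson kernel. *)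
Definition kernel_size Z x : R :=
  poisson Z x + cabs (map_k1 s s1 x Z - cauchy_k x Z) + cabs (map_k2 s s1 x Z).

Lemma density_near_corner : exists (c d : R), [/\ 0 < c, 0 < d & forall S, (circle `\` range X) S ->
  cabs (S - X j) < d -> `|psi S| <= c * cabs (S - X j) `^ (- g)].
Proof.
have [c c0 cP] := den_le pd.
have [c' c'1 [d d0 [_ near]]] := prodX_local XC Xinj (fun j => - gamma j).
have c'0 : 0 < c' by exact: lt_le_trans c'1.
exists (c * c'), d; split => //; first by rewrite mulr_gt0.
move=> S SX Sd; apply: le_trans (cP S SX) _; rewrite -mulrA ler_pM2l//.
by have [] := near S j (circle_cdisc SX.1) Sd.
Qed.

(* Kernels at distance comparable with [|S - X j| + |Z - X j|]. *)
Lemma kernel_size_medium : exists (c d : R), [/\ 0 < c, 0 < d & forall Z x, disc Z ->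
  cabs (Z - X j) < d -> (circle `\` range X) (expi x) -> cabs (expi x - X j) < d ->
  cabs (Z - X j) <= 8 * cabs (expi x - Z) ->
  kernel_size Z x <= c * (1 + cabs (expi x - X j) `^ b *
     (cabs (expi x - X j) + cabs (Z - X j)) `^ (- b)) / (cabs (expi x - X j) + cabs (Z - X j))].
Proof.
have [c2 c20 [r2 r20 s1P]] := cm_deriv_corner cm j.
have [c3 c30 [r3 r30 dP]] := cm_dquot_corner cm j.
exists (51 + 34 * (c2 / c3)), (Num.min r2 r3); split.
- by rewrite addr_gt0// mulr_gt0// divr_gt0.
- by rewrite lt_min r20.
move=> Z x Z1; rewrite !lt_min => /andP[Zr2 Zr3] SX /andP[Sr2 Sr3] far.
set S := expi x in SX Sr2 Sr3 far *; set t := cabs (S - X j) in Sr2 Sr3 *.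
set r := cabs (Z - X j) in Zr2 Zr3 far *.
have t0 : 0 < t.
  by rewrite cabs_gt0 subr_eq0; apply/eqP => e; apply: SX.2; rewrite e; exists j.
have r0 : 0 < r.
  rewrite cabs_gt0 subr_eq0; apply/eqP => e.
  by have := Z1; rewrite /disc/= e (XC j) ltxx.
have Zc := disc_cdisc Z1.
have SZ : S != Z by apply/eqP => e; have := Z1; rewrite /disc/= -e /S cabs_expi ltxx.
set v := cabs (S - Z) in far *.
have v0 : 0 < v by rewrite cabs_gt0 subr_eq0.
(* From [t <= r + v] and [r <= 8 * v]. *)
have vt : t + r <= 17 * v.
  have := cabs_dist_triangle Z S (X j); rewrite -/t -/v -/r; lra.
have tr0 : 0 < t + r by lra.
have iv : v^-1 <= 17 / (t + r).
  by rewrite ler_pdivlMr// mulrC ler_pdivrMr.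
have S1b : cabs (s1 S) <= c2 * t `^ b.
  apply: (s1P S _ _ _).2; [exact/circle_cdisc/(SX.1)| |exact: ltW].
  by rewrite -subr_eq0 -cabs_gt0.
have dq : c3 * (t + r) `^ b <= cabs (dquot s S Z).
  apply: dP => //; [|exact: ltW|rewrite -/t; lra].
  by split => //; exact: (disc_notin_corner XC Z1).
have p0 : 0 < (t + r) `^ b by rewrite powR_gt0.
have dq0 : 0 < cabs (dquot s S Z) by rewrite (lt_le_trans _ dq)// mulr_gt0.
have sSZ : s S != s Z.
  by apply/eqP => e; move: dq0; rewrite /dquot e subrr mul0r cabs0 ltxx.
have ws : cabs (s S - s Z) = cabs (dquot s S Z) * v.
  by rewrite /dquot cabs_div divfK// gt_eqF.
have k1b : cabs (s1 S) / cabs (s S - s Z) <= 17 * (c2 / c3) * (t `^ b * (t + r) `^ (- b)) / (t + r).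
  rewrite ws invfM [leLHS]mulrA.
  rewrite (_ : 17 * (c2 / c3) * (t `^ b * (t + r) `^ (- b)) / (t + r) =
     c2 * t `^ b * (c3 * (t + r) `^ b)^-1 * (17 / (t + r))); last first.
    by rewrite powRN; field; rewrite !gt_eqF.
  apply: ler_pM; rewrite ?mulr_ge0 ?invr_ge0 ?cabs_ge0 ?(ltW v0)//.
  apply: ler_pM; rewrite ?invr_ge0 ?cabs_ge0//.
  by rewrite lef_pV2 ?posrE// mulr_gt0.
have P : poisson Z x <= 34 / (t + r).
  have v1 : 1 - cabs Z <= v.
    by have := lerB_cabs S Z; rewrite {1}/S cabs_expi.
  have Z0 := cabs_ge0 Z.
  have Z1' : cabs Z <= 1 by [].
  rewrite /poisson -/S -/v; apply: (@le_trans _ _ (2 * v / v ^+ 2)).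
    rewrite ler_pM2r ?invr_gt0 ?exprn_gt0//.
    rewrite (_ : 1 - cabs Z ^+ 2 = (1 - cabs Z) * (1 + cabs Z)); last by ring.
    rewrite [leRHS]mulrC; apply: ler_pM; move: v1 Z0 Z1'; clra.
  rewrite (_ : 2 * v / v ^+ 2 = 2 * v^-1); last by field; rewrite gt_eqF.
  by rewrite (_ : 34 / (t + r) = 2 * (17 / (t + r))) ?ler_pM2l//; field; rewrite gt_eqF.
have k0b := cabs_cauchy_k x Z; rewrite -/S -/v in k0b.
have E1 : cabs (map_k1 s s1 x Z - cauchy_k x Z) <=
    17 * (c2 / c3) * (t `^ b * (t + r) `^ (- b)) / (t + r) + 17 / (t + r).
  by apply: le_trans (ler_cabsB _ _) _; rewrite k0b cabs_map_k1 lerD.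
have E2 := le_trans (cabs_map_k2_le s1 sSZ) k1b.
rewrite /kernel_size; apply: le_trans (lerD (lerD P E1) E2) _.
set w := t `^ b * _; have w0 : 0 <= w by rewrite mulr_ge0 ?powR_ge0.
have c23 : 0 < c2 / c3 by rewrite divr_gt0.
have -> : 34 / (t + r) + (17 * (c2 / c3) * w / (t + r) + 17 / (t + r)) + 17 * (c2 / c3) * w / (t + r)
  = (51 + 34 * (c2 / c3) * w) / (t + r) by field; rewrite !gt_eqF.
rewrite ler_pM2r ?invr_gt0//.
have h : 0 <= c2 / c3 * 1 + w by rewrite addr_ge0// mulr1 ltW.
nra.
Qed.

(** Within [r / 8] of [Z] every distance to the corner is comparable with [r], so the powers
    $r^{\beta_j}$ of $\sigma'$ and of the difference quotient cancel. There remains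
    $\omega(|S-T|)/(|S-T|\,\omega(r))$ up to constants, whose mass is bounded independently of [r]
    because $\int_0^\varepsilon\omega(\eta)\eta^{-1}d\eta\le k\,\omega(\varepsilon)$. *)
Lemma kernel_size_near : exists (K d B : R), [/\ 0 <= K, 0 < d, 0 <= B & forall Z, disc Z ->
  cabs (Z - X j) < d -> exists2 H : R -> R, mass_le H B & forall x,
  cabs (expi x - Z) < cabs (Z - X j) / 8 -> expi x != unit_part Z ->
  (circle `\` range X) (expi x) -> kernel_size Z x <= H x].
Proof.
have [om [A [r1 [kk [mom A0 /andP[r10 r11] din oscP]]]]] := cm_osc_corner cm j.
have [c2 c20 [r2 r20 s1P]] := cm_deriv_corner cm j.
have [c3 c30 [r3 r30 dP]] := cm_dquot_corner cm j.
pose kap := 3 `^ (- b) + 3 `^ b; have kap0 : 0 < kap by rewrite addr_gt0 ?powR_gt0.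
pose K := 30 * A * kap ^+ 2 / c3 * (2 + c2 * kap ^+ 2 / c3).
have c23 : 0 <= c2 * kap ^+ 2 / c3 by rewrite divr_ge0 ?mulr_ge0 ?exprn_ge0// ltW.
have K0 : 0 <= K.
  by rewrite /K !mulr_ge0 ?invr_ge0 ?exprn_ge0 ?addr_ge0// ltW.
have dd : 0 < Num.min (Num.min r1 r2) (Num.min r3 1) / 8.
  by rewrite divr_gt0// !lt_min r10 r20 r30 ltr01.
exists K, (Num.min (Num.min r1 r2) (Num.min r3 1) / 8), (2 * (2 * pi) + 2 * pi * 1 + K * (12 * kk)).
have [omP omL _ omD] := mom.
have kk0 : 0 <= kk.
  have := din r1 (introT andP (conj r10 (lexx r1))).
  have i0 : (0 <= \int[mu]_(x in `]0%R, r1]) (modulus_ext om x / x)%:E)%E.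
    by apply: integral_ge0 => x _; rewrite lee_fin modulus_ext_quot_ge0.
  by move/(le_trans i0); rewrite lee_fin pmulr_lge0// omP.
have p0 : 0 < pi :> R := pi_gt0 R.
have Kk0 : 0 <= K * (12 * kk) by apply: (mulr_ge0 K0); rewrite mulr_ge0.
split => //; first by lra.
move=> Z Z1; set r := cabs (Z - X j); rewrite ltr_pdivlMr// !lt_min => /andP[/andP[h1 h2] /andP[h3 h4]].
set T := unit_part Z.
have r0 : 0 < r.
  rewrite cabs_gt0 subr_eq0; apply/eqP => e.
  by have := Z1; rewrite /disc/= e (XC j) ltxx.
have Zh : cabs (Z - X j) <= 1 / 2 by rewrite -/r; lra.
have [T1 ZE r01 rZ TX] := unit_partP (disc_cdisc Z1) (XC j) Zh; rewrite -/T in T1 ZE TX.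
have r4 : 0 < r / 4 by rewrite divr_gt0.
(* The projection [T] is at distance at least [7 / 8 * r] from the corner, so [q] is a lower bound
   of the normalizing value at half that distance. *)
pose q := om (7 / 16 * r).
have q0 : 0 < q by apply: omP; lra.
exists (fun x => 2 * poisson Z x + 1 + K * (q^-1 * modulus_near om (r / 4) T x)).
  apply: mass_leD.
    apply: mass_leD; last by apply: mass_le_cst.
    by apply: mass_leZ => //; exact: mass_le_poisson.
  apply: mass_leZ => //.
  have M : mass_le (modulus_near om (r / 4) T) (6 * (kk * om (3 * (r / 4)))).
    split.
    - by apply: measurable_funTS; exact: measurable_modulus_near.
    - by move=> x; exact: modulus_near_ge0.
    apply: le_trans (integral_modulus_near_le mom T1 r4) _.
    by rewrite EFinM lee_pmul2l//; apply: din; lra.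
  apply: mass_le_weak (mass_leZ _ M); last by rewrite invr_ge0 ltW.
  (* Since [3 / 4 <= 7 / 8], semi-additivity at twice [7 / 16 * r] gives the factor 2. *)
  have o2 : om (3 * (r / 4)) <= 2 * q.
    apply: (@le_trans _ _ (om (7 / 16 * r + 7 / 16 * r))); first by apply: omL; move: r0; clra.
    have r7 : 0 < 7 / 16 * r by lra.
    by have := omD _ _ r7 r7; rewrite -/q; lra.
  rewrite mulrC ler_pdivrMr//; nra.
move=> x Sr ST SX; set S := expi x in Sr ST SX *.
have SZ : S != Z by apply/eqP => e; have := Z1; rewrite /disc/= -e /S cabs_expi ltxx.
have v1 : 1 - cabs Z <= cabs (S - Z).
  by have := lerB_cabs S Z; rewrite {1}/S cabs_expi.
have TZ : cabs (T - Z) < r / 8.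
  by rewrite cabsB [X in cabs (X - _)]ZE cabs_radial//; lra.
pose h := cabs (T - X j).
have hr : 7 / 8 * r <= h <= 9 / 8 * r.
  have a := cabs_dist_triangle Z T (X j); have a' := cabs_dist_triangle T Z (X j).
  by rewrite [cabs (Z - T)]cabsB in a'; rewrite /h -/r in a a' *; move: a a' TZ; clra.
have hp : 0 < h by move: hr r0; clra.
have TXj : T != X j by rewrite -subr_eq0 -cabs_gt0.
have hr1 : cabs (T - X j) <= r1 by rewrite -/h; move: hr h1 r0; clra.
have [nT oT] := oscP T T1 TXj hr1; rewrite -/h in nT oT.
have STr : cabs (S - T) < r / 4.
  by have := cabs_dist_triangle Z S T; rewrite [cabs (Z - T)]cabsB; move: TZ Sr; clra.
set t := cabs (S - X j).
have tr : 7 / 8 * r <= t <= 9 / 8 * r.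
  have a := cabs_dist_triangle Z S (X j); have a' := cabs_dist_triangle S Z (X j).
  by rewrite [cabs (Z - S)]cabsB in a'; rewrite /t -/r in a a' *; move: a a' Sr; clra.
have S1 : circle S by exact: circle_expi.
have oh : 0 < om (h / 2) by apply: omP; rewrite divr_gt0.
have A'0 : 0 <= A * h `^ b / om (h / 2).
  by rewrite divr_ge0 ?mulr_ge0 ?powR_ge0// ltW.
have diffT S' : circle S' -> cabs (S' - T) <= h / 2 -> cdiff circle s S' (s1 S').
  by move=> S'1 S'r; apply: (cm_diff_arc cm); exact: nT.
have Srho : cabs (S - T) <= h / 2 by move: STr hr r0; clra.
have Zrho : 1 - cabs Z <= h / 2 by move: v1 Sr hr r0; clra.
have xZ' : S != (cabs Z)%:C * T by rewrite -ZE.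
have L2 := local_dquot (cm_cont cm) (cm_diff cm) mom T1 A'0 diffT oT S1 r01 ST xZ' Srho Zrho.
rewrite -ZE in L2.
have S1b : cabs (s1 S) <= c2 * kap * r `^ b.
  apply: (@le_trans _ _ (c2 * t `^ b)).
    apply: (s1P S _ _ _).2; [exact/circle_cdisc| |rewrite -/t; move: tr h2 r0; clra].
    by rewrite -subr_eq0 -cabs_gt0 -/t; move: tr r0; clra.
  by rewrite -mulrA ler_pM2l//; apply: powR_triple_le => //; move: tr r0; clra.
have dq : c3 / kap * r `^ b <= cabs (dquot s S Z).
  apply: (@le_trans _ _ (c3 * (t + r) `^ b)); last first.
    apply: dP => //; [|rewrite -/r; move: h3 r0; clra|rewrite -/t; move: tr h3 r0; clra].
    by split; [exact: disc_cdisc|exact: (disc_notin_corner XC Z1)].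
  rewrite -mulrA ler_pM2l// ler_pdivrMl//.
  by apply: powR_triple_le; move: tr r0; clra.
have rb : 0 < r `^ b by rewrite powR_gt0.
have ck : 0 < c3 / kap by rewrite divr_gt0.
have dqp : 0 < cabs (dquot s S Z) by rewrite (lt_le_trans _ dq)// mulr_gt0.
have sSZ : s S != s Z.
  by apply/eqP => e; move: dqp; rewrite /dquot e subrr mul0r cabs0 ltxx.
have k1 := cabs_map_k1_sub_le s1 SZ sSZ.
have k2 := cabs_map_k2_sub_le SZ sSZ (cm_deriv_neq0 cm SX).
have k2m := cabs_main_k2_le s1 (ltW Z1) SZ.
have k2' : cabs (map_k2 s s1 x Z) <= cabs (map_k2 s s1 x Z - main_k2 s1 x Z) + (poisson Z x + 1).
  have := ler_cabsD (map_k2 s s1 x Z - main_k2 s1 x Z) (main_k2 s1 x Z).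
  by rewrite subrK => /le_trans; apply; rewrite lerD2l.
move: k1 k2 L2; rewrite -/S; set a := cabs (dquot s S Z - s1 S) / _.
set p := cabs (s1 S) in S1b *; set d := cabs (dquot s S Z) in dq dqp *.
move=> k1 k2 L2.
have STp : 0 < cabs (S - T) by rewrite cabs_gt0 subr_eq0.
have mnE : modulus_near om (r / 4) T x = om (cabs (S - T)) / cabs (S - T).
  by rewrite /modulus_near -/S STr /modulus_ext STp.
set w := om (cabs (S - T)) / _ in mnE L2.
have w0 : 0 <= w by rewrite divr_ge0 ?cabs_ge0// ltW// omP.
have a0 : 0 <= a by rewrite divr_ge0 ?cabs_ge0.
have ab : a <= 30 * A * kap * r `^ b * (q^-1 * w).
  apply: (le_trans L2).
  have hb : h `^ b <= kap * r `^ b by apply: powR_triple_le => //; move: hr r0; clra.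
  have oq : (om (h / 2))^-1 <= q^-1 by rewrite lef_pV2 ?posrE//; apply: omL; move: hr r0; clra.
  have hb0 : 0 <= h `^ b := powR_ge0 _ _.
  rewrite (_ : 30 * (A * h `^ b / om (h / 2)) * w = 30 * A * (h `^ b / om (h / 2)) * w); last by ring.
  rewrite (_ : 30 * A * kap * r `^ b * (q^-1 * w) = 30 * A * (kap * r `^ b / q) * w); last by ring.
  apply: ler_wpM2r => //; apply: ler_wpM2l; first by rewrite mulr_ge0.
  by apply: ler_pM => //; rewrite invr_ge0 ltW.
have id : d^-1 <= kap / c3 * (r `^ b)^-1.
  rewrite (_ : kap / c3 * (r `^ b)^-1 = (c3 / kap * r `^ b)^-1); last by field; rewrite !gt_eqF.
  by rewrite lef_pV2 ?posrE// mulr_gt0.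
have id0 : 0 <= d^-1 by rewrite invr_ge0 ltW.
have pd2 : p / d ^+ 2 <= c2 * kap ^+ 2 / c3 * (kap / c3 * (r `^ b)^-1).
  rewrite (_ : c2 * kap ^+ 2 / c3 * (kap / c3 * (r `^ b)^-1) =
    c2 * kap * r `^ b * (kap / c3 * (r `^ b)^-1) ^+ 2); last by field; rewrite !gt_eqF.
  rewrite -exprVn; apply: ler_pM => //; rewrite ?cabs_ge0 ?exprn_ge0//.
  by rewrite ler_sqr ?nnegrE// (le_trans id0).
have tot : cabs (map_k1 s s1 x Z - cauchy_k x Z) + cabs (map_k2 s s1 x Z - main_k2 s1 x Z) <=
    K * (q^-1 * w).
  apply: le_trans (lerD k1 k2) _; rewrite -mulrDr.
  rewrite (_ : K * (q^-1 * w) = 30 * A * kap * r `^ b * (q^-1 * w) *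
    (kap / c3 * (r `^ b)^-1 + (kap / c3 * (r `^ b)^-1 + c2 * kap ^+ 2 / c3 * (kap / c3 * (r `^ b)^-1)))).
    apply: ler_pM => //.
      by rewrite !addr_ge0 ?divr_ge0 ?exprn_ge0 ?cabs_ge0.
    by rewrite lerD// lerD.
  by rewrite /K; field; rewrite !gt_eqF.
rewrite /kernel_size mnE; move: tot k2'; clra.
Qed.

(** Three zones of [S]. Far from the corner the kernels are bounded by multiples of $1+|\sigma'|$.
    Close to [Z] the density is of order $r^{-\gamma}$ and the kernel mass is bounded. In between,
    $t^{-\gamma}(1+t^{\beta}(t+r)^{-\beta})/(t+r)$ integrates to order $r^{-\gamma}$. The added 1
    accounts for the constant in $P+1$. *)
Lemma corner_kernel_mass : exists (K d : R), [/\ 0 < K, 0 < d & forall Z, disc Z ->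
  cabs (Z - X j) < d -> exists2 H : R -> R, mass_le H (K * cabs (Z - X j) `^ (- g)) &
  forall x, ~ (corner_args X `|` [set x | expi x = unit_part Z]) x ->
    `|psi (expi x)| * (kernel_size Z x + 1) <= H x].
Proof.
have [g0 g1] : 0 < g < 1 /\ g < b + 1 by exact: gamma_bd.
have /andP[g0' g1'] := g0.
have [cp [dp [cp0 dp0 psiP]]] := density_near_corner.
have [cm' [dm [cm0 dm0 medP]]] := kernel_size_medium.
have [Kn [dn [Bn [Kn0 dn0 Bn0 nearP]]]] := kernel_size_near.
pose rho := Num.min dp dm / 2.
have rho0 : 0 < rho by rewrite divr_gt0// lt_min dp0.
have rho1 : 2 * rho <= dp by rewrite /rho mulrC divfK// ge_min lexx.
have rho2 : 2 * rho <= dm by rewrite /rho mulrC divfK// ge_min lexx orbT.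
have [Kf [df [Kf0 df0 farP]]] := map_kernels_far cm (XC j) rho0.
have [G iG GP] := density_dominated Xinj cm gamma_bd pd.
pose Gi := fine (\int[mu]_(x in I) `|G x|%:E)%E.
have mG : mass_le (fun x => `|G x|) Gi.
  have := integrable_norm iG => /integrableP[mn fn].
  have G0 : (0 <= \int[mu]_(x in I) `|G x|%:E)%E by apply: integral_ge0 => x _; rewrite lee_fin.
  have e : (\int[mu]_(x in I) `| `|G x|%:E| = \int[mu]_(x in I) `|G x|%:E)%E.
    by apply: eq_integral => x _; rewrite /= normr_id.
  split => //; rewrite /Gi fineK// ge0_fin_numE//.
  by rewrite -e; exact: fn.
have Gi0 : 0 <= Gi.
  by rewrite /Gi fine_ge0//; apply: integral_ge0 => x _; rewrite lee_fin.
have a1 : -1 < - g by lra.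
have a2 : -1 < b - g by lra.
have [B1 B10 N1] := mass_le_near_powR (XC j) a1.
have [B2 B20 N2] := mass_le_near_powR (XC j) a2.
have [B3 B30 N3] := mass_le_tail_powR (XC j) g0'.
pose kb := 3 `^ (- - b) + 3 `^ (- b); have kb0 : 0 < kb by rewrite addr_gt0 ?powR_gt0.
pose kg := 3 `^ (- - g) + 3 `^ (- g); have kg0 : 0 < kg by rewrite addr_gt0 ?powR_gt0.
have cc0 : 0 < cp * cm' by rewrite mulr_gt0.
exists (2 * (Kf + 1) * Gi + cp * cm' * (B1 + kb * B2 + (1 + kb) * B3) + cp * kg * Bn + Gi + 1).
exists (Num.min (Num.min df rho) (Num.min dn 1)); split.
- have t1 : 0 <= 2 * (Kf + 1) * Gi by rewrite !mulr_ge0// addr_ge0.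
  have t2 : 0 <= cp * cm' * (B1 + kb * B2 + (1 + kb) * B3).
    by rewrite mulr_ge0 ?(ltW cc0)// !addr_ge0 ?mulr_ge0 ?addr_ge0 ?(ltW kb0).
  have t3 : 0 <= cp * kg * Bn by rewrite !mulr_ge0 ?(ltW cp0) ?(ltW kg0).
  by move: t1 t2 t3 Gi0; clra.
- by rewrite !lt_min df0 rho0 dn0 ltr01.
move=> Z Z1; set r := cabs (Z - X j); rewrite !lt_min => /andP[/andP[rf rr] /andP[rn r1]].
have r0 : 0 < r.
  rewrite cabs_gt0 subr_eq0; apply/eqP => e.
  by have := Z1; rewrite /disc/= e (XC j) ltxx.
have [Hn mHn HnP] := nearP Z Z1 rn.
pose s_ x := cabs (expi x - X j).
(* [n1] and [n2] majorize the middle zone for $t<r$, where $t+r$ is of order $r$, and [n3] for $t\ge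
   r$, where it is of order $t$. With the prefactors $r^{-1}$, $r^{-\beta-1}$ and $1$ each mass is
   of order $r^{-\gamma}$. *)
pose n1 x := if s_ x < r then s_ x `^ (- g) else 0.
pose n2 x := if s_ x < r then s_ x `^ (b - g) else 0.
pose n3 x := if r <= s_ x then s_ x `^ (- g - 1) else 0.
have n10 x : 0 <= n1 x by rewrite /n1; case: ifP => // _; exact: powR_ge0.
have n20 x : 0 <= n2 x by rewrite /n2; case: ifP => // _; exact: powR_ge0.
have n30 x : 0 <= n3 x by rewrite /n3; case: ifP => // _; exact: powR_ge0.
have rg : 0 < r `^ (- g) by rewrite powR_gt0.
have Hn0 x : 0 <= Hn x by case: mHn.
have M1 : mass_le (fun x => r `^ (-1) * n1 x) (B1 * r `^ (- g)).
  have := mass_leZ (powR_ge0 r (-1)) (N1 r r0); apply: mass_le_weak.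
  by rewrite mulrCA pow_mul// (_ : -1 + (- g + 1) = - g); last by ring.
have M2 : mass_le (fun x => r `^ (- b - 1) * n2 x) (B2 * r `^ (- g)).
  have := mass_leZ (powR_ge0 r (- b - 1)) (N2 r r0); apply: mass_le_weak.
  by rewrite mulrCA pow_mul// (_ : - b - 1 + (b - g + 1) = - g); last by ring.
have M3 : mass_le n3 (B3 * r `^ (- g)) by exact: N3.
have MG1 : mass_le (fun x => `|G x|) (Gi * r `^ (- g)).
  apply: mass_le_weak mG; rewrite ler_peMr//.
  have := @ge0_ler_powR R g (ltW g0') r 1; rewrite !nnegrE ler01 (ltW r0) powR1 => h.
  by rewrite powRN invf_ge1 ?powR_gt0// h// ltW.
have MG : mass_le (fun x => 2 * (Kf + 1) * `|G x|) (2 * (Kf + 1) * Gi * r `^ (- g)).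
  by rewrite -mulrA; apply: mass_leZ => //; rewrite mulr_ge0// addr_ge0.
have MN : mass_le (fun x => cp * kg * r `^ (- g) * Hn x) (cp * kg * Bn * r `^ (- g)).
  rewrite [_ * Bn * _]mulrAC; apply: mass_leZ => //.
  by rewrite !mulr_ge0// ltW.
exists (fun x => 2 * (Kf + 1) * `|G x| + cp * cm' * (r `^ (-1) * n1 x + kb * (r `^ (- b - 1) * n2 x) +
   (1 + kb) * n3 x) + cp * kg * r `^ (- g) * Hn x + `|G x|).
  apply: mass_le_weak (mass_leD (mass_leD (mass_leD MG (mass_leZ (ltW cc0) (mass_leD (mass_leD M1
    (mass_leZ (ltW kb0) M2)) (mass_leZ (_ : 0 <= 1 + kb) M3)))) MN) MG1); last by rewrite addr_ge0// ltW.
  set u := r `^ (- g) in rg *.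
  rewrite [leLHS](_ : _ = (2 * (Kf + 1) * Gi + cp * cm' * (B1 + kb * B2 + (1 + kb) * B3) + cp * kg * Bn + Gi) * u); last by ring.
  by rewrite ler_wpM2r ?(ltW rg)// lerDl.
move=> x Nx.
have NX : ~ corner_args X x by move=> h; apply: Nx; left.
have ST : expi x != unit_part Z by apply/eqP => h; apply: Nx; right.
have SX := corner_args_circle NX.
rewrite mulrDr mulr1; apply: lerD; last first.
  apply: le_trans (ler_norm _); apply: le_trans (GP x NX).
  by rewrite ler_peMr// lerDl cabs_ge0.
set q1 := 2 * (Kf + 1) * _; set q2 := cp * cm' * _; set q3 := cp * kg * _ * _.
have q10 : 0 <= q1 by rewrite !mulr_ge0 ?addr_ge0.
have q20 : 0 <= q2.
  by rewrite mulr_ge0 ?(ltW cc0)// !addr_ge0 ?mulr_ge0 ?powR_ge0 ?addr_ge0 ?(ltW kb0).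
have q30 : 0 <= q3 by rewrite !mulr_ge0 ?(ltW cp0) ?(ltW kg0) ?(ltW rg).
have ks0 : 0 <= kernel_size Z x.
  by rewrite !addr_ge0 ?cabs_ge0// poisson_ge0// ltW.
have [far|close] := leP rho (s_ x).
  have [_ [h0 h1 h2 h3 _]] := farP Z x (disc_cdisc Z1) rf far.
  have GPx := GP x NX; set A := 1 + cabs (s1 (expi x)) in GPx.
  have A1 : 1 <= A by rewrite /A lerDl cabs_ge0.
  have kA : kernel_size Z x <= 2 * (Kf + 1) * A.
    have e1 := ler_cabsB (map_k1 s s1 x Z) (cauchy_k x Z).
    rewrite /kernel_size /A; set v := cabs (s1 _) in h1 h2 *.
    have v0 : 0 <= v by exact: cabs_ge0.
    have : 0 <= Kf * v by rewrite mulr_ge0.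
    rewrite mulrDr; move: h0 h1 h2 h3 e1 v0 Kf0 ; clra.
  apply: (@le_trans _ _ q1); last by move: q20 q30; clra.
  apply: (@le_trans _ _ (`|psi (expi x)| * (2 * (Kf + 1) * A))); first exact: ler_wpM2l.
  rewrite mulrCA /q1; apply: ler_wpM2l; first by rewrite mulr_ge0// addr_ge0.
  exact: le_trans GPx (ler_norm _).
have t0 : 0 < s_ x.
  by rewrite /s_ cabs_gt0 subr_eq0; apply/eqP => e; apply: SX.2; rewrite e; exists j.
have psx : `|psi (expi x)| <= cp * s_ x `^ (- g) by apply: psiP => //; rewrite -/(s_ x); move: close rho1 rho0; clra.
(* The threshold [r / 8] for the distance of [S] to [Z] separates the ranges of [kernel_size_medium]
   and [kernel_size_near]. *)
have [med|near] := leP r (8 * cabs (expi x - Z)); last first.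
  have sr : r / 3 <= s_ x <= 3 * r.
    have e1 := cabs_dist_triangle Z (expi x) (X j); have e2 := cabs_dist_triangle (expi x) Z (X j).
    by rewrite [cabs (Z - expi x)]cabsB in e2; rewrite /s_ -/r in e1 e2 *; move: e1 e2 near r0; clra.
  apply: (@le_trans _ _ q3); last by move: q20 q10; clra.
  have sg : s_ x `^ (- g) <= kg * r `^ (- g) by exact: powR_triple_le.
  apply: ler_pM => //.
    by apply: (le_trans psx); rewrite -mulrA ler_pM2l.
  by apply: HnP => //; rewrite ltr_pdivlMr// mulrC.
have rm : r < dm by move: rr rho2 rho0; clra.
have sm : s_ x < dm by move: close rho2 rho0; clra.
have := medP Z x Z1 rm SX sm med; rewrite -/(s_ x) -/r => mk.
apply: (@le_trans _ _ q2); last by move: q10 q30; clra.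
apply: (@le_trans _ _ (cp * s_ x `^ (- g) * (cm' * (1 + s_ x `^ b * (s_ x + r) `^ (- b)) / (s_ x + r)))).
  by apply: ler_pM.
rewrite /q2 (_ : cp * _ * _ = cp * cm' * (s_ x `^ (- g) * ((1 + s_ x `^ b * (s_ x + r) `^ (- b)) / (s_ x + r)))); last by ring.
rewrite ler_pM2l//; have sg0 := powR_ge0 (s_ x) (- g).
have sb0 := powR_ge0 (s_ x) b.
have sr0 : 0 < s_ x + r by rewrite addr_gt0.
have [rs|sr] := leP r (s_ x).
  rewrite /n1 /n2 /n3 rs ltNge rs /= !mulr0 !add0r.
  have e1 : s_ x `^ b * (s_ x + r) `^ (- b) <= kb.
    have h : (s_ x + r) `^ (- b) <= kb * s_ x `^ (- b) by apply: powR_triple_le => //; move: rs r0 t0; clra.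
    apply: (le_trans (ler_wpM2l sb0 h)).
    by rewrite mulrCA pow_mul// subrr powRr0 mulr1.
  have e2 : (s_ x + r)^-1 <= s_ x `^ (-1).
    by rewrite powR_inv1 ?(ltW t0)// lef_pV2 ?posrE// lerDl ltW.
  rewrite -(pow_mul (- g) (-1) t0) [leRHS]mulrCA; apply: ler_wpM2l => //.
  apply: ler_pM; rewrite ?invr_ge0 ?addr_ge0 ?mulr_ge0 ?powR_ge0 ?(ltW t0) ?(ltW r0)//.
  by rewrite lerD2l.
have rs : (r <= s_ x) = false by rewrite leNgt sr.
rewrite /n1 /n2 /n3 sr rs mulr0 addr0.
have e1 : (s_ x + r) `^ (- b) <= kb * r `^ (- b) by apply: powR_triple_le => //; move: sr r0 t0; clra.
have e2 : (s_ x + r)^-1 <= r `^ (-1).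
  by rewrite powR_inv1 ?(ltW r0)// lef_pV2 ?posrE// lerDr ltW.
rewrite (_ : r `^ (-1) * s_ x `^ (- g) + _ = s_ x `^ (- g) * ((1 + s_ x `^ b * (kb * r `^ (- b))) * r `^ (-1))); last first.
  rewrite -(pow_mul b (- g) t0) -(pow_mul (- b) (-1) r0); ring.
apply: ler_wpM2l => //.
apply: ler_pM; rewrite ?invr_ge0 ?addr_ge0 ?mulr_ge0 ?powR_ge0 ?(ltW t0) ?(ltW r0)//.
by rewrite lerD2l ler_wpM2l.
Qed.

(** The Cauchy part enters only through its real part $(4\pi)^{-1}\psi(P+1)$; every term is then
    below the majorant of [corner_kernel_mass]. *)
Lemma corner_growth : exists (K d : R), [/\ 0 < K, 0 < d & forall Z, disc Z ->
  cabs (Z - X j) < d ->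
  `|Re ((2 * pi%:C * 'i)^-1 * cintegral I (fun x => f x * map_k1 s s1 x Z))| <=
    K * cabs (Z - X j) `^ (- g) /\
  cabs ((2 * pi%:C * 'i)^-1 * cintegral I (fun x => f x * map_k2 s s1 x Z)) <=
    K * cabs (Z - X j) `^ (- g)].
Proof.
have [K [d [K0 d0 P]]] := corner_kernel_mass.
exists (4 * K), d; split => //; first by rewrite mulr_gt0.
move=> Z Z1 Zd; have [H mH HP] := P Z Z1 Zd.
set B := K * _ in mH; have -> : 4 * K * cabs (Z - X j) `^ (- g) = 2 * B + 2 * B.
  by rewrite /B; ring.
set N := _ `|` _ in HP.
have cN : countable N.
  by apply: countable_setU; [exact: countable_corner_args|exact: countable_expi_fiber].
have mI : measurable I by exact: measurable_itv.
have [i0 i1 i2 _] := interior_integrable Xinj cm gamma_bd pd Z1.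
have B0 : 0 <= B.
  have [_ h0 h1] := mH; rewrite -lee_fin; apply: le_trans h1.
  by apply: integral_ge0 => x _; rewrite lee_fin.
set w := (2 * pi%:C * 'i)^-1.
have w1 : cabs w <= 1.
  rewrite /w cabsV !cabsM cabs_i mulr1 -[2 : C](rmorph_nat (real_complex R)) !cabs_real.
  have := @pi_ge2 R => p2; rewrite invf_le1 !ger0_norm//; lra.
have ks x : [/\ 0 <= poisson Z x, 0 <= cabs (map_k1 s s1 x Z - cauchy_k x Z),
    0 <= cabs (map_k2 s s1 x Z) & 0 <= `|psi (expi x)|].
  by split; rewrite ?cabs_ge0 ?normr_ge0// poisson_ge0// ltW.
have SZ x : expi x != Z.
  by apply/eqP => e; have := Z1; rewrite /disc/= -e cabs_expi ltxx.
split; last first.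
  rewrite cabsM; apply: (@le_trans _ _ (1 * (2 * B))); last by lra.
  apply: ler_pM; rewrite ?cabs_ge0//; apply: cabs_cintegral_mass cN _ mH _; first by case: i2.
  move=> x Nx; apply: le_trans (HP x Nx); have [p1 p2 p3 p4] := ks x.
  by rewrite cabsM cabs_real ler_wpM2l// /kernel_size; lra.
have i1' : cintegrable I (fun x => f x * (map_k1 s s1 x Z - cauchy_k x Z)).
  rewrite (_ : (fun x => _) = (fun x => f x * map_k1 s s1 x Z - f x * cauchy_k x Z)).
    exact: cintegrableB.
  by apply/funext => x; rewrite mulrBr.
have -> : cintegral I (fun x => f x * map_k1 s s1 x Z) =
    cintegral I (fun x => f x * (map_k1 s s1 x Z - cauchy_k x Z)) +
    cintegral I (fun x => f x * cauchy_k x Z).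
  by rewrite -cintegralD//; apply: eq_cintegral => x _; rewrite -mulrDr subrK.
rewrite mulrDr ReD; apply: le_trans (ler_normD _ _) _; apply: lerD.
  apply: le_trans (ler_norm_Re _) _; rewrite cabsM.
  apply: (@le_trans _ _ (1 * (2 * B))); last by rewrite mul1r.
  apply: ler_pM; rewrite ?cabs_ge0//; apply: cabs_cintegral_mass cN _ mH _; first by case: i1'.
  move=> x Nx; apply: le_trans (HP x Nx); have [p1 p2 p3 p4] := ks x.
  by rewrite cabsM cabs_real ler_wpM2l// /kernel_size; lra.
rewrite -cintegralZ//.
pose F x : C := (Re (w * (f x * cauchy_k x Z)))%:C.
have iw : cintegrable I (fun x => w * (f x * cauchy_k x Z)) by exact: cintegrableZ.
have -> : Re (cintegral I (fun x => w * (f x * cauchy_k x Z))) = Re (cintegral I F) by [].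
apply: le_trans (ler_norm_Re _) _; apply: cabs_cintegral_mass cN _ mH _.
  by apply: cmeasurable_real; case: iw => -[].
move=> x Nx; apply: le_trans (HP x Nx); have [p1 p2 p3 p4] := ks x.
rewrite /F cabs_real.
have alg (a pp q e v : C) : pp != 0 -> q != 0 -> v != 0 ->
    (2 * pp * q)^-1 * (a * (q * e / v)) = a / (2 * pp) * (e / v).
  by move=> p0 q0 v0; field; rewrite p0 q0 v0.
have -> : Re (w * (f x * cauchy_k x Z)) = psi (expi x) * ((4 * pi)^-1 * (poisson Z x + 1)).
  have pn : pi != 0 :> R by rewrite gt_eqF// pi_gt0.
  rewrite poisson_Re//.
  have -> : w * (f x * cauchy_k x Z) = (psi (expi x) * (2 * pi)^-1)%:C * (expi x / (expi x - Z)).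
    rewrite /w /cauchy_k /f !realcM realcV !realcM (rmorph_nat (real_complex R) 2).
    have i0' : 'i != 0 :> C by rewrite -cabs_gt0 cabs_i.
    have pn' : pi%:C != 0 :> C by rewrite -cabs_gt0 cabs_real normr_gt0.
    have v0 : expi x - Z != 0 by rewrite subr_eq0.
    exact: alg.
  rewrite ReMr; move: (Re _) => a; move: (@pi R) pn (psi _) => q q0 e.
  by field.
rewrite normrM; apply: ler_wpM2l => //.
rewrite ger0_norm; last by rewrite mulr_ge0 ?invr_ge0 ?mulr_ge0 ?pi_ge0 ?addr_ge0.
rewrite /kernel_size; apply: (@le_trans _ _ (1 * (poisson Z x + 1))); last by lra.
apply: ler_wpM2r; first by rewrite addr_ge0.
by rewrite invf_le1 ?mulr_gt0 ?pi_gt0//; have := @pi_ge2 R; lra.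
Qed.

End CornerGrowth.

(** * Distances to a corner before and after the conformal map *)

Section CornerDistance.
Variables (R : realType) (m : nat) (X : 'I_m -> R[i]) (beta : 'I_m -> R).
Variables (s s1 : R[i] -> R[i]).
Local Notation C := R[i].
Hypothesis Xinj : injective X.
Hypothesis cm : corner_map X beta s s1.
Implicit Types Z T S : C.

Let XC : forall j, circle (X j) := cm_circle cm.

(** Strict convexity: $|T+t(Z-T)|^2=(1-t)|T|^2+t|Z|^2-t(1-t)|Z-T|^2$. *)
Lemma chord_disc T Z (t : R) : circle T -> cdisc Z -> Z != T -> 0 < t < 1 ->
  disc (T + t%:C * (Z - T)).
Proof.
move=> T1 Z1 ZT /andP[t0 t1].
have q0 : 0 < cabs (Z - T) ^+ 2 by rewrite exprn_gt0// cabs_gt0 subr_eq0.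
have e : cabs (T + t%:C * (Z - T)) ^+ 2 =
    (1 - t) * cabs T ^+ 2 + t * cabs Z ^+ 2 - t * (1 - t) * cabs (Z - T) ^+ 2.
  by rewrite !cabs_sqr !(ReD, ImD, ReB, ImB, ReMr, ImMr); ring.
have Z2 : cabs Z ^+ 2 <= 1 by rewrite expr_le1 ?cabs_ge0.
have lt1 : cabs (T + t%:C * (Z - T)) ^+ 2 < 1.
  rewrite e T1 expr1n mulr1.
  have t10 : 0 < 1 - t by rewrite subr_gt0.
  have := mulr_gt0 (mulr_gt0 t0 t10) q0.
  have : t * cabs Z ^+ 2 <= t * 1 by rewrite ler_pM2l.
  lra.
by move: lt1; rewrite expr_lt1 ?cabs_ge0.
Qed.

Lemma powR_within01 (K q : R) : 0 < q -> {within `[0, 1], continuous (fun t : R => K * t `^ q)}.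
Proof.
move=> q0; apply/subspace_continuousP => x /=; rewrite in_itv/= => /andP[x0 _].
apply: cvgM; first exact: cvg_cst.
have [->|xn0] := eqVneq x 0.
  rewrite powR0 ?gt_eqF//; apply/cvgrPdist_lt => e e0.
  have /cvgrPdist_lt/(_ e e0) := powR_cvg0 q0.
  rewrite !near_withinE; apply: filterS => t h /=; rewrite in_itv/= le_eqVlt.
  move=> /andP[/predU1P[<-|t0] _]; last exact: h.
  by rewrite powR0 ?gt_eqF// subrr normr0.
apply: cvg_within_filter; have xp : 0 < x by rewrite lt_neqAle eq_sym xn0.
exact: (is_derive_continuous (is_derive1_powR q xp)).
Qed.

(** Integrate $|\sigma'(W)|\le c|W-X_j|^{\beta_j}$ along the chord from [X j] to [Z], whose interior
    lies in the open disc; the integral converges at the corner since $\beta_j>-1$. *)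
Lemma map_corner_dist_le j : exists (c d : R), [/\ 0 < c, 0 < d & forall Z, cdisc Z ->
  Z != X j -> cabs (Z - X j) < d ->
  cabs (s Z - s (X j)) <= c * cabs (Z - X j) `^ (beta j + 1)].
Proof.
have /andP[b0 b1] := cm_beta cm j; set b := beta j in b0 b1 *.
have b10 : 0 < b + 1 by lra.
have [c c0 [d d0 s1P]] := cm_deriv_corner cm j.
exists (c / (b + 1)), d; split => //; first by rewrite divr_gt0.
move=> Z Z1 ZX Zd; set r := cabs (Z - X j) in Zd *.
have r0 : 0 < r by rewrite cabs_gt0 subr_eq0.
pose G t := c / (b + 1) * r `^ (b + 1) * t `^ (b + 1).
have dG (t : R) : 0 < t -> is_derive t 1 G (c * r `^ (b + 1) * t `^ b).
  move=> t0; rewrite (_ : c * _ * _ = (c / (b + 1) * r `^ (b + 1)) *: ((b + 1) * t `^ (b + 1 - 1))).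
    by apply: is_deriveZ; exact: is_derive1_powR.
  by rewrite /GRing.scale/= addrK; field; rewrite gt_eqF.
pose w (t : R) : C := X j + t%:C * (Z - X j).
have := @cabs_mean_value R (fun t => s (w t)) G (fun t => c * r `^ (b + 1) * t `^ b) 0 1 ler01.
have -> : w 1 = Z by rewrite /w mul1r addrC subrK.
have -> : w 0 = X j by rewrite /w mul0r addr0.
rewrite /G powR0 ?gt_eqF// mulr0 subr0 powR1 mulr1; apply.
- move=> t t01; have /andP[t0 t1] := t01.
  have wd : disc (w t) by exact: chord_disc.
  have wX : w t - X j = t%:C * (Z - X j) by rewrite /w addrAC subrr add0r.
  have wr : cabs (w t - X j) = t * r by rewrite wX cabsM cabs_real gtr0_norm.
  exists (s1 (w t) * (Z - X j)); split.
  + apply: (pderiv_comp (pderiv_affine _ _ _) (A := setT)); last by exists 1.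
    exact: (cm_diff cm).
  + rewrite cabsM -/r.
    have wtX : w t != X j by rewrite -subr_eq0 -cabs_gt0 wr mulr_gt0.
    have wtd : cabs (w t - X j) <= d.
      by rewrite wr; apply: le_trans (ltW Zd); rewrite ler_piMl// ltW.
    have [_] := s1P (w t) (disc_cdisc wd) wtX wtd; rewrite wr => h.
    apply: (@le_trans _ _ (c * (t * r) `^ b * r)); first by apply: ler_wpM2r; first exact: ltW.
    rewrite powRM ?(ltW t0) ?(ltW r0)// powRD; last by apply/implyP => _; rewrite gt_eqF.
    by rewrite powRr1 ?(ltW r0)// le_eqVlt; apply/orP; left; apply/eqP; ring.
  + exact: dG.
- apply: (cdisc_path_continuous (cm_cont cm)) => [|t /andP[t0 t1]].
    by apply: continuous_subspaceT => t; exact: (pderiv_continuous (pderiv_affine _ _ _)).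
  have [->|tn0] := eqVneq t 0; first by rewrite /w mul0r addr0; exact/circle_cdisc.
  have [->|tn1] := eqVneq t 1; first by rewrite /w mul1r addrC subrK.
  by apply/disc_cdisc/chord_disc => //; rewrite !lt_neqAle eq_sym tn0 t0 tn1.
- exact: powR_within01.
Qed.

(** The lower bound for the difference quotient excludes [Z = X j]. It is applied to a point of the
    radius so close to [X j] that replacing [s Z] by [s (X j)] costs at most half of the bound. *)
Lemma map_corner_dist_ge j : exists (c d : R), [/\ 0 < c, 0 < d & forall S,
  (circle `\` range X) S -> cabs (S - X j) < d ->
  c * cabs (S - X j) `^ (beta j + 1) <= cabs (s S - s (X j))].
Proof.
set b := beta j.
have [c c0 [d d0 dqP]] := cm_dquot_corner cm j.
pose k := 3 `^ (- b) + 3 `^ b; have k0 : 0 < k by rewrite addr_gt0 ?powR_gt0.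
exists (c / k / 4), d; split => //; first by rewrite !divr_gt0.
move=> S SX Sd; set t := cabs (S - X j) in Sd *.
have t0 : 0 < t.
  by rewrite cabs_gt0 subr_eq0; apply/eqP => e; apply: SX.2; rewrite e; exists j.
have tb : 0 < t `^ (b + 1) by rewrite powR_gt0.
have e0 : 0 < c / k / 4 * t `^ (b + 1) by rewrite mulr_gt0// !divr_gt0.
have [d' d'0 d'P] := cm_cont cm (circle_cdisc (XC j)) e0.
(* The halves put [Z] strictly inside the continuity range [d'] and inside [d]; [t / 2] keeps
   [S - Z] comparable with [S - X j]. *)
pose e := Num.min (1 / 2) (Num.min (d' / 2) (Num.min (t / 2) (d / 2))).
have e00 : 0 < e by rewrite !lt_min !divr_gt0.
have [e1 e2 e3 e4] : [/\ e <= 1 / 2, e <= d' / 2, e <= t / 2 & e <= d / 2].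
  by rewrite /e !ge_min !lexx ?orbT.
pose Z := (1 - e)%:C * X j.
have r01 : 0 <= 1 - e <= 1 by lra.
have ZX : cabs (Z - X j) = e by rewrite /Z cabs_radial//; lra.
have Zd : disc Z.
  rewrite /disc/= /Z cabsM cabs_real (XC j) mulr1 ger0_norm; lra.
have Zc : (cdisc `\` range X) Z by split; [exact: disc_cdisc|exact: (disc_notin_corner XC Zd)].
have SZ : S != Z.
  by apply/eqP => h; have := SX.1; rewrite h => h1; have := Zd; rewrite /disc/= h1 ltxx.
have h1 := dqP S Z Zc (ltac:(lra)) SX (ltac:(rewrite -/t; lra)) SZ.
have h2 := d'P Z (disc_cdisc Zd) (ltac:(lra)).
have h3 : t <= 2 * cabs (S - Z).
  by have := cabs_dist_triangle Z S (X j); rewrite -/t; lra.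
have v0 : 0 < cabs (S - Z) by lra.
have dE : cabs (s S - s Z) = cabs (dquot s S Z) * cabs (S - Z).
  by rewrite /dquot cabs_div divfK// gt_eqF.
have h4 : c / k * t `^ b <= cabs (dquot s S Z).
  apply: le_trans h1; rewrite -mulrA ler_pM2l// -/t ler_pdivrMl//.
  by apply: powR_triple_le; lra.
have h5 : c / k * t `^ b * (t / 2) <= cabs (s S - s Z).
  rewrite dE; apply: ler_pM => //; last by lra.
  - by rewrite mulr_ge0 ?powR_ge0// divr_ge0// ltW.
  - by lra.
have h6 := cabs_dist_triangle (s (X j)) (s S) (s Z).
rewrite [cabs (s (X j) - s Z)]cabsB in h6.
have h7 : c / k * t `^ b * (t / 2) = 2 * (c / k / 4 * t `^ (b + 1)).
  rewrite powRD; last by apply/implyP => _; rewrite gt_eqF.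
  by rewrite powRr1 ?(ltW t0)//; field; rewrite gt_eqF.
lra.
Qed.

(* The two weights are comparable near the corner, and elsewhere both are bounded. *)
Lemma map_corner_weight_le (a : R) j : exists2 K : R, 0 < K & forall S, (circle `\` range X) S ->
  cabs (S - X j) `^ ((beta j + 1) * a) <= K * cabs (s S - s (X j)) `^ a /\
  cabs (s S - s (X j)) `^ a <= K * cabs (S - X j) `^ ((beta j + 1) * a).
Proof.
set b := beta j.
have [c [d [c0 d0 up]]] := map_corner_dist_le j.
have [c' [d' [c'0 d'0 lo]]] := map_corner_dist_ge j.
have [M MP] := cm_bounded cm.
pose dd := Num.min d d'; have dd0 : 0 < dd by rewrite lt_min d0.
have [e e0 eP] := cm_inv cm (circle_cdisc (XC j)) dd0.
pose M' := Num.max (2 * M) e.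
have M'0 : 0 < M' by rewrite lt_max e0 orbT.
pose kk (x y q : R) := x `^ q + y `^ q.
have kk0 x y q : 0 < x -> 0 < kk x y q by move=> x0; rewrite ltr_wpDr ?powR_ge0 ?powR_gt0.
pose q := (b + 1) * a.
(* [A1] and [A2] serve near the corner, where both distances obey the power law; [A3] and [A4] serve
   away from it, where both lie between positive bounds. *)
pose A1 := kk c^-1 c'^-1 a; pose A2 := kk c' c a.
pose A3 := kk dd 2 q * kk e M' (- a); pose A4 := kk e M' a * kk dd 2 (- q).
have [A10 A20 A30 A40] : [/\ 0 < A1, 0 < A2, 0 < A3 & 0 < A4].
  by rewrite /A3 /A4; split; rewrite ?mulr_gt0// ?kk0// ?invr_gt0.
exists (A1 + A2 + A3 + A4); first by lra.
move=> S SX; set t := cabs (S - X j); set u := cabs (s S - s (X j)).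
have t0 : 0 < t.
  by rewrite cabs_gt0 subr_eq0; apply/eqP => h; apply: SX.2; rewrite h; exists j.
have XS : S != X j by rewrite -subr_eq0 -cabs_gt0.
have S1 := circle_cdisc SX.1.
have u0 : 0 < u.
  rewrite cabs_gt0 subr_eq0; apply/eqP => h; move/eqP: XS; apply.
  exact: (map_inj_cdisc cm S1 (circle_cdisc (XC j)) h).
have [ua tq] : 0 <= u `^ a /\ 0 <= t `^ q by rewrite !powR_ge0.
suff : (t `^ q <= A1 * u `^ a /\ u `^ a <= A2 * t `^ q) \/
       (t `^ q <= A3 * u `^ a /\ u `^ a <= A4 * t `^ q).
  by move=> [|] [h1 h2]; split; [apply: (le_trans h1)|apply: (le_trans h2)|
    apply: (le_trans h1)|apply: (le_trans h2)]; apply: ler_wpM2r => //; lra.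
have [tdd|tdd] := ltP t dd; [left|right].
  have [td td'] : t < d /\ t < d' by move: tdd; rewrite lt_min => /andP.
  have h1 := up S S1 XS td; have h2 := lo S SX td'.
  rewrite -/t -/u -/b in h1 h2; rewrite /q powRrM; set y := t `^ (b + 1) in h1 h2 *.
  have y0 : 0 < y by rewrite powR_gt0.
  have E (k1 k2 z : R) : 0 < k1 -> 0 < k2 -> 0 < z -> (k1 * z) `^ a + (k2 * z) `^ a = kk k1 k2 a * z `^ a.
    by move=> k10 k20 z0; rewrite /kk !powRM ?(ltW k10) ?(ltW k20) ?(ltW z0)// mulrDl.
  split.
    rewrite /A1 -E ?invr_gt0//; apply: powR_le_endpoints; first by rewrite mulr_gt0// invr_gt0.
    by rewrite ler_pdivrMl// ler_pdivlMl// h1 h2.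
  rewrite /A2 -E//; apply: powR_le_endpoints; first by rewrite mulr_gt0.
  by rewrite h1 h2.
have tr : dd <= t <= 2 by rewrite tdd; exact: (cdisc_corner_le2 XC).
have ur : e <= u <= M'.
  apply/andP; split.
    by rewrite leNgt; apply/negP => h; have := eP S S1 h; rewrite ltNge tdd.
  rewrite le_max; apply/orP; left; apply: le_trans (ler_cabsB _ _) _.
  by have := MP S S1; have := MP (X j) (circle_cdisc (XC j)); lra.
have inv (x z : R) : 0 < x -> x `^ z * x `^ (- z) = 1.
  by move=> x0; rewrite -powRD ?subrr ?powRr0//; apply/implyP => _; rewrite gt_eqF.
have h1 := powR_le_endpoints q dd0 tr; have h2 := powR_le_endpoints (- a) e0 ur.
have h3 := powR_le_endpoints a e0 ur; have h4 := powR_le_endpoints (- q) dd0 tr.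
split.
  rewrite /A3 -mulrA -[t `^ q]mulr1; apply: ler_pM => //.
  by rewrite -(inv u a u0) mulrC; apply: ler_wpM2r.
rewrite /A4 -mulrA -[u `^ a]mulr1; apply: ler_pM => //.
by rewrite -[leLHS](inv t q t0) [leLHS]mulrC; apply: ler_wpM2r.
Qed.

End CornerDistance.

(** * Sums of moduli and localization of the Dini condition *)

Section ModuliSums.
Variable R : realType.
Local Notation mu := (@lebesgue_measure R).

Lemma modulusD (o1 o2 : R -> R) : modulus o1 -> modulus o2 -> modulus (fun x => o1 x + o2 x).
Proof.
move=> [p1 l1 [M1 b1] a1] [p2 l2 [M2 b2] a2]; split.
- by move=> x x0; rewrite addr_gt0 ?p1 ?p2.
- by move=> x y x0 xy; rewrite lerD ?l1 ?l2.
- by exists (M1 + M2) => x x0; rewrite lerD ?b1 ?b2.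
- by move=> x y x0 y0; rewrite addrACA lerD ?a1 ?a2.
Qed.

Lemma diniD (o1 o2 : R -> R) : modulus o1 -> modulus o2 -> dini o1 -> dini o2 ->
  dini (fun x => o1 x + o2 x).
Proof.
move=> m1 m2 d1 d2; rewrite /dini.
rewrite (_ : (\int[mu]_(x in _) _)%E = (\int[mu]_(x in `]0%R, 1%R])
    ((modulus_ext o1 x / x)%:E + (modulus_ext o2 x / x)%:E))%E).
  rewrite ge0_integralD//.
  - exact: lte_add_pinfty.
  - by move=> x _; rewrite lee_fin modulus_ext_quot_ge0.
  - by apply: measurable_funTS; exact: measurable_modulus_quot.
  - by move=> x _; rewrite lee_fin modulus_ext_quot_ge0.
  - by apply: measurable_funTS; exact: measurable_modulus_quot.
apply: eq_integral => x _; rewrite -EFinD -mulrDl; congr (_ / _)%:E.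
by rewrite /modulus_ext; case: ifP => // _; rewrite addr0.
Qed.

Lemma modulus_ext_integral_le (om : R -> R) (e e' : R) : modulus om -> e < e' ->
  (\int[mu]_(x in `]0%R, e]) (modulus_ext om x / x)%:E <=
   \int[mu]_(x in `]0%R, e'[) (om x / x)%:E)%E.
Proof.
move=> mom ee'.
rewrite [leRHS](_ : _ = (\int[mu]_(x in `]0%R, e'[) (modulus_ext om x / x)%:E)%E); last first.
  by apply: eq_integral => x; rewrite inE/= in_itv/= /modulus_ext => /andP[-> _].
apply: ge0_subset_integral => //.
- by apply: measurable_funTS; exact: measurable_modulus_quot.
- by move=> x _; rewrite lee_fin modulus_ext_quot_ge0.
- by move=> x /=; rewrite !in_itv/= => /andP[-> /le_lt_trans -> ].
Qed.

(** Away from 0 the quotient is bounded, because a modulus is bounded; only small arguments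
    matter. *)
Lemma dini_of_small (om : R -> R) (e : R) : modulus om -> 0 < e ->
  (\int[mu]_(x in `]0%R, e]) (modulus_ext om x / x)%:E < +oo)%E -> dini om.
Proof.
move=> mom e0 fin; rewrite /dini.
have [_ _ [M MP] _] := mom.
have mq (A : set R) : measurable_fun A (fun x => (modulus_ext om x / x)%:E).
  by apply: measurable_funTS; exact: measurable_modulus_quot.
have q0 (x : R) : (0 <= (modulus_ext om x / x)%:E)%E by rewrite lee_fin modulus_ext_quot_ge0.
apply: (@le_lt_trans _ _ (\int[mu]_(x in `]0%R, e] `|` `]e, (e + 1)%R]) (modulus_ext om x / x)%:E)%E).
  apply: ge0_subset_integral => //; [exact: measurableU|exact: mq|].
  move=> x /=; rewrite !in_itv/= => /andP[x0 x1].
  have [xe|ex] := leP x e; first by left; rewrite x0.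
  by right; rewrite /= (le_trans x1)// lerDr ltW.
rewrite ge0_integral_setU//; last first.
  rewrite disj_set2E; apply/eqP/seteqP; split => // x [] /=; rewrite !in_itv/=.
  by move=> /andP[_ xe] /andP[/lt_le_trans/(_ xe)]; rewrite ltxx.
  exact: mq.
apply: lte_add_pinfty => //.
apply: (@le_lt_trans _ _ (\int[mu]_(x in `]e, (e + 1)%R]) (M / e)%:E)%E).
  apply: ge0_le_integral => //.
  - exact: mq.
  - move=> x; rewrite /= in_itv/= => /andP[ex _]; have x0 := lt_trans e0 ex.
    rewrite lee_fin /modulus_ext x0; apply: ler_pM.
    + by case: mom => + _ _ _ => /(_ x x0)/ltW.
    + by rewrite invr_ge0 ltW.
    + exact: MP.
    + by rewrite lef_pV2 ?posrE// ltW.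
by rewrite integral_cst//= lebesgue_measure_itv/= lte_fin ltrDl ltr01 -EFinB -EFinM ltry.
Qed.

End ModuliSums.

(** * From the hypotheses of the theorem to [corner_map] *)

Section CornerMapOfHypotheses.
Variables (R : realType) (D : set (R * R)) (m : nat) (p : 'I_m -> R * R).
Variables (sigma : R[i] -> R[i]) (X : 'I_m -> R[i]) (beta : 'I_m -> R).
Local Notation C := R[i].
Local Notation mu := (@lebesgue_measure R).
Hypothesis D_bounded : bounded_set D.
Hypothesis m_gt0 : (0 < m)%N.
Hypothesis p_inj : injective p.
Hypothesis sigma_conf : conformal_ext D sigma.
Hypothesis sigma_X : forall j, circle (X j) /\ sigma (X j) = z_of (p j).
Hypothesis beta_bd : forall j, -1 < beta j <= 1.
Hypothesis ha : hyp_a X sigma beta.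
Hypothesis hb : hyp_b X sigma beta.
Implicit Types Z T S : C.

Let XC j : circle (X j). Proof. by have [] := sigma_X j. Qed.

Lemma corners_inj : injective X.
Proof.
move=> j k e; apply: p_inj; have := (sigma_X j).2; rewrite e (sigma_X k).2 => -[].
by case: (p j) => a b; case: (p k) => c d /= -> ->.
Qed.

Let calR_lb Z : has_lbound [set cabs (Z - X j) | j in [set: 'I_m]].
Proof. by exists 0 => _ [j _ <-]; exact: cabs_ge0. Qed.

Lemma calR_le Z j : calR X Z <= cabs (Z - X j).
Proof. by apply: (ge_inf (calR_lb Z)); exists j. Qed.

Lemma calR_ge Z (e : R) : (forall j, e <= cabs (Z - X j)) -> e <= calR X Z.
Proof.
move=> h; apply: lb_le_inf; first by exists (cabs (Z - X (Ordinal m_gt0))), (Ordinal m_gt0).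
by move=> _ [j _ <-].
Qed.

Lemma calR0_le j k : j != k -> calR0 X <= cabs (X j - X k).
Proof.
move=> jk; rewrite /calR0 ifT.
  apply: ge_inf; last by exists (j, k).
  by exists 0 => _ [q _ <-]; exact: cabs_ge0.
have := max_card (mem [set j; k]%SET); rewrite cards2 jk card_ord.
by move: (m) => [|[|]].
Qed.

Lemma prodX_bounded (b : 'I_m -> R) (e : R) : 0 < e -> exists2 K : R, 0 < K & forall Z, cdisc Z ->
  (forall j, e <= cabs (Z - X j)) -> prodX X b Z <= K.
Proof.
move=> e0; exists (\prod_j (e `^ b j + 2 `^ b j)).
  by apply: prodr_gt0 => j _; rewrite ltr_wpDr ?powR_ge0 ?powR_gt0.
move=> Z Z1 Ze; apply: ler_prod => j _; rewrite powR_ge0/=.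
by apply: powR_le_endpoints => //; rewrite Ze; exact: (cdisc_corner_le2 XC).
Qed.

Let s1 := deriv_cdisc X sigma.

Let s1_circle T : circle T -> s1 T = contour_deriv X sigma T.
Proof. by move=> T1; rewrite /s1 /deriv_cdisc T1 ltxx. Qed.

Let sigma_cont Z : cdisc Z -> forall e : R, 0 < e -> exists2 d : R, 0 < d &
  forall W, cdisc W -> cabs (W - Z) < d -> cabs (sigma W - sigma Z) < e.
Proof. by have [_ _ [/continuous_withinc h _]] := sigma_conf; exact: h. Qed.

Let sigma_inv Z : cdisc Z -> forall d : R, 0 < d -> exists2 e : R, 0 < e &
  forall W, cdisc W -> cabs (sigma W - sigma Z) < e -> cabs (W - Z) < d.
Proof.
move=> Z1 d d0; have [_ _ [_ [g [/continuous_withinc gc gK _]]]] := sigma_conf.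
have [sZ gZ] := gK Z Z1; have [e e0 eP] := gc _ sZ d d0.
exists e => // W W1 /eP h; have [sW gW] := gK W W1.
by have := h sW; rewrite gW gZ.
Qed.

Let sigma_bounded : exists M : R, forall Z, cdisc Z -> cabs (sigma Z) <= M.
Proof.
have [M [_ MP]] := D_bounded; have [_ sD _] := sigma_conf.
have DM q : D q -> cabs (z_of q) <= 2 * (M + 1).
  move=> Dq; have : `|q| <= M + 1 by apply: MP => //; rewrite ltrDl.
  rewrite prod_normE ge_max => /andP[h1 h2].
  by apply: le_trans (ler_cabs_ReIm _) _; have := lerD h1 h2; move/le_trans; apply; lra.
have dM Z : disc Z -> cabs (sigma Z) <= 2 * (M + 1).
  move=> Z1; have : D_z D (sigma Z) by rewrite -sD; exists Z.
  by move=> [q Dq <-]; exact: DM.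
exists (2 * (M + 1) + 1) => Z Z1.
have [Zd|Zc] := ltP (cabs Z) 1; first by have := dM Z Zd; lra.
have Z1' : circle Z by apply/eqP; rewrite eq_le Zc andbT.
have [d d0 dP] := sigma_cont Z1 ltr01.
pose e := Num.min (1 / 2) (d / 2).
have e0 : 0 < e by rewrite lt_min !divr_gt0.
have [e1 e2] : e <= 1 / 2 /\ e <= d / 2 by rewrite /e !ge_min !lexx orbT.
pose W := (1 - e)%:C * Z.
have WZ : cabs (W - Z) = e by rewrite /W cabs_radial//; lra.
have Wd : disc W by rewrite /disc/= /W cabsM cabs_real Z1' mulr1 ger0_norm; lra.
have h1 := dP W (disc_cdisc Wd) (ltac:(lra)); have h2 := dM W Wd.
have := lerB_cabs (sigma Z) (sigma W); rewrite [cabs (sigma Z - _)]cabsB; lra.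
Qed.

Let sigma_diff Z : disc Z -> cdiff setT sigma Z (s1 Z).
Proof.
move=> Z1; have [sd _ _] := sigma_conf; have := sd Z Z1.
rewrite /s1 /deriv_cdisc (_ : cabs Z < 1)// => dZ.
have lim : (fun h => h^-1 *: (sigma (h *: (1 : C) + Z) - sigma Z)) @ (0 : C)^' --> sigma^`() Z.
  by rewrite derive1E; exact: dZ.
move=> e e0; move/cvgcP : lim => /(_ e e0)/near_withinc[d d0 dP].
exists d => // w _ wd; have [->|wZ] := eqVneq w Z; first by rewrite !subrr mulr0 subr0 cabs0 mulr0.
have wz0 : w - Z != 0 by rewrite subr_eq0.
have := dP (w - Z); rewrite subr0 => /(_ wd wz0).
rewrite /GRing.scale/= mulr1 subrK => h.
rewrite (_ : _ - _ - _ = ((w - Z)^-1 * (sigma w - sigma Z) - (sigma^`()%classic Z)) * (w - Z)).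
  by rewrite cabsM; apply: ler_wpM2r; [exact: cabs_ge0|exact: ltW].
by rewrite mulrBl mulrAC mulVf// mul1r.
Qed.

(** The contour quotients avoid the corners, but near a regular [T] there are none, so the
    derivative exists along the whole circle. *)
Let sigma_diff_arc T : (circle `\` range X) T -> cdiff circle sigma T (s1 T).
Proof.
move=> TX; have [cq _ _ _] := ha; rewrite (s1_circle TX.1).
have := cq T TX; rewrite /contour_quotients => h e e0.
have /cvgcP/(_ e e0)/near_withinc[d d0 dP] : (fun S => (sigma S - sigma T) / (S - T)) @
  within ((circle `\` range X) `\ T) (nbhs T) --> contour_deriv X sigma T by exact: h.
have [d' d'0 d'P] := near_notin_corner TX.2.
exists (Num.min d d'); first by rewrite lt_min d0.
move=> w w1; rewrite lt_min => /andP[wd wd'].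
have [->|wT] := eqVneq w T; first by rewrite !subrr mulr0 subr0 cabs0 mulr0.
have wt0 : w - T != 0 by rewrite subr_eq0.
have := dP w wd; move=> /(_ _)h1.
have {}h1 : cabs ((sigma w - sigma T) / (w - T) - contour_deriv X sigma T) < e.
  by apply: h1; split; [split => //; exact: d'P|exact/eqP].
rewrite (_ : _ - _ - _ = ((sigma w - sigma T) / (w - T) - contour_deriv X sigma T) * (w - T)).
  by rewrite cabsM; apply: ler_wpM2r; [exact: cabs_ge0|exact: ltW].
by rewrite mulrBl divfK.
Qed.

Let s1_cont T : (circle `\` range X) T -> forall e : R, 0 < e ->
  exists2 d : R, 0 < d & forall S, (circle `\` range X) S -> cabs (S - T) < d ->
    cabs (s1 S - s1 T) < e.
Proof.
move=> TX e e0; have [_ /continuous_withinc cd _ _] := ha.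
have [d d0 dP] := cd T TX e e0; exists d => // S SX Sd.
by rewrite (s1_circle SX.1) (s1_circle TX.1); exact: dP.
Qed.

Let s1_le : exists2 c : R, 0 < c & forall Z, (cdisc `\` range X) Z ->
  cabs (s1 Z) <= c * prodX X beta Z.
Proof.
have [_ _ _ [c cP]] := ha; exists (`|c| + 1); first by rewrite ltr_wpDl.
move=> Z ZX; apply: le_trans (cP Z ZX) _; apply: ler_wpM2r.
  by apply: prodr_ge0 => j _; exact: powR_ge0.
by have := ler_norm c; lra.
Qed.

Let radial_cdisc T W : circle T -> (circle W \/ exists2 r : R, 0 <= r < 1 & W = r%:C * T) ->
  cdisc W /\ (circle `|` segment0 T) W.
Proof.
move=> T1 [W1|[r /andP[r0 r1] ->]]; first by split; [exact: circle_cdisc|left].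
split; first by rewrite /cdisc/= cabsM cabs_real T1 mulr1 ger0_norm// ltW.
by right; exists r => //; rewrite /= in_itv/= r0 ltW.
Qed.

(** Points [T] near [T0] may lie on either side of the threshold [r0], where different moduli apply;
    the sum of the two moduli serves both. The corner weight is bounded since everything stays away
    from the corners. *)
Let s1_osc T0 : (circle `\` range X) T0 -> exists (omega : R -> R) (A rho : R),
  [/\ modulus omega, dini omega, 0 <= A, 0 < rho &
    forall T, circle T -> cabs (T - T0) <= rho ->
      (forall S, circle S -> cabs (S - T) <= rho -> (circle `\` range X) S) /\
      osc_at s1 omega A rho T].
Proof.
move=> TX0; have [r0 [ o1 [ o2 [[/andP[r00 r0c] m1 m2] [i1 [k k0 i2] [c2 c20 h2] [c1 c10 h1] _]]]]] := hb.
have [|e e0 eP] := @finite_pos_lower_bound R 'I_m xpredT (fun j => cabs (T0 - X j)).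
  by move=> j _; rewrite cabs_gt0 subr_eq0; apply/eqP => e; apply: TX0.2; exists j.
(* If [T] is within [rho] of [T0] and [S] within [rho] of [T], then [S] is still at distance at
   least [6 * rho] from every corner. *)
pose rho := e / 8; have rho0 : 0 < rho by rewrite divr_gt0.
have [K K0 KP] := prodX_bounded beta rho0.
have [[p1 l1 _ _] [p2 l2 _ _]] := (m1, m2).
have [ o1r o2r] : 0 < o1 rho /\ 0 < o2 rho by rewrite p1 ?p2.
have D1 : dini o1.
  apply: le_lt_trans i1; apply: modulus_ext_integral_le => //; first by rewrite ltr1n.
have D2 : dini o2.
  have r8 : 0 < r0 / 8 by rewrite divr_gt0.
  apply: (dini_of_small m2 r8); have r84 : r0 / 8 < r0 / 4 by lra.
  apply: le_lt_trans (modulus_ext_integral_le m2 r84) _.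
  by apply: lt_trans (i2 (r0 / 4) _) (ltry _); lra.
exists (fun x => o1 x + o2 x), (c1 / o1 rho * K + c2 / o2 rho * K), rho; split => //.
- exact: modulusD.
- exact: diniD.
- by rewrite addr_ge0 ?mulr_ge0 ?divr_ge0 ?invr_ge0// ltW.
move=> T T1 Tr.
have TXj j : 7 * rho <= cabs (T - X j).
  by have := cabs_dist_triangle T T0 (X j); have := eP j isT; rewrite cabsB /rho in Tr *; lra.
have far S j : cabs (S - T) <= rho -> 6 * rho <= cabs (S - X j).
  by move=> Sr; have := cabs_dist_triangle S T (X j); have := TXj j; rewrite cabsB in Sr; lra.
have nX S : cabs (S - T) <= rho -> ~ range X S.
  by move=> /far h [j _ e']; have := h j; rewrite e' subrr cabs0; lra.
split=> [S S1 Sr|W WT WnT Wr]; first by split => //; exact: nX.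
have [Wc WS] := radial_cdisc T1 WT.
have W0 : 0 < cabs (W - T) by rewrite cabs_gt0 subr_eq0.
have cT : 7 * rho <= calR X T by exact: calR_ge.
have Tp : (circle `\` range X) T by split => //; apply: nX; rewrite subrr cabs0 ltW.
have Wb : prodX X beta W <= K by apply: KP => // j; have := far W j Wr; lra.
have pW : 0 <= prodX X beta W by apply: prodr_ge0 => j _; exact: powR_ge0.
have Wr' : cabs (W - T) <= calR X T / 2 by lra.
have gen c (o : R -> R) : 0 < c -> (forall x, 0 < x -> 0 < o x) ->
    (forall x y, 0 < x -> x <= y -> o x <= o y) ->
    cabs (s1 W - s1 T) <= c * (o (cabs (W - T)) / o (calR X T / 2)) * prodX X beta W ->
    cabs (s1 W - s1 T) <= c / o rho * K * o (cabs (W - T)).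
  move=> c0 op ol h; apply: (le_trans h).
  rewrite (_ : c / o rho * K * o (cabs (W - T)) = c * (o (cabs (W - T)) / o rho) * K); last by ring.
  have ow := op _ W0.
  apply: ler_pM => //; first by rewrite mulr_ge0 ?divr_ge0 ?(ltW c0) ?(ltW ow)// ltW// op//; lra.
  rewrite ler_pM2l// ler_pM2l// lef_pV2 ?posrE ?op//; last by lra.
  by apply: ol => //; lra.
have [q1 q2] : 0 <= c1 / o1 rho * K /\ 0 <= c2 / o2 rho * K.
  by rewrite !mulr_ge0 ?invr_ge0// ltW.
have [ ow1 ow2] : 0 < o1 (cabs (W - T)) /\ 0 < o2 (cabs (W - T)) by rewrite p1 ?p2.
have t1 : 0 <= c1 / o1 rho * K * o2 (cabs (W - T)) by rewrite mulr_ge0// ltW.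
have t2 : 0 <= c2 / o2 rho * K * o1 (cabs (W - T)) by rewrite mulr_ge0// ltW.
have t3 : 0 <= c1 / o1 rho * K * o1 (cabs (W - T)) by rewrite mulr_ge0// ltW.
have t4 : 0 <= c2 / o2 rho * K * o2 (cabs (W - T)) by rewrite mulr_ge0// ltW.
rewrite mulrDl !mulrDr.
have [near|far'] := leP (calR X T) r0.
  have := gen c2 o2 c20 p2 l2 (h2 T W (conj Tp near) WS WnT Wr'); lra.
have := gen c1 o1 c10 p1 l1 (h1 T W (conj T1 far') WS WnT Wr'); lra.
Qed.

(** Near [X j] the other corners are at distance at least [r0], so [calR X T] is the distance to
    [X j] and the first oscillation estimate applies. Within half that distance the weight is
    comparable with its value at [T]. *)
Let s1_osc_corner j : exists (omega : R -> R) (A r1 k : R),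
  [/\ modulus omega, 0 <= A, 0 < r1 <= 1,
    forall e, 0 < e <= r1 ->
      (\int[mu]_(x in `]0%R, e]) (modulus_ext omega x / x)%:E <= (k * omega e)%:E)%E &
    forall T, circle T -> T != X j -> cabs (T - X j) <= r1 ->
      (forall S, circle S -> cabs (S - T) <= cabs (T - X j) / 2 -> (circle `\` range X) S) /\
      osc_at s1 omega (A * cabs (T - X j) `^ beta j / omega (cabs (T - X j) / 2))
        (cabs (T - X j) / 2) T].
Proof.
have [r0 [ o1 [ o2 [[/andP[r00 r0c] m1 m2] [_ [k k0 i2] [c c0 h2] _ _]]]]] := hb.
have [cl cl1 [d d0 [_ near]]] := prodX_local XC corners_inj beta.
have cl0 : 0 < cl by exact: lt_le_trans cl1.
have [p2 l2 _ a2] := m2.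
set b := beta j.
pose kap := 3 `^ (- b) + 3 `^ b; have kap0 : 0 < kap by rewrite addr_gt0 ?powR_gt0.
pose r1 := Num.min (Num.min 1 (r0 / 8)) (d / 2).
have r10 : 0 < r1 by rewrite /r1 !lt_min ltr01 !divr_gt0.
have [q1 q2 q3] : [/\ r1 <= 1, r1 <= r0 / 8 & r1 <= d / 2] by rewrite /r1 !ge_min !lexx ?orbT.
exists o2, (c * cl * kap), r1, (2 * k); split => //.
- by rewrite !mulr_ge0// ltW.
- by rewrite r10.
- move=> e /andP[e0 er].
  (* The hypothesis integrates over an open interval. Passing to [2 * e] includes the end point [e],
     and semi-additivity pays for it with a factor 2. *)
  have e2 : e < 2 * e by lra.
  apply: le_trans (modulus_ext_integral_le m2 e2) _.
  apply: le_trans (ltW (i2 (2 * e) _)) _; first by lra.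
  rewrite lee_fin -mulrA mulrCA ler_pM2l//.
  by rewrite (_ : 2 * e = e + e); [have := a2 e e e0 e0; lra|ring].
move=> T T1 TX; set h := cabs (T - X j) => hr.
have h0 : 0 < h by rewrite cabs_gt0 subr_eq0.
have sep k' : k' != j -> r0 * 4 < cabs (X k' - X j).
  by move=> kj; have := calR0_le kj; lra.
have far S k' : k' != j -> cabs (S - T) <= h / 2 -> r0 <= cabs (S - X k').
  move=> kj Sr; have := sep k' kj; have := cabs_dist_triangle S (X k') (X j).
  have := cabs_dist_triangle T S (X j); rewrite -/h [cabs (X k' - S)]cabsB.
  move: hr q2 h0 Sr r00; lra.
have nX S : cabs (S - T) <= h / 2 -> ~ range X S.
  move=> Sr [k' _ e]; have [kj|kj] := eqVneq k' j.
    by move: Sr; rewrite -e kj cabsB -/h; lra.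
  by have := far S k' kj Sr; rewrite e subrr cabs0; lra.
split=> [S S1 Sr|W WT WnT Wr]; first by split => //; exact: nX.
have [Wc WS] := radial_cdisc T1 WT.
have TT : cabs (T - T) <= h / 2 by rewrite subrr cabs0 divr_ge0// ltW.
have cR : calR X T = h.
  apply/le_anti; rewrite calR_le; apply: calR_ge => k'.
  have [->//|kj] := eqVneq k' j; have := far T k' kj TT; lra.
have Tp : (circle `\` range X) T by split => //; exact: nX.
have cT : calR X T <= r0 by rewrite cR; lra.
have Wr' : cabs (W - T) <= calR X T / 2 by rewrite cR.
have W0 : 0 < cabs (W - T) by rewrite cabs_gt0 subr_eq0.
have Wj : h / 3 <= cabs (W - X j) <= 3 * h.
  have e1 := cabs_dist_triangle T W (X j); have e2 := cabs_dist_triangle W T (X j).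
  by rewrite [cabs (T - W)]cabsB in e2; rewrite -/h in e1 e2; lra.
have Wd : cabs (W - X j) < d.
  by have e1 := cabs_dist_triangle T W (X j); rewrite -/h in e1; lra.
have [_ pW] := near W j Wc Wd.
have pW2 : prodX X beta W <= cl * (kap * h `^ b).
  by apply: (le_trans pW); rewrite ler_pM2l//; exact: powR_triple_le.
have := h2 T W (conj Tp cT) WS WnT Wr'; rewrite cR => /le_trans; apply.
rewrite (_ : c * cl * kap * h `^ b / o2 (h / 2) * o2 (cabs (W - T)) =
  c * (o2 (cabs (W - T)) / o2 (h / 2)) * (cl * (kap * h `^ b))); last by ring.
have ow := p2 _ W0; have oh : 0 < o2 (h / 2) by apply: p2; rewrite divr_gt0.
by apply: ler_wpM2l => //; rewrite mulr_ge0 ?divr_ge0// ltW.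
Qed.

Let s1_corner j : exists2 c : R, 0 < c & exists2 r1 : R, 0 < r1 &
  forall Z, cdisc Z -> Z != X j -> cabs (Z - X j) <= r1 ->
    ~ range X Z /\ cabs (s1 Z) <= c * cabs (Z - X j) `^ beta j.
Proof.
have [cl cl1 [d d0 [_ near]]] := prodX_local XC corners_inj beta.
have [c c0 cP] := s1_le.
exists (c * cl); first by rewrite mulr_gt0// (lt_le_trans _ cl1).
exists (d / 2); first by rewrite divr_gt0.
move=> Z Z1 ZX Zd; have Zd' : cabs (Z - X j) < d by lra.
have [far pZ] := near Z j Z1 Zd'.
have nX : ~ range X Z.
  move=> [k _ e]; have [kj|kj] := eqVneq k j; first by move/eqP: ZX; rewrite -e kj.
  by have := far k kj; rewrite e subrr cabs0; lra.
split => //; apply: le_trans (cP Z (conj Z1 nX)) _.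
by rewrite -mulrA ler_pM2l.
Qed.

Lemma corner_map_of_hypotheses : corner_map X beta sigma (deriv_cdisc X sigma).
Proof.
split => //.
- by move=> T TX; rewrite /deriv_cdisc TX.1 ltxx; have [_ _ h _] := ha; exact: h.
- move=> j; have [r0 [ o1 [ o2 [[/andP[r00 _] _ _] [_ _ _ _ [c c0 h]]]]]] := hb.
  by exists c => //; exists r0 => // S Z *; exact: h.
Qed.

End CornerMapOfHypotheses.

(** * Change of variable from the parametrized contour to the circle *)

Section BoundaryParametrization.
Variables (R : realType) (m : nat) (X : 'I_m -> R[i]) (beta : 'I_m -> R).
Variables (s s1 : R[i] -> R[i]).
Local Notation C := R[i].
Local Notation mu := (@lebesgue_measure R).
Local Notation I := (`[0, 2 * pi]%classic : set R).
Hypothesis cm : corner_map X beta s s1.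
Implicit Types Z T S : C.

Let XC : forall j, circle (X j) := cm_circle cm.

(* [gam] runs through the image of the circle, with velocity [v] off the finitely many
   values of the parameter [t k], where it passes through the corners. *)
Record positive_contour (gam v : R -> C) (t : nat -> R) : Prop := {
  pc_t0 : t 0%N = 0;
  pc_tm : t m = 1;
  pc_lt : forall k, (k < m)%N -> t k < t k.+1;
  pc_cont : forall u, 0 <= u <= 1 -> forall e : R, 0 < e -> exists2 d : R, 0 < d &
    forall u', 0 <= u' <= 1 -> `|u' - u| < d -> cabs (gam u' - gam u) < e;
  pc_end : gam 0 = gam 1;
  pc_inj : forall u u', 0 <= u < 1 -> 0 <= u' < 1 -> gam u = gam u' -> u = u';
  pc_img : forall u, 0 <= u <= 1 -> exists2 S, circle S & s S = gam u;
  pc_onto : forall S, circle S -> exists2 u, 0 <= u <= 1 & gam u = s S;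
  pc_corner : forall j, exists2 k, (k < m)%N & gam (t k) = s (X j);
  pc_deriv : forall k u, (k < m)%N -> t k < u < t k.+1 ->
    [/\ pderiv gam u (v u), v u != 0 & {for u, continuous v}];
  pc_orient : forall u, 0 < u < 1 -> (forall k, (k <= m)%N -> u != t k) ->
    \forall e \near (0 : R)^'+, exists2 Z, disc Z & s Z = gam u + e%:C * ('i * v u) }.

Section BoundaryArgument.
Variables (gam v : R -> C) (t : nat -> R).
Hypothesis pc : positive_contour gam v t.

Let arc u := exists2 k, (k < m)%N & t k < u < t k.+1.

Lemma contour_t_mono k l : (k <= l)%N -> (l <= m)%N -> t k <= t l.
Proof.
elim: l => [|l IHl]; first by rewrite leqn0 => /eqP ->.
rewrite leq_eqVlt => /orP[/eqP ->//|kl] lm; apply: (le_trans (IHl kl (ltnW lm))).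
exact/ltW/(pc_lt pc).
Qed.

Lemma contour_t_bd k : (k <= m)%N -> 0 <= t k <= 1.
Proof. by move=> km; rewrite -(pc_t0 pc) -(pc_tm pc) !contour_t_mono. Qed.

Lemma contour_m_gt0 : (0 < m)%N.
Proof.
rewrite lt0n; apply/eqP => m0; have := pc_t0 pc; have := pc_tm pc; rewrite m0 => -> /eqP.
by rewrite oner_eq0.
Qed.

Let arc01 u : arc u -> 0 < u < 1.
Proof.
move=> [k km /andP[k1 k2]].
have /andP[a0 _] := contour_t_bd (ltnW km); have /andP[_ a1] := contour_t_bd km.
by rewrite (le_lt_trans a0)//= (lt_le_trans k2).
Qed.

Let arc_neq u k : arc u -> (k <= m)%N -> u != t k.
Proof.
move=> [l lm /andP[l1 l2]] km; have [kl|lk] := leqP k l.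
  by rewrite gt_eqF// (le_lt_trans _ l1)// contour_t_mono// ltnW.
by rewrite lt_eqF// (lt_le_trans l2)// contour_t_mono.
Qed.

(* The argument of the point of the circle which [s] maps to [gam u]. *)
Lemma contour_arg_exists : exists (a0 : R) (th : R -> R),
  [/\ forall u, 0 < u < 1 -> a0 < th u < a0 + 2 * pi /\ s (expi (th u)) = gam u,
      s (expi a0) = gam 0, th 0 = a0 & th 1 = a0 + 2 * pi].
Proof.
have [|T0 T01 T0E] := pc_img pc (u := 0); first by rewrite lexx ler01.
have [a0 _ a0E] := circle_argP T01.
have ex u : exists th : R, 0 < u < 1 -> a0 < th < a0 + 2 * pi /\ s (expi th) = gam u.
  have [u01|] := pselect (0 < u < 1); last by move=> h; exists 0.
  have /andP[u0 u1] := u01.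
  have [|S S1 SE] := pc_img pc (u := u); first by rewrite !ltW.
  have [b /andP[b1 b2] bE] : exists2 b, - pi < b <= pi & expi b = S / T0 :> C.
    by apply: circle_argP; rewrite /circle/= cabs_div S1 T01 divr1.
  have bS : expi (a0 + b) = S by rewrite expiD a0E bE mulrC divfK// circle_neq0.
  have b0 : b != 0.
    apply/eqP => e; have : gam u = gam 0 by rewrite -SE -T0E -bS e addr0 a0E.
    move=> /(pc_inj pc) h; have : u = 0 by apply: h; rewrite ?lexx ?ltr01 ?(ltW u0) ?u1.
    by move=> e'; move: u0; rewrite e' ltxx.
  have [bp|bn] := ltP 0 b.
    exists (a0 + b) => _; rewrite bS; split => //; rewrite ltrDl bp ltrD2l/=; lra.
  exists (a0 + b + 2 * pi) => _; rewrite expiD2pi bS; split => //.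
  have bn' : b < 0 by rewrite lt_neqAle b0.
  by rewrite -addrA ltrDl ltrD2l -ltrBrDr subrr bn' andbT; lra.
have [th thP] := choice ex.
(* Outside []0, 1[] the chosen values are overridden, so that [th] begins at [a0] and ends one full
   turn later. *)
exists a0, (fun u => if u <= 0 then a0 else if 1 <= u then a0 + 2 * pi else th u); split.
- move=> u /andP[u0 u1]; rewrite leNgt u0 leNgt u1 /=; apply: thP.
  by rewrite u0.
- by rewrite a0E.
- by rewrite lexx.
- by rewrite lexx leNgt ltr01.
Qed.

Variables (a0 : R) (th : R -> R).
Hypothesis thP : forall u, 0 < u < 1 -> a0 < th u < a0 + 2 * pi /\ s (expi (th u)) = gam u.
Hypothesis a0P : s (expi a0) = gam 0.
Hypothesis th0 : th 0 = a0.
Hypothesis th1 : th 1 = a0 + 2 * pi.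

Let cdisc_expi x : cdisc (expi x : C). Proof. exact/circle_cdisc/circle_expi. Qed.

Let expi_itv_inj x y : a0 < x < a0 + 2 * pi -> a0 < y < a0 + 2 * pi -> expi x = expi y :> C -> x = y.
Proof. by move=> hx hy; apply: expi_inj; rewrite ltr_norml; lra. Qed.

Lemma contour_arg_inj u w : 0 < u < 1 -> 0 < w < 1 -> th u = th w -> u = w.
Proof.
move=> u01 w01 e; apply: (pc_inj pc).
- by case/andP: u01 => /ltW -> ->.
- by case/andP: w01 => /ltW -> ->.
by rewrite -(thP u01).2 -(thP w01).2 e.
Qed.

Lemma contour_arg_onto x : a0 < x < a0 + 2 * pi -> exists2 u, 0 < u < 1 & th u = x.
Proof.
move=> hx; have [u /andP[u0 u1] ue] := pc_onto pc (circle_expi x).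
have ex0 : expi x != expi a0 :> C.
  apply/eqP => e; have : x = a0 by apply: expi_inj e; rewrite ltr_norml; lra.
  by case/andP: hx => h _ e'; move: h; rewrite e' ltxx.
have nend : gam u != gam 0.
  apply/eqP => e; move/eqP: ex0; apply.
  by apply: (map_inj_cdisc cm (cdisc_expi x) (cdisc_expi a0)); rewrite -ue e a0P.
have u01 : 0 < u < 1.
  rewrite !lt_neqAle u0 u1 !andbT; apply/andP; split; apply/eqP => e; move/eqP: nend; apply.
    by rewrite -e.
  by rewrite e -(pc_end pc).
exists u => //; have [h1 h2] := thP u01; apply: (expi_itv_inj h1 hx).
by apply: (map_inj_cdisc cm (cdisc_expi _) (cdisc_expi _)); rewrite h2.
Qed.

(** The points of the circle move continuously. A jump of the argument by [2 * pi] is impossible,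
    since [th u] lies at a positive distance [mg] from both ends of the allowed interval. *)
Lemma contour_arg_cont u : 0 < u < 1 -> {for u, continuous th}.
Proof.
move=> u01; have /andP[u0 u1] := u01; have [h1 h2] := thP u01.
apply/cvgrPdist_lt => e e0.
pose mg := Num.min (th u - a0) (a0 + 2 * pi - th u).
have /andP[h3 h4] := h1.
have mg0 : 0 < mg by rewrite lt_min !subr_gt0 h3.
have [m1 m2] : mg <= th u - a0 /\ mg <= a0 + 2 * pi - th u by rewrite /mg !ge_min !lexx orbT.
pose dl := Num.min e mg / 3.
have dl0 : 0 < dl by rewrite divr_gt0// lt_min e0.
have [dl1 dl2] : 3 * dl <= e /\ 3 * dl <= mg.
  by rewrite /dl mulrC divfK//; split; rewrite ge_min lexx ?orbT.
have [d d0 dP] := cm_inv cm (cdisc_expi (th u)) dl0.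
have u01' : 0 <= u <= 1 by rewrite !ltW.
have [d' d'0 d'P] := pc_cont pc u01' d0.
have : \forall w \near u, `|u - w| < Num.min d' (Num.min u (1 - u)).
  apply/nbhs_ballP; exists (Num.min d' (Num.min u (1 - u))) => //=.
  by rewrite !lt_min d'0 u0 subr_gt0.
apply: filterS => w; rewrite !lt_min => /and3P[w1 w2 w3].
have w01 : 0 < w < 1 by move: w2 w3; rewrite !ltr_norml; lra.
have [g1 g2] := thP w01.
have : cabs (expi (th w) - expi (th u)) < dl.
  apply: dP => //; rewrite g2 h2; apply: d'P; last by rewrite distrC.
  by case/andP: w01 => /ltW -> /ltW ->.
have [near|far] := leP `|th w - th u| pi.
  by move=> hc; rewrite distrC; have := chord_ge near; lra.
have /andP[g3 g4] := g1.
(* If the arguments were more than [pi] apart, the shifted one would be within [pi] but at least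
   [mg] away, and [chord_ge] would contradict the closeness of the points. *)
pose k := if th u < th w then th w - 2 * pi else th w + 2 * pi.
have ek : expi k = expi (th w) :> C.
  by rewrite /k; case: ifP => _; [rewrite -[LHS]expiD2pi subrK|rewrite expiD2pi].
have kb : mg <= `|k - th u| <= pi.
  move: far; rewrite /k; case: (ltrP (th u) (th w)) => huw.
    move=> far; rewrite ltr0_norm; last by lra.
    by apply/andP; split; lra.
  move=> far; rewrite gtr0_norm; last by lra.
  by apply/andP; split; lra.
case/andP: kb => k1 k2; have := chord_ge k2; rewrite ek => c1 c2; exfalso.
lra.
Qed.

Lemma arc_corner_free u : arc u -> (circle `\` range X) (expi (th u)).
Proof.
move=> au; split; first exact: circle_expi.
have u01 := arc01 au; move=> [j _ e]; have [k km ke] := pc_corner pc j.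
have : gam u = gam (t k) by rewrite ke e (thP u01).2.
have /andP[t1 _] := contour_t_bd (ltnW km).
have t2 : t k < 1 by rewrite -(pc_tm pc); apply: lt_le_trans (pc_lt pc km) _; exact: contour_t_mono.
have hu : 0 <= u < 1 by case/andP: u01 => /ltW -> ->.
have ht : 0 <= t k < 1 by rewrite t1.
move=> /(pc_inj pc hu ht) e'; have := arc_neq au (ltnW km); by rewrite e' eqxx.
Qed.

Definition circle_velocity (x : R) : C := 'i * expi x * s1 (expi x).

(** By the chain rule this is the derivative of [th]; [arg_deriv] shows that on the arcs the
    quotient is real, so no information is lost by [Re]. *)
Definition arg_speed u : R := Re (v u / circle_velocity (th u)).

Lemma circle_velocity_neq0 x : (circle `\` range X) (expi x) -> circle_velocity x != 0.
Proof.
move=> Sx; rewrite !mulf_neq0//; last exact: (cm_deriv_neq0 cm Sx).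
- by rewrite -cabs_gt0 cabs_i.
- exact: expi_neq0.
Qed.

Lemma pderiv_map_expi x : (circle `\` range X) (expi x) ->
  pderiv (fun y => s (expi y)) x (circle_velocity x).
Proof.
move=> Sx; rewrite /circle_velocity mulrC.
apply: (pderiv_comp (pderiv_expi1 x) (cm_diff_arc cm Sx)).
by exists 1 => // h _; exact: circle_expi.
Qed.

(** [gam] and the map from an angle [x] to [s (expi x)] are both differentiable, the latter with
    nonzero velocity [D]. Since [gam] is [s (expi (th _))], comparing increments gives
    [dx * D = h * v u] up to small errors, which can be solved for [dx]. *)
Lemma arg_deriv u : arc u -> is_derive u 1 th (arg_speed u) /\
  v u = (arg_speed u)%:C * circle_velocity (th u).
Proof.
move=> au; have u01 := arc01 au; have Sx := arc_corner_free au.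
have [k km ku] := au; have [dg v0 _] := pc_deriv pc km ku.
have ds := pderiv_map_expi Sx; have D0 := circle_velocity_neq0 Sx.
set D := circle_velocity (th u) in ds D0 *; set x := th u in ds *.
pose q := v u / D; have vq : v u = q * D by rewrite /q divfK.
have Dp : 0 < cabs D by rewrite cabs_gt0.
have /andP[u0 u1] := u01.
pose L := 2 * (cabs q + 1).
have L0 : 0 < L by rewrite mulr_gt0// ltr_wpDl ?cabs_ge0.
have key e : 0 < e -> exists2 d : R, 0 < d & forall h : R, `|h| < d ->
    cabs ((th (u + h) - x)%:C - h%:C * q) <= e * `|h|.
  move=> e0.
  pose e1 := Num.min (1 / 2) (Num.min (e / 2) (e / 2 / L)).
  have e10 : 0 < e1 by rewrite !lt_min !divr_gt0.
  have [q1 q2 q3] : [/\ e1 <= 1 / 2, e1 <= e / 2 & e1 <= e / 2 / L].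
    by rewrite /e1 !ge_min !lexx ?orbT.
  have e1D : 0 < e1 * cabs D by rewrite mulr_gt0.
  have [d1 d10 d1P] := dg _ e1D; have [d2 d20 d2P] := ds _ e1D.
  have /cvgrPdist_lt/(_ _ d20)/nbhs_ballP[d3 /= d30 d3P] := contour_arg_cont u01.
  exists (Num.min d1 (Num.min d3 (Num.min u (1 - u)))).
    by rewrite !lt_min d10 d30 u0 subr_gt0.
  move=> h; rewrite !lt_min => /and4P[h1 h3 hu hu'].
  have w01 : 0 < u + h < 1 by move: hu hu'; rewrite !ltr_norml; lra.
  have hx : `|th (u + h) - x| < d2.
    rewrite distrC; apply: d3P; rewrite /ball/= opprD addrA subrr add0r normrN.
    exact: h3.
  have A1 := d1P h h1; have A2 := d2P _ hx; rewrite [x + _]addrC subrK in A2.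
  rewrite (thP w01).2 (thP u01).2 in A2.
  set dx := th (u + h) - x in A2 *.
  have tri : cabs (dx%:C * D - h%:C * v u) <= e1 * cabs D * `|dx| + e1 * cabs D * `|h|.
    apply: le_trans (cabs_dist_triangle (gam (u + h) - gam u) _ _) _.
    by rewrite cabsB lerD.
  have B : cabs (dx%:C - h%:C * q) <= e1 * `|dx| + e1 * `|h|.
    rewrite -(ler_pM2r Dp) -cabsM mulrBl -mulrA -vq; apply: (le_trans tri).
    by rewrite le_eqVlt; apply/orP; left; apply/eqP; ring.
  (* A preliminary Lipschitz bound turns the error proportional to [dx] into one proportional to
     [h]. *)
  have dxL : `|dx| <= L * `|h|.
    have c1 : `|dx| <= cabs (dx%:C - h%:C * q) + cabs (h%:C * q).
      have := ler_cabsD (dx%:C - h%:C * q) (h%:C * q).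
      by rewrite subrK cabs_real.
    rewrite cabsM cabs_real in c1.
    have nh := normr_ge0 h; have nx := normr_ge0 dx.
    have c2 : e1 * `|dx| <= 1 / 2 * `|dx| by rewrite ler_wpM2r.
    have c3 : e1 * `|h| <= 1 / 2 * `|h| by rewrite ler_wpM2r.
    rewrite /L; move: c1 c2 c3 nh nx B; rewrite [`|h| * _]mulrC.
    lra.
  apply: (le_trans B).
  have c2 : e1 * `|dx| <= e / 2 / L * (L * `|h|) by apply: ler_pM => //; exact: ltW.
  rewrite mulrA divfK ?gt_eqF// in c2.
  have c3 : e1 * `|h| <= e / 2 * `|h| by rewrite ler_wpM2r.
  by move: c2 c3; set hn := `|h|; lra.
(* [q] is a limit of real difference quotients. *)
have qr : Im q = 0.
  apply/eqP; rewrite -normr_le0; apply/ler_addgt0Pl => e e0; rewrite addr0.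
  have [d d0 dP] := key e e0; pose h := d / 2.
  have h0 : 0 < h by rewrite divr_gt0.
  have hd : `|h| < d by rewrite gtr0_norm// /h; lra.
  have := le_trans (ler_norm_Im _) (dP h hd).
  rewrite ImB ImMr /= sub0r normrN normrM mulrC; rewrite ler_pM2r//.
  by rewrite normr_gt0 gt_eqF.
have qE : (arg_speed u)%:C = q by apply: eq_complexP; rewrite //= qr.
split; last by rewrite qE vq.
apply/is_derive_epsP => e e0; have [d d0 dP] := key e e0; exists d => // h hd.
have := dP h hd; rewrite -qE -realcM -realcB cabs_real.
by [].
Qed.

Lemma arg_speed_neq0 u : arc u -> arg_speed u != 0.
Proof.
move=> au; have [_ e] := arg_deriv au; apply/eqP => e0.
have [k km ku] := au; have [_ v0 _] := pc_deriv pc km ku.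
by move: v0; rewrite e e0 mul0r eqxx.
Qed.

Lemma arg_speed_cont u : arc u -> {for u, continuous arg_speed}.
Proof.
move=> au; have [k km ku] := au; have [_ _ vc] := pc_deriv pc km ku.
have Sx := arc_corner_free au.
have tc : {for u, continuous th} by apply: contour_arg_cont; exact: arc01.
have cD : {for th u, continuous circle_velocity}.
  have ce : {for th u, continuous (fun y : R => 'i * expi y : C)}.
    exact: (ccontinuousM (@ccontinuous_cst _ _ _ _) (@expi_continuous R (th u))).
  exact: (ccontinuousM ce (cont_off_deriv cm Sx.2)).
have cDt : {for u, continuous (fun y => circle_velocity (th y))}.
  exact: (continuous_comp tc cD).
have D0 : (fun y => circle_velocity (th y)) u != 0 by exact: circle_velocity_neq0.
by have /cvg_ReImP[] := ccontinuous_div (g := fun y : R => circle_velocity (th y)) D0 vc cDt.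
Qed.

(** The local estimates around the projection of [Z] give the derivative at [S] for an unrestricted
    approach from inside the disc. *)
Lemma dquot_boundary S : (circle `\` range X) S -> forall e : R, 0 < e ->
  exists2 d : R, 0 < d & forall Z, disc Z -> cabs (Z - S) < d -> cabs (dquot s S Z - s1 S) <= e.
Proof.
move=> SX e e0; have [om [A [rho [mom dom A0 rho0 oscP]]]] := cm_osc cm SX.
have e2 : 0 < e / 2 by rewrite divr_gt0.
have [d1 d10 d1P] := cm_deriv_cont cm SX e2.
have A1 : 0 < 13 * A + 1 by rewrite ltr_wpDl// mulr_ge0.
have eA : 0 < e / 2 / (13 * A + 1) by rewrite !divr_gt0.
have [d2 d20 d2P] := dini_modulus_small mom dom eA.
pose d := Num.min (Num.min (1 / 2) (rho / 4)) (Num.min (d1 / 4) (d2 / 4)).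
have [dh dr da db] : [/\ d <= 1 / 2, d <= rho / 4, d <= d1 / 4 & d <= d2 / 4].
  by rewrite /d !ge_min !lexx ?orbT.
exists d; first by rewrite /d !lt_min !divr_gt0.
move=> Z Z1 Zd; set T := unit_part Z; have S1 := SX.1.
have Zd' : cabs (Z - S) <= 1 / 2 by lra.
have [T1 ZE r01 rZ TS] := unit_partP (disc_cdisc Z1) S1 Zd'; rewrite -/T in T1 ZE TS.
have Trho : cabs (T - S) <= rho by lra.
have [nT oT] := oscP T T1 Trho.
have SZ : S != Z by apply/eqP => h; have := Z1; rewrite /disc/= -h S1 ltxx.
have SZd : 0 < cabs (S - Z) <= d2 by rewrite cabs_gt0 subr_eq0 SZ cabsB; lra.
have TT : cabs (T - T) <= rho by rewrite subrr cabs0 ltW.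
have TX := nT T T1 TT.
have ob : forall x, 0 < x <= d2 -> 13 * A * om x <= e / 2.
  move=> x xd; apply: (@le_trans _ _ ((13 * A + 1) * (e / 2 / (13 * A + 1)))).
    apply: ler_pM; rewrite ?mulr_ge0 ?lerDl//; last exact: d2P.
    by case: mom => + _ _ _; move/(_ x); case/andP: xd => -> _ /(_ isT)/ltW.
  by rewrite mulrC divfK// gt_eqF.
have Zrho : 1 - cabs Z <= rho by lra.
(* When [Z] lies on the radius of [S] itself, the arc degenerates and the radial estimate alone
   applies. *)
have [eST|ST] := eqVneq S T.
  have Zlt : 0 <= cabs Z < 1 by rewrite cabs_ge0.
  have L := radial_estimate (cm_cont cm) (cm_diff cm) mom T1 A0 oT Zlt Zrho.
  rewrite -ZE -eST in L.
  have Sr : cabs (S - Z) = 1 - cabs Z by rewrite cabsB {1}ZE -eST cabs_radial.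
  have v0 : 0 < cabs (S - Z) by case/andP: SZd.
  rewrite -(ler_pM2r v0) -cabsM mulrBl /dquot divfK ?subr_eq0//.
  apply: (le_trans L); rewrite -Sr mulrC ler_wpM2r ?(ltW v0)//.
  have := ob _ SZd; have : 0 <= om (cabs (S - Z)).
    by case: mom => + _ _ _; move/(_ _ v0)/ltW.
  by move=> o0 o1; have := mulr_ge0 A0 o0; lra.
have diffT S' : circle S' -> cabs (S' - T) <= rho -> cdiff circle s S' (s1 S').
  by move=> S'1 S'r; apply: (cm_diff_arc cm); exact: nT.
have Srho : cabs (S - T) <= rho by rewrite cabsB.
have xZ' : S != (cabs Z)%:C * T by rewrite -ZE.
have L1 := local_dquot_center (cm_cont cm) (cm_diff cm) mom T1 A0 diffT oT S1 r01 ST xZ' Srho Zrho.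
rewrite -ZE in L1.
have sT : cabs (s1 T - s1 S) < e / 2 by apply: d1P => //; lra.
have := cabs_dist_triangle (s1 T) (dquot s S Z) (s1 S); have := ob _ SZd; lra.
Qed.

Let arc0 : arc (t 1%N / 2).
Proof.
have m0 := contour_m_gt0; have := pc_lt pc m0; rewrite (pc_t0 pc) => t1.
by exists 0%N => //; rewrite (pc_t0 pc); lra.
Qed.

(** If the argument decreased, the normal ['i * v u] would point out of the domain. With
    $a=-$[arg_speed u] positive, the point [gam u + e * ('i * v u)] is $\sigma(S)+ea\,S\sigma'(S)$,
    so its preimage satisfies $Z/S=1+ea\,\sigma'(S)/d(S,Z)$. For small [e] the last quotient has
    positive real part, whence $|Z|>1$, although orientation puts [Z] in the disc. *)
Lemma contour_arg_not_decreasing u : arc u -> ~ arg_speed u < 0.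
Proof.
move=> au w0; have [_ vE] := arg_deriv au; have Sx := arc_corner_free au.
have u01 := arc01 au.
have c0 := cm_deriv_neq0 cm Sx; set S := expi (th u) in Sx c0.
have cp : 0 < cabs (s1 S) by rewrite cabs_gt0.
have cp2 : 0 < cabs (s1 S) / 2 by rewrite divr_gt0.
have [d d0 dP] := dquot_boundary Sx cp2.
have [e1 e10 e1P] := cm_inv cm (circle_cdisc Sx.1) d0.
have ne k : (k <= m)%N -> u != t k by exact: arc_neq.
have near := pc_orient pc u01 ne.
pose a := - arg_speed u; have a0' : 0 < a by rewrite oppr_gt0.
have b0 : 0 < e1 / (a * cabs (s1 S)) by rewrite divr_gt0// mulr_gt0.
have [e [[[Z Z1 ZE] eb] ep]] := filter_ex (filterI (filterI near (nbhs_right_lt b0)) (nbhs_right_gt 0)).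
have dZ : s Z - s S = (e * a)%:C * S * s1 S.
  rewrite ZE -(thP u01).2 -/S addrAC subrr add0r vE /circle_velocity -/S.
  rewrite realcM (_ : a%:C = - (arg_speed u)%:C); last by rewrite /a rmorphN.
  have i2 : 'i * 'i = -1 :> C by rewrite -expr2 sqr_i.
  rewrite (_ : 'i * ((arg_speed u)%:C * _) = 'i * 'i * ((arg_speed u)%:C * S * s1 S)); last by ring.
  by rewrite i2; ring.
have ea : 0 < e * a by rewrite mulr_gt0.
have Zd : cabs (Z - S) < d.
  apply: e1P; first exact: disc_cdisc.
  rewrite dZ !cabsM cabs_real Sx.1 mulr1 gtr0_norm// -mulrA -ltr_pdivlMr//.
  by rewrite mulr_gt0.
have q1 := dP Z Z1 Zd; set q := dquot s S Z in q1.
have SZ : S - Z != 0.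
  by rewrite subr_eq0; apply/eqP => h; have := Z1; rewrite /disc/= -h Sx.1 ltxx.
have S0 : S != 0 by rewrite circle_neq0//; exact: Sx.1.
have q0 : q != 0.
  by apply/eqP => h; move: q1; rewrite h sub0r normcN; lra.
have ZS : Z / S = 1 + (e * a)%:C * (s1 S / q).
  have : q * (S - Z) = - ((e * a)%:C * S * s1 S) by rewrite /q /dquot divfK// -dZ opprB.
  move=> h; have -> : Z = S - (S - Z) by rewrite opprB addrC subrK.
  rewrite -[S - Z](mulKf q0) h mulrBl divff//.
  by congr (1 + _); field; rewrite q0 S0.
have Rp : 0 < Re (s1 S / q).
  have -> : s1 S / q = ((cabs q ^+ 2)^-1)%:C * (s1 S * conjc q).
    rewrite realcV -mulcJ; field; rewrite q0 /=.
    by rewrite andbT conjC_eq0.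
  rewrite ReMr; apply: mulr_gt0; first by rewrite invr_gt0 exprn_gt0// cabs_gt0.
  have -> : q = s1 S + (q - s1 S) by rewrite addrC subrK.
  rewrite conjcD mulrDr ReD mulcJ.
  have := ler_norm_Re (s1 S * conjc (q - s1 S)); rewrite cabsM cabsJ ler_norml => /andP[h _].
  have : cabs (s1 S) * cabs (q - s1 S) <= cabs (s1 S) * (cabs (s1 S) / 2) by rewrite ler_pM2l.
  have : 0 < cabs (s1 S) * cabs (s1 S) by rewrite mulr_gt0.
  rewrite /= expr2; lra.
have : 1 < cabs (Z / S).
  rewrite ZS; apply: lt_le_trans (le_trans (ler_norm _) (ler_norm_Re _)).
  by rewrite ReD ReMr /= ltrDl mulr_gt0.
rewrite cabs_div Sx.1 divr1 => h; have := Z1; rewrite /disc/= => h'.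
by have := lt_trans h h'; rewrite ltxx.
Qed.

Lemma arg_speed_gt0 u : arc u -> 0 < arg_speed u.
Proof.
move=> au; rewrite lt_neqAle eq_sym arg_speed_neq0//= leNgt; apply/negP.
exact: contour_arg_not_decreasing.
Qed.

(** A continuous injective function on an interval is monotone; the positive derivative at one arc
    point rules out the decreasing case. *)
Lemma contour_arg_increasing u w : 0 < u < 1 -> 0 < w < 1 -> u < w -> th u < th w.
Proof.
have [||inc|dec] := @itv_continuous_inj_mono R th (Interval (BRight 0) (BLeft 1)).
- apply: continuous_in_subspaceT => x; rewrite inE/= in_itv/= => x01.
  exact: contour_arg_cont.
- by move=> x y; rewrite !in_itv/=; exact: contour_arg_inj.

  by move=> u01 w01; apply: inc; rewrite in_itv.
exfalso; have u01 := arc01 arc0; set u0 := t 1%N / 2 in u01.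
have wp := arg_speed_gt0 arc0; have [/is_derive_epsP dw _] := arg_deriv arc0.
have w2 : 0 < arg_speed u0 / 2 by rewrite divr_gt0.
have [d d0 dP] := dw _ w2; have /andP[p0 p1] := u01.
pose h := Num.min (d / 2) ((1 - u0) / 2).
have h0 : 0 < h by rewrite lt_min !divr_gt0// subr_gt0.
have [h1 h2] : h <= d / 2 /\ h <= (1 - u0) / 2 by rewrite /h !ge_min !lexx orbT.
have hd : `|h| < d by rewrite gtr0_norm//; lra.
have := dP h hd; rewrite ler_norml (gtr0_norm h0) => /andP[lo _].
have : th (u0 + h) < th u0.
  by apply: dec; rewrite ?in_itv/= ?ltrDl//; lra.
have := mulr_gt0 h0 wp; lra.
Qed.

Lemma contour_arg_lt u w : 0 <= u -> u < w -> w <= 1 -> th u < th w.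
Proof.
rewrite le_eqVlt => /predU1P[<-|u0] uw; rewrite le_eqVlt => /predU1P[we|w1].
- by rewrite we th0 th1 ltrDl mulr_gt0// pi_gt0.
- by rewrite th0; have /andP[] := (@thP w (introT andP (conj uw w1))).1.
- rewrite we th1; have u1 : u < 1 by rewrite -we.
  by have /andP[] := (@thP u (introT andP (conj u0 u1))).1.
- by apply: contour_arg_increasing => //; rewrite ?u0 ?w1 ?andbT ?(lt_trans uw)//= (lt_trans u0).
Qed.

Lemma contour_arg_le u w : 0 <= u -> u <= w -> w <= 1 -> th u <= th w.
Proof.
by move=> u0; rewrite le_eqVlt => /predU1P[->//|uw] w1; apply/ltW/contour_arg_lt.
Qed.

Lemma arc_arg_onto k x : (k < m)%N -> th (t k) < x < th (t k.+1) ->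
  exists2 u, t k < u < t k.+1 & th u = x.
Proof.
move=> km /andP[x1 x2]; have /andP[k0 k1] := contour_t_bd (ltnW km).
have /andP[l0 l1] := contour_t_bd km.
have [|u /andP[u0 u1] ux] := contour_arg_onto (x := x).
  have h1 : a0 <= th (t k) by rewrite -th0 contour_arg_le.
  have h2 : th (t k.+1) <= a0 + 2 * pi by rewrite -th1 contour_arg_le.
  by rewrite (le_lt_trans h1)//= (lt_le_trans x2).
exists u => //; rewrite !ltNge; apply/andP; split; apply/negP => h.
  by move: x1; rewrite -ux ltNge contour_arg_le// ltW.
by move: x2; rewrite -ux ltNge contour_arg_le// ltW.
Qed.

Section NonnegTransfer.
Variables (h H : R -> R).
Hypothesis H0 : forall x, 0 <= H x.
Hypothesis h0 : forall u, 0 <= h u.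
Hypothesis Hc : forall x, ~ corner_args X x -> {for x, continuous H}.
Hypothesis HP : forall x, H (x + 2 * pi) = H x.
Hypothesis hH : forall u, arc u -> h u = H (th u) * arg_speed u.

Let mH : measurable_fun [set: R] (fun x => (H x)%:E).
Proof. by apply/measurable_EFinP; exact: (measurable_fun_off_countable (countable_corner_args X)). Qed.

Let fcont u : arc u -> {for u, continuous (fun u => H (th u) * arg_speed u)}.
Proof.
move=> au; apply: cvgM; last exact: arg_speed_cont.
by apply: continuous_comp; [apply: contour_arg_cont; exact: arc01|apply: Hc; exact: (arc_corner_free au).2].
Qed.

Let arc_open u : arc u -> \forall w \near u, arc w.
Proof.
move=> [k km /andP[k1 k2]]; near=> w; exists k => //; apply/andP; split; near: w.
  exact: lt_nbhsr.
exact: lt_nbhsl.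
Unshelve. all: by end_near. Qed.

Let dth u : arc u -> th^`() u = arg_speed u.
Proof. by move=> /arg_deriv[[_ e] _]; rewrite derive1E. Qed.

(** The substitution rule asks for a continuously differentiable [th] on a closed interval, hence
    the restriction to the inside of one arc. *)
Let closed_arc k a b : (k < m)%N -> t k < a -> a < b -> b < t k.+1 ->
  (\int[mu]_(x in `[th a, th b]) (H x)%:E = \int[mu]_(u in `[a, b]) (H (th u) * arg_speed u)%:E)%E.
Proof.
move=> km ka ab bk.
have A u : a <= u <= b -> arc u.
  by move=> /andP[h1 h2]; exists k => //; rewrite (lt_le_trans ka)//= (le_lt_trans h2).
have cth u : a <= u <= b -> {for u, continuous th}.
  by move=> /A/arc01; exact: contour_arg_cont.
have cd u : a <= u <= b -> {for u, continuous (th^`())}.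
  move=> hu; have au := A u hu; rewrite /prop_for /continuous_at (dth au).
  apply: cvg_trans (arg_speed_cont au); apply: near_eq_cvg.
  by apply: filterS (arc_open au) => w /dth ->.
have aa : a <= a <= b by rewrite lexx ltW.
have bb : a <= b <= b by rewrite lexx ltW.
rewrite (@integration_by_substitution_increasing R th H a b).
- by apply: eq_integral => u; rewrite inE/= in_itv/= => hu; rewrite -(dth (A u hu)).
- exact: ltW.
- move=> x y; rewrite !in_itv/= => hx hy xy.
  by apply: contour_arg_increasing => //; apply: arc01; exact: A.
- move=> x; rewrite in_itv/= => /andP[h1 h2]; apply: cd; by rewrite !ltW.
- apply: (@cvgP _ _ (th^`() a)); apply: cvg_at_right_filter; exact: cd.
- apply: (@cvgP _ _ (th^`() b)); apply: cvg_at_left_filter; exact: cd.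
- split.
  + move=> x; rewrite in_itv/= => /andP[h1 h2].
    by have [[]] := arg_deriv (A x (introT andP (conj (ltW h1) (ltW h2)))).
  + by apply: cvg_at_right_filter; exact: cth.
  + by apply: cvg_at_left_filter; exact: cth.
- apply: continuous_in_subspaceT => x; rewrite inE/= in_itv/= => /andP[x1 x2].
  have /andP[k0 k1] := contour_t_bd (ltnW km); have /andP[l0 l1] := contour_t_bd km.
  have [|u hu ux] := arc_arg_onto (k := k) (x := x) km.
    have h1 : th (t k) < th a by apply: contour_arg_lt => //; apply/ltW/(lt_trans ab)/(lt_le_trans bk).
    have h2 : th b < th (t k.+1).
      by apply: contour_arg_lt => //; apply: le_trans k0 _; apply/ltW/(lt_trans ka).
    by rewrite (lt_le_trans h1)//= (le_lt_trans x2).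
  by rewrite -ux; apply: Hc; exact: (arc_corner_free (ex_intro2 _ _ k km hu)).2.
Qed.


(** Exhaust the open arc by closed subarcs; by monotone convergence both sides converge. *)
Let arc_transfer k : (k < m)%N ->
  (\int[mu]_(x in `]th (t k), th (t k.+1)[) (H x)%:E =
   \int[mu]_(u in `]t k, t k.+1[) (H (th u) * arg_speed u)%:E)%E.
Proof.
move=> km; have tlt := pc_lt pc km.
have /andP[k0 k1] := contour_t_bd (ltnW km); have /andP[l0 l1] := contour_t_bd km.
set a := t k in tlt k0 k1 *; set b := t k.+1 in tlt l0 l1 *.
(* The denominator is at least 3, so [a + d n < b - d n] for every [n]. *)
pose d n : R := (b - a) / (n.+3)%:R.
have ba : 0 < b - a by rewrite subr_gt0.
have d0 n : 0 < d n by rewrite divr_gt0.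
have dlt n : d n < (b - a) / 2 by rewrite ltr_pM2l// ltf_pV2 ?posrE// ltr_nat.
have dle n n' : (n <= n')%N -> d n' <= d n.
  by move=> nn'; rewrite ler_pM2l// lef_pV2 ?posrE// ler_nat.
have dsmall e : 0 < e -> exists n, d n < e.
  move=> e0; exists (Num.trunc ((b - a) / e)).
  rewrite ltr_pdivrMr// mulrC -ltr_pdivrMr//.
  by apply: (lt_trans (truncnS_gt _)); rewrite ltr_nat.
pose E n := `[a + d n, b - d n]%classic : set R.
pose G n := `[th (a + d n), th (b - d n)]%classic : set R.
have dd n : [/\ a < a + d n, a + d n < b - d n & b - d n < b].
  by have := d0 n; have := dlt n; split; lra.
have EE : `]a, b[%classic = \bigcup_n E n.
  apply/seteqP; split => [u|u [n _]]; rewrite /E /= !in_itv/=; last first.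
    by have [h1 h2 h3] := dd n; move=> /andP[h4 h5]; rewrite (lt_le_trans h1)//= (le_lt_trans h5).
  move=> /andP[u0 u1].
  have [n] : exists n, d n < Num.min (u - a) (b - u) by apply: dsmall; rewrite lt_min !subr_gt0 u0.
  rewrite lt_min => /andP[n1 n2]; exists n => //=; rewrite in_itv/=.
  by apply/andP; split; lra.
have GG : `]th a, th b[%classic = \bigcup_n G n.
  apply/seteqP; split => [x|x [n _]]; rewrite /G /= !in_itv/=; last first.
    have [h1 h2 h3] := dd n; move=> /andP[h4 h5]; rewrite (lt_le_trans _ h4)/=; last first.
      by apply: contour_arg_lt => //; apply: le_trans l1; apply/ltW/(lt_trans h2).
    apply: (le_lt_trans h5); apply: contour_arg_lt => //.
    by apply: le_trans k0 _; apply/ltW/(lt_trans h1).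
  move=> hx; have [u hu <-] := arc_arg_onto km hx.
  have : (\bigcup_n E n) u by rewrite -EE /= in_itv.
  move=> [n _]; rewrite /E/= in_itv/= => /andP[h4 h5]; exists n => //=; rewrite in_itv/=.
  have [h1 h2 h3] := dd n; have /andP[u0 u1] := hu.
  apply/andP; split; apply: contour_arg_le => //.
  - by apply: le_trans k0 _; exact: ltW.
  - by apply: le_trans l1; exact: ltW.
  - by apply: le_trans k0 _; exact: ltW.
  - by apply: le_trans l1; exact: ltW.
have F0 n u : E n u -> (0 <= (H (th u) * arg_speed u)%:E)%E.
  rewrite /E/= in_itv/= => /andP[h4 h5]; have [h1 h2 h3] := dd n.
  rewrite lee_fin mulr_ge0//; apply/ltW/arg_speed_gt0; exists k => //.
  by rewrite (lt_le_trans h1)//= (le_lt_trans h5).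
have arcE n u : E n u -> arc u.
  rewrite /E/= in_itv/= => /andP[h4 h5]; have [h1 h2 h3] := dd n; exists k => //.
  by rewrite (lt_le_trans h1)//= (le_lt_trans h5).
have mF n : measurable_fun (E n) (fun u => (H (th u) * arg_speed u)%:E).
  have cE : {within E n, continuous (fun u => H (th u) * arg_speed u)}.
    apply: continuous_in_subspaceT => u; by rewrite inE => /arcE; exact: fcont.
  apply/measurable_EFinP; apply: subspace_continuous_measurable_fun cE.
  exact: measurable_itv.
have mE n : measurable (E n) by exact: measurable_itv.
have mG n : measurable (G n) by exact: measurable_itv.
have c1 : (\int[mu]_(u in E n) (H (th u) * arg_speed u)%:E)%E @[n --> \oo] -->
    (\int[mu]_(u in `]a, b[) (H (th u) * arg_speed u)%:E)%E.
  rewrite EE; apply: ge0_nondecreasing_set_cvg_integral; [|exact: mE|exact: mF|exact: F0].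
  move=> n n' nn'; apply/subsetPset => u; rewrite /E/= !in_itv/= => /andP[h4 h5].
  by have := dle _ _ nn'; move=> ?; apply/andP; split; lra.
have c2 : (\int[mu]_(x in G n) (H x)%:E)%E @[n --> \oo] -->
    (\int[mu]_(x in `]th a, th b[) (H x)%:E)%E.
  rewrite GG; apply: ge0_nondecreasing_set_cvg_integral; [|exact: mG|by move=> n; apply: measurable_funTS; exact: mH|by move=> n x _; rewrite lee_fin].
    move=> n n' nn'; apply/subsetPset => u; rewrite /G/= !in_itv/= => /andP[h4 h5].
    have h6 := dle _ _ nn'; have [h1 h2 h3] := dd n; have [g1 g2 g3] := dd n'.
    apply/andP; split.
      apply: le_trans h4; apply: contour_arg_le; first exact: le_trans k0 (ltW g1).
        by rewrite lerD2l.
      by apply: le_trans l1; apply/ltW/(lt_trans h2).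
    apply: (le_trans h5); apply: contour_arg_le.
    - by apply: le_trans k0 _; apply/ltW/(lt_trans h1).
    - by rewrite lerD2l lerN2.
    - by apply: le_trans l1; apply/ltW.
have e n : (\int[mu]_(x in G n) (H x)%:E = \int[mu]_(u in E n) (H (th u) * arg_speed u)%:E)%E.
  by have [h1 h2 h3] := dd n; exact: (closed_arc km h1 h2 h3).
have c3 : (\int[mu]_(x in G n) (H x)%:E)%E @[n --> \oo] -->
    (\int[mu]_(u in `]a, b[) (H (th u) * arg_speed u)%:E)%E.
  by apply: cvg_trans c1; apply: near_eq_cvg; apply: nearW => n; rewrite e.
exact: (cvg_unique _ c2 c3).
Qed.

Let arc_or_node u : 0 <= u <= 1 -> (forall k, (k <= m)%N -> u != t k) -> arc u.
Proof.
move=> /andP[u0 u1] un.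
have ex : exists k, (k <= m)%N && (u < t k).
  by exists m; rewrite leqnn lt_neqAle un//= (pc_tm pc).
have [k /andP[km uk] kmin] := ex_minnP ex.
case: k km uk kmin => [|k] km uk kmin; first by move: uk; rewrite (pc_t0 pc) ltNge u0.
exists k => //; rewrite uk andbT lt_neqAle eq_sym un ?(ltnW km)//= leNgt; apply/negP => uk'.
by have := kmin k; rewrite (ltnW km) uk' ltnn => /(_ isT).
Qed.

(** Cutting [h] off outside [[0, 1]] makes it continuous except at the finitely many nodes, hence
    measurable on the whole line. *)
Let hh u : R := if 0 <= u <= 1 then h u else 0.

Let mhh : measurable_fun [set: R] (fun x => (hh x)%:E).
Proof.
apply/measurable_EFinP.
apply: (@measurable_fun_off_countable R (t @` [set k | (k <= m)%N])).
  apply: finite_set_countable; apply: finite_image.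
  rewrite (_ : [set k | _] = `I_m.+1); first exact: finite_II.
  by apply/seteqP; split => k /=; rewrite ltnS.
move=> u un; have [/andP[u0 u1]|] := boolP (0 <= u <= 1).
  have au : arc u.
    apply: arc_or_node; rewrite ?u0// => k km; apply/eqP => e; apply: un.
    by exists k.
  have E w : arc w -> hh w = H (th w) * arg_speed w.
    by move=> aw; rewrite /hh; case/andP: (arc01 aw) => /ltW -> /ltW -> /=; exact: hH.
  rewrite /prop_for /continuous_at (E u au); apply: cvg_trans (fcont au); apply: near_eq_cvg.
  by apply: filterS (arc_open au) => w /E ->.
rewrite negb_and -!ltNge => hu; rewrite /prop_for /continuous_at /hh.
have -> : (0 <= u <= 1) = false by apply/negbTE; rewrite negb_and -!ltNge.
apply: cvg_near_cst; case/orP: hu => hu.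
  by apply: filterS (lt_nbhsl hu) => w w0; rewrite leNgt w0.
by apply: filterS (lt_nbhsr hu) => w w0; rewrite (leNgt w) w0 andbF.
Qed.

Let transfer_upto k : (k <= m)%N ->
  (\int[mu]_(u in `[0%R, t k[) (hh u)%:E = \int[mu]_(x in `[a0, th (t k)[) (H x)%:E)%E.
Proof.
have hh0 x : (0 <= (hh x)%:E)%E by rewrite lee_fin /hh; case: ifP.
elim: k => [_|k IHk km].
  by rewrite (pc_t0 pc) th0 !set_itvco0 !integral_set0.
have /andP[k0 k1] := contour_t_bd (ltnW km); have /andP[l0 l1] := contour_t_bd km.
have lt := pc_lt pc km.
have H0' x : (0 <= (H x)%:E)%E by rewrite lee_fin.
have g1 : a0 <= th (t k) by rewrite -th0 contour_arg_le.
have g2 : th (t k) <= th (t k.+1) by apply: contour_arg_le => //; exact: ltW.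
rewrite (ge0_integral_co_split k0 (ltW lt) mhh hh0) (ge0_integral_co_split g1 g2 mH H0').
rewrite (IHk (ltnW km)); congr (_ + _)%E.
rewrite -!integral_itv_obnd_cbnd; [|exact: measurable_funTS|exact: measurable_funTS].
rewrite arc_transfer//; apply: eq_integral => u; rewrite inE/= in_itv/= => hu.
have au : arc u by exists k.
by rewrite -hH// /hh; case/andP: (arc01 au) => /ltW -> /ltW ->.
Qed.

Lemma transfer_ge0 :
  (\int[mu]_(u in `[0%R, 1%R]) (h u)%:E = \int[mu]_(x in I) (H x)%:E)%E.
Proof.
rewrite -(@ge0_integral_periodic_full R (2 * pi) (fun x => (H x)%:E) a0); last 4 first.
- by rewrite mulr_gt0// pi_gt0.
- exact: mH.
- by move=> x; rewrite lee_fin.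
- by move=> x; rewrite HP.
transitivity (\int[mu]_(u in `[0%R, 1%R]) (hh u)%:E)%E.
  by apply: eq_integral => u; rewrite inE/= in_itv/= /hh => ->.
rewrite -!integral_itv_bndo_bndc; [|exact: measurable_funTS|exact: measurable_funTS].
by rewrite -th1 -(pc_tm pc) transfer_upto.
Qed.

End NonnegTransfer.

(** The real integral is the difference of the integrals of positive and negative parts; since
    [arg_speed] is positive, each part transfers separately. *)
Lemma transfer_real (h H : R -> R) :
  (forall x, ~ corner_args X x -> {for x, continuous H}) ->
  (forall x, H (x + 2 * pi) = H x) ->
  (forall u, arc u -> h u = H (th u) * arg_speed u) ->
  (\int[mu]_(u in `[0%R, 1%R]) h u = \int[mu]_(x in I) H x)%R.
Proof.
move=> Hc HP hH; rewrite /Rintegral [X in fine X]integralE [X in _ = fine X]integralE.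
congr (fine (_ - _)).
  under eq_integral do rewrite /= funeposE -EFin_max.
  under [RHS]eq_integral do rewrite /= funeposE -EFin_max.
  apply: (@transfer_ge0 (fun u => Num.max (h u) 0) (fun x => Num.max (H x) 0)).
  - by move=> x; rewrite le_max lexx orbT.
  - by move=> x; rewrite le_max lexx orbT.
  - by move=> x cx; apply: continuous_max; [exact: Hc|exact: cvg_cst].
  - by move=> x; rewrite HP.
  - by move=> u au; rewrite hH// maxr_pMl ?mul0r// ltW// arg_speed_gt0.
under eq_integral do rewrite /= funenegE -EFinN -EFin_max.
under [RHS]eq_integral do rewrite /= funenegE -EFinN -EFin_max.
apply: (@transfer_ge0 (fun u => Num.max (- h u) 0) (fun x => Num.max (- H x) 0)).
- by move=> x; rewrite le_max lexx orbT.
- by move=> x; rewrite le_max lexx orbT.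
- by move=> x cx; apply: continuous_max; [apply: cvgN; exact: Hc|exact: cvg_cst].
- by move=> x; rewrite HP.
- by move=> u au; rewrite hH// maxr_pMl ?mul0r ?mulNr// ltW// arg_speed_gt0.
Qed.

End BoundaryArgument.

(** [F] is a point-velocity integrand, homogeneous for positive real factors; since [v u] is a
    positive multiple of the velocity on the circle, the multiple becomes the Jacobian. *)
Lemma contour_integral_transfer (F : C -> C -> C) gam v t : positive_contour gam v t ->
  (forall w (r : R) z, 0 < r -> F w (r%:C * z) = r%:C * F w z) ->
  cont_off (corner_args X) (fun x => F (s (expi x)) (circle_velocity x)) ->
  cintegral `[0, 1] (fun u => F (gam u) (v u)) =
  cintegral I (fun x => F (s (expi x)) (circle_velocity x)).
Proof.
move=> pc FM Fc; have [a0 [th [thP a0P th0 th1]]] := contour_arg_exists pc.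
have Fp x : F (s (expi (x + 2 * pi))) (circle_velocity (x + 2 * pi)) =
    F (s (expi x)) (circle_velocity x) by rewrite /circle_velocity expiD2pi.
have FE u : (exists2 k, (k < m)%N & t k < u < t k.+1) ->
    F (gam u) (v u) = (arg_speed v th u)%:C * F (s (expi (th u))) (circle_velocity (th u)).
  move=> au; have [_ vE] := arg_deriv pc thP au.
  rewrite vE FM; last exact: (arg_speed_gt0 pc thP au).
  have u01 : 0 < u < 1.
    case: au => k km /andP[k1 k2].
    have /andP[h0 _] := contour_t_bd pc (ltnW km); have /andP[_ h1] := contour_t_bd pc km.
    by rewrite (le_lt_trans h0)//= (lt_le_trans k2).
  by rewrite -(thP u u01).2.
rewrite /cintegral; congr (_ +i* _).
- apply: (transfer_real pc thP a0P th0 th1 (H := fun x => Re (F (s (expi x)) (circle_velocity x)))).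
  + by move=> x /Fc /cvg_ReImP[].
  + by move=> x; rewrite Fp.
  + by move=> u /FE ->; rewrite ReMr mulrC.
- apply: (transfer_real pc thP a0P th0 th1 (H := fun x => Im (F (s (expi x)) (circle_velocity x)))).
  + by move=> x /Fc /cvg_ReImP[].
  + by move=> x; rewrite Fp.
  + by move=> u /FE ->; rewrite ImMr mulrC.
Qed.

End BoundaryParametrization.

(** * The piecewise smooth boundary as a positive contour, and the domain as image of the disc *)

Section PiecewiseSmoothContour.
Variables (R : realType) (D : set (R * R)) (m : nat) (p : 'I_m -> R * R).
Variables (g : R -> R * R) (t : nat -> R).
Variables (sigma : R[i] -> R[i]) (X : 'I_m -> R[i]) (s1 : R[i] -> R[i]).
Local Notation C := R[i].
Hypothesis D_open : open D.
Hypothesis D_bd : pw_smooth_boundary D p g t.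
Hypothesis sigma_conf : conformal_ext D sigma.
Hypothesis sigma_X : forall j, circle (X j) /\ sigma (X j) = z_of (p j).

Lemma z_ofB (a b : R * R) : z_of (a - b) = z_of a - z_of b.
Proof. by case: a b => [a1 a2] [b1 b2]; apply: eq_complexP. Qed.

Lemma z_ofN (a : R * R) : z_of (- a) = - z_of a.
Proof. by case: a => a1 a2; apply: eq_complexP. Qed.

Lemma z_of_inj : injective (@z_of R).
Proof. by move=> [a1 a2] [b1 b2] [-> ->]. Qed.

Lemma z_of_ReIm (w : C) : z_of (Re w, Im w) = w.
Proof. by case: w. Qed.

Lemma cabs_le_ReIm (w : C) : cabs w <= `|Re w| + `|Im w|.
Proof.
case: w => a b; have {1}-> : a +i* b = a%:C + 'i * b%:C by apply: eq_complexP; rewrite /=; ring.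
by apply: le_trans (ler_cabsD _ _) _; rewrite cabsM cabs_i mul1r !cabs_real.
Qed.

Lemma cabs_z_of_le (a : R * R) : cabs (z_of a) <= 2 * `|a|.
Proof.
apply: le_trans (cabs_le_ReIm _) _; rewrite /= mulr_natl mulr2n prod_normE.
by rewrite lerD// le_max lexx ?orbT.
Qed.

Lemma norm_le_cabs_z_of (a : R * R) : `|a| <= cabs (z_of a).
Proof.
by rewrite prod_normE ge_max; apply/andP; split; [exact: (ler_norm_Re (z_of a))|exact: (ler_norm_Im (z_of a))].
Qed.

Lemma z_of_continuous : continuous (@z_of R).
Proof.
move=> a; apply/cvgcP => e e0; near=> b.
rewrite -z_ofB; apply: le_lt_trans (cabs_z_of_le _) _; rewrite -ltr_pdivlMl//.
near: b; have e2 : 0 < 2^-1 * e by rewrite mulr_gt0.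
by have /cvgrPdist_lt/(_ _ e2) : b @[b --> a] --> a by []; apply: filterS => b; rewrite distrC.
Unshelve. all: by end_near. Qed.

Lemma closure_D_z w : closure (D_z D) w -> exists2 q, closure D q & z_of q = w.
Proof.
move=> cw; exists (Re w, Im w); last exact: z_of_ReIm.
move=> B /nbhs_ballP[e e0 eB].
have : nbhs w [set w' | cabs (w' - w) < e] by apply/nearbyc; exists e.
move=> /cw[_ [[q Dq <-] qw]]; exists q; split => //; apply: eB.
rewrite -ball_normE/=; apply: le_lt_trans (norm_le_cabs_z_of _) _.
by rewrite z_ofB z_of_ReIm cabsB.
Qed.

Lemma z_of_closure q : closure D q -> closure (D_z D) (z_of q).
Proof.
move=> cq B /(@z_of_continuous q) /cq[q' [Dq' Bq']].
by exists (z_of q'); split => //; exists q'.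
Qed.

Lemma boundary_openE : boundary D = closure D `\` D.
Proof. by rewrite /boundary; rewrite (_ : interior D = D)//; move: D_open; rewrite openE => DD; apply/seteqP; split; [exact: interior_subset|exact: DD]. Qed.

Lemma sigma_disc_D Z : disc Z -> exists2 q, D q & sigma Z = z_of q.
Proof.
by move=> Z1; have [_ e _] := sigma_conf; have : (sigma @` disc) (sigma Z) by [exists Z]; rewrite e => -[q Dq <-]; exists q.
Qed.

Lemma D_sigma_disc q : D q -> exists2 Z, disc Z & sigma Z = z_of q.
Proof.
move=> Dq; have [_ e _] := sigma_conf.
by have : (sigma @` disc) (z_of q) by [rewrite e; exists q].
Qed.

(** The preimage of [q] in the closed disc cannot be interior, since [sigma] maps the open disc into
    [D] and [D] is disjoint from its boundary. *)
Lemma boundary_sigma q : boundary D q -> exists2 S, circle S & sigma S = z_of q.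
Proof.
rewrite boundary_openE => -[cq nD].
have [_ e [_ [f [_ _ fP]]]] := sigma_conf.
have [W1 We] := fP _ (z_of_closure cq); exists (f (z_of q)) => //.
apply/eqP; rewrite eq_le W1/= leNgt; apply/negP => W2; apply: nD.
have : D_z D (sigma (f (z_of q))) by rewrite -e; exists (f (z_of q)).
by move=> [q' Dq' qe]; move: qe; rewrite We => /z_of_inj <-.
Qed.

Lemma sigma_circle_boundary S : circle S -> exists2 q, boundary D q & sigma S = z_of q.
Proof.
move=> S1; have [_ e [_ [f [_ sP fP]]]] := sigma_conf.
have [cS fS] := sP S (circle_cdisc S1); have [q cq qe] := closure_D_z cS.
exists q => //; rewrite boundary_openE; split => // Dq.
have : D_z D (sigma S) by rewrite -qe; exists q.
rewrite -e => -[W W1 We]; have [_ fW] := sP W (disc_cdisc W1).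
by move: S1; rewrite /circle/= -fS -We fW => h; move: W1; rewrite /disc/= h ltxx.
Qed.

Lemma bd_zetaP S : (circle `\` range X) S -> bd_zeta D p (sigma_tilde sigma S).
Proof.
move=> [S1 SX]; have [q bq qe] := sigma_circle_boundary S1.
exists q; last by rewrite /sigma_tilde qe; case: q {bq qe}.
split => // -[j _ je]; apply: SX; exists j => //.
have [_ e [_ [f [_ sP fP]]]] := sigma_conf.
have [_ f1] := sP S (circle_cdisc S1).
have [_ f2] := sP (X j) (circle_cdisc (sigma_X j).1).
by rewrite -f1 -f2 qe (sigma_X j).2 je.
Qed.

Lemma bd_zeta_onto zeta : bd_zeta D p zeta ->
  exists2 S, (circle `\` range X) S & zeta = sigma_tilde sigma S.
Proof.
move=> [q [bq nq] <-]; have [S S1 Se] := boundary_sigma bq.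
exists S; last by rewrite /sigma_tilde Se; case: q {bq nq Se}.
split => // -[j _ je]; apply: nq; exists j => //; apply: z_of_inj.
by rewrite -(sigma_X j).2 je.
Qed.

Lemma D_zetaP Z : disc Z -> D_zeta D (sigma_tilde sigma Z).
Proof. by move=> /sigma_disc_D[q Dq qe]; exists q => //; rewrite /sigma_tilde qe; case: q {Dq qe}. Qed.

Lemma D_zeta_onto zeta : D_zeta D zeta -> exists2 Z, disc Z & zeta = sigma_tilde sigma Z.
Proof.
move=> [q Dq <-]; have [Z Z1 Ze] := D_sigma_disc Dq.
by exists Z => //; rewrite /sigma_tilde Ze; case: q {Dq Ze}.
Qed.

Lemma pderiv_z_of u : derivable g u 1 -> pderiv (fun x => z_of (g x)) u (z_of (g^`() u)).
Proof.
move=> dg e e0; have e2 : 0 < e / 2 by rewrite divr_gt0.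
have : h^-1 *: (g (h *: 1 + u) - g u) @[h --> 0^'] --> derive1 g u.
  by rewrite derive1E; exact: dg.
move=> /cvgrPdist_lt/(_ _ e2); rewrite near_withinE => /nbhs_ballP[d d0 dP].
exists d => // h hd; have [->|h0] := eqVneq h 0.
  by rewrite addr0 subrr mul0r subrr cabs0 normr0 mulr0.
have : `|derive1 g u - h^-1 *: (g (h *: 1 + u) - g u)| < e / 2.
  by apply: (dP h) => //; rewrite /ball/= sub0r normrN.
rewrite (_ : h *: 1 + u = u + h); last by rewrite /GRing.scale/= mulr1 addrC.
set q := h^-1 *: _ => hh.
have qe : z_of (g (u + h)) - z_of (g u) = h%:C * z_of q.
  rewrite -z_ofB /q; case: (g (u + h) - g u) => a b.
  by apply: eq_complexP; rewrite /= mul0r ?subr0 ?addr0 /GRing.scale/= mulrA divff// mul1r.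
rewrite qe -mulrBr -z_ofB cabsM cabs_real mulrC ler_wpM2r// -opprB z_ofN normcN.
by apply: le_trans (cabs_z_of_le _) _; rewrite -ler_pdivlMl// mulrC ltW.
Qed.

Lemma pw_smooth_positive_contour :
  positive_contour X sigma (fun u => z_of (g u)) (fun u => z_of (g^`() u)) t.
Proof.
have [[t0 tm tlt] [gc ge ginj gimg] tp garc gor] := D_bd; split => //.
- move=> u u01 e e0; have e2 : 0 < e / 2 by rewrite divr_gt0.
  have gu : g @ within `[0, 1] (nbhs u) --> g u.
    by move/subspace_continuousP: gc; apply; rewrite /= in_itv.
  move/cvgrPdist_lt: gu => /(_ _ e2); rewrite near_withinE => /nbhs_ballP[d d0 dP].
  exists d => // u' u'01 u'd; rewrite cabsB -z_ofB; apply: le_lt_trans (cabs_z_of_le _) _.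
  rewrite -ltr_pdivlMl// mulrC; apply: (dP u'); first by rewrite /ball/= distrC.
  by rewrite /= in_itv.
- by rewrite ge.
- by move=> u u' u0 u'0 /z_of_inj; apply: ginj; rewrite inE/= in_itv.
- move=> u u01; apply: boundary_sigma; rewrite -gimg; exists u => //.
- move=> S S1; have [q bq ->] := sigma_circle_boundary S1.
  by move: bq; rewrite -gimg => -[u]; rewrite /= in_itv/= => u01 <-; exists u.
- move=> j; have : (range p) (p j) by exists j.
  by rewrite -tp => -[k km ke]; exists k => //; rewrite ke (sigma_X j).2.
- move=> k u km ku; have [dg [dgc dgP dg0]] := garc k km.
  have uo : u \in `]t k, t k.+1[%R by rewrite in_itv.
  have [du due] := dgP u (mem_set uo); split; first exact: pderiv_z_of.
    apply/eqP => e; have /eqP := dg0 u (mem_set (subset_itv_oo_cc uo)); apply.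
    rewrite -due; apply: z_of_inj; rewrite e; by apply: eq_complexP.
  apply: (@continuous_comp _ _ _ (g^`()) (@z_of R)); last exact: z_of_continuous.
  have cdg : {for u, continuous dg}.
    exact: (within_continuous_continuous (tlt k km) dgc uo).
  rewrite /prop_for /continuous_at due; apply: cvg_trans cdg; apply: near_eq_cvg.
  by apply: filterS (near_in_itvoo uo) => w wo; have [_ ->] := dgP w (mem_set wo).
- move=> u /andP[u0 u1] un; have u01 : u \in `[0, 1]%R by rewrite in_itv/= !ltW.
  apply: filterS (gor u (mem_set u01) un) => e /D_sigma_disc[Z Z1 Ze]; exists Z => //; rewrite Ze.
  case: (g u) (g^`() u) => [a b] [c d]; apply: eq_complexP; rewrite /= /GRing.scale/=; ring.
Qed.

End PiecewiseSmoothContour.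

(** * The biharmonic Cauchy kernel and coordinatewise estimates *)

Section BiharmonicKernel.
Variable R : realType.
Local Notation C := R[i].
Local Notation B := (biharm R).
Implicit Types (a b : B) (w v : C) (q : R * R).

Lemma biharm_eq a b : co1 a = co1 b -> co2 a = co2 b -> a = b.
Proof. by case: a b => [a1 a2] [b1 b2] /= -> ->. Qed.

Lemma co1M a b : co1 (a * b) = co1 a * co1 b + co2 a * co2 b. Proof. by []. Qed.

Lemma co2M a b : co2 (a * b) = co1 a * co2 b + co2 a * co1 b + 2 * 'i * (co2 a * co2 b).
Proof. by []. Qed.

Lemma zeta_ofE q : zeta_of q = Biharm q.1%:C q.2%:C.
Proof. by apply: biharm_eq; rewrite /= ?mulr1 ?mulr0 ?addr0 ?add0r. Qed.

Lemma zeta_ofB q q' : zeta_of q - zeta_of q' = zeta_of (q - q').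
Proof. by rewrite !zeta_ofE; apply: biharm_eq; rewrite /= realcB. Qed.

Lemma zeta_ofD q q' : zeta_of (q + q') = zeta_of q + zeta_of q'.
Proof. by rewrite !zeta_ofE; apply: biharm_eq; rewrite /= realcD. Qed.

Lemma z_ofD q q' : z_of (q + q') = z_of q + z_of q'.
Proof. by case: q q' => [? ?] [? ?]; apply: eq_complexP. Qed.

Lemma zeta_ofZ (r : R) q : zeta_of (r *: q) = r%:C *: zeta_of q.
Proof. by rewrite !zeta_ofE; apply: biharm_eq; rewrite /= realcM. Qed.

Lemma biharm_scaleAr (k : C) a b : a * (k *: b) = k *: (a * b).
Proof. by case: a b => [a1 a2] [b1 b2]; apply: biharm_eq; rewrite ?co1M ?co2M /= ?co1M ?co2M /=; ring. Qed.

Lemma norm_zeta_of q : `|zeta_of q| = cabs (z_of q).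
Proof. by rewrite zeta_ofE /= /Num.norm/= /bnorm /= !expr0n/= !addr0 !sqrtr_sqr !real_normK ?num_real. Qed.

Lemma z_of_split q : z_of q = q.1%:C + 'i * q.2%:C.
Proof. by apply: eq_complexP; rewrite /=; ring. Qed.

Lemma zeta_of_inv q : z_of q != 0 -> (zeta_of q)^-1 =
  Biharm ((q.1%:C + 2 * 'i * q.2%:C) / z_of q ^+ 2) (- q.2%:C / z_of q ^+ 2).
Proof.
move=> q0; transitivity (biharm_inv (zeta_of q)) => //.
by rewrite zeta_ofE /biharm_inv /biharm_unit /= -z_of_split q0.
Qed.

Lemma zeta_of_unit q : z_of q != 0 -> zeta_of q \is a GRing.unit.
Proof. by move=> q0; rewrite zeta_ofE; change (is_true ((q.1%:C + 'i * q.2%:C : C) != 0)); rewrite -z_of_split. Qed.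

(** With [q] for $\tau-\zeta$ and [q'] for $d\tau$, both in the biharmonic plane, the product in
    $\mathbb B$ splits into the analytic kernel $dw/w$ and multiples of the kernel that is [map_k2]
    on the circle. The common quantity is the determinant of [q] and [q']. *)
Lemma biharm_cauchy_kernel q q' : z_of q != 0 ->
  let K := (4 * 'i)^-1 * ((z_of q * conjc (z_of q') - conjc (z_of q) * z_of q') / z_of q ^+ 2) in
  (zeta_of q)^-1 * zeta_of q' = Biharm (z_of q' / z_of q + 2 * 'i * K) (- 2 * K).
Proof.
move=> q0 K; set w := z_of q in q0 K *; set v := z_of q' in K *.
have i2 : 'i * 'i = -1 :> C by rewrite -expr2 sqr_i.
have i0 : 'i != 0 :> C by rewrite -cabs_gt0 cabs_i.
have KE : K = - (q.1%:C * q'.2%:C - q.2%:C * q'.1%:C) / (2 * w ^+ 2).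
  rewrite /K (_ : w * _ - _ = - (2 * 'i) * (q.1%:C * q'.2%:C - q.2%:C * q'.1%:C)).
    by field; rewrite q0 i0.
  by apply: eq_complexP; rewrite /=; ring.
have vw : v / w = v * w / w ^+ 2 by field.
have vwE : v * w = q'.1%:C * q.1%:C - q'.2%:C * q.2%:C
    + 'i * (q'.1%:C * q.2%:C + q'.2%:C * q.1%:C).
  by apply: eq_complexP; rewrite /=; ring.
rewrite zeta_of_inv// -/w zeta_ofE; apply: biharm_eq; rewrite ?co1M ?co2M /= KE.
  by rewrite vw vwE; field.
by field.
Qed.

Lemma cabs_2i : cabs (2 * 'i : C) = 2.
Proof. by rewrite cabsM cabs_i mulr1 (_ : (2 : C) = (2 : R)%:C) ?cabs_real ?ger0_norm// realcD. Qed.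

(** A bound on both coordinates; it is equivalent to a bound on the norm up to a factor 2 and passes
    easily through products. *)
Definition co_le (a : B) (M : R) := cabs (co1 a) <= M /\ cabs (co2 a) <= M.

Lemma co_le_norm a : co_le a `|a|.
Proof.
have h1 := cabs_ge0 (co1 a); have h2 := cabs_ge0 (co2 a).
rewrite /co_le /Num.norm/= /bnorm; split.
  by rewrite -[leLHS]ger0_norm// -sqrtr_sqr ler_wsqrtr// lerDl sqr_ge0.
by rewrite -[leLHS]ger0_norm// -sqrtr_sqr ler_wsqrtr// lerDr sqr_ge0.
Qed.

Lemma norm_le_co a M : co_le a M -> `|a| <= 2 * M.
Proof.
move=> [h1 h2]; have M0 : 0 <= M := le_trans (cabs_ge0 _) h1.
rewrite /Num.norm/= /bnorm -[leRHS]ger0_norm ?mulr_ge0// -sqrtr_sqr ler_wsqrtr//.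
have p1 := cabs_ge0 (co1 a); have p2 := cabs_ge0 (co2 a).
have s1 : cabs (co1 a) ^+ 2 <= M ^+ 2 by rewrite ler_sqr ?nnegrE.
have s2 : cabs (co2 a) ^+ 2 <= M ^+ 2 by rewrite ler_sqr ?nnegrE.
rewrite exprMn; have : 0 <= M ^+ 2 by rewrite sqr_ge0.
by lra.
Qed.

(** The constant 4 comes from the second coordinate: two mixed products and the term with
    coefficient $2i$. *)
Lemma co_leM a b M M' : co_le a M -> co_le b M' -> co_le (a * b) (4 * M * M').
Proof.
move=> [a1 a2] [b1 b2].
have P (u v : C) : cabs u <= M -> cabs v <= M' -> cabs (u * v) <= M * M'.
  by move=> hu hv; rewrite cabsM ler_pM ?cabs_ge0.
have p11 := P _ _ a1 b1; have p12 := P _ _ a1 b2; have p21 := P _ _ a2 b1; have p22 := P _ _ a2 b2.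
have Q0 := le_trans (cabs_ge0 _) p11.
rewrite /co_le co1M co2M -mulrA; split.
  apply: le_trans (ler_cabsD _ _) _; lra.
apply: le_trans (ler_cabsD _ _) _.
apply: le_trans (lerD (ler_cabsD _ _) (lexx _)) _.
by rewrite [cabs (2 * 'i * _)]cabsM cabs_2i; lra.
Qed.

Lemma co_leZ (k : C) a M : co_le a M -> co_le (k *: a) (cabs k * M).
Proof.
move=> [h1 h2]; split; [rewrite -[co1 _]/(k * co1 a)|rewrite -[co2 _]/(k * co2 a)];
  by rewrite cabsM ler_wpM2l ?cabs_ge0.
Qed.

Lemma co_le_zetaV q (e : R) : 0 < e -> e <= cabs (z_of q) -> co_le (zeta_of q)^-1 (3 / e).
Proof.
move=> e0 eq; set r := cabs (z_of q) in eq; have r0 : 0 < r by exact: lt_le_trans eq.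
have q0 : z_of q != 0 by rewrite -cabs_gt0.
have h1 : `|q.1| <= r := ler_norm_Re (z_of q).
have h2 : `|q.2| <= r := ler_norm_Im (z_of q).
have rr : 3 / r <= 3 / e by rewrite ler_pM2l// lef_pV2.
have rE : 3 / r = 3 * r / r ^+ 2 by rewrite expr2 -mulrA -[r / (r * r)]/(_ ); field; rewrite gt_eqF.
have c2 : cabs (z_of q ^+ 2) = r ^+ 2 by rewrite expr2 cabsM.
have E1 : co1 (zeta_of q)^-1 = (q.1%:C + 2 * 'i * q.2%:C) / z_of q ^+ 2 by rewrite zeta_of_inv.
have E2 : co2 (zeta_of q)^-1 = - q.2%:C / z_of q ^+ 2 by rewrite zeta_of_inv.
rewrite /co_le E1 E2 !cabs_div c2; split; apply: le_trans rr; rewrite rE ler_pM2r ?invr_gt0 ?exprn_gt0//.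
  apply: le_trans (ler_cabsD _ _) _; by rewrite cabs_real cabsM cabs_2i cabs_real; lra.
by rewrite normcN cabs_real; lra.
Qed.

Definition cont_offB (N : set R) (A : R -> B) :=
  cont_off N (fun x => co1 (A x)) /\ cont_off N (fun x => co2 (A x)).

Lemma cont_offB_M N A A' : cont_offB N A -> cont_offB N A' -> cont_offB N (fun x => A x * A' x).
Proof.
move=> [a1 a2] [b1 b2]; split => x Nx.
  exact: (ccontinuousD (ccontinuousM (a1 x Nx) (b1 x Nx)) (ccontinuousM (a2 x Nx) (b2 x Nx))).
have h1 := ccontinuousD (ccontinuousM (a1 x Nx) (b2 x Nx)) (ccontinuousM (a2 x Nx) (b1 x Nx)).
have h2 := ccontinuousM (a2 x Nx) (b2 x Nx).
exact: (ccontinuousD h1 (ccontinuousM (@ccontinuous_cst _ _ _ _) h2)).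
Qed.

Lemma cont_offB_cst N (b : B) : cont_offB N (fun=> b).
Proof. by split => x Nx; exact: ccontinuous_cst. Qed.

Lemma cont_off_re (h : R -> R) (x : R) : {for x, continuous h} -> {for x, continuous (fun y => (h y)%:C : C)}.
Proof. by move=> hx; apply/cvg_ReImP; split => //; exact: cvg_cst. Qed.

Lemma cont_offB_zeta N (y : R -> C) : cont_off N y -> cont_offB N (fun x => zeta_of (Re (y x), Im (y x))).
Proof.
move=> cy; split => x Nx; have /cvg_ReImP[c1 c2] := cy x Nx.
  rewrite (_ : (fun x => _) = (fun x => (Re (y x))%:C)); last by apply/funext => z; rewrite zeta_ofE.
  exact: cont_off_re.
rewrite (_ : (fun x => _) = (fun x => (Im (y x))%:C)); last by apply/funext => z; rewrite zeta_ofE.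
exact: cont_off_re.
Qed.

Lemma cont_offB_zetaV N (y : R -> C) : cont_off N y -> (forall x, y x != 0) ->
  cont_offB N (fun x => (zeta_of (Re (y x), Im (y x)))^-1).
Proof.
move=> cy y0.
have E x : (zeta_of (Re (y x), Im (y x)))^-1 =
    Biharm (((Re (y x))%:C + 2 * 'i * (Im (y x))%:C) / (y x ^+ 2)) (- (Im (y x))%:C / (y x ^+ 2)).
  by rewrite zeta_of_inv /z_of/=; case: (y x) (y0 x).
have c12 x : ~ N x -> {for x, continuous (fun z => (Re (y z))%:C : C)} /\
    {for x, continuous (fun z => (Im (y z))%:C : C)}.
  by move=> Nx; have /cvg_ReImP[c1 c2] := cy x Nx; split; exact: cont_off_re.
have cy2 x : ~ N x -> {for x, continuous (fun z => y z ^+ 2)}.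
  by move=> Nx; exact: (ccontinuousM (cy x Nx) (cy x Nx)).
split => x Nx; have [c1 c2] := c12 x Nx.
  rewrite (_ : (fun x => _) = (fun z => ((Re (y z))%:C + 2 * 'i * (Im (y z))%:C) / (y z ^+ 2))); last first.
    by apply/funext => z; rewrite E.
  apply: (ccontinuous_div (g := fun z => y z ^+ 2)); [by rewrite expf_neq0| |exact: cy2].
  exact: (ccontinuousD c1 (ccontinuousM (@ccontinuous_cst _ _ _ _) c2)).
rewrite (_ : (fun x => _) = (fun z => - (Im (y z))%:C / (y z ^+ 2))); last by apply/funext => z; rewrite E.
apply: (ccontinuous_div (g := fun z => y z ^+ 2)); [by rewrite expf_neq0| |exact: cy2].
rewrite (_ : (fun x => _) = (fun z => (-1) * (Im (y z))%:C)); last by apply/funext => z; rewrite mulN1r.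
exact: (ccontinuousM (@ccontinuous_cst _ _ _ _) c2).
Qed.

End BiharmonicKernel.

(** * The Cauchy-type integral on the circle, its derivative and its components *)

Section CauchyTypeIntegral.
Variables (R : realType) (m : nat) (X : 'I_m -> R[i]) (beta gamma : 'I_m -> R).
Variables (s s1 : R[i] -> R[i]) (g : R -> R * R) (t : nat -> R).
Variables (phi1 phi3 : biharm R -> R).
Local Notation C := R[i].
Local Notation B := (biharm R).
Local Notation mu := (@lebesgue_measure R).
Local Notation I := (`[0, 2 * pi]%classic : set R).
Local Notation N := (corner_args X).
Local Notation J := ((2 * pi%:C * 'i)^-1 : C).
Hypothesis Xinj : injective X.
Hypothesis cm : corner_map X beta s s1.
Hypothesis gamma_bd : forall j, 0 < gamma j < 1 /\ gamma j < beta j + 1.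
Hypothesis pd1 : density X gamma (phi1 \o sigma_tilde s).
Hypothesis pd3 : density X gamma (phi3 \o sigma_tilde s).
Hypothesis pc : positive_contour X s (fun u => z_of (g u)) (fun u => z_of (g^`() u)) t.

Let zeta (w : C) : B := zeta_of (Re w, Im w).
Let f1 (x : R) : C := (phi1 (zeta (s (expi x))))%:C.
Let f3 (x : R) : C := (phi3 (zeta (s (expi x))))%:C.
Let V (x : R) : B := zeta (circle_velocity s1 x).
(** The Cauchy-type integrand on the circle with $(\tau-\zeta)^{-1}$ replaced by an arbitrary [A].
    It is linear in [A], so difference quotients of the integral are integrals of the same kind. *)
Let P (A : R -> B) (x : R) : B := (f1 x *: e1 + f3 x *: e2) * A x * V x.

Let mI : measurable I. Proof. exact: measurable_itv. Qed.

Let f1c : cont_off N f1. Proof. exact: (cont_off_density pd1). Qed.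
Let f3c : cont_off N f3. Proof. exact: (cont_off_density pd3). Qed.

Let velc : cont_off N (circle_velocity s1).
Proof.
move=> x Nx; have ce : {for x, continuous (fun y : R => 'i * expi y : C)}.
  exact: (ccontinuousM (@ccontinuous_cst _ _ _ _) (@expi_continuous R x)).
exact: (ccontinuousM ce (cont_off_deriv cm Nx)).
Qed.

Let PE A x :
  co1 (P A x) = f1 x * (co1 (A x * V x)) + f3 x * (co2 (A x * V x)) /\
  co2 (P A x) = f1 x * (co2 (A x * V x)) + f3 x * (co1 (A x * V x) + 2 * 'i * co2 (A x * V x)).
Proof.
rewrite /P -mulrA; set b := A x * V x; rewrite co1M co2M /=.
by split; ring.
Qed.

Let Vle x : co_le (V x) (cabs (s1 (expi x))).
Proof.
have := co_le_norm (V x); rewrite /V norm_zeta_of z_of_ReIm /circle_velocity.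
by rewrite !cabsM cabs_i cabs_expi !mul1r.
Qed.

Definition bintegrable (A : set R) (F : R -> B) :=
  cintegrable A (fun x => co1 (F x)) /\ cintegrable A (fun x => co2 (F x)).

Let P_integrable A M : cont_offB N A -> (forall x, ~ N x -> co_le (A x) M) ->
  bintegrable I (P A).
Proof.
move=> cA AM; have cN := countable_corner_args X.
have [c1 c2] := cont_offB_M cA (cont_offB_zeta velc).
have c12 : cont_off N (fun x => co1 (A x * V x) + 2 * 'i * co2 (A x * V x)).
  move=> x Nx; exact: (ccontinuousD (c1 x Nx) (ccontinuousM (@ccontinuous_cst _ _ _ _) (c2 x Nx))).
have b x : ~ N x -> co_le (A x * V x) (4 * M * cabs (s1 (expi x))).
  by move=> Nx; exact: (co_leM (AM x Nx) (Vle x)).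
have M0 x : ~ N x -> 0 <= M by move=> /AM[h _]; exact: le_trans (cabs_ge0 _) h.
have aux x q : ~ N x -> q <= 12 * M * cabs (s1 (expi x)) -> q <= 12 * M * (1 + cabs (s1 (expi x))).
  move=> Nx h; apply: (le_trans h); rewrite ler_wpM2l ?mulr_ge0 ?(M0 x)//.
  by rewrite lerDr.
have i1 : cintegrable I (fun x => f1 x * co1 (A x * V x)).
  apply: (density_integrable_gen Xinj cm gamma_bd pd1 cN (@subset_refl _ N) c1 (K := 12 * M)) => x Nx.
  apply: aux => //; have [h _] := b x Nx; have := cabs_ge0 (s1 (expi x)) => ?.
  by apply: (le_trans h); rewrite ler_wpM2r// ler_wpM2r ?(M0 x)// ler_nat.
have i2 : cintegrable I (fun x => f3 x * co2 (A x * V x)).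
  apply: (density_integrable_gen Xinj cm gamma_bd pd3 cN (@subset_refl _ N) c2 (K := 12 * M)) => x Nx.
  apply: aux => //; have [_ h] := b x Nx; have := cabs_ge0 (s1 (expi x)) => ?.
  by apply: (le_trans h); rewrite ler_wpM2r// ler_wpM2r ?(M0 x)// ler_nat.
have i3 : cintegrable I (fun x => f1 x * co2 (A x * V x)).
  apply: (density_integrable_gen Xinj cm gamma_bd pd1 cN (@subset_refl _ N) c2 (K := 12 * M)) => x Nx.
  apply: aux => //; have [_ h] := b x Nx; have := cabs_ge0 (s1 (expi x)) => ?.
  by apply: (le_trans h); rewrite ler_wpM2r// ler_wpM2r ?(M0 x)// ler_nat.
have i4 : cintegrable I (fun x => f3 x * (co1 (A x * V x) + 2 * 'i * co2 (A x * V x))).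
  apply: (density_integrable_gen Xinj cm gamma_bd pd3 cN (@subset_refl _ N) c12 (K := 12 * M)) => x Nx.
  apply: aux => //; have [h1 h2] := b x Nx.
  by apply: le_trans (ler_cabsD _ _) _; rewrite [cabs (2 * 'i * _)]cabsM cabs_2i; lra.
split.
  rewrite (_ : (fun x => _) = (fun x => f1 x * co1 (A x * V x) + f3 x * co2 (A x * V x))).
    exact: (cintegrableD mI i1 i2).
  by apply/funext => x; have [] := PE A x.
rewrite (_ : (fun x => _) = (fun x => f1 x * co2 (A x * V x) +
    f3 x * (co1 (A x * V x) + 2 * 'i * co2 (A x * V x)))).
  exact: (cintegrableD mI i3 i4).
by apply/funext => x; have [] := PE A x.
Qed.

Let bintegralB F G : bintegrable I F -> bintegrable I G ->
  bintegral I (fun x => F x - G x) = bintegral I F - bintegral I G.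
Proof.
move=> [F1 F2] [G1 G2]; apply: biharm_eq => /=.
  by rewrite (cintegralB mI F1 G1).
by rewrite (cintegralB mI F2 G2).
Qed.

Let bintegralMr F (b : B) : bintegrable I F ->
  bintegrable I (fun x => F x * b) /\ bintegral I (fun x => F x * b) = bintegral I F * b.
Proof.
move=> [F1 F2].
have E (a a' : C) : cintegrable I (fun x => a * co1 (F x) + a' * co2 (F x)) /\
    cintegral I (fun x => a * co1 (F x) + a' * co2 (F x)) =
    a * cintegral I (fun x => co1 (F x)) + a' * cintegral I (fun x => co2 (F x)).
  have h1 := cintegrableZ a mI F1; have h2 := cintegrableZ a' mI F2.
  split; first exact: (cintegrableD mI h1 h2).
  by rewrite (cintegralD mI h1 h2) (cintegralZ a mI F1) (cintegralZ a' mI F2).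
have e1 : (fun x => co1 (F x * b)) = (fun x => co1 b * co1 (F x) + co2 b * co2 (F x)).
  by apply/funext => x; rewrite co1M; ring.
have e2 : (fun x => co2 (F x * b)) =
    (fun x => co2 b * co1 (F x) + (co1 b + 2 * 'i * co2 b) * co2 (F x)).
  by apply/funext => x; rewrite co2M; ring.
have [i1 v1] := E (co1 b) (co2 b); have [i2 v2] := E (co2 b) (co1 b + 2 * 'i * co2 b).
split; first by split; rewrite ?e1 ?e2.
rewrite /bintegral e1 e2 v1 v2; apply: biharm_eq; rewrite ?co1M ?co2M /=; ring.
Qed.


Let mass_le_cintegrable (F : R -> C) : cintegrable I F ->
  exists2 W : R, 0 <= W & mass_le (fun x => cabs (F x)) W.
Proof.
move=> [mF Fy]; have F0 : (0 <= \int[mu]_(x in I) (cabs (F x))%:E)%E.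
  by apply: integral_ge0 => x _; rewrite lee_fin cabs_ge0.
exists (fine (\int[mu]_(x in I) (cabs (F x))%:E)); first exact: fine_ge0.
split; [exact: cmeasurable_cabsE|by move=> x; exact: cabs_ge0|].
by rewrite fineK// ge0_fin_numE.
Qed.

(** The bound is linear in [M] with a constant independent of [A]; applied to the remainder of the
    difference quotient it gives $O(|h|)$. *)
Let P_bound : exists2 W : R, 0 <= W & forall A M, 0 <= M -> cont_offB N A ->
  (forall x, ~ N x -> co_le (A x) M) -> co_le (bintegral I (P A)) (W * M).
Proof.
have cN := countable_corner_args X.
have sle x : cabs (s1 (expi x)) <= 1 * (1 + cabs (s1 (expi x))) by rewrite mul1r lerDr.
have i1 : cintegrable I (fun x => f1 x * s1 (expi x)).
  exact: (density_integrable_gen Xinj cm gamma_bd pd1 cN (@subset_refl _ N) (@cont_off_deriv _ _ _ _ _ _ cm) (fun x _ => sle x)).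
have i3 : cintegrable I (fun x => f3 x * s1 (expi x)).
  exact: (density_integrable_gen Xinj cm gamma_bd pd3 cN (@subset_refl _ N) (@cont_off_deriv _ _ _ _ _ _ cm) (fun x _ => sle x)).
have [W1 W10 m1] := mass_le_cintegrable i1; have [W3 W30 m3] := mass_le_cintegrable i3.
exists (24 * (W1 + W3)); first by rewrite mulr_ge0// addr_ge0.
move=> A M M0 cA AM; have [[mP1 _] [mP2 _]] := P_integrable cA AM.
have M12 : 0 <= 12 * M by rewrite mulr_ge0.
have mH := mass_leZ M12 (mass_leD m1 m3).
have key x : ~ N x -> co_le (P A x) (12 * M * (cabs (f1 x * s1 (expi x)) + cabs (f3 x * s1 (expi x)))).
  move=> Nx; have [h1 h2] : co_le (A x * V x) (4 * M * cabs (s1 (expi x))) by exact: (co_leM (AM x Nx) (Vle x)).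
  rewrite /co_le; have [-> ->] := PE A x; rewrite [cabs (f1 x * s1 _)]cabsM [cabs (f3 x * s1 _)]cabsM.
  set a := cabs (f1 x); set b := cabs (f3 x); set c := cabs (s1 _) in h1 h2 *.
  have a0 : 0 <= a by exact: cabs_ge0.
  have b0 : 0 <= b by exact: cabs_ge0.
  have c0 : 0 <= c by exact: cabs_ge0.
  have e : 12 * M * (a * c + b * c) = a * (12 * M * c) + b * (12 * M * c) by ring.
  have l412 : 4 * M * c <= 12 * M * c by rewrite ler_wpM2r// ler_wpM2r// ler_nat.
  rewrite e; split; apply: le_trans (ler_cabsD _ _) _; rewrite !cabsM -/a -/b; apply: lerD; rewrite ler_wpM2l//.
  - exact: le_trans h1 l412.
  - exact: le_trans h2 l412.
  - exact: le_trans h2 l412.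
  - by apply: le_trans (ler_cabsD _ _) _; rewrite [cabs (2 * 'i * _)]cabsM cabs_2i; lra.
have -> : 24 * (W1 + W3) * M = 2 * (12 * M * (W1 + W3)) by ring.
split; apply: (cabs_cintegral_mass cN _ mH) => // x Nx; by have [] := key x Nx.
Qed.

Let kernel_cont z : (forall x, z_of (Re (s (expi x)), Im (s (expi x))) != z_of z) ->
  cont_offB N (fun x => (zeta (s (expi x)) - zeta_of z)^-1).
Proof.
move=> zs.
  have -> : (fun x => (zeta (s (expi x)) - zeta_of z)^-1) =
     (fun x => (zeta_of (Re (s (expi x) - z_of z), Im (s (expi x) - z_of z)))^-1).
    apply/funext => x; congr (_^-1); rewrite /zeta zeta_ofB; congr zeta_of.
    by rewrite ReB ImB; case: z {zs}.
  apply: (cont_offB_zetaV (y := fun x => s (expi x) - z_of z)).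
    move=> x _; have h := continuous_map_expi cm (x := x).
    exact: (ccontinuousB h (@ccontinuous_cst _ _ _ _)).
  by move=> x; rewrite subr_eq0 -[s _]z_of_ReIm.
Qed.

(** The integrand is linear in the velocity, so [contour_integral_transfer] applies to each of its
    two complex coordinates. *)
Lemma cauchy_type_circle z : (forall x, z_of (Re (s (expi x)), Im (s (expi x))) != z_of z) ->
  cauchy_type g phi1 phi3 (zeta_of z) =
  J *: bintegral I (P (fun x => (zeta (s (expi x)) - zeta_of z)^-1)).
Proof.
move=> zs; rewrite /cauchy_type /bd_integral /bintegral; congr (_ *: _).
pose F (y v : C) : B := ((phi1 (zeta y))%:C *: e1 + (phi3 (zeta y))%:C *: e2) *
  (zeta y - zeta_of z)^-1 * zeta v.
have FZ y (r : R) v : F y (r%:C * v) = r%:C *: F y v.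
  rewrite /F -biharm_scaleAr; congr (_ * _); rewrite /zeta -zeta_ofZ; congr zeta_of.
  by rewrite ReMr ImMr.
have cA := kernel_cont zs.
have cf : cont_offB N (fun x => f1 x *: e1 + f3 x *: e2).
  split => x Nx.
    rewrite (_ : (fun x => _) = f1); first exact: f1c.
    by apply/funext => y; rewrite /= mulr1 mulr0 addr0.
  rewrite (_ : (fun x => _) = f3); first exact: f3c.
  by apply/funext => y; rewrite /= mulr1 mulr0 add0r.
have [F1 F2] := cont_offB_M (cont_offB_M cf cA) (cont_offB_zeta velc).
have zz w : zeta (z_of w) = zeta_of w by case: w.
have H1 y (r : R) v : 0 < r -> co1 (F y (r%:C * v)) = r%:C * co1 (F y v) by rewrite FZ.
have H2 y (r : R) v : 0 < r -> co2 (F y (r%:C * v)) = r%:C * co2 (F y v) by rewrite FZ.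
have T1 := contour_integral_transfer (F := fun y v => co1 (F y v)) cm pc H1 F1.
have T2 := contour_integral_transfer (F := fun y v => co2 (F y v)) cm pc H2 F2.
apply: biharm_eq.
  transitivity (cintegral `[0, 1] (fun u => co1 (F (z_of (g u)) (z_of (derive1 g u))))); last exact: T1.
  by congr (cintegral _ _); apply/funext => u; rewrite /F !zz.
transitivity (cintegral `[0, 1] (fun u => co2 (F (z_of (g u)) (z_of (derive1 g u))))); last exact: T2.
by congr (cintegral _ _); apply/funext => u; rewrite /F !zz.
Qed.


Let PB A A' x : P A x - P A' x = P (fun y => A y - A' y) x.
Proof. by rewrite /P mulrBr mulrBl. Qed.

Let PM A b x : P A x * b = P (fun y => A y * b) x.
Proof. by rewrite /P -!mulrA [V x * b]mulrC. Qed.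

(** With $a_h=\tau-\zeta-h$, the kernel of the difference quotient is $(a_ha_0)^{-1}$ and the
    candidate derivative has kernel $a_0^{-2}$. Their difference is of order $|h|$ uniformly on the
    contour, because [z_of z] stays at distance at least [e] from it. *)
Lemma cauchy_type_derivative z (e : R) (Phi : B -> B) (d : R) : 0 < e -> 0 < d ->
  (forall x, e <= cabs (s (expi x) - z_of z)) ->
  (forall q, cabs (z_of q - z_of z) < d -> Phi (zeta_of q) = cauchy_type g phi1 phi3 (zeta_of q)) ->
  exists l : B, (Phi (zeta_of z + h) - Phi (zeta_of z)) * h^-1
    @[h --> within (@biplane R `\ 0) (nbhs (0 : B))] --> l.
Proof.
move=> e0 d0 es PhiE.
have e2 : 0 < e / 2 by rewrite divr_gt0.
pose a q x : B := zeta (s (expi x)) - zeta_of (z + q).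
have aE q x : a q x = zeta_of (Re (s (expi x) - z_of (z + q)), Im (s (expi x) - z_of (z + q))).
  by rewrite /a /zeta zeta_ofB; congr zeta_of; rewrite ReB ImB; case: (z + q).
have far q x : cabs (z_of q) < e / 2 -> e / 2 <= cabs (s (expi x) - z_of (z + q)).
  move=> qe; have := es x.
  have -> : s (expi x) - z_of z = s (expi x) - z_of (z + q) + z_of q.
    by rewrite z_ofD opprD addrA subrK.
  move=> h; have := le_trans h (ler_cabsD _ _); lra.
have ale q x : cabs (z_of q) < e / 2 -> co_le (a q x)^-1 (3 / (e / 2)).
  by move=> qe; rewrite aE; apply: co_le_zetaV => //; rewrite z_of_ReIm; exact: far.
have aun q x : cabs (z_of q) < e / 2 -> a q x \is a GRing.unit.
  move=> qe; rewrite aE; apply: zeta_of_unit; rewrite z_of_ReIm -cabs_gt0.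
  exact: lt_le_trans (far q x qe).
have neq q x : cabs (z_of q) < e / 2 -> z_of (Re (s (expi x)), Im (s (expi x))) != z_of (z + q).
  move=> qe; rewrite z_of_ReIm -subr_eq0 -cabs_gt0; exact: lt_le_trans (far q x qe).
have ac q : cabs (z_of q) < e / 2 -> cont_offB N (fun x => (a q x)^-1).
  by move=> qe; apply: kernel_cont => x; exact: neq.
have z0 : cabs (z_of (0 : R * R)) < e / 2 by rewrite (_ : z_of 0 = 0) ?cabs0//; apply: eq_complexP.
have [K K0 KE] : exists2 K : R, 0 < K & K = 3 / (e / 2) by exists (3 / (e / 2)) => //; rewrite divr_gt0.
rewrite -KE in ale.
have [W W0 WP] := P_bound.
exists (J *: bintegral I (P (fun x => (a 0 x)^-1 * (a 0 x)^-1))).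
pose L : R := 2 * (cabs J * (W * (4 * (4 * (4 * K) * K) * K))).
have L0 : 0 <= L by rewrite /L !mulr_ge0 ?cabs_ge0 ?(ltW K0).
apply/cvgrPdist_lt => eps eps0.
pose dd := Num.min d (Num.min (e / 2) (eps / (L + 1))).
have L1 : 0 < L + 1 by rewrite ltr_wpDl.
have dd0 : 0 < dd by rewrite !lt_min d0 e2 divr_gt0.
rewrite near_withinE; apply/nbhs_ballP; exists dd => //= h.
rewrite -ball_normE /= sub0r normrN => hd [[q _ qE] h0]; move: hd; rewrite -qE norm_zeta_of.
rewrite !lt_min => /and3P[qd qe qeps].
have q0 : z_of q != 0.
  apply/eqP => q0; apply: h0; rewrite -qE zeta_ofE; case: q0 => -> ->; exact: biharm_eq.
have hu : zeta_of q \is a GRing.unit by exact: zeta_of_unit.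
rewrite -zeta_ofD PhiE; last first.
  by rewrite z_ofD addrAC subrr add0r.
rewrite PhiE; last by rewrite subrr cabs0.
rewrite (cauchy_type_circle (fun x => neq q x qe)).
have nz x : z_of (Re (s (expi x)), Im (s (expi x))) != z_of z by have := neq 0 x z0; rewrite addr0.
rewrite (cauchy_type_circle nz).
have iq := P_integrable (ac q qe) (fun x _ => ale q x qe).
have i0 := P_integrable (ac 0 z0) (fun x _ => ale 0 x z0).
have a0E x : zeta (s (expi x)) - zeta_of z = a 0 x by rewrite /a addr0.
rewrite (_ : P (fun x => (zeta (s (expi x)) - zeta_of z)^-1) = P (fun x => (a 0 x)^-1)); last first.
  by apply/funext => x; rewrite /P a0E.
have caa := cont_offB_M (ac 0 z0) (ac 0 z0).
have i00 := P_integrable caa (fun x _ => co_leM (ale 0 x z0) (ale 0 x z0)).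
rewrite -[P (fun x => (zeta (s (expi x)) - zeta_of (z + q))^-1)]/(P (fun x => (a q x)^-1)).
set bq := bintegral I _; set b0 := bintegral I _; set b00 := bintegral I _.
have -> : J *: b00 - (J *: bq - J *: b0) * (zeta_of q)^-1 = J *: (b00 - (bq - b0) * (zeta_of q)^-1).
  by rewrite -scalerBr -scalerAl scalerBr.
have iD : bintegrable I (fun x => P (fun y => (a q y)^-1) x - P (fun y => (a 0 y)^-1) x).
  by case: iq i0 => [q1 q2] [p1 p2]; split; [exact: (cintegrableB mI q1 p1)|exact: (cintegrableB mI q2 p2)].
have [iM vM] := bintegralMr (zeta_of q)^-1 iD.
rewrite /bq /b0 -(bintegralB iq i0) -vM /b00 -(bintegralB i00 iM).
(* This is the remainder: $a_0^{-2}-(a_ha_0)^{-1}=-h\,a_h^{-1}a_0^{-2}$, since $a_0-a_h=h$. *)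
pose A x := zeta_of q * (a q x)^-1 * (a 0 x)^-1 * (a 0 x)^-1.
have -> : (fun x => P (fun x0 => (a 0 x0)^-1 * (a 0 x0)^-1) x -
   (P (fun y => (a q y)^-1) x - P (fun y => (a 0 y)^-1) x) * (zeta_of q)^-1) = P (fun x => - A x).
  apply/funext => x; rewrite PB PM PB /P; congr (_ * _ * _); rewrite /A.
  have ee : a 0 x = a q x + zeta_of q.
    by rewrite /a addr0 (zeta_ofD z q); ring.
  have u0 := aun 0 x z0; have uq := aun q x qe.
  (* The algebra has zero divisors; the identity is checked after multiplying by the units $a_0$,
     $a_0$, $a_h$ and $h$. *)
  apply: (mulIr u0); apply: (mulIr u0); apply: (mulIr uq); apply: (mulIr hu).
  set h1 := zeta_of q in ee hu *; set A0 := a 0 x in ee u0 *; set Aq := a q x in ee uq *.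
  have r1 : A0^-1 * A0 = 1 by exact: mulVr.
  have r2 : Aq^-1 * Aq = 1 by exact: mulVr.
  have r3 : h1^-1 * h1 = 1 by exact: mulVr.
  transitivity ((A0^-1 * A0) * (A0^-1 * A0) * Aq * h1 - ((Aq^-1 * Aq) * A0 * A0 - (A0^-1 * A0) * A0 * Aq) * (h1^-1 * h1)); first by ring.
  transitivity (- (h1 * h1 * (Aq^-1 * Aq) * (A0^-1 * A0) * (A0^-1 * A0))); last by ring.
  by rewrite r1 r2 r3 ee; ring.
have cAA : cont_offB N A by exact: (cont_offB_M (cont_offB_M (cont_offB_M (cont_offB_cst N _) (ac q qe)) (ac 0 z0)) (ac 0 z0)).
have cA : cont_offB N (fun x => - A x).
  have := cont_offB_M (cont_offB_cst N (-1)) cAA.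
  by rewrite (_ : (fun x => -1 * A x) = (fun x => - A x))//; apply/funext => x; rewrite mulN1r.
have r0 : 0 <= cabs (z_of q) by exact: cabs_ge0.
set r := cabs (z_of q) in qd qe qeps r0.
have AM x : co_le (- A x) (4 * (4 * (4 * r * K) * K) * K).
  have hr : co_le (zeta_of q) r by have := co_le_norm (zeta_of q); rewrite norm_zeta_of.
  have := co_leM (co_leM (co_leM hr (ale q x qe)) (ale 0 x z0)) (ale 0 x z0).
  by move=> [h1 h2]; split; rewrite /= normcN.
have M0 : 0 <= 4 * (4 * (4 * r * K) * K) * K by rewrite !mulr_ge0 ?(ltW K0).
have [c1 c2] := WP _ _ M0 cA (fun x _ => AM x).
apply: (@le_lt_trans _ _ (L * r)).
  have -> : L * r = 2 * (cabs J * (W * (4 * (4 * (4 * r * K) * K) * K))) by rewrite /L; ring.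
  by apply: norm_le_co; apply: co_leZ; split.
have : r * (L + 1) < eps by rewrite -ltr_pdivlMr.
by move=> h1; have : 0 <= r by []; move: h1; rewrite mulrDr mulr1 [L * r]mulrC; lra.
Qed.

Lemma cauchy_type_components Z : disc Z ->
  let k1 f := cintegral I (fun x => f x * map_k1 s s1 x Z) in
  let k2 f := cintegral I (fun x => f x * map_k2 s s1 x Z) in
  cauchy_type g phi1 phi3 (sigma_tilde s Z) =
  Biharm (J * (k1 f1 + 2 * 'i * k2 f1 - 2 * k2 f3)) (J * (k1 f3 - 2 * 'i * k2 f3 - 2 * k2 f1)).
Proof.
move=> Zd k1 k2.
have sZ x := (interior_neq cm Zd x).2.
have zs x : z_of (Re (s (expi x)), Im (s (expi x))) != z_of (Re (s Z), Im (s Z)).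
  by rewrite !z_of_ReIm.
rewrite /sigma_tilde (cauchy_type_circle zs).
pose A x := (zeta (s (expi x)) - zeta_of (Re (s Z), Im (s Z)))^-1.
have AV x : A x * V x = Biharm (map_k1 s s1 x Z + 2 * 'i * map_k2 s s1 x Z) (- 2 * map_k2 s s1 x Z).
  rewrite /A /zeta zeta_ofB.
  have wE : z_of ((Re (s (expi x)), Im (s (expi x))) - (Re (s Z), Im (s Z))) = s (expi x) - s Z.
    by rewrite z_ofB !z_of_ReIm.
  rewrite /V /zeta biharm_cauchy_kernel wE ?subr_eq0// z_of_ReIm.
  by rewrite /map_k2 /map_k1 /circle_velocity.
have [_ h1 h2 _] := interior_integrable Xinj cm gamma_bd pd1 Zd.
have [_ h3 h4 _] := interior_integrable Xinj cm gamma_bd pd3 Zd.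
have lin (a b c : R -> C) (k l : C) : cintegrable I a -> cintegrable I b -> cintegrable I c ->
    cintegral I (fun x => a x + k * b x + l * c x) =
    cintegral I a + k * cintegral I b + l * cintegral I c.
  move=> ia ib ic; have kb := cintegrableZ k mI ib; have lc := cintegrableZ l mI ic.
  have ab := cintegrableD mI ia kb.
  by rewrite (cintegralD mI ab lc) (cintegralD mI ia kb) (cintegralZ k mI ib) (cintegralZ l mI ic).
have E1 : cintegral I (fun x => co1 (P A x)) = k1 f1 + 2 * 'i * k2 f1 + (- 2) * k2 f3.
  rewrite /k1 /k2 -(lin _ _ _ (2 * 'i) (- 2) h1 h2 h4); congr (cintegral I _).
  by apply/funext => x; have [-> _] := PE A x; rewrite AV [co1 _]/= [co2 _]/=; ring.
have E2 : cintegral I (fun x => co2 (P A x)) = k1 f3 + (- (2 * 'i)) * k2 f3 + (- 2) * k2 f1.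
  rewrite /k1 /k2 -(lin _ _ _ (- (2 * 'i)) (- 2) h3 h4 h2); congr (cintegral I _).
  by apply/funext => x; have [_ ->] := PE A x; rewrite AV [co1 _]/= [co2 _]/=; ring.
transitivity (Biharm (J * cintegral I (fun x => co1 (P A x))) (J * cintegral I (fun x => co2 (P A x)))) => //.
by rewrite E1 E2 !mulNr.
Qed.

End CauchyTypeIntegral.

(** * Principal values, the constants $C_\psi$ and the limits of the real parts *)

Section PrincipalValues.
Variables (R : realType) (m : nat) (X : 'I_m -> R[i]) (beta gamma : 'I_m -> R).
Variables (sigma : R[i] -> R[i]) (psi : R[i] -> R).
Local Notation C := R[i].
Local Notation mu := (@lebesgue_measure R).
Local Notation I := (`[0, 2 * pi]%classic : set R).
Local Notation N := (corner_args X).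
Local Notation J := ((2 * pi%:C * 'i)^-1 : C).
Local Notation s1 := (deriv_cdisc X sigma).
Hypothesis Xinj : injective X.
Hypothesis cm : corner_map X beta sigma s1.
Hypothesis gamma_bd : forall j, 0 < gamma j < 1 /\ gamma j < beta j + 1.
Hypothesis pd : density X gamma psi.
Hypothesis sq : forall T, (circle `\` range X) T -> cvg (contour_quotients X sigma T).

Let f (x : R) : C := (psi (expi x))%:C.
Let mI : measurable I. Proof. exact: measurable_itv. Qed.

Lemma radial_sequence (Z0 : C) : circle Z0 ->
  exists Zn : nat -> C, (forall n, disc (Zn n)) /\ Zn n @[n --> \oo] --> Z0.
Proof.
move=> Z1; exists (fun n => (1 - n.+1%:R^-1 : R)%:C * Z0); split.
  move=> n; rewrite /disc/= cabsM Z1 mulr1 cabs_real.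
  have n0 : 0 < (n.+1%:R^-1 : R) by rewrite invr_gt0.
  have n1 : (n.+1%:R^-1 : R) <= 1 by rewrite invf_le1// ler1n.
  by rewrite ger0_norm ?subr_ge0// ltrBlDr ltrDl.
apply/cvgcP => e e0; near=> n.
rewrite -[X in _ - X]mul1r -mulrBl cabsM Z1 mulr1.
rewrite (_ : (1 : C) = (1 : R)%:C)// -realcB cabs_real addrC addKr normrN ger0_norm ?invr_ge0//.
near: n; exact: near_infty_natSinv_lt (PosNum e0).
Unshelve. all: by end_near. Qed.

Lemma measurable_eq_off (F G : R -> R) (A K : set R) : measurable A -> countable K ->
  measurable_fun A G -> (forall x, A x -> ~ K x -> F x = G x) -> measurable_fun A F.
Proof.
move=> mA cK mG FG _ Y mY.
have -> : A `&` F @^-1` Y = ((A `&` G @^-1` Y) `\` K) `|` (A `&` F @^-1` Y `&` K).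
  apply/seteqP; split => x.
    move=> [Ax FY]; have [Kx|Kx] := pselect (K x); [by right|left].
    by split => //; split => //; rewrite /preimage/= -FG.
  by move=> [[[Ax GY] Kx]|[[Ax FY] _]]; split => //; rewrite /preimage/= FG.
apply: measurableU.
  by apply: measurableD; [exact: mG|exact: countable_measurable].
apply: countable_measurable => //; apply: sub_countable cK.
by apply: subset_card_le; exact: subIsetr.
Qed.

Lemma eq_cintegral_off (F G : R -> C) (A K : set R) : measurable A -> countable K ->
  cmeasurable A G -> (forall x, A x -> ~ K x -> F x = G x) -> cintegral A F = cintegral A G.
Proof.
move=> mA cK mG FG; have [mG1 mG2] := mG.
have mF : cmeasurable A F.
  split; [apply: (measurable_eq_off mA cK mG1)|apply: (measurable_eq_off mA cK mG2)] => x Ax Kx;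
  by rewrite FG.
rewrite -(cintegral_setD_countable mA cK mF) -(cintegral_setD_countable mA cK mG).
by apply: eq_cintegral => x [Ax Kx]; exact: FG.
Qed.

(** Write $\sigma_2=(\sigma-\overline\sigma)/(2i)$. On the circle $\overline{S-T}=-(S-T)\,\overline
    S\,\overline T$, so the contour quotient of $\overline\sigma$ is $-\overline S\,\overline T$
    times the conjugate quotient of $\sigma$. *)
Lemma contour_deriv_sigma2 T : (circle `\` range X) T ->
  contour_deriv X (sigma2 sigma) T =
  (2 * 'i)^-1 * (contour_deriv X sigma T + conjc (contour_deriv X sigma T) * conjc T ^+ 2).
Proof.
move=> TX; have T1 := TX.1; set s' := contour_deriv X sigma T.
have c1 : contour_quotients X sigma T --> s' by exact: sq.
pose F := within ((circle `\` range X) `\ T) (nbhs T).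
have FF : Filter F by exact: within_filter.
(* Uniqueness of the limit requires a proper filter: regular points of the circle other than [T]
   accumulate at [T]. *)
have n0 : ~ F set0.
  move=> /near_withinc[e e0 eP]; have [d d0 dP] := near_notin_corner TX.2.
  have [x _ xT] := circle_argP T1.
  pose h := Num.min 1 (Num.min (e / 2) (d / 2)).
  have h0 : 0 < h by rewrite !lt_min ltr01 !divr_gt0.
  have [h1 h2 h3] : [/\ h <= 1, h <= e / 2 & h <= d / 2] by rewrite /h !ge_min !lexx ?orbT.
  have hd : cabs (expi (x + h) - T) <= h.
    by rewrite -xT; apply: le_trans (chord_le _ _) _; rewrite addrAC subrr add0r gtr0_norm.
  apply: (eP (expi (x + h))); first by lra.
  split; first by split; [exact: circle_expi|apply: dP; lra].
  rewrite /= -xT => /expi_inj eh; have : x + h = x.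
    by apply: eh; rewrite addrAC subrr add0r gtr0_norm//; have := @pi_ge2 R; lra.
  by move=> /eqP; rewrite -subr_eq0 addrAC subrr add0r gt_eqF.
have PF : ProperFilter F by split.
have cS : S @[S --> F] --> T by exact: cvg_within.
have i0 : 2 * 'i != 0 :> C by rewrite -cabs_gt0 cabs_2i.
have c2 : (2 * 'i)^-1 * ((sigma S - sigma T) / (S - T) +
    conjc ((sigma S - sigma T) / (S - T)) * (conjc S * conjc T)) @[S --> F] -->
    (2 * 'i)^-1 * (s' + conjc s' * (conjc T * conjc T)).
  have h1 := @ccvgM _ _ F FF _ _ _ _ (@ccvg_conj _ _ F FF _ _ cS) (@ccvg_cst R C F FF (conjc T)).
  have h2 := @ccvgM _ _ F FF _ _ _ _ (@ccvg_conj _ _ F FF _ _ c1) h1.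
  exact: (@ccvgM _ _ F FF _ _ _ _ (@ccvg_cst R C F FF _) (@ccvgD _ _ F FF _ _ _ _ c1 h2)).
have hC : hausdorff_space C by exact: norm_hausdorff.
rewrite expr2 /contour_deriv.
suff c3 : contour_quotients X (sigma2 sigma) T --> (2 * 'i)^-1 * (s' + conjc s' * (conjc T * conjc T)).
  by apply: (@cvg_lim C hC C F PF _ _ c3).
apply: cvg_trans c2; apply: near_eq_cvg.
rewrite /F near_withinE; apply: nearW => S [[S1 _] /= ST].
have ST0 : S - T != 0 by rewrite subr_eq0; apply/eqP.
have TS0 : T - S != 0 by rewrite -opprB oppr_eq0.
have S0 : S != 0 by exact: circle_neq0.
have T0 : T != 0 by exact: circle_neq0.
have i1 : 'i != 0 :> C by rewrite -cabs_gt0 cabs_i.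
have cSi : conjc S = S^-1 by apply: (mulIf S0); rewrite mulVf// mulrC mulcJ S1 expr1n.
have cTi : conjc T = T^-1 by apply: (mulIf T0); rewrite mulVf// mulrC mulcJ T1 expr1n.
have im w : (Im w)%:C = (w - conjc w) / (2 * 'i) :> C.
  by apply: (mulIf i0); rewrite divfK//; apply: eq_complexP; case: w => a b; rewrite /=; ring.
rewrite !conjcM conjcV !conjcB cSi cTi /sigma2 !im; field.
by rewrite mulN1r ST0 i1 T0 S0 TS0.
Qed.

(** After multiplication by $dS/dx$ and division by $S-Z_0$, the factors $d$ and $d_2$ combine into
    $\sigma(S)-\sigma(Z_0)$ and its imaginary part, and [contour_deriv_sigma2] removes
    $\sigma_2'$. *)
Lemma Omega_kernels Z0 x : (circle `\` range X) Z0 -> ~ N x -> expi x != Z0 ->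
  Omega1 X sigma psi (expi x) Z0 / (expi x - Z0) * ('i * expi x) =
    f x * (map_k1 sigma s1 x Z0 - cauchy_k x Z0) /\
  Omega2 X sigma psi (expi x) Z0 / (expi x - Z0) * ('i * expi x) = f x * map_k2 sigma s1 x Z0.
Proof.
move=> ZX Nx xZ; set S := expi x in xZ *.
have SX : (circle `\` range X) S.
  by split; [exact: circle_expi|move=> h; exact: Nx].
have S1 := SX.1.
have sE : contour_deriv X sigma S = s1 S by rewrite /deriv_cdisc S1 ltxx.
have SZ : S - Z0 != 0 by rewrite subr_eq0.
have w0 : sigma S - sigma Z0 != 0.
  rewrite subr_eq0; apply/eqP => h; move/eqP: xZ; apply.
  exact: (map_inj_cdisc cm (circle_cdisc S1) (circle_cdisc ZX.1) h).
have S0 : S != 0 by exact: circle_neq0.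
have i0 : 'i != 0 :> C by rewrite -cabs_gt0 cabs_i.
split.
  rewrite /Omega1 /dquot sE /map_k1 /cauchy_k -/S /f; field.
  by rewrite SZ w0.
rewrite /Omega2 /dquot contour_deriv_sigma2// sE /map_k2 -/S /f.
have cS : conjc S = S^-1.
  by apply: (mulIf S0); rewrite mulVf// mulrC mulcJ S1 expr1n.
rewrite !conjcM conjc_i cS /sigma2.
have im w : (Im w)%:C = (w - conjc w) / (2 * 'i) :> C.
  have i2 : 2 * 'i != 0 :> C by rewrite mulf_neq0// pnatr_eq0.
  by apply: (mulIf i2); rewrite divfK//; apply: eq_complexP; case: w => a b; rewrite /=; ring.
rewrite !im conjcB; field.
by rewrite SZ w0 S0 i0.
Qed.

(** The limit theorems provide absolute integrability at [Z0], so [cvg_truncated_integral] applies.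
    The given and the simplified integrands may differ only at corner angles and at angles of [Z0],
    a countable set. *)
Lemma principal_values Z0 : (circle `\` range X) Z0 ->
  pv_truncations (Omega1 X sigma psi) Z0 -->
    J * cintegral I (fun x => f x * (map_k1 sigma s1 x Z0 - cauchy_k x Z0)) /\
  pv_truncations (Omega2 X sigma psi) Z0 -->
    J * cintegral I (fun x => f x * map_k2 sigma s1 x Z0).
Proof.
move=> ZX; have [Zn [Zd Zc]] := radial_sequence ZX.1.
have [i1 _] := map_k1_limit Xinj cm gamma_bd pd ZX Zd Zc.
have [i2 _] := map_k2_limit Xinj cm gamma_bd pd ZX Zd Zc.
have cT := @countable_expi_fiber R Z0.
have cN := countable_corner_args X.
have K (Om : C -> C -> C) (G : R -> C) : cintegrable I G ->
    (forall x, ~ N x -> expi x != Z0 -> Om (expi x) Z0 / (expi x - Z0) * ('i * expi x) = G x) ->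
    pv_truncations Om Z0 --> J * cintegral I G.
  move=> iG OG; have [mG _] := iG.
  have h := cvg_truncated_integral (T := Z0) iG.
  rewrite (cintegral_setD_countable mI cT mG) in h.
  have F0 : Filter (0 : R)^'+ by exact: at_right_proper_filter.
  have h' := @ccvgM R _ _ F0 _ _ _ _ (@ccvg_cst R _ _ F0 J) h.
  rewrite /pv_truncations; apply: cvg_trans h'; apply: near_eq_cvg.
  near=> d; congr (J * _); rewrite /circle_integral.
  have mA : measurable (I `&` (@expi R) @^-1` [set S | d < cabs (S - Z0)]).
    apply: measurableI => //.
    have -> : (@expi R) @^-1` [set S | d < cabs (S - Z0)] =
        setT `&` (fun x => cabs (expi x - Z0)) @^-1` `]d, +oo[%classic.
      by rewrite setTI; apply/seteqP; split => x /=; rewrite in_itv/= andbT.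
    exact: (measurable_dist_expi Z0).
  have mG' : cmeasurable (I `&` (@expi R) @^-1` [set S | d < cabs (S - Z0)]) G.
    by apply: cmeasurableS mG => //; exact: subIsetl.
  apply/esym/(eq_cintegral_off mA cN mG') => x [_ /= dx] Nx; apply: OG => //.
  have d0 : 0 < d by near: d; exact: nbhs_right_gt.
  by rewrite -subr_eq0 -cabs_gt0 (lt_trans d0).
split; apply: K => //.
  by move=> x Nx xZ; have [] := Omega_kernels ZX Nx xZ.
by move=> x Nx xZ; have [] := Omega_kernels ZX Nx xZ.
Unshelve. all: by end_near. Qed.

(** Since $dS/S=i\,dx$, the constant is half the mean of [psi], a real number. *)
Lemma C_real : C_ psi = ((4 * pi)^-1 * (\int[mu]_(x in I) psi (expi x))%R)%:C.
Proof.
have p0 : pi != 0 :> R by rewrite gt_eqF// pi_gt0.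
have i0 : 'i != 0 :> C by rewrite -cabs_gt0 cabs_i.
have fi : cintegrable I f by exact: (density_integrable Xinj cm gamma_bd pd).
rewrite /C_ /circle_integral (_ : (_ `&` _) = I); last first.
  by apply/seteqP; split => x //= [].
have -> : cintegral I (fun x => (psi (expi x))%:C / expi x * ('i * expi x)) = 'i * cintegral I f.
  rewrite -(cintegralZ _ mI fi); congr (cintegral _ _); apply/funext => x.
  have := expi_neq0 x => e0; rewrite /f; field; exact: e0.
have -> : cintegral I f = (\int[mu]_(x in I) psi (expi x))%R%:C.
  apply: eq_complexP => //=; rewrite /Rintegral integral0_eq//.
have alg (q : R) (w : C) : q != 0 -> (4 * q%:C * 'i)^-1 * ('i * w) = ((4 * q)^-1)%:C * w.
  move=> q0; have qC : q%:C != 0 :> C by rewrite -cabs_gt0 cabs_real normr_gt0.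
  rewrite realcV realcM (_ : (4 : R)%:C = 4 :> C); last by rewrite rmorphMn.
  by field; rewrite i0 qC.
by rewrite alg// -realcM.
Qed.

Lemma map_k1_boundary Z0 (Zn : nat -> C) : (circle `\` range X) Z0 -> (forall n, disc (Zn n)) ->
  Zn n @[n --> \oo] --> Z0 ->
  Re (J * cintegral I (fun x => f x * map_k1 sigma s1 x (Zn n))) @[n --> \oo] -->
  psi Z0 / 2 + (4 * pi)^-1 * (\int[mu]_(x in I) psi (expi x))%R +
  Re (J * cintegral I (fun x => f x * (map_k1 sigma s1 x Z0 - cauchy_k x Z0))).
Proof.
move=> ZX Zd Zc.
have [_ l1] := map_k1_limit Xinj cm gamma_bd pd ZX Zd Zc.
have l0 := cauchy_limit Xinj cm gamma_bd pd ZX Zd Zc.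
have FN : Filter (\oo : set_system nat) by exact: eventually_filter.
have l1' := @ccvgM R _ _ FN _ _ _ _ (@ccvg_cst R _ _ FN J) l1.
have /cvg_ReImP[lr _] := l1'.
rewrite (_ : (fun n => Re (J * cintegral I (fun x => f x * map_k1 sigma s1 x (Zn n)))) =
  (fun n => Re (J * cintegral I (fun x => f x * cauchy_k x (Zn n))) +
    Re (J * cintegral I (fun x => f x * (map_k1 sigma s1 x (Zn n) - cauchy_k x (Zn n)))))).
  exact: (cvgD l0 lr).
apply/funext => n; have [h1 h2 _ _] := interior_integrable Xinj cm gamma_bd pd (Zd n).
rewrite -ReD -mulrDr; congr (Re (J * _)).
rewrite [X in _ + X](_ : _ = cintegral I (fun x => f x * map_k1 sigma s1 x (Zn n) - f x * cauchy_k x (Zn n))).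
  by rewrite (cintegralB mI h2 h1) addrC subrK.
by congr (cintegral _ _); apply/funext => x; rewrite mulrBr.
Qed.

Lemma map_k2_boundary Z0 (Zn : nat -> C) : (circle `\` range X) Z0 -> (forall n, disc (Zn n)) ->
  Zn n @[n --> \oo] --> Z0 ->
  J * cintegral I (fun x => f x * map_k2 sigma s1 x (Zn n)) @[n --> \oo] -->
  J * cintegral I (fun x => f x * map_k2 sigma s1 x Z0).
Proof.
move=> ZX Zd Zc; have [_ l] := map_k2_limit Xinj cm gamma_bd pd ZX Zd Zc.
have FN : Filter (\oo : set_system nat) by exact: eventually_filter.
exact: (@ccvgM R _ _ FN _ _ _ _ (@ccvg_cst R _ _ FN J) l).
Qed.

End PrincipalValues.

Lemma norm_combination (R : realType) (x y a b c d e f : R) :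
  `|a| <= x -> `|b| <= y -> `|c| <= x -> `|d| <= x -> `|e| <= y -> `|f| <= y -> 0 <= x -> 0 <= y ->
  `|a - 2 * c - 2 * f| <= 3 * x + 3 * y /\ `|b + 2 * e - 2 * d| <= 3 * x + 3 * y.
Proof.
rewrite !ler_norml => /andP[? ?] /andP[? ?] /andP[? ?] /andP[? ?] /andP[? ?] /andP[? ?] ? ?.
by split; apply/andP; split; lra.
Qed.

(** * Equivalence of the boundary value problem and the system *)

Section ReductionToIntegralEquations.
Variables (R : realType) (D : set (R * R)) (m : nat) (p : 'I_m -> R * R).
Variables (g : R -> R * R) (t : nat -> R) (sigma : R[i] -> R[i]) (X : 'I_m -> R[i]).
Variables (alpha beta : 'I_m -> R).
Local Notation C := R[i].
Local Notation B := (biharm R).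
Local Notation mu := (@lebesgue_measure R).
Local Notation I := (`[0, 2 * pi]%classic : set R).
Local Notation J := ((2 * pi%:C * 'i)^-1 : C).
Local Notation s1 := (deriv_cdisc X sigma).
Hypothesis D_open : open D.
Hypothesis Xinj : injective X.
Hypothesis D_bd : pw_smooth_boundary D p g t.
Hypothesis sigma_conf : conformal_ext D sigma.
Hypothesis sigma_X : forall j, circle (X j) /\ sigma (X j) = z_of (p j).
Hypothesis ha : hyp_a X sigma beta.
Hypothesis alpha_bd : forall j, 0 < alpha j < 1.
Hypothesis alpha_beta : forall j, 0 <= beta j -> alpha j < 1 / (beta j + 1).
Hypothesis cm : corner_map X beta sigma s1.
Local Notation gamma := (fun j => (beta j + 1) * alpha j).
Local Notation st := (sigma_tilde sigma).

(** For $\beta_j\ge0$ the bound $\gamma_j<1$ is the hypothesis on $\alpha_j$; for $\beta_j<0$ both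
    factors of $\gamma_j$ are below 1. Finally $\gamma_j<\beta_j+1$ because $\alpha_j<1$. *)
Lemma gamma_bounds j : 0 < gamma j < 1 /\ gamma j < beta j + 1.
Proof.
have /andP[b0 b1] := cm_beta cm j; have /andP[a0 a1] := alpha_bd j.
have bp : 0 < beta j + 1 by lra.
have g1 : gamma j < beta j + 1 by rewrite -[ltRHS]mulr1 ltr_pM2l.
split => //; rewrite mulr_gt0//=; have [bn|bneg] := leP 0 (beta j); last by lra.
by have := alpha_beta bn; rewrite ltr_pdivlMr// mulrC.
Qed.

Lemma norm_sigma_tilde S T : `|st S - st T| = cabs (sigma S - sigma T).
Proof. by rewrite /sigma_tilde zeta_ofB norm_zeta_of z_ofB !z_of_ReIm. Qed.

Lemma sigma_tilde_corner j : st (X j) = zeta_of (p j).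
Proof. by rewrite /sigma_tilde (sigma_X j).2; case: (p j). Qed.

Let weight_le : exists2 K : R, 0 < K & forall S, (circle `\` range X) S ->
  prodX X (fun j => - gamma j) S <= K * \prod_j `|st S - zeta_of (p j)| `^ (- alpha j) /\
  \prod_j `|st S - zeta_of (p j)| `^ (- alpha j) <= K * prodX X (fun j => - gamma j) S.
Proof.
have ex j : exists K : R, 0 < K /\ forall S, (circle `\` range X) S ->
    cabs (S - X j) `^ (- gamma j) <= K * `|st S - zeta_of (p j)| `^ (- alpha j) /\
    `|st S - zeta_of (p j)| `^ (- alpha j) <= K * cabs (S - X j) `^ (- gamma j).
  have [K K0 KP] := map_corner_weight_le cm (- alpha j) j; exists K; split => // S SX.
  by have := KP S SX; rewrite mulrN -sigma_tilde_corner norm_sigma_tilde.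
have [K KP] := choice ex.
exists (\prod_j K j); first by apply: prodr_gt0 => j _; have [] := KP j.
move=> S SX; rewrite /prodX -!big_split; split; apply: ler_prod => j _ /=;
  by rewrite powR_ge0 /=; have [_ /(_ S SX)[]] := KP j.
Qed.

Lemma bd_class_density phi : bd_class D p alpha phi -> density X gamma (phi \o st).
Proof.
move=> [pc [c cP]]; split.
- move=> T TX e e0; have bT := bd_zetaP D_open sigma_conf sigma_X TX.
  move/subspace_continuousP: pc => /(_ _ bT)/cvgrPdist_lt/(_ _ e0).
  rewrite near_withinE => /nbhs_ballP[d d0 dP].
  have [d' d'0 d'P] := cm_cont cm (circle_cdisc TX.1) d0.
  exists d' => // S SX SD; rewrite distrC; apply: dP; last exact: (bd_zetaP D_open sigma_conf sigma_X SX).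
  rewrite -ball_normE/= norm_sigma_tilde cabsB; apply: d'P => //; exact: (circle_cdisc SX.1).
have [K K0 KP] := weight_le.
exists ((`|c| + 1) * K); first by rewrite mulr_gt0// ltr_wpDl.
move=> S SX; have := cP _ (bd_zetaP D_open sigma_conf sigma_X SX).
have [_ h] := KP S SX; set w := \prod_j _ in h *; move=> h1.
have w0 : 0 <= w by apply: prodr_ge0 => j _; exact: powR_ge0.
apply: (le_trans h1); rewrite -mulrA; apply: (@le_trans _ _ ((`|c| + 1) * w)).
  by rewrite ler_wpM2r//; have := ler_norm c; lra.
by rewrite ler_wpM2l// addr_ge0.
Qed.

Lemma density_classK psi : density X gamma psi -> classK X gamma psi.
Proof.
move=> [pc [c c0 cP]]; split; last by exists c.
apply/subspace_continuousP => T TX; apply/cvgrPdist_lt => e e0.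
have [d d0 dP] := pc T TX e e0; apply/near_withinc; exists d => // S SD SX.
by rewrite distrC; exact: dP.
Qed.

Lemma classK_density psi : classK X gamma psi -> density X gamma psi.
Proof.
move=> [pc [c cP]]; split.
  move=> T TX e e0; move/subspace_continuousP: pc => /(_ _ TX)/cvgrPdist_lt/(_ _ e0).
  move=> /near_withinc[d d0 dP]; exists d => // S SX SD.
  by rewrite distrC; exact: dP.
exists (`|c| + 1); first by rewrite ltr_wpDl.
move=> S SX; apply: (le_trans (cP S SX)); rewrite ler_wpM2r//.
  by apply: prodr_ge0 => j _; exact: powR_ge0.
by have := ler_norm c; lra.
Qed.

(** Compose [psi] with the inverse homeomorphism. Continuity of the inverse gives continuity on the
    boundary, and the comparison of weights gives the growth bound. *)
Lemma classK_pullback psi : classK X gamma psi ->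
  exists2 phi : B -> R, bd_class D p alpha phi &
    forall S, (circle `\` range X) S -> phi (st S) = psi S.
Proof.
move=> /classK_density[pc [c c0 cP]].
have [_ _ [_ [f [_ fP _]]]] := sigma_conf.
pose phi (zeta : B) := psi (f (z_of (Re (co1 zeta), Re (co2 zeta)))).
have phiE S : (circle `\` range X) S -> phi (st S) = psi S.
  move=> SX; have [_ fS] := fP S (circle_cdisc SX.1).
  by rewrite /phi /sigma_tilde zeta_ofE [Re (co1 _)]/= [Re (co2 _)]/= z_of_ReIm fS.
exists phi => //; split.
  apply/subspace_continuousP => zeta /(bd_zeta_onto D_open sigma_conf sigma_X)[T TX ->].
  apply/cvgrPdist_lt => e e0; have [d d0 dP] := pc T TX e e0.
  have [d' d'0 d'P] := cm_inv cm (circle_cdisc TX.1) d0.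
  rewrite near_withinE; apply/nbhs_ballP; exists d' => // zeta' zd.
  move=> /(bd_zeta_onto D_open sigma_conf sigma_X)[S SX zE].
  move: zd; rewrite zE -ball_normE/= norm_sigma_tilde cabsB => zd.
  change (is_true (`|phi (st T) - phi (st S)| < e)).
  by rewrite !phiE// distrC; apply: dP => //; apply: d'P => //; exact: (circle_cdisc SX.1).
have [K K0 KP] := weight_le; exists (c * K) => zeta /(bd_zeta_onto D_open sigma_conf sigma_X)[S SX ->].
rewrite phiE//; apply: (le_trans (cP S SX)); rewrite -mulrA ler_wpM2l ?(ltW c0)//.
by have [] := KP S SX.
Qed.

(** [V S] is the limit along every sequence of the disc tending to [S]. One radial sequence suffices
    to identify it with a given boundary value; conversely, were the full limit to fail, points
    violating it ever closer to [st S] would form a forbidden sequence. *)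
Lemma bvp_limitP (U u : B -> R) (Phi : B -> B) (V : C -> R) :
  (forall S (Zn : nat -> C), (circle `\` range X) S -> (forall n, disc (Zn n)) ->
     Zn n @[n --> \oo] --> S -> U (Phi (st (Zn n))) @[n --> \oo] --> V S) ->
  (forall zeta0, bd_zeta D p zeta0 ->
     U (Phi zeta) @[zeta --> within (D_zeta D) (nbhs zeta0)] --> u zeta0) <->
  forall S, (circle `\` range X) S -> V S = u (st S).
Proof.
move=> UV; split.
  move=> bv S SX; have [Zn [Zd Zc]] := radial_sequence SX.1.
  have l1 := UV S Zn SX Zd Zc.
  have l2 : U (Phi (st (Zn n))) @[n --> \oo] --> u (st S).
    apply/cvgrPdist_lt => e e0.
    have := bv _ (bd_zetaP D_open sigma_conf sigma_X SX).
    move=> /cvgrPdist_lt/(_ _ e0); rewrite near_withinE => /nbhs_ballP[d d0 dP].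
    have [d' d'0 d'P] := cm_cont cm (circle_cdisc SX.1) d0.
    move/cvgcP: Zc => /(_ _ d'0); apply: filterS => n nd; apply: dP; last exact: (D_zetaP sigma_conf).
    rewrite -ball_normE/= norm_sigma_tilde cabsB; apply: d'P => //; exact: disc_cdisc.
  exact: (cvg_unique _ l1 l2).
move=> VE zeta0 /(bd_zeta_onto D_open sigma_conf sigma_X)[S SX ->].
apply/cvgrPdist_lt => e e0; apply: contrapT => nn.
(* The violating points are chosen by their images; continuity of the inverse map then makes them
   converge to [S]. *)
have ex n : exists Z, [/\ disc Z, cabs (sigma Z - sigma S) < n.+1%:R^-1 & e <= `|u (st S) - U (Phi (st Z))|].
  apply: contrapT => nex; apply: nn; rewrite near_withinE; apply/nbhs_ballP.
  exists n.+1%:R^-1; first by rewrite /= invr_gt0.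
  move=> zeta zd /(D_zeta_onto sigma_conf)[Z Z1 zE]; rewrite ltNge; apply/negP => le; apply: nex.
  exists Z; split; rewrite -?zE//; move: zd; rewrite -ball_normE/= zE norm_sigma_tilde.
  by rewrite cabsB.
have [Zn ZnP] := choice ex.
have Zd n : disc (Zn n) by have [] := ZnP n.
have Zc : Zn n @[n --> \oo] --> S.
  apply/cvgcP => d d0; have [d' d'0 d'P] := cm_inv cm (circle_cdisc SX.1) d0.
  near=> n; apply: d'P; first exact: disc_cdisc.
  have [_ h _] := ZnP n; apply: (lt_trans h).
  by near: n; exact: near_infty_natSinv_lt (PosNum d'0).
have := UV S Zn SX Zd Zc; rewrite VE// => /cvgrPdist_lt/(_ _ e0)[n0 _ /(_ n0 (leqnn _))] /=.
by rewrite ltNge; have [_ _ ->] := ZnP n0.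
Unshelve. all: by end_near. Qed.

(** With $r=|Z-X_j|$, $r^{-\gamma_j}=(r^{\beta_j+1})^{-\alpha_j}$, and $r^{\beta_j+1}\ge
    c^{-1}|\sigma(Z)-\sigma(X_j)|$ by [map_corner_dist_le]. *)
Lemma bvp_growth (U : B -> R) (Phi : B -> B) j :
  (exists K d : R, 0 < d /\ forall Z, disc Z -> cabs (Z - X j) < d ->
     `|U (Phi (st Z))| <= K * cabs (Z - X j) `^ (- gamma j)) ->
  exists c : R, \forall zeta \near within (D_zeta D) (nbhs (zeta_of (p j))),
     `|U (Phi zeta)| <= c * `|zeta - zeta_of (p j)| `^ (- alpha j).
Proof.
move=> [K [d [d0 KP]]]; have [c [d' [c0 d'0 cP]]] := map_corner_dist_le cm j.
have /andP[b0 b1] := cm_beta cm j; have bp : 0 < beta j + 1 by lra.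
have /andP[a0 a1] := alpha_bd j.
have dd0 : 0 < Num.min d d' by rewrite lt_min d0.
have [e e0 eP] := cm_inv cm (circle_cdisc (cm_circle cm j)) dd0.
exists ((`|K| + 1) * c `^ alpha j).
rewrite near_withinE; apply/nbhs_ballP; exists e => // zeta zd /(D_zeta_onto sigma_conf)[Z Z1 zE].
move: zd; rewrite -ball_normE/= -sigma_tilde_corner zE distrC norm_sigma_tilde => zd.
have := eP Z (disc_cdisc Z1) zd; rewrite lt_min => /andP[Zd Zd'].
have ZX : Z != X j.
  by apply/eqP => h; have := Z1; rewrite /disc/= h (cm_circle cm j) ltxx.
have r0 : 0 < cabs (Z - X j) by rewrite cabs_gt0 subr_eq0.
have := cP Z (disc_cdisc Z1) ZX Zd'; set r := cabs (Z - X j) in r0 Zd Zd' *.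
set w := cabs (sigma Z - sigma (X j)) => wr.
have w0 : 0 < w.
  rewrite cabs_gt0 subr_eq0; apply/eqP => h; move/eqP: ZX; apply.
  exact: (map_inj_cdisc cm (disc_cdisc Z1) (circle_cdisc (cm_circle cm j)) h).
have rg : r `^ (- gamma j) <= c `^ alpha j * w `^ (- alpha j).
  rewrite -mulrN powRrM !powRN -ler_pdivrMl ?powR_gt0// -invfM lef_pV2 ?posrE ?mulr_gt0 ?powR_gt0 ?powRr_gt0//.
  by rewrite -powRM ?powR_ge0 ?(ltW c0)// ge0_ler_powR ?nnegrE ?mulr_ge0 ?powR_ge0// ltW.
apply: (le_trans (KP Z Z1 Zd)); apply: (@le_trans _ _ ((`|K| + 1) * r `^ (- gamma j))).
  by rewrite ler_wpM2r ?powR_ge0//; have := ler_norm K; lra.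
by rewrite -mulrA ler_wpM2l// addr_ge0.
Qed.

Lemma Re_combination (k a b c : C) :
  Re (k * (a + 2 * 'i * b - 2 * c)) = Re (k * a) - 2 * Im (k * b) - 2 * Re (k * c) /\
  Re (k * (a - 2 * 'i * b - 2 * c)) = Re (k * a) + 2 * Im (k * b) - 2 * Re (k * c).
Proof. by case: k a b c => [? ?] [? ?] [? ?] [? ?]; split; rewrite /=; ring. Qed.

Variables (phi1 phi3 u1 u3 : B -> R) (Phi : B -> B).
Hypothesis phi1_bd : bd_class D p alpha phi1.
Hypothesis phi3_bd : bd_class D p alpha phi3.
Hypothesis PhiE : forall zeta, D_zeta D zeta -> Phi zeta = cauchy_type g phi1 phi3 zeta.

Let pd1 := bd_class_density phi1_bd.
Let pd3 := bd_class_density phi3_bd.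
Let pc := pw_smooth_positive_contour D_open D_bd sigma_conf sigma_X.
Let k1 (phi : B -> R) Z := J * cintegral I (fun x => ((phi \o st) (expi x))%:C * map_k1 sigma s1 x Z).
Let k2 (phi : B -> R) Z := J * cintegral I (fun x => ((phi \o st) (expi x))%:C * map_k2 sigma s1 x Z).
Let k10 (phi : B -> R) Z := J * cintegral I (fun x => ((phi \o st) (expi x))%:C *
  (map_k1 sigma s1 x Z - cauchy_k x Z)).
Let c0 (phi : B -> R) := (4 * pi)^-1 * (\int[mu]_(x in I) (phi \o st) (expi x))%R.

Let PhiU Z : disc Z ->
  U1 (Phi (st Z)) = Re (k1 phi1 Z) - 2 * Im (k2 phi1 Z) - 2 * Re (k2 phi3 Z) /\
  U3 (Phi (st Z)) = Re (k1 phi3 Z) + 2 * Im (k2 phi3 Z) - 2 * Re (k2 phi1 Z).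
Proof.
move=> Zd; rewrite (PhiE (D_zetaP sigma_conf Zd)).
rewrite (cauchy_type_components Xinj cm gamma_bounds pd1 pd3 pc Zd) /U1 /U3 [co1 _]/= [co2 _]/=.
by split; rewrite ?(Re_combination _ _ _ _).1 ?(Re_combination _ _ _ _).2.
Qed.

Lemma solution_monogenic : monogenic D Phi.
Proof.
move=> zeta [z Dz <-]; have [Z Z1 ZE] := D_sigma_disc sigma_conf Dz.
have [e e0 eP] := map_dist_circle cm Z1.
have [d d0 dP] : exists2 d : R, 0 < d & forall q, cabs (z_of q - z_of z) < d -> D q.
  have /nbhs_ballP[d d0 dP] : nbhs z D by exact: open_nbhs_nbhs.
  exists d => // q qd; apply: dP; rewrite -ball_normE/=; apply: le_lt_trans (norm_le_cabs_z_of _) _.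
  by rewrite z_ofB cabsB.
apply: (@cauchy_type_derivative _ _ _ _ _ _ _ _ _ _ _ Xinj cm gamma_bounds pd1 pd3 pc z e Phi d e0 d0).
  by move=> x; rewrite -ZE; have [_] := eP _ (circle_expi x).
by move=> q qd; apply: PhiE; exists q => //; exact: dP.
Qed.

Let limits S (Zn : nat -> C) : (circle `\` range X) S -> (forall n, disc (Zn n)) ->
  Zn n @[n --> \oo] --> S ->
  U1 (Phi (st (Zn n))) @[n --> \oo] -->
    (phi1 \o st) S / 2 + c0 phi1 + Re (k10 phi1 S) - 2 * Im (k2 phi1 S) - 2 * Re (k2 phi3 S) /\
  U3 (Phi (st (Zn n))) @[n --> \oo] -->
    (phi3 \o st) S / 2 + c0 phi3 + Re (k10 phi3 S) + 2 * Im (k2 phi3 S) - 2 * Re (k2 phi1 S).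
Proof.
move=> SX Zd Zc.
have a1 := map_k1_boundary Xinj cm gamma_bounds pd1 SX Zd Zc.
have a3 := map_k1_boundary Xinj cm gamma_bounds pd3 SX Zd Zc.
have /cvg_ReImP[r1 i1] := map_k2_boundary Xinj cm gamma_bounds pd1 SX Zd Zc.
have /cvg_ReImP[r3 i3] := map_k2_boundary Xinj cm gamma_bounds pd3 SX Zd Zc.
have two (h : nat -> R) (l : R) : h n @[n --> \oo] --> l -> 2 * h n @[n --> \oo] --> 2 * l.
  by move=> hl; apply: cvgM => //; exact: cvg_cst.
split.
  rewrite (_ : (fun n => U1 (Phi (st (Zn n)))) = (fun n => Re (k1 phi1 (Zn n)) -
    2 * Im (k2 phi1 (Zn n)) - 2 * Re (k2 phi3 (Zn n)))); last first.
    by apply/funext => n; have [-> _] := PhiU (Zd n).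
  exact: (cvgB (cvgB a1 (two _ _ i1)) (two _ _ r3)).
rewrite (_ : (fun n => U3 (Phi (st (Zn n)))) = (fun n => Re (k1 phi3 (Zn n)) +
  2 * Im (k2 phi3 (Zn n)) - 2 * Re (k2 phi1 (Zn n)))); last first.
  by apply/funext => n; have [_ ->] := PhiU (Zd n).
exact: (cvgB (cvgD a3 (two _ _ i3)) (two _ _ r1)).
Qed.

Let growth j : exists K d : R, 0 < d /\ forall Z, disc Z -> cabs (Z - X j) < d ->
  `|U1 (Phi (st Z))| <= K * cabs (Z - X j) `^ (- gamma j) /\
  `|U3 (Phi (st Z))| <= K * cabs (Z - X j) `^ (- gamma j).
Proof.
have [K1 [d1 [K10 d10 P1]]] := corner_growth Xinj cm gamma_bounds pd1 j.
have [K3 [d3 [K30 d30 P3]]] := corner_growth Xinj cm gamma_bounds pd3 j.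
exists (3 * K1 + 3 * K3), (Num.min d1 d3); rewrite lt_min d10; split => // Z Z1.
rewrite lt_min => /andP[Zd1 Zd3]; have [-> ->] := PhiU Z1.
have [b1 e1] := P1 Z Z1 Zd1; have [b3 e3] := P3 Z Z1 Zd3.
have i1 := le_trans (ler_norm_Im _) e1; have r1 := le_trans (ler_norm_Re _) e1.
have i3 := le_trans (ler_norm_Im _) e3; have r3 := le_trans (ler_norm_Re _) e3.
rewrite -/(k1 phi1 Z) in b1; rewrite -/(k2 phi1 Z) in i1 r1.
rewrite -/(k1 phi3 Z) in b3; rewrite -/(k2 phi3 Z) in i3 r3.
set w := cabs (Z - X j) `^ _ in b1 b3 i1 r1 i3 r3 *.
have w0 : 0 <= w by exact: powR_ge0.
have kw1 : 0 <= K1 * w by rewrite mulr_ge0// ltW.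
have kw3 : 0 <= K3 * w by rewrite mulr_ge0// ltW.
have -> : (3 * K1 + 3 * K3) * w = 3 * (K1 * w) + 3 * (K3 * w) by ring.
exact: norm_combination.
Qed.

Let sq T : (circle `\` range X) T -> cvg (contour_quotients X sigma T).
Proof. by have [h _ _ _] := ha; exact: h. Qed.

Let calIE phi (pd : density X gamma (phi \o st)) S : (circle `\` range X) S ->
  [/\ cvg (pv_truncations (Omega1 X sigma (phi \o st)) S),
      cvg (pv_truncations (Omega2 X sigma (phi \o st)) S),
      calI (Omega1 X sigma (phi \o st)) S = k10 phi S &
      calI (Omega2 X sigma (phi \o st)) S = k2 phi S].
Proof.
move=> SX; have [l1 l2] := principal_values Xinj cm gamma_bounds pd sq SX.
have hC : hausdorff_space C by exact: norm_hausdorff.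
have PF : ProperFilter (0 : R)^'+ by exact: at_right_proper_filter.
split; [exact: (cvgP _ l1)|exact: (cvgP _ l2)| |].
  exact: (@cvg_lim C hC R _ PF _ _ l1).
exact: (@cvg_lim C hC R _ PF _ _ l2).
Qed.

(** Monogenicity, growth at the corners and membership in the class hold for every $\Phi$ of the
    given form, as does existence of the principal values. What remains on both sides is that the
    computed limits equal the data. *)
Lemma problem13_iff_system : problem13 D p alpha u1 u3 Phi <->
  [/\ classK X gamma (phi1 \o st), classK X gamma (phi3 \o st)
    & solves_system X sigma (u1 \o st) (u3 \o st) (phi1 \o st) (phi3 \o st)].
Proof.
have L1 := bvp_limitP u1 (fun S Zn SX Zd Zc => (@limits S Zn SX Zd Zc).1).
have L3 := bvp_limitP u3 (fun S Zn SX Zd Zc => (@limits S Zn SX Zd Zc).2).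
(* The equations are stated in [R[i]] because [C_] is complex-valued; by [C_real] both sides are
   real and the equation descends to [R]. *)
have eqC (r c v : R) : (r%:C + c%:C = v%:C :> C) <-> r + c = v.
  by rewrite -realcD; split => [/(congr1 (@complex.Re R))//|->].
have G1 j := bvp_growth (U := @U1 R) (Phi := Phi) (j := j).
have G3 j := bvp_growth (U := @U3 R) (Phi := Phi) (j := j).
split.
  move=> [_ [/L1 b1 _] [/L3 b3 _]].
  split; [exact: density_classK pd1|exact: density_classK pd3|].
  move=> S SX; have [v1 v2 e1 e2] := calIE pd1 SX; have [v3 v4 e3 e4] := calIE pd3 SX.
  split; first by split.
  rewrite e1 e2 e3 e4 (C_real Xinj cm gamma_bounds pd1) (C_real Xinj cm gamma_bounds pd3).
  split; apply/eqC; [rewrite -[RHS](b1 S SX)|rewrite -[RHS](b3 S SX)]; rewrite /c0; ring.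
move=> [_ _ sys]; split; first exact: solution_monogenic.
- split.
    apply/L1 => S SX; have [_ _ e1 e2] := calIE pd1 SX; have [_ _ e3 e4] := calIE pd3 SX.
    have [_ [+ _]] := sys S SX; rewrite e1 e2 e4 (C_real Xinj cm gamma_bounds pd1) => /eqC E.
    by rewrite -[RHS]E /c0; ring.
  move=> j; apply: G1; have [K [d [d0 KP]]] := growth j; exists K, d; split => // Z Z1 Zd.
  by have [] := KP Z Z1 Zd.
split.
  apply/L3 => S SX; have [_ _ e1 e2] := calIE pd1 SX; have [_ _ e3 e4] := calIE pd3 SX.
  have [_ [_ +]] := sys S SX; rewrite e2 e3 e4 (C_real Xinj cm gamma_bounds pd3) => /eqC E.
  by rewrite -[RHS]E /c0; ring.
move=> j; apply: G3; have [K [d [d0 KP]]] := growth j; exists K, d; split => // Z Z1 Zd.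
by have [] := KP Z Z1 Zd.
Qed.

End ReductionToIntegralEquations.

Theorem mainTheorem1 (R : realType) (D : set (R * R))
  (m : nat) (p : 'I_m -> R * R) (g : R -> R * R) (t : nat -> R)
  (sigma : R[i] -> R[i]) (X : 'I_m -> R[i])
  (alpha beta : 'I_m -> R) (u1 u3 : biharm R -> R) :
  open D -> connected D -> D !=set0 -> bounded_set D ->
  (0 < m)%N -> injective p -> pw_smooth_boundary D p g t ->
  conformal_ext D sigma ->
  (forall j, circle (X j) /\ sigma (X j) = z_of (p j)) ->
  (forall j, -1 < beta j <= 1) ->
  hyp_a X sigma beta ->
  hyp_b X sigma beta ->
  (forall j, 0 < alpha j < 1) ->
  (forall j, 0 <= beta j -> alpha j < 1 / (beta j + 1)) ->
  bd_class D p alpha u1 -> bd_class D p alpha u3 ->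
  let gamma := fun j => (beta j + 1) * alpha j in
  (forall (phi1 phi3 : biharm R -> R) (Phi : biharm R -> biharm R),
     bd_class D p alpha phi1 -> bd_class D p alpha phi3 ->
     (forall zeta, D_zeta D zeta -> Phi zeta = cauchy_type g phi1 phi3 zeta) ->
     problem13 D p alpha u1 u3 Phi <->
     [/\ classK X gamma (phi1 \o sigma_tilde sigma),
         classK X gamma (phi3 \o sigma_tilde sigma)
       & solves_system X sigma
           (u1 \o sigma_tilde sigma) (u3 \o sigma_tilde sigma)
           (phi1 \o sigma_tilde sigma) (phi3 \o sigma_tilde sigma)]) /\
  (forall psi : R[i] -> R, classK X gamma psi ->
     exists2 phi : biharm R -> R, bd_class D p alpha phi &
       forall S, (circle `\` range X) S -> phi (sigma_tilde sigma S) = psi S).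
Proof.
move=> Dopen _ _ Dbdd m0 pinj Dbd sconf sX bbd ha hb abd ab _ _ gamma.
have Xinj := corners_inj pinj sX.
have cm := corner_map_of_hypotheses Dbdd m0 pinj sconf sX bbd ha hb.
split.
  move=> phi1 phi3 Phi b1 b3 PhiE.
  exact: (problem13_iff_system Dopen Xinj Dbd sconf sX ha abd ab cm u1 u3 b1 b3 PhiE).
exact: (classK_pullback Dopen sconf sX cm).
Qed.
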